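(* Let $u_0\in H^1_c(\mathbb{R})$ be standard, let $z$ be the entropy solution of Burgers' equation $\partial_tu+u\,\partial_xu=0$ with initial condition $u_0$ and, for every $\nu\in(\mathbb{R}^+)^*$, let $u_\nu$ be the solution of $$\left\{\begin{array}{l}u\in\mathcal{C}^1(I^*,U_\Lambda(\mathbb{R}))\ \text{ and, for all } v\in U_\Lambda(\mathbb{R}),\\[2pt] \int(\partial_tu+u\,\partial_xu)\,v\,dx=\int\nu\,\partial_x^2u\,v\,dx,\\[2pt] u(0)=u_0^*.\end{array}\right.$$ Then there exists a positive infinitesimal number $\nu_0$ such that, for every infinitesimal $\nu\geq\nu_0$, $[u_\nu]_{\mathscr{D}(I\times\mathbb{R})}=z$.
   Context: Nonstandard setting. $V_\infty(\mathbb{R})$ is the superstructure on $\mathbb{R}$ ($V_0=\mathbb{R}$, $V_{n+1}=V_n\cup\mathcal{P}(V_n)$, $V_\infty=\bigcup_nV_n$), $\mathfrak{L}$ is the set of its finite subsets ordered by inclusion, $\mathcal{U}$ is a fine ultrafilter on $\mathfrak{L}$ (i.e. $\{\mu:\lambda\subseteq\mu\}\in\mathcal{U}$ for all $\lambda\in\mathfrak{L}$). $\mathbb{R}^*=\mathbb{R}^{\mathfrak{L}}/\mathcal{U}$; for $\varphi:\mathfrak{L}\to\mathbb{R}$, $\lim_{\lambda\uparrow\Lambda}\varphi(\lambda)$ is its class; for $\varphi:\mathfrak{L}\to V_n(\mathbb{R})$, inductively $\lim_{\lambda\uparrow\Lambda}\varphi(\lambda)=\{\lim_{\lambda\uparrow\Lambda}\psi(\lambda):\psi(\lambda)\in\varphi(\lambda)\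 \forall\lambda\}$. $E^*,f^*$ are natural extensions (limits of constant nets); $E^\sigma=\{f^*:f\in E\}$; $sh$ is the standard part. The extension is assumed sufficiently enlarging. A space of ultrafunctions based on a function space $V\subseteq L^2(\mathbb{R})$ is $V_\Lambda=\lim_{\lambda\uparrow\Lambda}V_\lambda$, where $(V_\lambda)_{\lambda\in\mathfrak{L}}$ are finite dimensional subspaces of $V$, increasing in $\lambda$, every finite dimensional subspace of $V$ being contained in some $V_\lambda$. The space $U_\Lambda(\mathbb{R})$. Let $H^1_\flat(\mathbb{R})=\mathrm{Span}\{u\in L^2(\mathbb{R}):\exists n\in\mathbb{N},\ \mathrm{supp}(u)\subseteq[-n,n],\ u(n)=u(-n),\ u\in H^1([-n,n])\}$; it contains $H^1_c(\mathbb{R})$, the compactly supported $H^1$ functions. Fix $\beta\in\mathbb{N}^*\setminus\mathbb{N}$. $U_\Lambda(\mathbb{R})$ is a space of ultrafunctions based on $H^1_\flat(\mathbb{R})$ that contains $[H^1_\flat(\mathbb{R})]^\sigma$ and the characteristic function $1_{[-\beta,\beta]}$, and all of whose elements $v\in[H^1_\flat(\mathbb{R})]^*$ satisfy $\mathrm{supp}(v)\subseteq[-\beta,\beta]$ and $v(-\beta)=v(\beta)$. $I=[0,T)$; $\mathcal{C}^1(I^*,U_\Lambda(\mathbb{R}))$ is the set of $u\in[\mathcal{C}^1(I,H^1_\flat(\mathbb{R}))]^*$ with $u(t,\cdot),\partial_tu(t,\cdot)\in U_\Lambda(\mathbb{R})$ for all $t\in I^*$. Derivatives in $x$ are natural extensions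 of weak derivatives and the integrals involving them are the corresponding extended pairings. For each $\nu\in(\mathbb{R}^+)^*$ the problem in the claim has a unique solution $u_\nu$. Distributions. If $u\in L^2(I\times\mathbb{R})^*$ is such that $\int\int u\varphi^*dxdt$ is finite for all $\varphi\in\mathscr{D}(I\times\mathbb{R})$, then $[u]_{\mathscr{D}(I\times\mathbb{R})}$ is identified with the distribution $\varphi\mapsto sh\left(\int\int u\varphi^*\,dx\,dt\right)$. The entropy solution of Burgers' equation is the unique weak solution satisfying the entropy conditions along its discontinuity curves; equivalently, the limit as $\nu\to0^+$ of the solutions of the viscous Burgers' equation $\partial_tu+u\partial_xu=\nu\partial_x^2u$ with the same initial datum.
   Formalization: Since elements of U_Λ may jump (e.g. 1_{[-1,1]}), ∫ν∂ₓ²u v dx is undefined as written; it is read as −ν∫Du Dv dx with Du∈U_Λ the ultrafunction derivative (∫Du v=⟨∂ₓu,v⟩ for all v∈U_Λ), and pairings at jumps use mean values of the one-sided limits. *)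

(* Defs.v *)
From HB Require Import structures.
From mathcomp Require Import all_boot all_order all_algebra.
From mathcomp Require Import all_classical all_reals all_analysis.
Set Implicit Arguments.
Unset Strict Implicit.
Unset Printing Implicit Defensive.
Import Order.TTheory GRing.Theory Num.Theory.
Import numFieldNormedType.Exports.
Local Open Scope classical_set_scope.
Local Open Scope ring_scope.

(* [level X n] packs V_n(X) together with its part V_n \ V_(n-1) (all of V_0 if
   n = 0).  An element of V_(n+1) is either an element of V_n or a subset of
   V_n which is not already a subset of V_(n-1); when n = 0 every subset of
   V_0 = X is new, since X consists of atoms.  Every atom and every set is
   therefore represented exactly once. *)
Fixpoint level (X : Type) (n : nat) : {V : Type & set V} :=
  if n is m.+1 then
    let V := projT1 (level X m) in
    let fresh := projT2 (level X m) in
    existT (fun W : Type => set W)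
      (V + {A : set V | m = 0%N \/ A `&` fresh !=set0})%type
      [set y | exists A, y = inr A]
  else existT (fun W : Type => set W) X setT.

(* V_oo(X), split according to the level at which an element first appears. *)
Definition superstructure (X : Type) : Type :=
  {n : nat & {x : projT1 (level X n) | projT2 (level X n) x}}.

Definition finpart (X : Type) : Type :=
  {A : set (superstructure X) | finite_set A}.

Definition finpart_le (X : Type) (l m : finpart X) : Prop :=
  proj1_sig l `<=` proj1_sig m.

Definition fine_ultrafilter (X : Type) (U : set_system (finpart X)) : Prop :=
  UltraFilter U /\ forall l, U [set m | finpart_le l m].

(* Internal objects live in ultrapowers X^L / U of arbitrary types X (reals,
   functions, ...); the superstructure only provides the index set L. *)
Section Ultrapower.
Context {L : Type} (U : set_system L).

Definition germ {X : Type} (f : L -> X) : set (L -> X) :=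
  [set g | U [set l | f l = g l]].

Definition upower (X : Type) : Type :=
  {C : set (L -> X) | exists f, C = germ f}.

Definition Lim {X : Type} (f : L -> X) : upower X :=
  exist _ (germ f) (ex_intro _ f erefl).

Definition net {X : Type} (x : upower X) : L -> X :=
  projT1 (cid (proj2_sig x)).

(* For a net of sets: all limits of nets of elements. *)
Definition LimSet {X : Type} (A : L -> set X) : set (upower X) :=
  [set Lim f | f in [set f : L -> X | forall l, A l (f l)]].

Definition star_elt {X : Type} (x : X) : upower X := Lim (fun _ => x).

Definition star_set {X : Type} (A : set X) : set (upower X) :=
  LimSet (fun _ => A).

Definition star {X Y : Type} (f : X -> Y) (x : upower X) : upower Y :=
  Lim (fun l => f (net x l)).

Definition star2 {X Y Z : Type} (f : X -> Y -> Z)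
    (x : upower X) (y : upower Y) : upower Z :=
  Lim (fun l => f (net x l) (net y l)).

Definition star_rel {X Y : Type} (P : X -> Y -> Prop)
    (x : upower X) (y : upower Y) : Prop :=
  U [set l | P (net x l) (net y l)].

Definition iapp {X Y : Type} : upower (X -> Y) -> upower X -> upower Y :=
  star2 (fun f x => f x).

End Ultrapower.

Arguments Lim {L} U {X} f.
Arguments LimSet {L} U {X} A.
Arguments star_elt {L} U {X} x.
Arguments star_set {L} U {X} A.
Arguments star {L U X Y} f x.
Arguments star2 {L U X Y Z} f x y.
Arguments star_rel {L U X Y} P x y.
Arguments iapp {L U X Y}.

Section Hyperreals.
Context {R : realType} {L : Type} {U : set_system L}.
Local Notation "'R*'" := (upower U R).
Implicit Types x y : R*.

Definition hle x y : Prop := star_rel (fun a b : R => a <= b) x y.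
Definition hlt x y : Prop := star_rel (fun a b : R => a < b) x y.
Definition hadd x y : R* := star2 +%R x y.
Definition hmul x y : R* := star2 *%R x y.
Definition hopp x : R* := star -%R x.
Definition habs x : R* := star Num.norm x.

Definition hfinite x : Prop := exists M : R, hle (habs x) (star_elt U M).

Definition infinitesimal x : Prop :=
  forall e : R, 0 < e -> hlt (habs x) (star_elt U e).

(* standard part (meaningful for finite x only) *)
Definition sh x : R :=
  [get r : R | infinitesimal (hadd x (hopp (star_elt U r)))].

End Hyperreals.

Definition infinite_hypernat {L : Type} {U : set_system L} (b : upower U nat) :
  Prop := forall n : nat, b <> star_elt U n.

Section Span.
Context {R : realType}.

Definition span (A : set (R -> R)) : set (R -> R) :=
  [set f | exists (n : nat) (c : 'I_n -> R) (e : 'I_n -> R -> R),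
     (forall i, A (e i)) /\ f = (fun x => \sum_(i < n) c i * e i x)].

Definition fin_dim_subspace (W : set (R -> R)) : Prop :=
  exists (n : nat) (e : 'I_n -> R -> R), W = span (range e).

Definition ultrafunction_space (U : set_system (finpart R))
    (V : set (R -> R)) (VL : set (upower U (R -> R))) : Prop :=
  exists Vl : finpart R -> set (R -> R),
  [/\ (forall l, fin_dim_subspace (Vl l) /\ Vl l `<=` V),
      (forall l m, finpart_le l m -> Vl l `<=` Vl m),
      (forall W, fin_dim_subspace W -> W `<=` V -> exists l, W `<=` Vl l) &
      VL = LimSet U Vl].

End Span.

Section FunctionSpaces.
Context {R : realType}.
Local Notation mu := (@lebesgue_measure R).

Definition L2 (D : set R) (u : R -> R) : Prop :=
  measurable_fun D u /\ mu.-integrable D (fun x => (u x ^+ 2)%:E).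

Definition test1 (D : set R) (phi : R -> R) : Prop :=
  (forall n x, derivable (derive1n n phi) x 1) /\
  exists K : set R,
    [/\ compact K, K `<=` D & forall x, ~ K x -> phi x = 0].

Definition weak_derivative (D : set R) (u g : R -> R) : Prop :=
  forall phi, test1 D phi ->
    \int[mu]_(x in D) (u x * derive1 phi x) = - \int[mu]_(x in D) (g x * phi x).

(* Sobolev space H^1(D), D open *)
Definition H1 (D : set R) (u : R -> R) : Prop :=
  L2 D u /\ exists g, L2 D g /\ weak_derivative D u g.

(* Elements of H^1_c and H^1_flat are functions rather than classes: the
   representative is the one that is continuous on R, resp. on [-n, n], so that
   the endpoint values below make sense.  The case n = 0 only contributes the
   zero class and is left out. *)
Definition H1c (u : R -> R) : Prop :=
  [/\ continuous u, H1 setT u &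
      exists K : set R, compact K /\ forall x, ~ K x -> u x = 0].

Definition H1flat : set (R -> R) :=
  span [set u : R -> R | exists n : nat,
    [/\ (0 < n)%N,
        (forall x, n%:R < `|x| -> u x = 0),
        u n%:R = u (- n%:R),
        {within `[(- n%:R : R), (n%:R : R)], continuous u} &
        H1 `](- n%:R : R), (n%:R : R)[ u]].

Definition box (n : nat) : R -> R := \1_(`[- n%:R, n%:R]).

Definition ip (u v : R -> R) : R := \int[mu]_x (u x * v x).

(* Weak derivative of a function which may jump: a signed measure m1 - m2. *)
Definition measure_derivative (u : R -> R)
    (m1 m2 : {finite_measure set (measurableTypeR R) -> \bar R}) : Prop :=
  forall phi, test1 setT phi ->
    \int[mu]_x (u x * derive1 phi x) =
    - (\int[m1]_x phi x - \int[m2]_x phi x).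

(* integral of the bounded Borel function w against the measure d(u)/dx *)
Definition dint (u w : R -> R) : R :=
  [get c : R | exists m1 m2, measure_derivative u m1 m2 /\
     c = \int[m1]_x w x - \int[m2]_x w x].

(* precise representative: mean of the one-sided limits *)
Definition prec (v : R -> R) : R -> R :=
  fun x => (lim (v y @[y --> x^'-]) + lim (v y @[y --> x^'+])) / 2.

(* [dpair u v] is the pairing of d(u)/dx with v; [cpair u v] is the pairing of
   u * d(u)/dx with v.  Elements of H^1_flat have finitely many jumps, and the
   measure d(u)/dx can charge points where v jumps: there v (and the factor u)
   are given their precise values.  With this convention
   dpair u v = - dpair v u and u * d(u)/dx = d(u^2/2)/dx on H^1_flat. *)
Definition dpair (u v : R -> R) : R := dint u (prec v).
Definition cpair (u v : R -> R) : R :=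
  dint u (fun x => prec u x * prec v x).

Definition timeI (T : R) : set R := `[0, T[.

Definition strip (T : R) : set (R * R) := timeI T `*` setT.

Definition mu2 := (mu \x mu)%E.

(* w is the (continuous) derivative of u : [0, T) -> H^1_flat, one-sided at 0;
   H^1_flat carries the topology of L^2(R). *)
Definition time_derivative (T : R) (u w : R -> R -> R) : Prop :=
  [/\ (forall t, timeI T t -> H1flat (w t)),
      (forall t, timeI T t ->
        (\int[mu]_x (((u (t + h) x - u t x) / h - w t x) ^+ 2)%:E)%E
          @[h --> within [set h | timeI T (t + h)] 0^'] --> 0%E) &
      (forall t, timeI T t ->
        (\int[mu]_x ((w s x - w t x) ^+ 2)%:E)%E
          @[s --> within (timeI T) (nbhs t)] --> 0%E)].

Definition C1flat (T : R) : set (R -> R -> R) :=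
  [set u : R -> R -> R | (forall t, timeI T t -> H1flat (u t)) /\
           exists w, time_derivative T u w].

Definition dt (T : R) (u : R -> R -> R) : R -> R -> R :=
  get [set w : R -> R -> R | time_derivative T u w].

Definition partial_t (phi : R -> R -> R) : R -> R -> R :=
  fun t x => derive1 (fun s => phi s x) t.
Definition partial_x (phi : R -> R -> R) : R -> R -> R :=
  fun t x => derive1 (phi t) x.

Fixpoint Ck (k : nat) (phi : R -> R -> R) : Prop :=
  continuous (fun p : R * R => phi p.1 p.2) /\
  (if k is j.+1 then
     [/\ (forall t x, derivable (fun s => phi s x) t 1),
         (forall t x, derivable (phi t) x 1),
         Ck j (partial_t phi) & Ck j (partial_x phi)]
   else True).

(* D([0, T) x R): restrictions to [0, T) x R of smooth functions, with compact
   support in [0, T) x R; they need not vanish at t = 0. *)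
Definition test2 (T : R) (phi : R -> R -> R) : Prop :=
  (forall k, Ck k phi) /\
  exists K : set (R * R),
    [/\ compact K, K `<=` strip T &
        forall p, strip T p -> ~ K p -> phi p.1 p.2 = 0].

Definition pair2 (T : R) (u phi : R -> R -> R) : R :=
  \int[mu2]_(p in strip T) (u p.1 p.2 * phi p.1 p.2).

Definition L2strip (T : R) : set (R -> R -> R) :=
  [set u : R -> R -> R | measurable_fun (strip T) (fun p => u p.1 p.2) /\
           mu2.-integrable (strip T) (fun p => (u p.1 p.2 ^+ 2)%:E)].

Definition weak_solution (T : R) (u0 : R -> R) (z : R -> R -> R) : Prop :=
  [/\ measurable_fun (strip T) (fun p => z p.1 p.2),
      (exists M : R, forall t x, timeI T t -> `|z t x| <= M) &
      forall phi, test2 T phi ->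
        pair2 T z (partial_t phi)
        + pair2 T (fun t x => z t x ^+ 2 / 2) (partial_x phi)
        + \int[mu]_x (u0 x * phi 0 x) = 0].

(* Spatial variation bounded uniformly in time: all traces z(t, x-), z(t, x+)
   exist and the discontinuities lie on curves. *)
Definition BV_slices (T : R) (z : R -> R -> R) : Prop :=
  exists C : R, forall t a b, timeI T t -> a <= b ->
    (total_variation a b (z t) <= C%:E)%E.

(* Lax condition z(t, g(t)-) > g'(t) > z(t, g(t)+) at almost every time at which
   the Lipschitz curve x = g(t) meets a discontinuity of z. *)
Definition entropy_conditions (T : R) (z : R -> R -> R) : Prop :=
  forall g : R -> R, [lipschitz g t | t in timeI T] ->
  {ae mu, forall t, 0 < t < T -> derivable g t 1 ->
    forall zl zr : R,
      z t y @[y --> (g t)^'-] --> zl -> z t y @[y --> (g t)^'+] --> zr ->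
      zl != zr -> zl > derive1 g t /\ derive1 g t > zr}.

Definition entropy_weak_solution (T : R) (u0 : R -> R) (z : R -> R -> R) :
  Prop := [/\ weak_solution T u0 z, BV_slices T z & entropy_conditions T z].

Definition entropy_solution (T : R) (u0 : R -> R) (z : R -> R -> R) : Prop :=
  entropy_weak_solution T u0 z /\
  forall z', entropy_weak_solution T u0 z' ->
    {ae mu2, forall p, strip T p -> z' p.1 p.2 = z p.1 p.2}.

End FunctionSpaces.

Section ViscousProblem.
Context {R : realType} {U : set_system (finpart R)}.
Local Notation "X *^" := (upower U X) (at level 2, format "X *^").

Definition U_Lambda_space (beta : nat*^) (UL : set ((R -> R)*^)) : Prop :=
  let b : R*^ := star (fun n : nat => n%:R) beta in
  [/\ ultrafunction_space (@H1flat R) UL,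
      (forall f, H1flat f -> UL (star_elt U f)),
      UL (star box beta) &
      forall v, UL v ->
        (forall x : R*^, hlt b (habs x) -> iapp v x = star_elt U 0) /\
        iapp v (hopp b) = iapp v b].

(* Ultrafunction derivative: the element d of U_Lambda(R) which represents the
   functional v |-> <d(u)/dx, v> on U_Lambda(R). *)
Definition ultra_derivative (UL : set ((R -> R)*^)) (u d : (R -> R)*^) :
  Prop := UL d /\ forall v, UL v -> star2 ip d v = star2 dpair u v.

(* The second derivative of u is the weak derivative of d, the ultrafunction
   derivative of u; for v in U_Lambda(R),
   <d/dx d, v> = - <d, ultrafunction derivative of v>.
   Applying the weak derivative twice directly would leave the pairing undefined
   when u and v jump at the same point. *)
Definition viscous_solution (UL : set ((R -> R)*^)) (T : R) (u0 : R -> R)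
    (nu : R*^) (u : (R -> R -> R)*^) : Prop :=
  let It := star_set U (timeI T) in
  let ut := star (dt T) u in
  [/\ star_set U (C1flat T) u,
      (forall t, It t -> UL (iapp u t) /\ UL (iapp ut t)),
      (forall t, It t -> exists2 d, ultra_derivative UL (iapp u t) d &
        forall v, UL v ->
          hadd (star2 ip (iapp ut t) v) (star2 cpair (iapp u t) v)
          = hmul nu (star2 dpair d v)) &
      iapp u (star_elt U 0) = star_elt U u0].

(* [u] = z as distributions on [0, T) x R *)
Definition distribution_eq (T : R) (u : (R -> R -> R)*^) (z : R -> R -> R) :
  Prop :=
  star_set U (L2strip T) u /\
  forall phi, test2 T phi ->
    hfinite (star2 (pair2 T) u (star_elt U phi)) /\
    sh (star2 (pair2 T) u (star_elt U phi)) = pair2 T z phi.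

End ViscousProblem.

(* Main.v *)
(* Elements of H^1_flat have opposite jumps at n and -n, hence
   <d(u)/dx, u> = <u d(u)/dx, u> = 0 and the Galerkin problem satisfies the
   energy identity of the viscous Burgers' equation exactly.  Gronwall's lemma
   then bounds the L^2 distance from a Galerkin solution to any regular w by the
   residual of w in the equation, provided that the approximation space contains
   the finitely many functions from which w is built.  For nu > 0 take for w the
   Cole-Hopf solution of a mollified datum, cut off in space and interpolated
   affinely in time.  By compactness, for every m finitely many functions serve
   for all nu in [1/m, 1], so that for almost all lambda all Galerkin solutions
   with nu in [1/m, 1] are 1/m-close to Cole-Hopf solutions.  Letting m grow with
   lambda, below beta, gives nu_0 = 1/m(lambda).

   As nu tends to 0, Laplace's method shows that the Cole-Hopf solutions converge
   almost everywhere to u0(y(t, x)), where y(t, x) minimises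
   (x - y)^2 / (2 t) + \int_{-oo}^y u0 (Lax-Oleinik).  This limit is a weak solution
   of bounded variation satisfying the entropy condition, so it is z by
   uniqueness. *)
Require Import Defs.
From HB Require Import structures.
From mathcomp Require Import all_boot all_order all_algebra.
From mathcomp Require Import all_classical all_reals all_analysis.
From mathcomp Require Import measurable_realfun.
From mathcomp Require Import ring lra.
Set Implicit Arguments.
Unset Strict Implicit.
Unset Printing Implicit Defensive.
Import Order.TTheory GRing.Theory Num.Theory.
Import numFieldNormedType.Exports.
Local Open Scope classical_set_scope.
Local Open Scope ring_scope.

(** * Integrals *)

(** Two obstacles shape the proof. The other obstacle is the Gronwall factor. It multiplies the
    mollification error, so it must not involve derivatives of the mollified datum. Gaussian
    smoothing bounds w_x by A + B / sqrt t, with A and B depending only on the viscosity and on the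
    bound and support of u0; this is integrable at t = 0, and the mollification can be chosen after
    the factor. A and B grow as nu decreases, hence the restriction to [1/m, 1] before the diagonal
    choice. Interpolation in time is forced by finiteness: the comparison function may use only its
    nodal values, its slopes and their x-derivatives. Uniqueness of the entropy solution is part of
    the assumption on z, so it is enough to show that the Lax-Oleinik formula is an entropy weak
    solution. *)

Section real_integrals.
Context d (T : measurableType d) (R : realType).
Variable mu : {measure set T -> \bar R}.
Variable D : set T.
Hypothesis mD : measurable D.
Implicit Types (f g : T -> R) (c M : R).

Lemma intR_measurable f : mu.-integrable D (EFin \o f) -> measurable_fun D f.
Proof. by move=> /integrableP[/measurable_EFinP]. Qed.

Lemma intRD f g : mu.-integrable D (EFin \o f) -> mu.-integrable D (EFin \o g) ->
  mu.-integrable D (EFin \o (fun x => f x + g x)).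
Proof. by move=> fi gi; have := integrableD mD fi gi. Qed.

Lemma intRZ c f : mu.-integrable D (EFin \o f) ->
  mu.-integrable D (EFin \o (fun x => c * f x)).
Proof. by move=> fi; have := integrableZl mD c fi. Qed.

Lemma intRN f : mu.-integrable D (EFin \o f) ->
  mu.-integrable D (EFin \o (fun x => - f x)).
Proof. by move=> fi; have := integrableN fi. Qed.

Lemma intRB f g : mu.-integrable D (EFin \o f) -> mu.-integrable D (EFin \o g) ->
  mu.-integrable D (EFin \o (fun x => f x - g x)).
Proof. by move=> fi gi; apply: intRD => //; exact: intRN. Qed.

Lemma intR_le f g : measurable_fun D f -> mu.-integrable D (EFin \o g) ->
  (forall x, D x -> `|f x| <= g x) -> mu.-integrable D (EFin \o f).
Proof.
move=> mf gi fg; apply: (le_integrable mD _ _ gi); first exact/measurable_EFinP.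
by move=> x Dx /=; rewrite lee_fin (le_trans (fg _ Dx))// ler_norm.
Qed.

Lemma intR_abs f : mu.-integrable D (EFin \o f) ->
  mu.-integrable D (EFin \o (fun x => `|f x|)).
Proof. by move=> fi; have := integrable_abse fi. Qed.

Lemma intR_bM f g M : mu.-integrable D (EFin \o f) -> measurable_fun D g ->
  (forall x, D x -> `|g x| <= M) -> mu.-integrable D (EFin \o (fun x => f x * g x)).
Proof.
move=> fi mg gM; apply: (@intR_le _ (fun x => M * `|f x|)).
- by apply: measurable_funM => //; exact: intR_measurable.
- exact/intRZ/intR_abs.
- by move=> x Dx; rewrite normrM mulrC ler_wpM2r// gM.
Qed.

Lemma intR_finite f M : (mu D < +oo)%E -> measurable_fun D f ->
  (forall x, D x -> `|f x| <= M) -> mu.-integrable D (EFin \o f).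
Proof.
move=> Doo mf fM; apply: measurable_bounded_integrable => //.
exists M; split; first exact: num_real.
by move=> N MN x Dx /=; rewrite (le_trans (fM _ Dx))// ltW.
Qed.

Lemma intR_sum (I : Type) (s : seq I) (F : I -> T -> R) :
  (forall i, mu.-integrable D (EFin \o F i)) ->
  mu.-integrable D (EFin \o (fun x => \sum_(i <- s) F i x)).
Proof.
move=> Fi; elim: s => [|i s IH].
  rewrite (_ : _ \o _ = cst 0%E); first exact: integrable0.
  by apply/funext => x /=; rewrite big_nil.
rewrite (_ : (fun x => _) = (fun x => F i x + \sum_(j <- s) F j x)); last first.
  by apply/funext => x; rewrite big_cons.
exact: intRD.
Qed.

Lemma Rintegral_sum (I : Type) (s : seq I) (F : I -> T -> R) :
  (forall i, mu.-integrable D (EFin \o F i)) ->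
  \int[mu]_(x in D) (\sum_(i <- s) F i x) = \sum_(i <- s) \int[mu]_(x in D) F i x.
Proof.
move=> Fi; elim: s => [|i s IH].
  rewrite big_nil -[RHS](mul0r (fine (mu D))) -Rintegral_cst//.
  by apply: eq_Rintegral => x _; rewrite big_nil.
rewrite big_cons -IH -RintegralD//; last exact: intR_sum.
by apply: eq_Rintegral => x _; rewrite big_cons.
Qed.

Lemma RintegralE f : mu.-integrable D (EFin \o f) ->
  (\int[mu]_(x in D) f x)%:E = (\int[mu]_(x in D) (f x)%:E)%E.
Proof. by move=> fi; rewrite fineK//; exact: integrable_fin_num. Qed.

Lemma Rintegral_dominated (f_ : nat -> T -> R) f g :
  (forall n, measurable_fun D (f_ n)) -> mu.-integrable D (EFin \o g) ->
  (forall n x, D x -> `|f_ n x| <= g x) ->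
  measurable_fun D f ->
  {ae mu, forall x, D x -> f_ n x @[n --> \oo] --> f x} ->
  \int[mu]_(x in D) f_ n x @[n --> \oo] --> \int[mu]_(x in D) f x.
Proof.
move=> mf_ gi fg mf fcvg.
have [] := @dominated_convergence _ T R mu D mD (fun n x => (f_ n x)%:E)
  (EFin \o f) (EFin \o g).
- by move=> n; exact/measurable_EFinP.
- exact/measurable_EFinP.
- apply: filterS fcvg => x /= fx Dx.
  by apply: cvg_EFin; [exact: nearW|exact: fx].
- exact: gi.
- by apply: aeW => x n Dx /=; rewrite lee_fin fg.
move=> fi _ cvgi; apply/fine_cvg; rewrite RintegralE//.
Qed.

Lemma ae_Rintegral f g : measurable_fun D f -> measurable_fun D g ->
  {ae mu, forall x, D x -> f x = g x} ->
  \int[mu]_(x in D) f x = \int[mu]_(x in D) g x.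
Proof.
move=> mf mg fg; congr fine; apply: ae_eq_integral => //.
- exact/measurable_EFinP.
- exact/measurable_EFinP.
- by apply: filterS fg => x /= fgx Dx; rewrite fgx.
Qed.

Lemma ae_imply1 (P Q : T -> Prop) : {ae mu, forall x, P x} ->
  (forall x, P x -> Q x) -> {ae mu, forall x, Q x}.
Proof. by move=> aP PQ; apply: filterS aP. Qed.

Lemma ae_imply2 (P1 P2 Q : T -> Prop) : {ae mu, forall x, P1 x} ->
  {ae mu, forall x, P2 x} -> (forall x, P1 x -> P2 x -> Q x) ->
  {ae mu, forall x, Q x}.
Proof. by move=> a1 a2 PQ; apply: filterS2 a1 a2. Qed.

Lemma ae_imply3 (P1 P2 P3 Q : T -> Prop) : {ae mu, forall x, P1 x} ->
  {ae mu, forall x, P2 x} -> {ae mu, forall x, P3 x} ->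
  (forall x, P1 x -> P2 x -> P3 x -> Q x) -> {ae mu, forall x, Q x}.
Proof. by move=> a1 a2 a3 PQ; apply: filterS3 a1 a2 a3. Qed.

End real_integrals.

(** * Bounded Borel functions with compact support *)

Section integrals_on_the_line.
Context {R : realType}.
Local Notation mu := (@lebesgue_measure R).
Implicit Types (f g u v : R -> R).

Lemma countable_ae (A : set R) (P : R -> Prop) : countable A ->
  (forall x, ~ A x -> P x) -> {ae mu, forall x, P x}.
Proof.
move=> cA AP; exists A; split.
- exact: countable_measurable.
- exact: countable_lebesgue_measure0.
- by move=> x /= nP; apply: contrapT => /AP.
Qed.

(** The working class for functions of x: an algebra in which every product is integrable. A single
    constant serves as bound and as radius of the support. *)
Definition bcs u : Prop := measurable_fun setT u /\
  exists M : R, forall x, `|u x| <= M /\ (M < `|x| -> u x = 0).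

Lemma bcsP u : bcs u <-> measurable_fun setT u /\ exists M : R,
  [/\ 0 < M, forall x, `|u x| <= M & forall x, M < `|x| -> u x = 0].
Proof.
split=> -[mu' [M]].
  move=> uM; split => //; exists (M + 1).
  have M0 : 0 <= M by rewrite (le_trans _ (uM 0).1).
  split; first by lra.
    by move=> x; rewrite (le_trans (uM x).1)//; lra.
  by move=> x Mx; apply: (uM x).2; lra.
by move=> [M0 uM u0]; split => //; exists M => x; split; [exact: uM|exact: u0].
Qed.

Lemma bcsD u v : bcs u -> bcs v -> bcs (fun x => u x + v x).
Proof.
move=> /bcsP[mu' [M [M0 uM u0]]] /bcsP[mv [N [N0 vN v0]]]; split.
  exact: measurable_funD.
exists (M + N) => x; split; first by rewrite (le_trans (ler_normD _ _))// lerD.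
by move=> MNx; rewrite u0 ?v0 ?addr0//; lra.
Qed.

Lemma bcs_bM u v M : bcs u -> measurable_fun setT v -> (forall x, `|v x| <= M) ->
  bcs (fun x => u x * v x).
Proof.
move=> /bcsP[mu' [N [N0 uN u0]]] mv vM; split.
  exact: measurable_funM.
have M0 : 0 <= M by rewrite (le_trans _ (vM 0)).
exists (N * M + N) => x; split.
  rewrite normrM (le_trans (ler_pM _ _ (uN x) (vM x)))// lerDl; lra.
move=> MNx; rewrite u0 ?mul0r//.
by rewrite (le_lt_trans _ MNx)// lerDr mulr_ge0// ltW.
Qed.

Lemma bcsM u v : bcs u -> bcs v -> bcs (fun x => u x * v x).
Proof. by move=> bu /bcsP[mv [M [_ vM _]]]; exact: (@bcs_bM _ _ M). Qed.

Lemma bcsZ c u : bcs u -> bcs (fun x => c * u x).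
Proof.
move=> bu; have := @bcs_bM u (cst c) `|c| bu (@measurable_cst _ _ _ _ _ _) _.
by under eq_fun do rewrite mulrC; apply.
Qed.

Lemma bcsN u : bcs u -> bcs (fun x => - u x).
Proof. by move=> /(bcsZ (-1)); under eq_fun do rewrite mulN1r. Qed.

Lemma bcsB u v : bcs u -> bcs v -> bcs (fun x => u x - v x).
Proof. by move=> bu bv; apply: bcsD => //; exact: bcsN. Qed.

Lemma bcsX u n : bcs u -> bcs (fun x => u x ^+ n.+1).
Proof.
move=> bu; elim: n => [|n IH]; first by under eq_fun do rewrite expr1.
by under eq_fun do rewrite exprS; exact: bcsM.
Qed.

Lemma bcs0 : bcs (fun=> 0).
Proof. by split; [exact: measurable_cst|exists 0 => x; rewrite normr0]. Qed.

Lemma bcs_sum (I : Type) (s : seq I) (F : I -> R -> R) :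
  (forall i, bcs (F i)) -> bcs (fun x => \sum_(i <- s) F i x).
Proof.
move=> bF; elim: s => [|i s IH].
  by under eq_fun do rewrite big_nil; exact: bcs0.
by under eq_fun do rewrite big_cons; exact: bcsD.
Qed.

Lemma bcs_integrable u : bcs u -> mu.-integrable setT (EFin \o u).
Proof.
move=> /bcsP[mu' [M [M0 uM u0]]].
rewrite (_ : EFin \o u = (EFin \o u) \_ `[- M, M]); last first.
  apply/funext => x; rewrite /restrict; case: ifPn => // /negP xM.
  rewrite /= u0// ltNge; apply/negP => xM'; apply: xM.
  by rewrite inE /= in_itv /= -ler_norml.
suff h : mu.-integrable `[- M, M] (EFin \o u).
  by have /integrable_mkcond := h; apply.
apply: (@intR_finite _ _ R mu `[- M, M] _ u M) => //.
- by rewrite /= lebesgue_measure_itv/=; case: ifP => // _; rewrite -EFinD ltry.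
- exact: measurable_funTS.
Qed.

Lemma bcs_continuous u M : continuous u -> (forall x, M < `|x| -> u x = 0) -> bcs u.
Proof.
move=> cu u0; split; first exact: continuous_measurable_fun.
have [K uK] : exists K, forall x, x \in `[- `|M|, `|M|] -> `|u x| <= K.
  have /compact_bounded[K [_ Kb]] : compact [set u x | x in `[- `|M|, `|M|]].
    apply: continuous_compact; last exact: segment_compact.
    by apply: continuous_subspaceT.
  exists (K + 1) => x xM; apply: (Kb (K + 1)); first lra.
  by exists x.
exists (Num.max `|M| K) => x; split.
  case: (leP `|x| `|M|) => xM.
    by rewrite le_max uK ?orbT// in_itv/= -ler_norml.
  by rewrite u0 ?normr0 ?le_max ?normr_ge0// (le_lt_trans _ xM)// ler_norm.
rewrite gt_max => /andP[xM _]; apply: u0; apply: le_lt_trans xM; exact: ler_norm.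
Qed.

Lemma bcs_indic (a b : R) : bcs (\1_(`[a, b]) : R -> R).
Proof.
split; first exact: measurable_indic.
exists (1 + `|a| + `|b|) => x; rewrite indicE; split.
  by case: (_ \in _); rewrite ?normr1 ?normr0; have := normr_ge0 a;
     have := normr_ge0 b; lra.
move=> xab; case: (boolP (x \in _)) => //; rewrite inE /= in_itv /= => /andP[ax xb].
exfalso; move: xab; rewrite ltNge => /negP; apply; rewrite ler_norml.
have := ler_norm b; have := ler_norm (- a); rewrite normrN.
have := normr_ge0 a; have := normr_ge0 b; lra.
Qed.

End integrals_on_the_line.

(** * Fubini's theorem for real-valued integrals *)

Section fubini.
Context d1 d2 (T1 : measurableType d1) (T2 : measurableType d2) (R : realType).
Variables (m1 : {sigma_finite_measure set T1 -> \bar R}).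
Variables (m2 : {sigma_finite_measure set T2 -> \bar R}).
Implicit Types F : T1 * T2 -> R.

Lemma Rintegral_prod F : (m1 \x m2)%E.-integrable setT (EFin \o F) ->
  (forall x, m2.-integrable setT (EFin \o (fun y => F (x, y)))) ->
  \int[(m1 \x m2)%E]_p F p = \int[m1]_x \int[m2]_y F (x, y).
Proof.
move=> Fi F2; rewrite /Rintegral -(integral12_prod_meas1 Fi); congr fine.
by apply: eq_integral => x _; rewrite /fubini_F -RintegralE.
Qed.

Lemma Rintegral_prod_swap F : (m1 \x m2)%E.-integrable setT (EFin \o F) ->
  (forall y, m1.-integrable setT (EFin \o (fun x => F (x, y)))) ->
  \int[(m1 \x m2)%E]_p F p = \int[m2]_y \int[m1]_x F (x, y).
Proof.
move=> Fi F1; rewrite /Rintegral -(integral21_prod_meas1 Fi); congr fine.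
by apply: eq_integral => x _; rewrite /fubini_G -RintegralE.
Qed.

Lemma integrable_prodM (f : T1 -> R) (g : T2 -> R) :
  m1.-integrable setT (EFin \o f) -> m2.-integrable setT (EFin \o g) ->
  (m1 \x m2)%E.-integrable setT (EFin \o (fun p => f p.1 * g p.2)).
Proof.
move=> fi gi.
have mf : measurable_fun setT f by exact: intR_measurable fi.
have mg : measurable_fun setT g by exact: intR_measurable gi.
apply/integrable12ltyP.
  apply/measurable_EFinP; apply: measurable_funM.
  - exact: measurableT_comp.
  - exact: measurableT_comp.
have fi' := intR_abs fi; have gi' := intR_abs gi.
rewrite (_ : (fun x => _) = EFin \o (fun x => (\int[m2]_y `|g y|) * `|f x|)).
  rewrite -RintegralE ?ltry//; exact: intRZ.
apply/funext => x /=.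
rewrite (_ : (fun y => _) = EFin \o (fun y => `|f x| * `|g y|)); last first.
  by apply/funext => y /=; rewrite normrM.
rewrite -RintegralE//; last exact: intRZ.
by rewrite RintegralZl// mulrC.
Qed.

End fubini.

Lemma indic_bool (T : Type) (R : pzRingType) (A : set T) (P : T -> bool) :
  (forall x, A x <-> P x) -> (\1_A : T -> R) = (fun x => (P x)%:R).
Proof.
move=> AP; apply/funext => x; rewrite indicE.
by congr ((nat_of_bool _)%:R); apply/idP/idP; rewrite inE => /AP.
Qed.

(** Turns the domain of integration into a 0/1 factor, so that domains are handled by algebra in the
    integrand. *)
Lemma Rintegral_bool d (T : measurableType d) (R : realType)
    (mu : {measure set T -> \bar R}) (D : set T) (P : T -> bool) (f : T -> R) :
  (forall x, D x <-> P x) ->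
  \int[mu]_(x in D) f x = \int[mu]_x (f x * (P x)%:R).
Proof.
move=> DP; rewrite Rintegral_mkcond; apply: eq_Rintegral => x _.
rewrite /restrict; case: ifPn => [|/negP]; rewrite inE => /DP.
  by move=> ->; rewrite mulr1.
by case: (P x) => // _; rewrite mulr0.
Qed.

(** * Primitives vanishing at minus infinity *)

Section primitive.
Context {R : realType}.
Local Notation mu := (@lebesgue_measure R).
Implicit Types (f g h : R -> R) (x y : R).

Lemma Rintegral_itv (i : interval R) f :
  \int[mu]_(x in [set` i]) f x = \int[mu]_x (f x * (x \in i)%:R).
Proof. exact: Rintegral_bool. Qed.

Lemma measurable_mem_itv (i : interval R) :
  measurable_fun setT (fun x : R => (x \in i)%:R : R).
Proof.
by rewrite -(@indic_bool _ _ [set` i] (fun x => x \in i)).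
Qed.

Definition prim g x : R := \int[mu]_(t in `]-oo, x]) g t.

Definition below x : R -> R := fun t => (t <= x)%R%:R.

Lemma measurable_below x : measurable_fun setT (below x).
Proof.
rewrite /below -(@indic_bool _ _ `]-oo, x]); first exact: measurable_indic.
by move=> t /=; rewrite in_itv.
Qed.

Lemma below_le1 x t : `|below x t| <= 1.
Proof. by rewrite /below; case: (t <= x); rewrite ?normr1 ?normr0. Qed.

Lemma integrable_below g x : mu.-integrable setT (EFin \o g) ->
  mu.-integrable setT (EFin \o (fun t => g t * below x t)).
Proof.
move=> gi; apply: (@intR_bM _ _ R mu setT _ _ _ 1) => //.
- exact: measurable_below.
- by move=> t _; exact: below_le1.
Qed.

Lemma primE g x : prim g x = \int[mu]_t (g t * below x t).
Proof.
by apply: Rintegral_bool => t /=; rewrite in_itv.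
Qed.

Lemma prim_le g x : mu.-integrable setT (EFin \o g) ->
  `|prim g x| <= \int[mu]_t `|g t|.
Proof.
move=> gi; rewrite primE.
have gbi := integrable_below x gi.
rewrite (le_trans (le_normr_Rintegral _ gbi))// le_Rintegral//.
- exact: intR_abs.
- exact: intR_abs.
- by move=> t _; rewrite normrM ler_piMr// below_le1.
Qed.

(** Dominated convergence along sequences: [below (w n) t] is eventually constant for every t other
    than the limit point. *)
Lemma prim_continuous g : mu.-integrable setT (EFin \o g) -> continuous (prim g).
Proof.
move=> gi x; apply/(@cvg_nbhsP _ R^o) => w wx.
rewrite (_ : (fun n => prim g (w n)) = (fun n => \int[mu]_t (g t * below (w n) t))); last first.
  by apply/funext => n /=; rewrite primE.
rewrite primE.
have mg : measurable_fun setT g by exact: intR_measurable gi.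
apply: (@Rintegral_dominated _ _ R mu setT _ _ _ (fun t => `|g t|)) => //.
- by move=> n; apply: measurable_funM => //; exact: measurable_below.
- exact: intR_abs.
- by move=> n t _; rewrite normrM ler_piMr// below_le1.
- by apply: measurable_funM => //; exact: measurable_below.
apply: (@countable_ae _ [set x]) => // t /eqP tx _.
apply: cvgM; first exact: cvg_cst.
apply: cvg_near_cst; case: (ltgtP t x) tx => // tx _.
  have : \forall n \near \oo, t < w n by apply: (cvgr_gt _ wx).
  by apply: filterS => n tw; rewrite /below (ltW tx) (ltW tw).
have : \forall n \near \oo, w n < t by apply: (cvgr_lt _ wx).
by apply: filterS => n tw; rewrite /below !leNgt tx tw.
Qed.

Lemma measurable_prim g : mu.-integrable setT (EFin \o g) -> measurable_fun setT (prim g).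
Proof. by move=> gi; apply: continuous_measurable_fun; exact: prim_continuous. Qed.

Lemma integrable_Mprim g h : mu.-integrable setT (EFin \o g) ->
  mu.-integrable setT (EFin \o h) ->
  mu.-integrable setT (EFin \o (fun t => g t * prim h t)).
Proof.
move=> gi hi; apply: (@intR_bM _ _ R mu setT _ _ _ (\int[mu]_t `|h t|)) => //.
- exact: measurable_prim.
- by move=> t _; exact: prim_le.
Qed.

Lemma integrable_primM g h : mu.-integrable setT (EFin \o g) ->
  mu.-integrable setT (EFin \o h) ->
  mu.-integrable setT (EFin \o (fun t => prim g t * h t)).
Proof.
by move=> gi hi; under eq_fun do rewrite mulrC; exact: integrable_Mprim.
Qed.

Lemma primD g h x : mu.-integrable setT (EFin \o g) ->
  mu.-integrable setT (EFin \o h) ->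
  prim (fun t => g t + h t) x = prim g x + prim h x.
Proof.
move=> gi hi; rewrite !primE -RintegralD//; last 2 first.
- exact: integrable_below.
- exact: integrable_below.
by apply: eq_Rintegral => t _; rewrite mulrDl.
Qed.

Lemma primZ c g x : mu.-integrable setT (EFin \o g) ->
  prim (fun t => c * g t) x = c * prim g x.
Proof.
move=> gi; rewrite !primE -RintegralZl//; last exact: integrable_below.
by apply: eq_Rintegral => t _; rewrite mulrA.
Qed.

(* Fubini on the square ]-oo, b]^2, cut along its diagonal. *)
Lemma prim_ibp g h b : mu.-integrable setT (EFin \o g) ->
  mu.-integrable setT (EFin \o h) ->
  prim g b * prim h b = prim (fun t => g t * prim h t + prim g t * h t) b.
Proof.
move=> gi hi.
have gbi := integrable_below b gi; have hbi := integrable_below b hi.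
have mg : measurable_fun setT g by exact: intR_measurable gi.
have mh : measurable_fun setT h by exact: intR_measurable hi.
pose D : R * R -> R := fun p => (p.1 <= p.2)%R%:R.
have mD : measurable_fun setT D.
  rewrite /D -(@indic_bool _ _ [set p : R * R | 0 <= p.2 - p.1]); last first.
    by move=> p; rewrite /= subr_ge0.
  apply: measurable_indic.
  have : measurable_fun setT (fun p : R * R => p.2 - p.1).
    by apply: measurable_funB; [exact: measurable_snd|exact: measurable_fst].
  move=> /(_ measurableT `[0, +oo[%classic (measurable_itv _)); rewrite setTI.
  by congr (measurable _); apply/seteqP; split => p /=; rewrite in_itv/= andbT.
have D1 p : `|D p| <= 1 by rewrite /D; case: (p.1 <= p.2); rewrite ?normr1 ?normr0.
have D1' p : `|1 - D p| <= 1.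
  by rewrite /D; case: (p.1 <= p.2); rewrite ?subrr ?subr0 ?normr1 ?normr0.
pose F (p : R * R) := (g p.1 * below b p.1) * (h p.2 * below b p.2).
have Fi : (mu \x mu)%E.-integrable setT (EFin \o F).
  exact: (@integrable_prodM _ _ _ _ R mu mu _ _ gbi hbi).
have FDi : (mu \x mu)%E.-integrable setT (EFin \o (fun p => F p * D p)).
  by apply: (@intR_bM _ _ R (mu \x mu)%E setT _ _ _ 1) => // p _; exact: D1.
have FDi' : (mu \x mu)%E.-integrable setT (EFin \o (fun p => F p * (1 - D p))).
  by apply: (@intR_bM _ _ R (mu \x mu)%E setT _ _ _ 1) => //; exact: measurable_funB.
have mD1 x : measurable_fun setT (fun y => D (x, y)).
  exact: measurableT_comp.
have mD2 y : measurable_fun setT (fun x => D (x, y)).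
  exact: measurableT_comp.
have -> : prim g b * prim h b = \int[(mu \x mu)%E]_p F p.
  rewrite Rintegral_prod//; last first.
    by move=> x; exact: (intRZ measurableT (g x * below b x) hbi).
  rewrite !primE -RintegralZr//; apply: eq_Rintegral => x _.
  by rewrite -RintegralZl.
have -> : \int[(mu \x mu)%E]_p F p =
    \int[(mu \x mu)%E]_p (F p * D p) + \int[(mu \x mu)%E]_p (F p * (1 - D p)).
  rewrite -RintegralD//; apply: eq_Rintegral => p _; ring.
rewrite Rintegral_prod_swap//; last first.
  move=> y; apply: (@intR_bM _ _ R mu setT measurableT _ _ 1).
  - have := intRZ measurableT (h y * below b y) gbi.
    by congr (_.-integrable _ _); apply/funext => x; rewrite /F/= mulrC.
  - exact: mD2.
  - by move=> x _; exact: D1.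
rewrite Rintegral_prod//; last first.
  move=> x; apply: (@intR_bM _ _ R mu setT measurableT _ _ 1).
  - exact: (intRZ measurableT (g x * below b x) hbi).
  - by apply: measurable_funB => //; exact: mD1.
  - by move=> y _; exact: D1'.
rewrite addrC primE.
have -> : \int[mu]_t ((g t * prim h t + prim g t * h t) * below b t) =
    \int[mu]_t (g t * prim h t * below b t) + \int[mu]_t (prim g t * h t * below b t).
  rewrite -RintegralD//; last 2 first.
  - by apply: integrable_below; exact: integrable_Mprim.
  - by apply: integrable_below; exact: integrable_primM.
  by apply: eq_Rintegral => t _; rewrite mulrDl.
congr (_ + _); apply: eq_Rintegral => x _.
- transitivity (\int[mu]_y (g x * below b x * (h y * (y < x)%R%:R))).
    apply: eq_Rintegral => y _; rewrite /F/D/= /below.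
    case: (ltP y x) => yx /=; last by rewrite subrr !mulr0.
    by case: (leP x b) => xb /=; rewrite ?(le_trans (ltW yx) xb) /=; ring.
  have yi : mu.-integrable setT (EFin \o (fun y => h y * (y < x)%R%:R)).
    apply: (@intR_bM _ _ R mu setT _ _ _ 1) => //.
    - rewrite -(@indic_bool _ _ `]-oo, x[); first exact: measurable_indic.
      by move=> y /=; rewrite in_itv.
    - by move=> y _; case: (y < x); rewrite ?normr1 ?normr0.
  rewrite RintegralZl// mulrAC; congr (_ * _ * _).
  (* The complement of [D] is the strict half y < x, so the inner integral runs over ]-oo, x[;
     adding the endpoint does not change it. *)
  rewrite /prim -Rintegral_itv_bndo_bndc; last exact: integrableS hi.
  by symmetry; apply: Rintegral_bool => t /=; rewrite in_itv.
- transitivity (\int[mu]_y (h x * below b x * (g y * below x y))).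
    apply: eq_Rintegral => y _; rewrite /F/D/= /below.
    case: (leP y x) => yx; rewrite ?mulr0 ?mulr1//.
    case: (leP x b) => xb; rewrite ?mulr0 ?mul0r ?mulr1//.
    by rewrite (le_trans yx xb) mulr1 mulrC.
  rewrite RintegralZl//; last exact: integrable_below.
  by rewrite primE; ring.
Qed.

End primitive.

(** * Smooth bumps, and uniqueness of finite measures *)

Section smooth_functions.
Context {R : realType}.
Implicit Types (f g : R -> R) (x y p q c : R).

Lemma is_derive_derive1 f x c : is_derive x 1 f c -> derive1 f x = c.
Proof. by move=> [_ fc]; rewrite derive1E. Qed.

Lemma derivable_is_derive1 f x : derivable f x 1 -> is_derive x 1 f (derive1 f x).
Proof. by move=> df; rewrite derive1E; exact: DeriveDef. Qed.

Fixpoint sm (n : nat) f : Prop :=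
  if n is m.+1 then (forall x, derivable f x 1) /\ sm m (derive1 f) else True.

Lemma smS n f : sm n.+1 f -> sm n f.
Proof.
elim: n f => [//|n IH] f [df sf]; split => //; exact: IH.
Qed.

Lemma sm_of_derive n f g : (forall x, is_derive x 1 f (g x)) -> sm n g -> sm n.+1 f.
Proof.
move=> fg sg; split; first by move=> x; have [] := fg x.
by rewrite (_ : derive1 f = g)//; apply/funext => x; exact: is_derive_derive1.
Qed.

Lemma sm_derivable n f : (forall k, sm k f) -> forall x, derivable (derive1n n f) x 1.
Proof.
elim: n f => [|n IH] f sf; first exact: (sf 1%N).1.
rewrite /derive1n iterSr; apply: IH => k; exact: (sf k.+1).2.
Qed.

Lemma smD n f g : sm n f -> sm n g -> sm n (fun x => f x + g x).
Proof.
elim: n f g => [//|n IH] f g [df sf] [dg sg].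
apply: (@sm_of_derive _ _ (fun x => derive1 f x + derive1 g x)).
  by move=> x; apply: is_deriveD; exact: derivable_is_derive1.
exact: IH.
Qed.

Lemma smM n f g : sm n f -> sm n g -> sm n (fun x => f x * g x).
Proof.
elim: n f g => [//|n IH] f g sf sg.
apply: (@sm_of_derive _ _ (fun x => f x * derive1 g x + g x * derive1 f x)).
  by move=> x; apply: is_deriveM; apply: derivable_is_derive1; [exact: sf.1|exact: sg.1].
apply: smD; apply: IH; [exact: smS|exact: sg.2|exact: smS|exact: sf.2].
Qed.

Lemma sm_cst n c : sm n (fun=> c).
Proof.
elim: n c => [//|n IH] c; apply: (@sm_of_derive _ _ (fun=> 0)) => //.
Qed.

Lemma smZ n c f : sm n f -> sm n (fun x => c * f x).
Proof. by move=> sf; apply: smM => //; exact: sm_cst. Qed.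

Lemma sm_affine n f a b : sm n f -> sm n (fun x => f (a * x + b)).
Proof.
elim: n f => [//|n IH] f [df sf].
apply: (@sm_of_derive n (fun x => f (a * x + b)) (fun x => derive1 f (a * x + b) * a)).
  move=> x; apply: (@is_derive1_comp _ f (fun x => a * x + b)).
    exact: derivable_is_derive1.
  apply: is_derive_eq; rewrite /GRing.scale/=; ring.
have := smZ a (IH _ sf); by under eq_fun do rewrite mulrC.
Qed.

(** The classical flat functions s^(-k) exp(-1/s), extended by 0. Derivatives of members of the
    family are combinations of members, which makes smoothness an induction. *)
Definition flatexp (k : nat) (s : R) : R :=
  if 0 < s then s^-1 ^+ k * expR (- s^-1) else 0.

Lemma flatexp_ge0 k s : 0 <= flatexp k s.
Proof.
rewrite /flatexp; case: ifPn => // s0.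
by rewrite mulr_ge0// ?expR_ge0// exprn_ge0// invr_ge0 ltW.
Qed.

(** With y = 1/s, the inequality 1 + y/(k+1) <= exp(y/(k+1)) raised to the power k+1 bounds y^(k+1)
    exp(-y). A bound linear in |s| is what the derivative at 0 requires. *)
Lemma flatexp_le k s : flatexp k s <= (k.+1%:R ^+ k.+1) * `|s|.
Proof.
rewrite /flatexp; case: ifPn => [s0|_]; last by rewrite mulr_ge0// exprn_ge0.
have y0 : 0 < s^-1 by rewrite invr_gt0.
rewrite gtr0_norm// -ler_pdivrMr// expRN mulrAC -exprSr ler_pdivrMr ?expR_gt0//.
have -> : s^-1 ^+ k.+1 = k.+1%:R ^+ k.+1 * (s^-1 / k.+1%:R) ^+ k.+1.
  by rewrite -exprMn mulrC divfK.
rewrite ler_wpM2l ?exprn_ge0//.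
rewrite [leRHS](_ : _ = expR (s^-1 / k.+1%:R) ^+ k.+1); last first.
  by rewrite -expRM_natl -mulrC divfK.
rewrite lerXn2r ?nnegrE ?expR_ge0 ?divr_ge0 ?(ltW y0)//.
by rewrite (le_trans _ (expR_ge1Dx _))// lerDr.
Qed.

Lemma flatexp_derive (k : nat) (s : R) :
  is_derive s 1 (flatexp k) (flatexp k.+2 s - k%:R * flatexp k.+1 s).
Proof.
case: (ltgtP s 0) => [s0|s0|->].
- apply: (@near_eq_is_derive R R R (fun=> 0)).
    have : \forall t \near s, t < 0 by exact: lt_nbhsl.
    by apply: filterS => t t0; rewrite /flatexp ltNge (ltW t0).
  rewrite /flatexp !ltNge (ltW s0)/= mulr0 subrr; exact: is_derive_cst.
- apply: (@near_eq_is_derive R R R (fun t : R => t^-1 ^+ k * expR (- t^-1) : R)).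
    have : \forall t \near s, 0 < t by exact: lt_nbhsr.
    by apply: filterS => t t0; rewrite /flatexp t0.
  rewrite /flatexp s0.
  have sn0 : s != 0 by rewrite gt_eqF.
  have dinv : is_derive s 1 (fun t : R => t^-1) (- s ^- 2).
    have := @is_deriveV R (@id R) s 1 1 sn0 (is_derive_id _ _).
    by rewrite /GRing.scale/= mulr1.
  have dX : is_derive s 1 (fun t : R => t^-1 ^+ k) (k%:R * s^-1 ^+ k.-1 * - s ^- 2).
    have := @is_deriveX _ _ _ k s 1 _ dinv; rewrite /GRing.scale/=.
    by congr (is_derive _ _ _ _); apply/funext => t; rewrite exprfctE.
  have dE : is_derive s 1 (fun t : R => expR (- t^-1)) (expR (- s^-1) * s ^- 2).
    apply: (@is_derive1_comp _ expR (fun t => - t^-1)).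
    have := is_deriveN dinv; by rewrite opprK.
  have := is_deriveM dX dE; rewrite /GRing.scale/=.
  congr (is_derive _ _ _ _); rewrite -exprVn; case: k {dX} => [|k] /=.
    by rewrite !mul0r subr0 expr0 mul1r mulr0 addr0 mulrC.
  rewrite !exprS; ring.
rewrite /flatexp ltxx mulr0 subrr.
have cv : h^-1 *: ((flatexp k \o shift 0) (h *: 1) - flatexp k 0) @[h --> 0^'] --> (0 : R).
  apply/cvgrPdist_le => e e0; near=> h.
  rewrite sub0r normrN /= /shift/= /GRing.scale/= mulr1 addr0 {2}/flatexp ltxx subr0.
  (* The difference quotient at 0 is again a member of the family, and it tends to 0. *)
  have -> : h^-1 * flatexp k h = flatexp k.+1 h.
    by rewrite /flatexp; case: ifP => _; rewrite ?mulr0// exprS mulrA.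
  rewrite ger0_norm ?flatexp_ge0// (le_trans (flatexp_le _ _))//.
  rewrite -ler_pdivlMl; last by rewrite exprn_gt0.
  by near: h; apply: dnbhs0_le; rewrite mulr_gt0// invr_gt0 exprn_gt0.
by apply: DeriveDef; [apply/cvg_ex; exists 0|apply/cvg_lim].
Unshelve. all: by end_near. Qed.

Lemma sm_flatexp n k : sm n (flatexp k).
Proof.
elim: n k => [//|n IH] k; apply: (sm_of_derive (flatexp_derive k)).
apply: smD; first exact: IH.
have := smZ (- k%:R) (IH k.+1); by under eq_fun do rewrite mulNr.
Qed.

(* The bumps [bump p q n] are supported in [p, q] and tend to the indicator of
   ]p, q[ as n tends to infinity. *)
Definition bump p q (n : nat) x : R :=
  flatexp 0 (n.+1%:R * (x - p)) * flatexp 0 (n.+1%:R * (q - x)).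

Lemma flatexp0_le1 s : flatexp 0 s <= 1.
Proof.
rewrite /flatexp; case: ifPn => // s0; rewrite expr0 mul1r.
by rewrite -expR0 ler_expR oppr_le0 invr_ge0 ltW.
Qed.

Lemma flatexp0_cvg s : 0 < s -> flatexp 0 (n.+1%:R * s) @[n --> \oo] --> (1 : R).
Proof.
move=> s0; rewrite -[X in _ --> X]expR0.
rewrite (_ : (fun n => _) = (fun n => expR (- (s^-1 * harmonic n)))); last first.
  apply/funext => n; rewrite /flatexp expr0 mul1r mulr_gt0// ?ltr0n//.
  by rewrite invfM mulrC.
apply: continuous_cvg; first exact: continuous_expR.
rewrite -oppr0; apply: cvgN; rewrite -[X in _ --> X](mulr0 s^-1).
by apply: cvgM; [exact: cvg_cst|exact: cvg_harmonic].
Qed.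

Lemma bump_ge0 p q n x : 0 <= bump p q n x.
Proof. by rewrite mulr_ge0// flatexp_ge0. Qed.

Lemma bump_le1 p q n x : `|bump p q n x| <= 1.
Proof. by rewrite ger0_norm ?bump_ge0// mulr_ile1 ?flatexp_ge0 ?flatexp0_le1. Qed.

Lemma bump_eq0 p q n x : x \notin `]p, q[ -> bump p q n x = 0.
Proof.
rewrite in_itv/= negb_and -!leNgt /bump /flatexp => /orP[xp|qx].
  by rewrite ltNge mulr_ge0_le0 ?ler0n ?subr_le0// mul0r.
by rewrite [X in _ * X]ifN ?mulr0// -leNgt mulr_ge0_le0 ?ler0n ?subr_le0.
Qed.

Lemma bump_cvg p q x :
  bump p q n x @[n --> \oo] --> ((x \in `]p, q[)%:R : R).
Proof.
have [xpq|xpq] := boolP (x \in `]p, q[); last first.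
  apply: cvg_near_cst; near=> n; exact: bump_eq0.
move: xpq; rewrite in_itv/= => /andP[px xq]; rewrite -[X in _ --> X](mulr1 1).
by apply: cvgM; apply: flatexp0_cvg; rewrite subr_gt0.
Unshelve. all: by end_near. Qed.

Lemma sm_bump k p q n : sm k (bump p q n).
Proof.
apply: smM.
  rewrite (_ : (fun x => _) = (fun x => flatexp 0 (n.+1%:R * x + - (n.+1%:R * p)))).
    exact/sm_affine/sm_flatexp.
  by apply/funext => x; rewrite mulrBr.
rewrite (_ : (fun x => _) = (fun x => flatexp 0 (- n.+1%:R * x + n.+1%:R * q))).
  exact/sm_affine/sm_flatexp.
by apply/funext => x; rewrite mulrBr mulNr addrC.
Qed.

Lemma test1_bump (D : set R) p q n : `[p, q] `<=` D -> test1 D (bump p q n).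
Proof.
move=> pqD; split.
  by move=> k x; apply: sm_derivable => j; exact: sm_bump.
exists `[p, q]%classic; split=> //; first exact: segment_compact.
move=> x xpq; apply: bump_eq0; apply/negP => xin; apply: xpq.
exact: subset_itv_oo_cc xin.
Qed.

Lemma continuous_bump p q n : continuous (bump p q n).
Proof.
move=> x; apply/differentiable_continuous/derivable1_diffP.
exact: (sm_bump 1 p q n).1.
Qed.

Lemma bcs_bump p q n : bcs (bump p q n).
Proof.
apply: (@bcs_continuous _ _ (`|p| + `|q|)); first exact: continuous_bump.
move=> x xpq; apply: bump_eq0; rewrite in_itv/=; apply/negP => /andP[px qx].
move: xpq; rewrite ltNge => /negP; apply; rewrite ler_norml.
have := ler_norm q; have := ler_norm (- p); rewrite normrN.
have := normr_ge0 p; have := normr_ge0 q; lra.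
Qed.

Lemma Rintegral_indic_itv (a b : R) : a <= b ->
  \int[@lebesgue_measure R]_x \1_(`[a, b]) x = b - a.
Proof.
move=> ab; have xE x : `[a, b]%classic x <-> x \in `[a, b] by [].
rewrite (indic_bool R xE).
have := Rintegral_bool lebesgue_measure (fun=> 1) xE.
under [in X in _ = X]eq_Rintegral do rewrite mul1r.
move=> <-; rewrite Rintegral_cst// mul1r /= lebesgue_measure_itv/=.
rewrite lte_fin; case: ltP => [_|ba]; first by rewrite -EFinD.
by rewrite (le_anti (introT andP (conj ab ba))) subrr.
Qed.

(** On the middle third of [p, q] both factors are at least their value at distance (q - p) / 3 from
    the endpoint. *)
Lemma bump_mass p q n : p < q ->
  0 < \int[@lebesgue_measure R]_x bump p q n x.
Proof.
move=> pq; pose d := (q - p) / 3; have d0 : 0 < d by rewrite /d; lra.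
have nd0 : 0 < n.+1%:R * d by rewrite mulr_gt0// ltr0n.
pose c : R := flatexp 0 (n.+1%:R * d) * flatexp 0 (n.+1%:R * d).
have fl s : n.+1%:R * d <= s -> flatexp 0 (n.+1%:R * d) <= flatexp 0 s.
  move=> ds; rewrite /flatexp nd0 (lt_le_trans nd0 ds) !expr0 !mul1r ler_expR lerN2.
  by rewrite lef_pV2// posrE// (lt_le_trans nd0).
have c0 : 0 < c by rewrite /c /flatexp nd0 expr0 mul1r mulr_gt0// expR_gt0.
apply: (@lt_le_trans _ _ (c * d)); first exact: mulr_gt0.
have -> : c * d = \int[lebesgue_measure]_x (c * \1_(`[p + d, q - d]) x).
  rewrite RintegralZl//; last exact: (bcs_integrable (bcs_indic _ _)).
  by rewrite Rintegral_indic_itv /d; [congr (_ * _); field|lra].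
apply: le_Rintegral => //.
- exact: (bcs_integrable (bcsZ c (bcs_indic _ _))).
- exact: (bcs_integrable (bcs_bump _ _ _)).
- move=> x _; rewrite indicE; case: (boolP (_ \in _)) => [|_]; last first.
    by rewrite mulr0 bump_ge0.
  rewrite inE/= in_itv/= => /andP[px xq]; rewrite mulr1 /c /bump.
  apply: ler_pM; rewrite ?flatexp_ge0// fl// ler_pM2l ?ltr0n//; lra.
Qed.

Lemma test_measure_itv (m : {finite_measure set (measurableTypeR R) -> \bar R}) p q :
  \int[m]_x bump p q n x @[n --> \oo] --> fine (m `]p, q[%classic).
Proof.
have -> : fine (m `]p, q[%classic) = \int[m]_x \1_(`]p, q[%classic) x.
  by rewrite /Rintegral integral_indic// setIT.
apply: (@Rintegral_dominated _ _ R m setT measurableT _ _ (fun=> 1)).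
- by move=> n; apply: continuous_measurable_fun; exact: continuous_bump.
- apply: (@intR_finite _ _ R m setT measurableT _ 1) => //.
    exact: fin_num_fun_lty.
  by move=> x _; rewrite normr1.
- by move=> n x _; exact: bump_le1.
- exact: measurable_indic.
- apply: aeW => x _; have := @bump_cvg p q x.
  by rewrite (@indic_bool _ _ `]p, q[%classic (fun x => x \in `]p, q[)).
Qed.

(** Bumps converge to indicators of open intervals, so the measures agree on these; open intervals
    are stable under intersection, generate the Borel sets and exhaust the line. *)
Lemma test_measure_unique (m1 m2 : {finite_measure set (measurableTypeR R) -> \bar R}) :
  (forall phi, test1 setT phi -> \int[m1]_x phi x = \int[m2]_x phi x) ->
  forall A, measurable A -> m1 A = m2 A.
Proof.
move=> m12.
have mitv p q : m1 `]p, q[%classic = m2 `]p, q[%classic.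
  rewrite -[LHS]fineK ?fin_num_measure// -[RHS]fineK ?fin_num_measure//.
  congr (_%:E); have h1 := @test_measure_itv m1 p q.
  have h2 := @test_measure_itv m2 p q.
  rewrite -(cvg_lim (@Rhausdorff R) h1) -(cvg_lim (@Rhausdorff R) h2).
  congr (limn _); apply/funext => n; rewrite m12//.
  exact: test1_bump.
move=> A mA; have := @measure_unique _ R (measurableTypeR R) (@RGenOpens.G R)
  (fun n => `](- n%:R : R), n%:R[%classic) (RGenOpens.measurableE R).
move=> h; apply: (h _ _ _ m1 m2 _ _ A mA).
- move=> _ _ [a [b ->]] [c [d ->]].
  exists (Num.max a c), (Num.min b d); apply/seteqP; split=> x /=;
    rewrite !in_itv/= gt_max lt_min.
    by move=> [/andP[-> ->] /andP[-> ->]].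
  by move=> /andP[/andP[-> ->] /andP[-> ->]].
- by move=> n; exists (- n%:R), n%:R.
- apply/seteqP; split => // x _; exists (Num.bound `|x|) => //=.
  by rewrite in_itv/= -ltr_norml archi_boundP.
- by move=> _ [a [b ->]]; exact: mitv.
- by move=> k; rewrite -ge0_fin_numE// fin_num_measure.
Qed.

End smooth_functions.

(** * Weak derivatives and derivative measures *)

Section weak_derivatives.
Context {R : realType}.
Local Notation mu := (@lebesgue_measure R).
Implicit Types (f g u : R -> R) (x y p q c a b : R).

Lemma prim_derive g x : mu.-integrable setT (EFin \o g) ->
  {for x, continuous g} -> is_derive x 1 (prim g) (g x).
Proof.
move=> gi gc.
have gi' : mu.-integrable [set` Interval -oo%O (BRight (x + 1))] (EFin \o g).
  exact: (integrableS measurableT).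
have x1 : x < x + 1 by rewrite ltrDl.
have [dG dGE] := @continuous_FTC1 R g -oo%O x (x + 1) x1 gi' (ltNyr _) gc.
by rewrite -dGE; exact: derivable_is_derive1.
Qed.

Lemma prim_below g a x : (forall y, y <= a -> g y = 0) -> x <= a -> prim g x = 0.
Proof.
move=> g0 xa; rewrite primE -[RHS](mul0r (fine (mu setT))) -Rintegral_cst//.
apply: eq_Rintegral => t _; rewrite /below.
by case: leP => tx; rewrite ?mulr0// mulr1 g0// (le_trans tx).
Qed.

Lemma prim_above g b x : (forall y, b < y -> g y = 0) -> b <= x ->
  prim g x = \int[mu]_t g t.
Proof.
move=> g0 bx; rewrite primE; apply: eq_Rintegral => t _; rewrite /below.
by case: leP => tx; rewrite ?mulr1// mulr0 g0// (le_lt_trans bx).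
Qed.

Lemma test1_smooth (D : set R) phi : test1 D phi ->
  (forall x, is_derive x 1 phi (derive1 phi x)) /\ continuous (derive1 phi).
Proof.
move=> [sphi _]; split=> x; first by apply: derivable_is_derive1; exact: (sphi 0%N).
apply/differentiable_continuous/derivable1_diffP; exact: (sphi 1%N).
Qed.

Lemma derive1_locally0 f x : (\forall y \near x, f y = 0) -> derive1 f x = 0.
Proof.
move=> f0; rewrite derive1E.
rewrite (@near_eq_derive _ R R f (cst 0) x 1) ?derive_cst//.
Qed.

Lemma test1_support (D : set R) phi : test1 D phi -> exists2 M : R, 0 < M &
  (forall x, M < `|x| -> phi x = 0 /\ derive1 phi x = 0).
Proof.
move=> [_ [K [cK _ K0]]].
have [M [_ KM]] := compact_bounded cK.
pose N : R := `|M| + 1; have N0 : 0 < N by rewrite /N; have := normr_ge0 M; lra.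
have KN x : N < `|x| -> phi x = 0.
  move=> Nx; apply: K0 => Kx; have := KM N _ x Kx.
  have MN : M < N by rewrite /N; have := ler_norm M; lra.
  by move=> /(_ MN) /=; rewrite leNgt Nx.
exists N => // x Nx; split; first exact: KN.
apply: derive1_locally0.
have : \forall y \near x, N < `|y|.
  by apply: (cvgr_gt _ (@norm_continuous _ _ x)).
by apply: filterS => y; exact: KN.
Qed.

Lemma test1_bcs (D : set R) phi : test1 D phi -> bcs phi /\ bcs (derive1 phi).
Proof.
move=> tphi; have [dphi cphi] := test1_smooth tphi.
have [M M0 phi0] := test1_support tphi.
split; apply: (@bcs_continuous _ _ M) => //.
- by move=> x; apply/differentiable_continuous/derivable1_diffP; have [] := dphi x.
- by move=> x /phi0[].
- by move=> x /phi0[].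
Qed.

Lemma C1_prim f f' M : (forall x, is_derive x 1 f (f' x)) -> continuous f' ->
  (forall x, M < `|x| -> f x = 0) -> (forall x, M < `|x| -> f' x = 0) ->
  forall x, f x = prim f' x.
Proof.
move=> df cf' f0 f'0 x.
have bf' : bcs f' by exact: (@bcs_continuous _ _ M).
pose h y := f y - prim f' y.
have dh y : is_derive y 1 h 0.
  rewrite -(subrr (f' y)); apply: is_deriveB; apply: prim_derive; last exact: cf'.
  exact: bcs_integrable.
have hc y z : h y = h z by exact: is_derive_0_is_cst.
have h0 : h (- `|M| - 1) = 0.
  have f'0' y : y <= - `|M| - 1 -> f' y = 0.
    move=> yM; apply: f'0; rewrite ltr_normr; apply/orP; right.
    have := ler_norm M; lra.
  rewrite /h (@prim_below _ (- `|M| - 1))// subr0 f0// ltr_normr; apply/orP; right.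
  have := ler_norm M; lra.
by apply/eqP; rewrite -subr_eq0 -/(h x) (hc x (- `|M| - 1)) h0.
Qed.

Lemma test1_prim (D : set R) phi x : test1 D phi -> phi x = prim (derive1 phi) x.
Proof.
move=> tphi; have [dphi cphi] := test1_smooth tphi.
have [M M0 phi0] := test1_support tphi.
by apply: (@C1_prim _ _ M) => // y /phi0[].
Qed.

Lemma prim_ibp_line g h M : mu.-integrable setT (EFin \o g) ->
  mu.-integrable setT (EFin \o h) ->
  (forall x, M < x -> g x = 0) -> (forall x, M < x -> h x = 0) ->
  \int[mu]_x (g x * prim h x) + \int[mu]_x (prim g x * h x) =
  (\int[mu]_x g x) * (\int[mu]_x h x).
Proof.
move=> gi hi g0 h0.
rewrite -(prim_above g0 (lexx M)) -(prim_above h0 (lexx M)) prim_ibp//.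
rewrite (@prim_above _ M)//; last by move=> x Mx; rewrite g0// h0// mul0r mulr0 addr0.
by rewrite RintegralD//; [exact: integrable_Mprim|exact: integrable_primM].
Qed.

(** A difference of two bumps of mass one has integral zero, so its primitive is compactly
    supported. This supplies test functions with a prescribed derivative. *)
Lemma test1_prim_bump p q d (D : set R) : 0 < d ->
  `[p - d, p + d] `<=` D -> `[q - d, q + d] `<=` D ->
  (forall x y z, D x -> D y -> x <= z <= y -> D z) ->
  let I r := \int[mu]_x bump (r - d) (r + d) 0 x in
  let eta x := (I p)^-1 * bump (p - d) (p + d) 0 x -
               (I q)^-1 * bump (q - d) (q + d) 0 x in
  test1 D (prim eta) /\ derive1 (prim eta) = eta.
Proof.
move=> d0 pD qD Dconv I eta.
have I0 r : 0 < I r by apply: bump_mass; lra.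
have bb r := bcs_bump (r - d) (r + d) 0.
have beta : bcs eta by apply: bcsB; exact: bcsZ.
have ceta : continuous eta.
  move=> x; apply: cvgB; (apply: cvgM; first exact: cvg_cst); exact: continuous_bump.
have ieta := bcs_integrable beta.
have deta x : is_derive x 1 (prim eta) (eta x) by apply: prim_derive => //; exact: ceta.
have etaE : derive1 (prim eta) = eta.
  by apply/funext => x; exact: is_derive_derive1.
have eta0 : \int[mu]_x eta x = 0.
  rewrite RintegralB//; try by apply: bcs_integrable; exact: bcsZ.
  rewrite !RintegralZl//; try exact: bcs_integrable.
  by rewrite -/(I p) -/(I q) !mulVf ?gt_eqF// subrr.
split => //; split.
  move=> n x; apply: sm_derivable => -[//|k].
  apply: (sm_of_derive deta); rewrite /eta.
  apply: smD; first exact/smZ/sm_bump.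
  under eq_fun do rewrite -mulNr.
  exact/smZ/sm_bump.
pose lo := Num.min p q - d; pose hi := Num.max p q + d.
exists `[lo, hi]%classic; split.
- exact: segment_compact.
- move=> x; rewrite /= in_itv/= => /andP[lox xhi]; apply: (Dconv lo hi).
  + rewrite /lo; case: (leP p q) => _; [apply: pD|apply: qD]; rewrite /= in_itv/=; apply/andP; split; lra.
  + rewrite /hi; case: (leP p q) => _; [apply: qD|apply: pD]; rewrite /= in_itv/=; apply/andP; split; lra.
  + by rewrite lox.
- move=> x; rewrite /= in_itv/= => /negP; rewrite negb_and -!ltNge => /orP[xlo|hix].
    apply: (@prim_below _ lo); last exact: ltW.
    move=> y ylo; rewrite /eta !bump_eq0 ?mulr0 ?subrr// in_itv/= negb_and -!leNgt;
    apply/orP; left; rewrite (le_trans ylo)// /lo lerD2r ge_min lexx ?orbT//.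
  rewrite (@prim_above _ hi) ?(ltW hix)//.
  move=> y hiy; rewrite /eta !bump_eq0 ?mulr0 ?subrr// in_itv/= negb_and -!leNgt;
    apply/orP; right; rewrite (le_trans _ (ltW hiy))// /hi lerD2r le_max lexx ?orbT//.
Qed.

(* du Bois-Reymond, testing against normalised bumps at p and at q. *)
Lemma test1_const (k : R -> R) a b : {in `]a, b[, continuous k} ->
  (forall phi, test1 `]a, b[ phi -> \int[mu]_(x in `]a, b[) (k x * derive1 phi x) = 0) ->
  forall p q, p \in `]a, b[ -> q \in `]a, b[ -> k p = k q.
Proof.
move=> kc k0.
suff H p q : p \in `]a, b[ -> q \in `]a, b[ -> k p <= k q.
  by move=> p q pab qab; apply/eqP; rewrite eq_le !H.
move=> pab qab; rewrite leNgt; apply/negP => kqp.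
pose e := (k p - k q) / 3; have e0 : 0 < e by rewrite /e; lra.
have near_d r : r \in `]a, b[ -> \forall d \near (0 : R)^'+, forall x,
    x \in `[r - d, r + d] -> (x \in `]a, b[) /\ `|k r - k x| < e.
  move=> rab; have : \forall x \near r, (x \in `]a, b[) /\ `|k r - k x| < e.
    near=> x; split; last by near: x; move/cvgrPdist_lt : (kc r rab); exact.
    by near: x; exact: near_in_itvoo.
  move=> /nbhs_ballP[d /= d0 dr]; near=> d' => x xd'; apply: dr.
  rewrite /ball/= distrC ltr_distlC; move: xd'; rewrite in_itv/= => /andP[h1 h2].
  have d'd : d' < d by near: d'; exact: nbhs_right_lt.
  by apply/andP; split; lra.
near (0 : R)^'+ => d.
have d0 : 0 < d by [].
have Pd : forall x, x \in `[p - d, p + d] -> (x \in `]a, b[) /\ `|k p - k x| < e.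
  by near: d; exact: near_d.
have Qd : forall x, x \in `[q - d, q + d] -> (x \in `]a, b[) /\ `|k q - k x| < e.
  by near: d; exact: near_d.
pose I r := \int[mu]_x bump (r - d) (r + d) 0 x.
pose eta x := (I p)^-1 * bump (p - d) (p + d) 0 x - (I q)^-1 * bump (q - d) (q + d) 0 x.
have [teta deta] : test1 `]a, b[%classic (prim eta) /\ derive1 (prim eta) = eta.
  apply: (@test1_prim_bump p q d _ d0).
  - by move=> x /Pd[].
  - by move=> x /Qd[].
  - move=> x y z; rewrite /= !in_itv/= => /andP[ax xb] /andP[ay yb] /andP[xz zy].
    by rewrite (lt_le_trans ax xz) (le_lt_trans zy yb).
have I0 r : 0 < I r by apply: bump_mass; lra.
have := k0 _ teta; rewrite deta => k0'.
have bb r := bcs_bump (r - d) (r + d) 0.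
have ib r c : mu.-integrable setT (EFin \o (fun x => c * ((I r)^-1 * bump (r - d) (r + d) 0 x))).
  by apply: bcs_integrable; do 2 apply: bcsZ.
(* [L] replaces [k] by its lower bound near p and its upper bound near q. It lies below [k * eta],
   whose integral is 0, and yet has integral (k p - e) - (k q + e) = e > 0. *)
pose L x := (k p - e) * ((I p)^-1 * bump (p - d) (p + d) 0 x) -
            (k q + e) * ((I q)^-1 * bump (q - d) (q + d) 0 x).
have iL : mu.-integrable setT (EFin \o L) by exact: intRB.
have I1 r c : \int[mu]_x (c * ((I r)^-1 * bump (r - d) (r + d) 0 x)) = c.
  rewrite RintegralZl//; last by apply: bcs_integrable; exact: bcsZ.
  rewrite RintegralZl//; last exact: bcs_integrable.
  by rewrite -/(I r) mulVf ?mulr1// gt_eqF.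
have bump_out r x : x \notin `[r - d, r + d] -> bump (r - d) (r + d) 0 x = 0.
  move=> xr; apply: bump_eq0; apply: contra xr; exact: subset_itv_oo_cc.
have bump_pos r x : 0 <= (I r)^-1 * bump (r - d) (r + d) 0 x.
  by rewrite mulr_ge0 ?bump_ge0// invr_ge0 ltW.
have IL : \int[mu]_(x in `]a, b[) L x = e.
  transitivity (\int[mu]_x L x); last by rewrite RintegralB// !I1 /e; lra.
  rewrite Rintegral_itv.
  apply: eq_Rintegral => x _; case: (boolP (x \in _)) => [_|xab]; first by rewrite mulr1.
  rewrite mulr0 /L !bump_out ?mulr0 ?subr0//.
    by apply: contra xab => /Qd[].
  by apply: contra xab => /Pd[].
have mketa : measurable_fun (`]a, b[%classic : set R) (fun x => k x * eta x).
  apply: measurable_funM.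
    apply: open_continuous_measurable_fun; first exact: itv_open.
    by move=> x; rewrite inE; exact: kc.
  apply: measurable_funTS; apply: (proj1 _); last first.
    by apply: bcsB; exact: (bcsZ _ (bb _)).
have keta_bound x : `|k x * eta x| <= (`|k p| + `|k q| + e) * (`|eta x|).
  rewrite normrM.
  have [xp|xp] := boolP (x \in `[p - d, p + d]).
    rewrite ler_wpM2r//; have [_] := Pd x xp; rewrite ltr_norml => /andP[h1 h2].
    have := normr_ge0 (k q); have := ler_norm (k p); have := ler_norm (- k p).
    rewrite normrN ler_norml; lra.
  have [xq|xq] := boolP (x \in `[q - d, q + d]).
    rewrite ler_wpM2r//; have [_] := Qd x xq; rewrite ltr_norml => /andP[h1 h2].
    have := normr_ge0 (k p); have := ler_norm (k q); have := ler_norm (- k q).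
    rewrite normrN ler_norml; lra.
  by rewrite /eta (bump_out _ _ xp) (bump_out _ _ xq) !mulr0 subrr normr0 !mulr0.
have ieta : mu.-integrable setT (EFin \o eta).
  by apply: bcs_integrable; apply: bcsB; exact: (bcsZ _ (bb _)).
have : e <= 0; last by rewrite leNgt e0.
rewrite -IL -k0'; apply: le_Rintegral => //.
- exact: integrableS iL.
- apply: (@intR_le _ _ R mu _ _ _ (fun x => (`|k p| + `|k q| + e) * (`|eta x|))) => //.
  by apply: integrableS (intRZ measurableT _ (intR_abs ieta)).
move=> x _; rewrite /L /eta mulrBr lerB//.
  have [xp|xp] := boolP (x \in `[p - d, p + d]); last by rewrite bump_out// !mulr0.
  rewrite ler_wpM2r//; have [_] := Pd x xp; rewrite ltr_norml; lra.
have [xq|xq] := boolP (x \in `[q - d, q + d]); last by rewrite bump_out// !mulr0.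
rewrite ler_wpM2r//; have [_] := Qd x xq; rewrite ltr_norml; lra.
Unshelve. all: by end_near. Qed.

(** [u - prim G] has weak derivative zero, so it is constant on the open interval, and by continuity
    on the closed one. Weak derivatives are thereby replaced by integrals from here on. *)
Lemma weak_derivative_prim u g a b : a < b ->
  {within `[a, b], continuous u} -> mu.-integrable `]a, b[ (EFin \o g) ->
  weak_derivative `]a, b[ u g ->
  let G := fun x => g x * (x \in `]a, b[)%:R in
  mu.-integrable setT (EFin \o G) /\
  forall x, x \in `[a, b] -> u x = u a + prim G x.
Proof.
move=> ab cu gi ug G.
have GE : EFin \o G = (EFin \o g) \_ `]a, b[.
  apply/funext => x; rewrite /= /G /restrict.
  by case: ifPn => [|/negP]; rewrite inE/= => h; rewrite ?h ?mulr1// (negbTE (introN idP h)) mulr0.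
have Gi : mu.-integrable setT (EFin \o G).
  by rewrite GE; have /integrable_mkcond := gi; apply.
split => //.
have cuab x : x \in `]a, b[ -> {for x, continuous u}.
  move=> xab; have [cu' _ _] := (continuous_within_itvP u ab).1 cu.
  exact: cu'.
pose k x := u x - prim G x.
have ck : {in `]a, b[, continuous k}.
  by move=> x xab; apply: cvgB; [exact: cuab|exact: prim_continuous].
have mu' : measurable_fun (`]a, b[%classic : set R) u.
  apply: open_continuous_measurable_fun; first exact: itv_open.
  by move=> x; rewrite inE; exact: cuab.
have [K uK] : exists K : R, forall x, x \in `[a, b] -> `|u x| <= K.
  have /compact_bounded[K [_ Kb]] : compact [set u x | x in `[a, b]].
    by apply: continuous_compact cu _; exact: segment_compact.
  exists (K + 1) => x xab; apply: (Kb (K + 1)); first by rewrite ltrDl.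
  by exists x.
have k0 phi : test1 `]a, b[ phi -> \int[mu]_(x in `]a, b[) (k x * derive1 phi x) = 0.
  move=> tphi; have [bphi bdphi] := test1_bcs tphi.
  have iphi := bcs_integrable bphi; have idphi := bcs_integrable bdphi.
  have phi0 x : x \notin `]a, b[ -> phi x = 0.
    have [_ [C [_ Cab C0]]] := tphi.
    by move=> /negP xab; apply: C0 => /Cab.
  have iud : mu.-integrable `]a, b[ (EFin \o (fun x => u x * derive1 phi x)).
    rewrite (_ : (fun x => u x * _) = (fun x => derive1 phi x * u x)); last first.
      by apply/funext => x; rewrite mulrC.
    apply: (@intR_bM _ _ R mu _ _ _ _ K) => //.
      exact: integrableS idphi.
    by move=> x xab; apply: uK; exact: subset_itv_oo_cc xab.
  have iGd : mu.-integrable setT (EFin \o (fun x => prim G x * derive1 phi x)).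
    exact: integrable_primM.
  transitivity (\int[mu]_(x in `]a, b[) (u x * derive1 phi x - prim G x * derive1 phi x)).
    by apply: eq_Rintegral => x _; rewrite /k mulrBl.
  rewrite RintegralB//; last exact: integrableS iGd.
  rewrite ug//.
  have [M M0 phiM] := test1_support tphi.
  pose M' := Num.max M b.
  have phiE : phi = prim (derive1 phi) by apply/funext => x; exact: test1_prim tphi.
  have := @prim_ibp_line G (derive1 phi) M' Gi idphi.
  rewrite -phiE => ibp.
  have Iphi0 : \int[mu]_x derive1 phi x = 0.
    rewrite -(@prim_above _ M' (M' + 1)) ?lerDl//.
      rewrite -(test1_prim _ tphi); apply: (phiM _ _).1.
      by rewrite (lt_le_trans _ (ler_norm _))// /M' ltr_pwDr// le_max lexx.
    move=> y My; apply: (phiM _ _).2; rewrite (lt_le_trans _ (ler_norm _))//.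
    by rewrite (le_lt_trans _ My)// le_max lexx.
  have : \int[mu]_x (G x * phi x) + \int[mu]_x (prim G x * derive1 phi x) = 0.
    rewrite ibp ?Iphi0 ?mulr0//.
      move=> x Mx; rewrite /G in_itv/= [x < b]ltNge (le_trans _ (ltW Mx)) ?andbF ?mulr0//.
      by rewrite le_max lexx orbT.
    move=> y My; apply: (phiM _ _).2; rewrite (lt_le_trans _ (ler_norm _))//.
    by rewrite (le_lt_trans _ My)// le_max lexx.
  have -> : \int[mu]_(x in `]a, b[) (g x * phi x) = \int[mu]_x (G x * phi x).
    rewrite Rintegral_itv.
    by apply: eq_Rintegral => x _; rewrite /G mulrAC.
  have -> : \int[mu]_(x in `]a, b[) (prim G x * derive1 phi x) =
      \int[mu]_x (prim G x * derive1 phi x); last by lra.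
  rewrite Rintegral_itv.
  rewrite {1}/Rintegral; congr fine; apply: ae_eq_integral => //.
  - apply/measurable_EFinP; apply: measurable_funM.
      by apply: measurable_funM; [exact: measurable_prim|exact: bdphi.1].
    exact: measurable_mem_itv.
  - by apply/measurable_EFinP; apply: measurable_funM; [exact: measurable_prim|exact: bdphi.1].
  (* The endpoints form a null set; strictly outside [a, b] the test function vanishes near x, and
     so does its derivative. *)
  apply: (@countable_ae _ [set a; b]); first exact: finite_set_countable.
  move=> x /not_orP[/eqP xa /eqP xb] _; congr (_%:E).
  have [|xab] := boolP (x \in `]a, b[); rewrite ?mulr1//.
  rewrite (_ : derive1 phi x = 0) ?mulr0//; apply: derive1_locally0.
  move: xab; rewrite in_itv/= negb_and -!leNgt !le_eqVlt (negbTE xa) [b == x]eq_sym (negbTE xb)/=.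
  move=> /orP[xa'|bx].
    have : \forall y \near x, y < a by exact: lt_nbhsl.
    by apply: filterS => y ya; apply: phi0; rewrite in_itv/= ltNge (ltW ya).
  have : \forall y \near x, b < y by exact: lt_nbhsr.
  by apply: filterS => y ya; apply: phi0; rewrite in_itv/= andbC ltNge (ltW ya).
have kconst := test1_const ck k0.
have Ga : prim G a = 0.
  apply: (@prim_below _ a) => // y ya.
  by rewrite /G in_itv/= ltNge ya/= mulr0.
have wk : {within `[a, b], continuous k}.
  move=> x; apply: cvgB; first exact: cu.
  by apply: continuous_subspaceT; exact: prim_continuous.
have mid : (a + b) / 2 \in `]a, b[ by rewrite in_itv/=; apply/andP; split; lra.
have [_ kR kL] := (continuous_within_itvP k ab).1 wk.
have kmid x : x \in `[a, b] -> k x = k ((a + b) / 2).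
  rewrite in_itv/= !le_eqVlt => /andP[/orP[/eqP <-|ax] /orP[/eqP xb|xb]].
  - by move: ab; rewrite xb ltxx.
  - apply: (@cvg_unique _ (@Rhausdorff R) (k x @[x --> a^'+])) kR _.
    apply: cvg_near_cst; near=> y; apply: kconst => //.
    by rewrite in_itv/=; apply/andP; split.
  - rewrite xb; apply: (@cvg_unique _ (@Rhausdorff R) (k x @[x --> b^'-])) kL _.
    apply: cvg_near_cst; near=> y; apply: kconst => //.
    by rewrite in_itv/=; apply/andP; split.
  - by apply: kconst => //; rewrite in_itv/= ax.
move=> x xab; have := kmid x xab; rewrite -(kmid a) ?in_itv/= ?lexx ?(ltW ab)//.
by rewrite /k Ga subr0 => /eqP; rewrite subr_eq => /eqP.
Unshelve. all: by end_near. Qed.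

End weak_derivatives.

(** * Finite measures and measures with a density *)

Section finite_measures.
Context d (T : measurableType d) (R : realType).

(** The identity on measures; the proof of finiteness is an argument so that the structure of a
    finite measure can be attached to the name. *)
Definition fin_meas (m : {measure set T -> \bar R}) of (m setT < +oo)%E :
  set T -> \bar R := m.

Section pack.
Variables (m : {measure set T -> \bar R}) (moo : (m setT < +oo)%E).

HB.instance Definition _ := Measure.copy (fin_meas moo) m.

Let finm : fin_num_fun (fin_meas moo).
Proof.
move=> A mA; rewrite ge0_fin_numE//; apply: le_lt_trans moo.
by apply: le_measure => //; rewrite inE.
Qed.

HB.instance Definition _ := Measure_isFinite.Build d T R (fin_meas moo) finm.
End pack.

Lemma finite_measure_ex (m : {measure set T -> \bar R}) : (m setT < +oo)%E ->
  exists m' : {finite_measure set T -> \bar R}, forall A, m' A = m A.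
Proof. by move=> moo; exists (fin_meas moo). Qed.

Definition density (mu : {measure set T -> \bar R}) (g : T -> R)
  of measurable_fun setT g & (forall x, 0 <= g x) : set T -> \bar R :=
  fun A => (\int[mu]_(x in A) (g x)%:E)%E.

Section density_measure.
Variables (mu : {measure set T -> \bar R}) (g : T -> R).
Hypotheses (mg : measurable_fun setT g) (g0 : forall x, 0 <= g x).

Let dens0 : density mu mg g0 set0 = 0%E.
Proof. by rewrite /density integral_set0. Qed.

Let dens_ge0 A : (0 <= density mu mg g0 A)%E.
Proof. by apply: integral_ge0 => x _; rewrite lee_fin. Qed.

Let dens_sigma : semi_sigma_additive (density mu mg g0).
Proof.
apply: semi_sigma_additive_nng_induced; first exact/measurable_EFinP.
by move=> x; rewrite lee_fin.
Qed.

HB.instance Definition _ := isMeasure.Build d T R (density mu mg g0)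
  dens0 dens_ge0 dens_sigma.
End density_measure.

Lemma integrable_bounded_fin (m : {finite_measure set T -> \bar R}) (w : T -> R) M :
  measurable_fun setT w -> (forall x, `|w x| <= M) ->
  m.-integrable setT (EFin \o w).
Proof.
move=> mw wM; apply: (@intR_finite _ _ R m setT _ _ M) => //.
by rewrite -ge0_fin_numE// fin_num_measure.
Qed.

End finite_measures.

(** The density measure is absolutely continuous and its Radon-Nikodym derivative equals g almost
    everywhere. The change of variables for nonnegative functions extends to bounded w by splitting
    w into positive and negative parts. *)
Lemma density_ex d (T : measurableType d) (R : realType)
    (mu : {sigma_finite_measure set T -> \bar R}) (g : T -> R) :
  mu.-integrable setT (EFin \o g) -> (forall x, 0 <= g x) ->
  exists m : {finite_measure set T -> \bar R}, forall (w : T -> R) (M : R),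
    measurable_fun setT w -> (forall x, `|w x| <= M) ->
    \int[m]_x w x = \int[mu]_x (g x * w x).
Proof.
move=> gi g0; have mg := intR_measurable gi.
have doo : (density mu mg g0 setT < +oo)%E.
  by rewrite /density -RintegralE// ltry.
have [m mE] := finite_measure_ex doo; exists m => w M mw wM.
have numu : m `<< mu.
  apply/null_content_dominatesP => A mA A0.
  by rewrite mE /= /density; apply: null_set_integral => //; exact/measurable_EFinP/measurable_funTS.
have RNg : ae_eq mu setT (Radon_Nikodym_SigmaFinite.f m mu) (EFin \o g).
  apply: integral_ae_eq => //.
  - exact: Radon_Nikodym_SigmaFinite.f_integrable.
  - exact/measurable_EFinP.
  move=> E _ mEE; have <- := Radon_Nikodym_SigmaFinite.f_integral numu mEE.
  exact: mE.
have pos (v : T -> R) (K : R) : measurable_fun setT v -> (forall x, 0 <= v x) ->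
    (forall x, `|v x| <= K) -> \int[m]_x v x = \int[mu]_x (g x * v x).
  move=> mv v0 vK; rewrite /Rintegral; congr fine.
  rewrite -(Radon_Nikodym_SigmaFinite.change_of_variables numu)//; last first.
    exact/measurable_EFinP.
  apply: ae_eq_integral => //.
  - apply: emeasurable_funM; first exact/measurable_EFinP.
    exact: (measurable_int mu (Radon_Nikodym_SigmaFinite.f_integrable numu)).
  - by apply/measurable_EFinP; apply: measurable_funM.
  apply: filterS RNg => x /= RNx _; rewrite RNx//= -EFinM mulrC//.
have [K wK] : exists K : R, forall x, `|w x| <= K by exists M.
pose wp x := Num.max (w x) 0; pose wn x := Num.max (- w x) 0.
have wE x : w x = wp x - wn x.
  by rewrite /wp /wn; case: (ltP (w x) 0) => h; case: (ltP (- w x) 0); lra.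
have mwp : measurable_fun setT wp by apply: measurable_maxr.
have mwn : measurable_fun setT wn.
  by apply: measurable_maxr => //; exact: measurable_funN.
have wp0 x : 0 <= wp x by rewrite /wp le_max lexx orbT.
have wn0 x : 0 <= wn x by rewrite /wn le_max lexx orbT.
have wpK x : `|wp x| <= K.
  rewrite ger0_norm// /wp ge_max (le_trans _ (wK x)) ?ler_norm//=.
  by rewrite (le_trans _ (wK x)).
have wnK x : `|wn x| <= K.
  have := wK x; rewrite ler_norml => /andP[h1 h2].
  by rewrite ger0_norm// /wn ge_max; apply/andP; split; lra.
have iwp := integrable_bounded_fin m mwp wpK.
have iwn := integrable_bounded_fin m mwn wnK.
transitivity (\int[m]_x (wp x - wn x)); first exact: eq_Rintegral.
rewrite RintegralB// (pos _ K)// (pos _ K)// -RintegralB//.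
- by apply: eq_Rintegral => x _; rewrite wE mulrBr.
- by apply: (@intR_bM _ _ R mu _ _ _ _ K).
- by apply: (@intR_bM _ _ R mu _ _ _ _ K).
Qed.

(** * Integration against differences of finite measures *)

Section signed_functionals.
Context {R : realType}.
Local Notation mu := (@lebesgue_measure R).
Implicit Types (w g : R -> R) (Phi : (R -> R) -> R).

Definition borel_bounded w := measurable_fun setT w /\ exists M : R, forall x, `|w x| <= M.

(** Signed measures are represented by their action on bounded Borel functions, since a pair (m1,
    m2) is not determined by the difference. *)
Definition signed_measure_functional Phi :=
  exists m1 m2 : {finite_measure set (measurableTypeR R) -> \bar R},
  forall w, borel_bounded w -> Phi w = \int[m1]_x w x - \int[m2]_x w x.

Lemma bb_integrable (m : {finite_measure set (measurableTypeR R) -> \bar R}) w :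
  borel_bounded w -> m.-integrable setT (EFin \o w).
Proof. by move=> [mw [M wM]]; exact: (integrable_bounded_fin m mw wM). Qed.

Lemma finite_measure_add (m1 m2 : {finite_measure set (measurableTypeR R) -> \bar R}) :
  exists m : {finite_measure set (measurableTypeR R) -> \bar R},
    (forall A, m A = (m1 A + m2 A)%E) /\
    forall w, borel_bounded w -> \int[m]_x w x = \int[m1]_x w x + \int[m2]_x w x.
Proof.
have [|m mE] := @finite_measure_ex _ _ R (measure_add m1 m2).
  apply: (@eq_ind _ _ (fun z => (z < +oo)%E) _ _ (esym (measure_addE m1 m2 setT))).
  by apply: lte_add_pinfty; rewrite -ge0_fin_numE// fin_num_measure.
exists m; split; first by move=> A; rewrite mE; exact: measure_addE.
move=> w bw; rewrite /Rintegral.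
rewrite (@eq_measure_integral _ _ R setT (measure_add m1 m2) m) ?integral_measure_add//.
- by rewrite fineD//; apply: integrable_fin_num => //; exact: bb_integrable.
- exact: bb_integrable.
- exact: bb_integrable.
- by move=> A _ _; exact: mE.
Qed.

Lemma smf_ext Phi Psi : (forall w, borel_bounded w -> Phi w = Psi w) ->
  signed_measure_functional Phi -> signed_measure_functional Psi.
Proof.
move=> PhiPsi [m1 [m2 mE]]; exists m1, m2 => w bw.
by rewrite -PhiPsi// mE.
Qed.

Lemma smfD Phi Psi : signed_measure_functional Phi ->
  signed_measure_functional Psi ->
  signed_measure_functional (fun w => Phi w + Psi w).
Proof.
move=> [m1 [m2 m12]] [n1 [n2 n12]].
have [p1 [_ p1E]] := finite_measure_add m1 n1.
have [p2 [_ p2E]] := finite_measure_add m2 n2.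
exists p1, p2 => w bw; rewrite p1E// p2E// m12// n12//; ring.
Qed.

Lemma smfN Phi : signed_measure_functional Phi ->
  signed_measure_functional (fun w => - Phi w).
Proof. by move=> [m1 [m2 m12]]; exists m2, m1 => w bw; rewrite m12// opprB. Qed.

Lemma smf_density g : mu.-integrable setT (EFin \o g) ->
  signed_measure_functional (fun w => \int[mu]_x (g x * w x)).
Proof.
move=> gi; have mg := intR_measurable gi.
pose gp x := Num.max (g x) 0; pose gn x := Num.max (- g x) 0.
have gE x : g x = gp x - gn x.
  by rewrite /gp /gn; case: (ltP (g x) 0) => h; case: (ltP (- g x) 0); lra.
have mgp : measurable_fun setT gp by apply: measurable_maxr.
have mgn : measurable_fun setT gn.
  by apply: measurable_maxr => //; exact: measurable_funN.
have gp0 x : 0 <= gp x by rewrite /gp le_max lexx orbT.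
have gn0 x : 0 <= gn x by rewrite /gn le_max lexx orbT.
have ig := intR_abs gi.
have igp : mu.-integrable setT (EFin \o gp).
  apply: (@intR_le _ _ R mu _ _ _ _ _ ig) => // x _.
  by rewrite ger0_norm// /gp ge_max ler_norm normr_ge0.
have ign : mu.-integrable setT (EFin \o gn).
  apply: (@intR_le _ _ R mu _ _ _ _ _ ig) => // x _.
  by rewrite ger0_norm// /gn ge_max -normrN ler_norm normr_ge0.
have [m1 m1E] := density_ex igp gp0; have [m2 m2E] := density_ex ign gn0.
exists m1, m2 => w [mw [M wM]]; rewrite (m1E _ M)// (m2E _ M)//.
rewrite -RintegralB//; last 2 first.
- by apply: (@intR_bM _ _ R mu _ _ _ _ M).
- by apply: (@intR_bM _ _ R mu _ _ _ _ M).
by apply: eq_Rintegral => x _; rewrite gE mulrBl.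
Qed.

Lemma smf0 : signed_measure_functional (fun=> 0).
Proof.
have := smf_density (bcs_integrable (@bcs0 R)); apply: smf_ext => w _.
rewrite -[RHS](mul0r (fine (mu setT))) -Rintegral_cst//.
by apply: eq_Rintegral => x _; rewrite mul0r.
Qed.

Lemma smf_dirac (a c : R) : signed_measure_functional (fun w => c * w a).
Proof.
suff pos (e : R) : 0 <= e -> signed_measure_functional (fun w => e * w a).
  have [c0|c0] := leP 0 c; first exact: pos.
  have := smfN (pos (- c) _); rewrite oppr_ge0 => /(_ (ltW c0)).
  by apply: smf_ext => w _; rewrite mulNr opprK.
move=> e0; pose D : {sigma_finite_measure set (measurableTypeR R) -> \bar R} :=
  @dirac _ (measurableTypeR R) a R.
have ei : D.-integrable setT (EFin \o (fun=> e)).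
  apply: (@intR_finite _ _ R D setT _ _ e) => //.
    by rewrite /D /= diracT ltry.
  by move=> x _; rewrite ger0_norm.
have [m mE] := density_ex ei (fun=> e0).
(* The second measure of the pair is taken from a representation of the zero functional, and
   compensated by adding [m0] to [m]. *)
have [m0 [m0' m0E]] := smf0.
have [n [_ nE]] := finite_measure_add m m0.
exists n, m0' => w bw; have [mw [M wM]] := bw.
rewrite nE// (mE _ M)// -addrA -(m0E w bw) addr0 /Rintegral /D integral_dirac//.
  by rewrite diracT mul1e.
by apply/measurable_EFinP; apply: measurable_funM.
Qed.

Lemma smf_sum (I : Type) (s : seq I) (F : I -> (R -> R) -> R) :
  (forall i, signed_measure_functional (F i)) ->
  signed_measure_functional (fun w => \sum_(i <- s) F i w).
Proof.
move=> FI; elim: s => [|i s IH].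
  by apply: smf_ext smf0 => w _; rewrite big_nil.
by apply: smf_ext (smfD (FI i) IH) => w _; rewrite big_cons.
Qed.

Lemma borel_boundedM v w : borel_bounded v -> borel_bounded w ->
  borel_bounded (fun x => v x * w x).
Proof.
move=> [mv [M vM]] [mw [N wN]]; split; first exact: measurable_funM.
by exists (M * N) => x; rewrite normrM ler_pM.
Qed.

Lemma bcs_borel_bounded w : bcs w -> borel_bounded w.
Proof. by move=> /bcsP[mw [M [_ wM _]]]; split => //; exists M. Qed.

(* The junk-free value of [dint]: two representations of the same distribution
   by differences of finite measures agree on all bounded Borel functions. *)
Lemma dint_eq (u : R -> R) Phi : signed_measure_functional Phi ->
  (forall phi, test1 setT phi -> \int[mu]_x (u x * derive1 phi x) = - Phi phi) ->
  forall w, borel_bounded w -> dint u w = Phi w.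
Proof.
move=> [m1 [m2 m12]] uPhi w bw; rewrite /dint.
have tb phi : test1 setT phi -> borel_bounded phi.
  by move=> /test1_bcs[/bcs_borel_bounded].
have um : measure_derivative u m1 m2.
  by move=> phi tphi; rewrite uPhi// m12//; exact: tb.
have : exists c, exists n1 n2, measure_derivative u n1 n2 /\
    c = \int[n1]_x w x - \int[n2]_x w x.
  by exists (Phi w), m1, m2; rewrite m12.
move=> /getPex[n1 [n2 [un ->]]].
(* m1 - m2 and n1 - n2 agree exactly when the positive measures m1 + n2 and n1 + m2 do, and to these
   the uniqueness result applies. *)
have [p [pE pI]] := finite_measure_add m1 n2.
have [q [qE qI]] := finite_measure_add n1 m2.
have pq A : measurable A -> p A = q A.
  apply: test_measure_unique => phi tphi; have bphi := tb _ tphi.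
  rewrite pI// qI//; have := um phi tphi; rewrite un//; lra.
have : \int[p]_x w x = \int[q]_x w x.
  by rewrite /Rintegral; congr fine; apply: eq_measure_integral => A mA _; exact: pq.
rewrite pI// qI// m12//; lra.
Qed.

End signed_functionals.

(** * Structure of H^1_flat, and explicit formulas for the pairings *)

Section flat_functions.
Context {R : realType}.
Local Notation mu := (@lebesgue_measure R).
Local Notation dpair := Defs.dpair.
Implicit Types (u v w g h f : R -> R) (s r : seq (nat * R)) (x : R).

Definition steps s x : R := \sum_(i <- s) i.2 * box i.1 x.

(* The jumps of an element of H^1_flat at -n and n are opposite: it is the sum
   of an absolutely continuous function and of multiples of indicators of the
   intervals [-n, n]. *)
Record flat_rep g s : Prop := FlatRep {
  flat_int : mu.-integrable setT (EFin \o g);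
  flat_supp : exists2 M : R, 0 < M & forall x, M < `|x| -> g x = 0;
  flat_int0 : \int[mu]_x g x = 0;
  flat_pos : all (fun i => 0 < i.1)%N s }.

Definition flat g s x : R := prim g x + steps s x.

Lemma prim_supp g (M x : R) : (forall x, M < `|x| -> g x = 0) -> \int[mu]_x g x = 0 ->
  M < `|x| -> prim g x = 0.
Proof.
move=> g0 ig; rewrite ltr_normr => /orP[Mx|Mx].
  rewrite (@prim_above _ _ M) ?(ltW Mx)// => y My.
  by rewrite g0// (lt_le_trans My (ler_norm _)).
apply: (@prim_below _ _ x) => // y yx; apply: g0.
by rewrite ltr_normr; apply/orP; right; rewrite (lt_le_trans Mx)// lerN2.
Qed.

Lemma bcs_prim g s : flat_rep g s -> bcs (prim g).
Proof.
move=> [gi [M M0 g0] ig _]; apply: (@bcs_continuous _ _ M).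
  exact: prim_continuous.
by move=> x; exact: prim_supp.
Qed.

Lemma bcs_steps s : bcs (steps s).
Proof. by apply: bcs_sum => i; apply: bcsZ; exact: bcs_indic. Qed.

Lemma bcs_flat g s : flat_rep g s -> bcs (flat g s).
Proof. by move=> gs; apply: bcsD; [exact: bcs_prim gs|exact: bcs_steps]. Qed.

Lemma boxE n x : box n x = (`|x| <= n%:R)%R%:R :> R.
Proof.
by rewrite /box (@indic_bool _ _ _ (fun x => `|x| <= n%:R))// => y /=;
  rewrite in_itv/= -ler_norml.
Qed.

(** The condition u(n) = u(-n) says that the weak derivative, extended by 0, has total integral 0.
    Its primitive then vanishes outside [-n, n], and u exceeds it there by the constant u(-n). *)
Lemma flat_gen u (n : nat) : (0 < n)%N -> (forall x, n%:R < `|x| -> u x = 0) ->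
  u n%:R = u (- n%:R) -> {within `[(- n%:R : R), (n%:R : R)], continuous u} ->
  H1 `](- n%:R : R), (n%:R : R)[ u ->
  exists g s, flat_rep g s /\ u = flat g s.
Proof.
move=> n0 u0 un cu [_ [g [[mg gi] ug]]].
have nn : - n%:R < n%:R :> R by rewrite gtrN// ltr0n.
have gi1 : mu.-integrable `](- n%:R : R), (n%:R : R)[ (EFin \o g).
  have i1 : mu.-integrable `](- n%:R : R), (n%:R : R)[ (EFin \o (fun=> 1 : R)).
    apply: (@intR_finite _ _ R mu _ _ _ 1) => //.
      by rewrite /= lebesgue_measure_itv/= lte_fin nn -EFinD ltry.
    by move=> x _; rewrite normr1.
  apply: (@intR_le _ _ R mu _ _ _ (fun x => 1 + g x ^+ 2)) => //.
    exact: intRD.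
  move=> x _; rewrite ler_norml; apply/andP; split; nra.
have [Gi uE] := weak_derivative_prim nn cu gi1 ug.
set G := fun x => _ in Gi uE.
have G0 x : n%:R < `|x| -> G x = 0.
  move=> nx; rewrite /G in_itv/=; case: ltP => h1; rewrite ?mulr0//=.
  case: ltP => h2; rewrite ?mulr0//; move: nx.
  by rewrite ltNge ler_norml !ltW.
have IG : \int[mu]_x G x = 0.
  rewrite -(@prim_above _ _ n%:R n%:R)//.
    have := uE n%:R; rewrite in_itv/= lexx (ltW nn) un => /(_ isT); lra.
  by move=> y ny; rewrite G0// (lt_le_trans ny (ler_norm _)).
exists G, [:: (n, u (- n%:R))]; split.
  split=> //; first by exists n%:R; rewrite ?ltr0n.
  by rewrite /= n0.
apply/funext => x; rewrite /flat /steps big_seq1 boxE/=.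
case: (leP `|x| n%:R) => xn; last by rewrite u0// mulr0 addr0 (prim_supp G0).
by rewrite uE ?in_itv/= -?ler_norml// mulr1 addrC.
Qed.

Lemma stepsZ c s x : steps [seq (i.1, c * i.2) | i <- s] x = c * steps s x.
Proof.
rewrite /steps big_map mulr_sumr; apply: eq_bigr => i _ /=; by rewrite mulrA.
Qed.

Lemma steps_cat s r x : steps (s ++ r) x = steps s x + steps r x.
Proof. by rewrite /steps big_cat. Qed.

Lemma flat_repD g s h r : flat_rep g s -> flat_rep h r ->
  flat_rep (fun x => g x + h x) (s ++ r).
Proof.
move=> [gi [M M0 g0] ig ps] [hi [N N0 h0] ih pr]; split.
- exact: intRD.
- exists (M + N); first lra.
  by move=> x MNx; rewrite g0 ?h0 ?addr0//; lra.
- by rewrite RintegralD// ig ih addr0.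
- by rewrite all_cat ps pr.
Qed.

Lemma flatD g s h r x : flat_rep g s -> flat_rep h r ->
  flat (fun x => g x + h x) (s ++ r) x = flat g s x + flat h r x.
Proof.
move=> [gi _ _ _] [hi _ _ _]; rewrite /flat steps_cat primD//; ring.
Qed.

Lemma flat_repZ c g s : flat_rep g s ->
  flat_rep (fun x => c * g x) [seq (i.1, c * i.2) | i <- s].
Proof.
move=> [gi [M M0 g0] ig ps]; split.
- exact: intRZ.
- by exists M => // x Mx; rewrite g0 ?mulr0.
- by rewrite RintegralZl// ig mulr0.
- by rewrite all_map.
Qed.

Lemma flatZ c g s x : flat_rep g s ->
  flat (fun x => c * g x) [seq (i.1, c * i.2) | i <- s] x = c * flat g s x.
Proof.
by move=> [gi _ _ _]; rewrite /flat stepsZ primZ// mulrDr.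
Qed.

Lemma flat_rep0 : flat_rep (fun=> 0) [::].
Proof.
split=> //; first exact: (bcs_integrable (@bcs0 R)).
  by exists 1.
by rewrite Rintegral_cst// mul0r.
Qed.

Lemma H1flat_rep u : H1flat u -> exists g s, flat_rep g s /\ u = flat g s.
Proof.
move=> [n [c [e [eA ->]]]].
suff H (l : seq 'I_n) : exists g s, flat_rep g s /\
    (fun x => \sum_(i <- l) c i * e i x) = flat g s by exact: H.
elim: l => [|i l [g [s [gs lE]]]].
  exists (fun=> 0), [::]; split; first exact: flat_rep0.
  apply/funext => x; rewrite big_nil /flat /steps big_nil addr0.
  by rewrite (@prim_below _ _ x x).
have [k [k0 ek0 ek ck hk]] := eA i.
have [h [r [hr eE]]] := flat_gen k0 ek0 ek ck hk.
exists (fun x => c i * h x + g x), ([seq (j.1, c i * j.2) | j <- r] ++ s); split.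
  by apply: flat_repD => //; exact: flat_repZ.
apply/funext => x; rewrite big_cons flatD//; last exact: flat_repZ.
by rewrite flatZ// -eE -lE.
Qed.

Lemma H1flat_bcs u : H1flat u -> bcs u.
Proof. by move=> /H1flat_rep[g [s [gs ->]]]; exact: bcs_flat. Qed.

(** Action of the derivative measure of [flat g s]: density g, and for each step of height c on
    [-n, n] an atom c at -n and an atom -c at n. *)
Definition flat_pair g s w : R :=
  \int[mu]_x (g x * w x) + \sum_(i <- s) i.2 * (w (- i.1%:R) - w i.1%:R).

Lemma smf_flat_pair g s : flat_rep g s -> signed_measure_functional (flat_pair g s).
Proof.
move=> [gi _ _ _]; apply: smfD; first exact: smf_density.
apply: smf_sum => i.
apply: smf_ext (smfD (smf_dirac (- i.1%:R) i.2) (smf_dirac i.1%:R (- i.2))) => w _.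
by ring.
Qed.

Lemma Rintegral_box_prim h (n : nat) : mu.-integrable setT (EFin \o h) ->
  \int[mu]_x (box n x * h x) = prim h n%:R - prim h (- n%:R).
Proof.
move=> hi.
have nn : - n%:R <= n%:R :> R by rewrite lerNl (le_trans _ (ler0n _ _))// oppr_le0.
rewrite !primE -RintegralB//; try exact: integrable_below.
apply: ae_Rintegral => //.
- apply: measurable_funM; first exact: measurable_indic.
  exact: intR_measurable hi.
- apply: measurable_funB; [exact: (intR_measurable (integrable_below _ hi))|].
  exact: (intR_measurable (integrable_below _ hi)).
apply: (@countable_ae _ [set - n%:R]) => // x /eqP xn _.
rewrite -mulrBr mulrC; congr (_ * _); rewrite boxE ler_norml /below.
case: (ltgtP x (- n%:R)) xn => //= xn _; last by rewrite subr0.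
by rewrite (le_trans (ltW xn) nn) subrr.
Qed.

Lemma flat_derivative g s phi : flat_rep g s -> test1 setT phi ->
  \int[mu]_x (flat g s x * derive1 phi x) = - flat_pair g s phi.
Proof.
move=> gs tphi; have [gi [M M0 g0] ig _] := gs.
have [bphi bdphi] := test1_bcs tphi; have idphi := bcs_integrable bdphi.
have [N N0 phiN] := test1_support tphi.
have phiE x : phi x = prim (derive1 phi) x by exact: test1_prim tphi.
rewrite /flat; under eq_Rintegral do rewrite mulrDl.
rewrite RintegralD//; last 2 first.
- exact: integrable_primM.
- by apply: bcs_integrable; apply: bcsM => //; exact: bcs_steps.
have -> : \int[mu]_x (prim g x * derive1 phi x) = - \int[mu]_x (g x * phi x).
  have := @prim_ibp_line _ g (derive1 phi) (M + N) gi idphi.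
  rewrite ig mul0r.
  have <- : phi = prim (derive1 phi) by apply/funext.
  move=> ibp; apply/eqP; rewrite -addr_eq0 addrC ibp//.
    by move=> x MNx; apply: g0; rewrite (lt_le_trans _ (ler_norm _))//; lra.
  by move=> x MNx; apply: (phiN x _).2; rewrite (lt_le_trans _ (ler_norm _))//; lra.
rewrite /flat_pair opprD; congr (_ + _).
transitivity (\int[mu]_x \sum_(i <- s) (i.2 * (box i.1 x * derive1 phi x))).
  apply: eq_Rintegral => x _; rewrite /steps mulr_suml; apply: eq_bigr => i _.
  by rewrite mulrA.
have bi (i : nat * R) : bcs (fun x => box i.1 x * derive1 phi x).
  by apply: bcsM => //; exact: bcs_indic.
rewrite Rintegral_sum//; last first.
  by move=> i; apply: bcs_integrable; exact: bcsZ.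
rewrite -sumrN; apply: eq_bigr => i _.
rewrite RintegralZl//; last exact: bcs_integrable.
by rewrite Rintegral_box_prim// -!phiE; ring.
Qed.

Lemma dint_flat g s w : flat_rep g s -> borel_bounded w ->
  dint (flat g s) w = flat_pair g s w.
Proof.
move=> gs; apply: dint_eq; first exact: smf_flat_pair.
by move=> phi; exact: flat_derivative.
Qed.

(** Precise representative of [box n], equal to 1/2 at the two jumps. *)
Definition pbox (n : nat) x : R :=
  if `|x| < n%:R then 1 else if `|x| == n%:R then 2^-1 else 0.

Lemma box_left (n : nat) x : (0 < n)%N ->
  box n y @[y --> x^'-] --> (((- n%:R < x) && (x <= n%:R))%R%:R : R).
Proof.
move=> n0; apply: cvg_near_cst.
case: (ltP (- n%:R) x) => /= nx.
  case: (leP x n%:R) => xn.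
    near=> y; rewrite boxE ler_norml; congr ((nat_of_bool _)%:R).
    apply/andP; split; first by near: y; apply: nbhs_left_ge.
    by rewrite (le_trans _ xn)//; near: y; exact: nbhs_left_le.
  near=> y; rewrite boxE ler_norml [y <= _]leNgt.
  have -> : n%:R < y by near: y; exact: nbhs_left_gt.
  by rewrite andbF.
near=> y; rewrite boxE ler_norml leNgt.
have -> : y < - n%:R.
  by rewrite (lt_le_trans _ nx)//; near: y; exact: nbhs_left_lt.
by [].
Unshelve. all: by end_near. Qed.

Lemma box_right (n : nat) x : (0 < n)%N ->
  box n y @[y --> x^'+] --> (((- n%:R <= x) && (x < n%:R))%R%:R : R).
Proof.
move=> n0; apply: cvg_near_cst.
case: (leP (- n%:R) x) => /= nx; last first.
  near=> y; rewrite boxE ler_norml leNgt.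
  have -> : y < - n%:R by near: y; exact: nbhs_right_lt.
  by [].
case: (ltP x n%:R) => xn.
  near=> y; rewrite boxE ler_norml; congr ((nat_of_bool _)%:R).
  apply/andP; split; last by near: y; apply: nbhs_right_le.
  by rewrite (le_trans nx)//; near: y; exact: nbhs_right_ge.
near=> y; rewrite boxE ler_norml [y <= _]leNgt.
have -> : n%:R < y by rewrite (le_lt_trans xn)//; near: y; exact: nbhs_right_gt.
by rewrite andbF.
Unshelve. all: by end_near. Qed.

Lemma box_mean (n : nat) x : (0 < n)%N ->
  (((- n%:R < x) && (x <= n%:R))%R%:R + ((- n%:R <= x) && (x < n%:R))%R%:R) / 2
  = pbox n x.
Proof.
move=> n0; have n0' : 0 < n%:R :> R by rewrite ltr0n.
rewrite /pbox ltr_norml eqr_norml (ltW n0')/= andbT.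
case: (ltgtP (- n%:R) x) => h1 /=; case: (ltgtP x n%:R) => h2 //=;
  rewrite ?eqxx ?orbT ?(gt_eqF h1) ?(lt_eqF h1)//=; try lra.
Qed.

Definition psteps s x : R := \sum_(i <- s) i.2 * pbox i.1 x.

Lemma steps_left s x : all (fun i => 0 < i.1)%N s -> steps s y @[y --> x^'-] -->
  \sum_(i <- s) i.2 * ((- i.1%:R < x) && (x <= i.1%:R))%R%:R.
Proof.
rewrite /steps; elim: s => [_|i s IH /= /andP[i0 s0]].
  by under eq_fun do rewrite big_nil; rewrite big_nil; exact: cvg_cst.
under eq_fun do rewrite big_cons; rewrite big_cons; apply: cvgD; last exact: IH.
by apply: cvgM; [exact: cvg_cst|exact: box_left].
Qed.

Lemma steps_right s x : all (fun i => 0 < i.1)%N s -> steps s y @[y --> x^'+] -->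
  \sum_(i <- s) i.2 * ((- i.1%:R <= x) && (x < i.1%:R))%R%:R.
Proof.
rewrite /steps; elim: s => [_|i s IH /= /andP[i0 s0]].
  by under eq_fun do rewrite big_nil; rewrite big_nil; exact: cvg_cst.
under eq_fun do rewrite big_cons; rewrite big_cons; apply: cvgD; last exact: IH.
by apply: cvgM; [exact: cvg_cst|exact: box_right].
Qed.

Lemma steps_mean s x : all (fun i => 0 < i.1)%N s ->
  (\sum_(i <- s) i.2 * ((- i.1%:R < x) && (x <= i.1%:R))%R%:R +
   \sum_(i <- s) i.2 * ((- i.1%:R <= x) && (x < i.1%:R))%R%:R) / 2 = psteps s x.
Proof.
rewrite /psteps; elim: s => [_|i s IH /= /andP[i0 s0]].
  by rewrite !big_nil addr0 mul0r.
rewrite !big_cons -IH// -box_mean//; lra.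
Qed.

Lemma prec_flat g s : flat_rep g s ->
  prec (flat g s) = (fun x => prim g x + psteps s x).
Proof.
move=> [gi _ _ ps]; apply/funext => x; have cg := @prim_continuous _ g gi x.
have hl : flat g s y @[y --> x^'-] --> prim g x +
    \sum_(i <- s) i.2 * ((- i.1%:R < x) && (x <= i.1%:R))%R%:R.
  by apply: cvgD; [exact: cvg_at_left_filter cg|exact: steps_left].
have hr : flat g s y @[y --> x^'+] --> prim g x +
    \sum_(i <- s) i.2 * ((- i.1%:R <= x) && (x < i.1%:R))%R%:R.
  by apply: cvgD; [exact: cvg_at_right_filter cg|exact: steps_right].
rewrite /prec (cvg_lim (@Rhausdorff R) hl) (cvg_lim (@Rhausdorff R) hr).
rewrite -steps_mean//; lra.
Qed.

Lemma pboxE (n : nat) x : pbox n x = (box n x + (x \in `](- n%:R : R), n%:R[)%:R) / 2.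
Proof.
rewrite boxE in_itv/= -ltr_norml /pbox.
by case: (ltgtP `|x| n%:R) => h /=; lra.
Qed.

Lemma pboxN n x : pbox n (- x) = pbox n x.
Proof. by rewrite /pbox normrN. Qed.

Lemma pstepsN s x : psteps s (- x) = psteps s x.
Proof. by apply: eq_bigr => i _; rewrite pboxN. Qed.

Lemma bcs_pbox n : bcs (pbox n).
Proof.
rewrite (_ : pbox n = (fun x => 2^-1 * (box n x + (x \in `](- n%:R : R), n%:R[)%:R))).
  apply: bcsZ; apply: bcsD; first exact: bcs_indic.
  split; first exact: measurable_mem_itv.
  exists (n%:R + 1) => x; split.
    by case: (_ \in _); rewrite ?normr1 ?normr0 ?lerDr// addr_ge0.
  move=> nx; rewrite in_itv/= -ltr_norml ltNge; case: (leP _ _) => // xn.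
  by move: nx; rewrite ltNge (le_trans (ltW xn))// lerDl.
by apply/funext => x; rewrite pboxE mulrC.
Qed.

Lemma bcs_psteps s : bcs (psteps s).
Proof. by apply: bcs_sum => i; apply: bcsZ; exact: bcs_pbox. Qed.

Lemma pbox_ae n : {ae mu, forall x, pbox n x = box n x}.
Proof.
apply: (@countable_ae _ [set n%:R; - n%:R]); first exact: finite_set_countable.
move=> x /not_orP[/eqP xn /eqP xn']; rewrite pboxE boxE in_itv/= -ltr_norml.
case: (ltgtP `|x| n%:R) => h /=; [lra|lra|].
by case: (ger0P x) h => _ h; move: xn xn'; rewrite -h ?eqxx// opprK eqxx.
Qed.

Lemma psteps_ae s : {ae mu, forall x, psteps s x = steps s x}.
Proof.
rewrite /psteps /steps; elim: s => [|i s IH].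
  by apply: aeW => x; rewrite !big_nil.
apply: (ae_imply2 (pbox_ae i.1) IH) => x xi xs.
by rewrite !big_cons xi xs.
Qed.

Lemma int_pbox h n : mu.-integrable setT (EFin \o h) ->
  \int[mu]_x (h x * pbox n x) = prim h n%:R - prim h (- n%:R).
Proof.
move=> hi; rewrite -Rintegral_box_prim//; apply: ae_Rintegral => //.
- by apply: measurable_funM; [exact: intR_measurable hi|exact: (bcs_pbox n).1].
- by apply: measurable_funM; [exact: measurable_indic|exact: intR_measurable hi].
- by apply: (ae_imply1 (pbox_ae n)) => x /= -> _; rewrite mulrC.
Qed.

Lemma integrableM_bcs h v : mu.-integrable setT (EFin \o h) -> bcs v ->
  mu.-integrable setT (EFin \o (fun x => h x * v x)).
Proof. by move=> hi /bcsP[mv [M [_ vM _]]]; apply: (@intR_bM _ _ R mu _ _ _ _ M). Qed.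

Lemma int_psteps h s : mu.-integrable setT (EFin \o h) ->
  \int[mu]_x (h x * psteps s x) =
  \sum_(i <- s) i.2 * (prim h i.1%:R - prim h (- i.1%:R)).
Proof.
move=> hi.
have ip i : mu.-integrable setT (EFin \o (fun x => h x * pbox i x)).
  by apply: integrableM_bcs => //; exact: bcs_pbox.
transitivity (\int[mu]_x \sum_(i <- s) (i.2 * (h x * pbox i.1 x))).
  apply: eq_Rintegral => x _; rewrite /psteps mulr_sumr; apply: eq_bigr => i _.
  by rewrite mulrCA.
rewrite Rintegral_sum//; last by move=> i; exact: intRZ.
by apply: eq_bigr => i _; rewrite RintegralZl// int_pbox.
Qed.

(** The product of two boxes is the smaller box; with precise values this holds off the jumps, hence
    under the integral. *)
Lemma int_psteps2 h s : mu.-integrable setT (EFin \o h) ->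
  \int[mu]_x (h x * psteps s x ^+ 2) =
  \sum_(i <- s) \sum_(j <- s) i.2 * j.2 *
    (prim h (minn i.1 j.1)%:R - prim h (- (minn i.1 j.1)%:R)).
Proof.
move=> hi.
have ip i j : mu.-integrable setT (EFin \o (fun x => h x * (pbox i x * pbox j x))).
  by apply: integrableM_bcs => //; apply: bcsM; exact: bcs_pbox.
transitivity (\int[mu]_x \sum_(i <- s) \sum_(j <- s)
    (i.2 * j.2 * (h x * (pbox i.1 x * pbox j.1 x)))).
  apply: eq_Rintegral => x _; rewrite /psteps expr2 mulr_suml mulr_sumr.
  apply: eq_bigr => i _; rewrite mulr_sumr mulr_sumr; apply: eq_bigr => j _; ring.
rewrite Rintegral_sum//; last first.
  by move=> i; apply: intR_sum => // j; exact: intRZ.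
apply: eq_bigr => i _; rewrite Rintegral_sum//; last by move=> j; exact: intRZ.
apply: eq_bigr => j _; rewrite RintegralZl//; congr (_ * _).
rewrite -int_pbox//; apply: ae_Rintegral => //.
- exact: intR_measurable (ip _ _).
- by apply: measurable_funM; [exact: intR_measurable hi|exact: (bcs_pbox _).1].
apply: (ae_imply3 (pbox_ae i.1) (pbox_ae j.1) (pbox_ae (minn i.1 j.1))).
move=> x -> -> -> _; congr (_ * _); rewrite !boxE -natrM mulnb natr_min.
by rewrite le_min.
Qed.

(* [pbox m n + pbox n m = 1], the diagonal value being 1/2: this is why the
   precise representative gives u du/dx = d(u^2/2)/dx. *)
Lemma pbox_symm s (Delta : nat -> R) : all (fun i => 0 < i.1)%N s ->
  \sum_(i <- s) \sum_(j <- s) i.2 * j.2 * Delta (minn i.1 j.1) =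
  2 * \sum_(i <- s) i.2 * psteps s i.1%:R * Delta i.1.
Proof.
move=> ps.
have pE (i j : nat) : Delta (minn i j) = pbox j i%:R * Delta i + pbox i j%:R * Delta j.
  rewrite /pbox !normr_nat !ltr_nat !eqr_nat; case: (ltngtP i j) => ij.
  - by rewrite /= mul1r mul0r addr0.
  - by rewrite /= mul1r mul0r add0r.
  - by rewrite ij; lra.
have -> : \sum_(i <- s) \sum_(j <- s) i.2 * j.2 * Delta (minn i.1 j.1) =
    \sum_(i <- s) \sum_(j <- s) i.2 * j.2 * (pbox j.1 i.1%:R * Delta i.1) +
    \sum_(i <- s) \sum_(j <- s) i.2 * j.2 * (pbox i.1 j.1%:R * Delta j.1).
  rewrite -big_split; apply: eq_bigr => i _; rewrite -big_split; apply: eq_bigr => j _.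
  by rewrite /= -mulrDr pE.
rewrite [X in _ + X]exchange_big mulr_sumr -big_split; apply: eq_bigr => i _ /=.
rewrite /psteps mulr_sumr mulr_suml mulr_sumr -big_split; apply: eq_bigr => j _ /=.
by ring.
Qed.

Lemma prec_bb g s : flat_rep g s -> borel_bounded (prec (flat g s)).
Proof.
move=> gs; rewrite prec_flat//; apply: bcs_borel_bounded; apply: bcsD.
  exact: bcs_prim gs.
exact: bcs_psteps.
Qed.

(** The atoms at -n and n have opposite weights and [psteps] is even, so jumps paired with jumps
    cancel. Only terms with at least one continuous part remain. *)
Lemma dpair_flat g s h r : flat_rep g s -> flat_rep h r ->
  dpair (flat g s) (flat h r) = \int[mu]_x (g x * prim h x) +
    \sum_(j <- r) j.2 * (prim g j.1%:R - prim g (- j.1%:R)) -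
    \sum_(i <- s) i.2 * (prim h i.1%:R - prim h (- i.1%:R)).
Proof.
move=> gs hr; have [gi _ _ _] := gs; have [hi _ _ _] := hr.
rewrite /dpair dint_flat//; last exact: prec_bb.
rewrite /flat_pair prec_flat//; congr (_ + _); last first.
  rewrite -sumrN; apply: eq_bigr => i _; rewrite pstepsN; ring.
under eq_Rintegral do rewrite mulrDr.
rewrite RintegralD//.
- by rewrite int_psteps.
- exact: integrable_Mprim.
- by apply: integrableM_bcs => //; exact: bcs_psteps.
Qed.

Lemma flat_ibp g s h r : flat_rep g s -> flat_rep h r ->
  \int[mu]_x (g x * prim h x) = - \int[mu]_x (prim g x * h x).
Proof.
move=> [gi [M M0 g0] ig _] [hi [N N0 h0] ih _].
apply/eqP; rewrite -addr_eq0 (@prim_ibp_line _ _ _ (M + N))// ?ig ?mul0r//.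
  by move=> x MNx; apply: g0; rewrite (lt_le_trans _ (ler_norm _))//; lra.
by move=> x MNx; apply: h0; rewrite (lt_le_trans _ (ler_norm _))//; lra.
Qed.

Lemma dpair_anti u v : H1flat u -> H1flat v -> dpair u v = - dpair v u.
Proof.
move=> /H1flat_rep[g [s [gs ->]]] /H1flat_rep[h [r [hr ->]]].
rewrite !dpair_flat// (flat_ibp gs hr).
under [in X in - X]eq_Rintegral do rewrite mulrC.
by ring.
Qed.

(** The square of the continuous part is again the primitive of a compactly supported function of
    integral zero, so integration by parts applies to it. *)
Lemma flat_rep_square g s : flat_rep g s ->
  flat_rep (fun x => 2 * (g x * prim g x)) [::] /\
  forall x, prim (fun x => 2 * (g x * prim g x)) x = prim g x ^+ 2.
Proof.
move=> gs; have [gi [M M0 g0] ig _] := gs.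
have ggi := integrable_Mprim gi gi.
have sqE x : prim (fun x => 2 * (g x * prim g x)) x = prim g x ^+ 2.
  rewrite expr2 prim_ibp// primZ// primD//; last exact: integrable_primM.
  by rewrite mulr2n mulrDl !mul1r; congr (_ + _); congr prim; apply/funext => y; rewrite mulrC.
split => //; split => //; first exact: intRZ.
  by exists M => // x Mx; rewrite g0// mul0r mulr0.
have g0' x : M < x -> 2 * (g x * prim g x) = 0.
  by move=> Mx; rewrite g0 ?mul0r ?mulr0// (lt_le_trans Mx (ler_norm _)).
rewrite -(prim_above g0' (lexx M)) sqE (@prim_above _ g M)//.
  by rewrite ig expr0n.
by move=> x Mx; rewrite g0// (lt_le_trans Mx (ler_norm _)).
Qed.

(** With G the continuous and S the jump part, g G^2 integrates to 0 as it equals minus twice itself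
    after integration by parts. The terms 2 g G S and g S^2 become sums over the jumps, by
    [pbox_symm] for the latter, and cancel the atoms weighted with (G + S)^2. *)
Lemma cpair_self u : H1flat u -> cpair u u = 0.
Proof.
move=> /H1flat_rep[g [s [gs ->]]]; have [gi _ _ ps] := gs.
have [qs qE] := flat_rep_square gs; have [qi _ _ _] := qs.
have bp := bcs_psteps s; have bG := bcs_prim gs.
rewrite /cpair dint_flat//; last by apply: borel_boundedM; exact: prec_bb.
rewrite /flat_pair prec_flat//.
have -> : \int[mu]_x (g x * ((prim g x + psteps s x) * (prim g x + psteps s x))) =
    \int[mu]_x (g x * prim g x ^+ 2) +
    \int[mu]_x (2 * (g x * prim g x) * psteps s x) +
    \int[mu]_x (g x * psteps s x ^+ 2).
  rewrite -RintegralD//; last 2 first.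
  - by apply: integrableM_bcs => //; exact: bcsX.
  - exact: integrableM_bcs.
  rewrite -RintegralD//; last 2 first.
  - apply: intRD => //; first by apply: integrableM_bcs => //; exact: bcsX.
    exact: integrableM_bcs.
  - by apply: integrableM_bcs => //; exact: bcsX.
  by apply: eq_Rintegral => x _; ring.
have -> : \int[mu]_x (g x * prim g x ^+ 2) = 0.
  have := flat_ibp gs qs.
  under eq_Rintegral do rewrite qE.
  have -> : \int[mu]_x (prim g x * (2 * (g x * prim g x))) =
      2 * \int[mu]_x (g x * prim g x ^+ 2).
    rewrite -RintegralZl//; last by apply: integrableM_bcs => //; exact: bcsX.
    by apply: eq_Rintegral => x _; ring.
  by lra.
rewrite int_psteps// int_psteps2//.
rewrite (pbox_symm (fun k => prim g k%:R - prim g (- k%:R)) ps) add0r.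
rewrite mulr_sumr -!big_split/= big1// => i _; rewrite !qE pstepsN; ring.
Qed.

(* Compactly supported C^1 functions are the jump-free test functions. *)
Definition C1c f (f' : R -> R) := [/\ forall x, is_derive x 1 f (f' x), continuous f' &
  exists2 M : R, 0 < M & forall x, M < `|x| -> f x = 0 /\ f' x = 0].

Lemma C1c_rep f f' : C1c f f' -> flat_rep f' [::] /\ f = flat f' [::].
Proof.
move=> [df cf' [M M0 f0]].
have bf' : bcs f' by apply: (@bcs_continuous _ _ M) => // x /f0[].
have fE x : f x = prim f' x by apply: (@C1_prim _ _ _ M) => // y /f0[].
have f'0 x : M < x -> f' x = 0.
  by move=> Mx; apply: (f0 x _).2; rewrite (lt_le_trans Mx (ler_norm _)).
split; last first.
  by apply/funext => x; rewrite /flat /steps big_nil addr0 fE.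
split => //; first exact: bcs_integrable.
  by exists M => // x /f0[].
rewrite -(@prim_above _ _ M (M + 1)) ?lerDl// -fE; apply: (f0 _ _).1.
by rewrite (lt_le_trans _ (ler_norm _))// ltrDl.
Qed.

(** The derivative of f has no atoms, so the precise representative of v may be replaced by v
    itself. *)
Lemma dpair_C1c f f' v : C1c f f' -> H1flat v -> dpair f v = ip f' v.
Proof.
move=> /C1c_rep[gs ->] /H1flat_rep[h [r [hr ->]]].
have [f'i _ _ _] := gs.
rewrite /dpair dint_flat//; last exact: prec_bb.
rewrite /flat_pair big_nil addr0 prec_flat// /ip.
apply: ae_Rintegral => //.
- apply: measurable_funM; first exact: intR_measurable f'i.
  by apply: measurable_funD; [exact: (bcs_prim hr).1|exact: (bcs_psteps r).1].
- by apply: measurable_funM; [exact: intR_measurable f'i|exact: (bcs_flat hr).1].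
- by apply: (ae_imply1 (psteps_ae r)) => x /= -> _.
Qed.

(** The conservative form u u_x = (u^2/2)_x tested against a function without jumps. The
    cancellation is that of [cpair_self], with [prim f'] as one of the factors. *)
Lemma cpair_C1c u f f' : C1c f f' -> H1flat u ->
  cpair u f = - 2^-1 * ip (fun x => u x ^+ 2) f'.
Proof.
move=> /C1c_rep[hs ->] /H1flat_rep[g [s [gs ->]]].
have [gi _ _ ps] := gs; have [f'i _ _ _] := hs.
have [qs qE] := flat_rep_square gs; have [qi _ _ _] := qs.
have bp := bcs_psteps s; have bG := bcs_prim gs; have bF := bcs_prim hs.
rewrite /cpair dint_flat//; last by apply: borel_boundedM; exact: prec_bb.
rewrite /flat_pair !prec_flat//.
have pn x : psteps [::] x = 0 by rewrite /psteps big_nil.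
under eq_Rintegral do rewrite pn addr0.
have -> : ip (fun x => flat g s x ^+ 2) f' =
    \int[mu]_x (f' x * (prim g x + psteps s x) ^+ 2).
  rewrite /ip; apply: ae_Rintegral => //.
  - apply: measurable_funM; last exact: intR_measurable f'i.
    exact: (bcsX 1 (bcs_flat gs)).1.
  - apply: measurable_funM; first exact: intR_measurable f'i.
    exact: (bcsX 1 (bcsD bG bp)).1.
  - by apply: (ae_imply1 (psteps_ae s)) => x /= -> _; rewrite mulrC.
have gFi := integrable_Mprim gi f'i; have Gf'i := integrable_primM gi f'i.
have -> : \int[mu]_x (g x * ((prim g x + psteps s x) * prim f' x)) =
   \int[mu]_x (g x * prim g x * prim f' x) +
   \int[mu]_x (g x * prim f' x * psteps s x).
  rewrite -RintegralD//; last 2 first.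
  - by apply: integrableM_bcs => //; exact: integrable_Mprim.
  - exact: integrableM_bcs.
  by apply: eq_Rintegral => x _; ring.
have -> : \int[mu]_x (f' x * (prim g x + psteps s x) ^+ 2) =
    \int[mu]_x (prim g x ^+ 2 * f' x) +
    2 * \int[mu]_x (prim g x * f' x * psteps s x) +
    \int[mu]_x (f' x * psteps s x ^+ 2).
  have i1 : mu.-integrable setT (EFin \o (fun x => prim g x ^+ 2 * f' x)).
    have := integrableM_bcs f'i (bcsX 1 bG).
    by congr (_.-integrable _ _); apply/funext => x /=; rewrite mulrC.
  have i2 := integrableM_bcs Gf'i bp.
  have i3 := integrableM_bcs f'i (bcsX 1 bp).
  rewrite -RintegralZl// -RintegralD//; last exact: intRZ.
  rewrite -RintegralD//; last by apply: intRD => //; exact: intRZ.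
  by apply: eq_Rintegral => x _; ring.
have -> : \int[mu]_x (prim g x ^+ 2 * f' x) = - 2 * \int[mu]_x (g x * prim g x * prim f' x).
  have := flat_ibp qs hs.
  under [in X in _ = X -> _]eq_Rintegral do rewrite qE.
  under [in X in X = _ -> _]eq_Rintegral do rewrite -mulrA.
  rewrite RintegralZl//; last first.
    by apply: integrableM_bcs => //; exact: integrable_Mprim.
  by lra.
rewrite !int_psteps// int_psteps2//.
rewrite (pbox_symm (fun k => prim f' k%:R - prim f' (- k%:R)) ps).
have GfE x : prim (fun t => prim g t * f' t) x =
    prim g x * prim f' x - prim (fun t => g t * prim f' t) x.
  by rewrite prim_ibp// primD//; ring.
under [in X in 2 * X]eq_bigr do rewrite !GfE.
set A := \int[mu]_x _.
suff : \sum_(i <- s) i.2 * (prim (fun t => g t * prim f' t) i.1%:R -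
      prim (fun t => g t * prim f' t) (- i.1%:R)) +
    \sum_(i <- s) i.2 * ((prim g (- i.1%:R) + psteps s (- i.1%:R)) *
       (prim f' (- i.1%:R) + psteps [::] (- i.1%:R)) -
       (prim g i.1%:R + psteps s i.1%:R) * (prim f' i.1%:R + psteps [::] i.1%:R)) +
    \sum_(i <- s) i.2 * (prim g i.1%:R * prim f' i.1%:R -
       prim (fun t => g t * prim f' t) i.1%:R -
       (prim g (- i.1%:R) * prim f' (- i.1%:R) -
        prim (fun t => g t * prim f' t) (- i.1%:R))) +
    \sum_(i <- s) i.2 * psteps s i.1%:R * (prim f' i.1%:R - prim f' (- i.1%:R)) = 0.
  by lra.
rewrite -!big_split/= big1// => i _; rewrite !pn pstepsN; ring.
Qed.

End flat_functions.

(** * The Galerkin energy estimate *)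

Section galerkin.
Context {R : realType}.
Local Notation mu := (@lebesgue_measure R).
Local Notation dpair := Defs.dpair.
Implicit Types (u v w f g : R -> R) (t h a b T nu e d c K : R).

Lemma ipC u v : ip u v = ip v u.
Proof. by apply: eq_Rintegral => x _; rewrite mulrC. Qed.

Lemma ipDl u v w : bcs u -> bcs v -> bcs w -> ip (fun x => u x + v x) w = ip u w + ip v w.
Proof.
move=> bu bv bw; rewrite /ip -RintegralD//; last 2 first.
- exact: (bcs_integrable (bcsM bu bw)).
- exact: (bcs_integrable (bcsM bv bw)).
by apply: eq_Rintegral => x _; rewrite mulrDl.
Qed.

Lemma ipZl c u w : bcs u -> bcs w -> ip (fun x => c * u x) w = c * ip u w.
Proof.
move=> bu bw; rewrite /ip -RintegralZl//; last exact: (bcs_integrable (bcsM bu bw)).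
by apply: eq_Rintegral => x _; rewrite mulrA.
Qed.

Lemma ipBl u v w : bcs u -> bcs v -> bcs w -> ip (fun x => u x - v x) w = ip u w - ip v w.
Proof.
move=> bu bv bw; rewrite /ip -RintegralB//; last 2 first.
- exact: (bcs_integrable (bcsM bu bw)).
- exact: (bcs_integrable (bcsM bv bw)).
by apply: eq_Rintegral => x _; rewrite mulrBl.
Qed.

Lemma ipDr u v w : bcs u -> bcs v -> bcs w -> ip w (fun x => u x + v x) = ip w u + ip w v.
Proof. by move=> bu bv bw; rewrite ipC ipDl// !(ipC _ w). Qed.

Lemma ipZr c u w : bcs u -> bcs w -> ip w (fun x => c * u x) = c * ip w u.
Proof. by move=> bu bw; rewrite ipC ipZl// (ipC _ w). Qed.

Lemma ipBr u v w : bcs u -> bcs v -> bcs w -> ip w (fun x => u x - v x) = ip w u - ip w v.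
Proof. by move=> bu bv bw; rewrite ipC ipBl// !(ipC _ w). Qed.

Lemma ip_ge0 u : 0 <= ip u u.
Proof. by apply: Rintegral_ge0 => x _; rewrite -expr2 sqr_ge0. Qed.

Lemma le_ip u v u' v' : bcs u -> bcs v -> bcs u' -> bcs v' ->
  (forall x, u x * v x <= u' x * v' x) -> ip u v <= ip u' v'.
Proof.
move=> bu bv bu' bv' uv; apply: le_Rintegral => //.
- exact: (bcs_integrable (bcsM bu bv)).
- exact: (bcs_integrable (bcsM bu' bv')).
Qed.

Lemma ip_young u v : bcs u -> bcs v -> 2 * `|ip u v| <= ip u u + ip v v.
Proof.
move=> bu bv.
have H (c : R) : c = 1 \/ c = -1 -> 2 * (c * ip u v) <= ip u u + ip v v.
  move=> hc; have := ip_ge0 (fun x => u x - c * v x).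
  have bcv := bcsZ c bv.
  have bd := bcsB bu bcv.
  rewrite ipBl// !ipBr// (ipZl c bv bu) (ipZl c bv bcv) !(ipZr c bv)// (ipC v u).
  by move: hc => [] ->; lra.
by case: (ger0P (ip u v)) => _; have := H 1 (or_introl erefl);
   have := H (-1) (or_intror erefl); lra.
Qed.

(** Young's inequality for sqrt c u and v / sqrt c with c = sqrt B / sqrt A. If A or B vanishes,
    another c shows that a nonzero inner product is impossible. *)
Lemma ip_CS u v : bcs u -> bcs v -> `|ip u v| <= Num.sqrt (ip u u) * Num.sqrt (ip v v).
Proof.
move=> bu bv; set A := ip u u; set B := ip v v.
have A0 : 0 <= A by exact: ip_ge0.
have B0 : 0 <= B by exact: ip_ge0.
have key (c : R) : 0 < c -> 2 * `|ip u v| <= c * A + c^-1 * B.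
  move=> c0; have sc0 : 0 < Num.sqrt c by rewrite sqrtr_gt0.
  have := ip_young (bcsZ (Num.sqrt c) bu) (bcsZ (Num.sqrt c)^-1 bv).
  rewrite !ipZl ?ipZr//; try exact: bcsZ.
  rewrite !mulrA mulfV ?gt_eqF// mul1r -/A -/B -!expr2 sqr_sqrtr ?(ltW c0)//.
  by rewrite exprVn sqr_sqrtr ?(ltW c0).
have [A00|A00] := eqVneq A 0.
  rewrite A00 sqrtr0 mul0r.
  have [//|uv0] := leP `|ip u v| 0.
  have := key ((B + 1) / `|ip u v|) (divr_gt0 (ltr_wpDl B0 ltr01) uv0).
  rewrite A00 mulr0 add0r invf_div => h.
  suff : `|ip u v| * B < 2 * `|ip u v| * (B + 1).
    rewrite ltNge => /negP; case; rewrite -ler_pdivlMr ?(ltr_wpDl B0 ltr01)//.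
    by rewrite mulrAC.
  nra.
have [B00|B00] := eqVneq B 0.
  rewrite B00 sqrtr0 mulr0.
  have [//|uv0] := leP `|ip u v| 0.
  have A1 : 0 < A + 1 by rewrite ltr_wpDl.
  have := key (`|ip u v| / (A + 1)) (divr_gt0 uv0 A1).
  rewrite B00 mulr0 addr0 mulrAC ler_pdivlMr// => h; nra.
have A1 : 0 < A by rewrite lt_neqAle eq_sym A00.
have B1 : 0 < B by rewrite lt_neqAle eq_sym B00.
have sA : 0 < Num.sqrt A by rewrite sqrtr_gt0.
have sB : 0 < Num.sqrt B by rewrite sqrtr_gt0.
have := key (Num.sqrt B / Num.sqrt A) (divr_gt0 sB sA).
rewrite -{2}(sqr_sqrtr A0) -{3}(sqr_sqrtr B0) invf_div.
have -> : Num.sqrt B / Num.sqrt A * Num.sqrt A ^+ 2 = Num.sqrt A * Num.sqrt B.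
  by field; rewrite gt_eqF.
have -> : Num.sqrt A / Num.sqrt B * Num.sqrt B ^+ 2 = Num.sqrt A * Num.sqrt B.
  by field; rewrite gt_eqF.
by lra.
Qed.

Lemma C1c_H1flat f f' : C1c f f' -> H1flat f.
Proof.
move=> Cf; have [df cf' [M M0 f0]] := Cf; have [fr fE] := C1c_rep Cf.
have cf : continuous f.
  by move=> x; apply/differentiable_continuous/derivable1_diffP; have [] := df x.
have bf : bcs f by apply: (@bcs_continuous _ _ M) => // x /f0[].
have bf' : bcs f' by apply: (@bcs_continuous _ _ M) => // x /f0[].
pose n := (Num.bound M).+1.
have Mn : M < n%:R.
  by rewrite (lt_trans (archi_boundP (ltW M0)))// ltr_nat.
have f0n x : n%:R <= `|x| -> f x = 0 /\ f' x = 0.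
  by move=> nx; apply: f0; exact: lt_le_trans nx.
exists 1%N, (fun=> 1), (fun=> f); split; last first.
  by apply/funext => x; rewrite big_ord_recl big_ord0 mul1r addr0.
move=> _; exists n; split => //.
- by move=> x /ltW/f0n[].
- by rewrite (f0n n%:R _).1 ?(f0n (- n%:R) _).1// ?normrN normr_nat.
- exact: continuous_subspaceT.
have L2b v : bcs v -> L2 `](- n%:R : R), n%:R[ v.
  move=> bv; split; first exact: measurable_funTS bv.1.
  have := bcs_integrable (bcsX 1 bv); exact: integrableS.
split; first exact: L2b.
exists f'; split; first exact: L2b.
move=> phi tphi; have [bphi bdphi] := test1_bcs tphi.
have [N N0 phiN] := test1_support tphi.
have out x : x \notin `](- n%:R : R), n%:R[ -> f x = 0 /\ f' x = 0.
  by rewrite in_itv/= -ltr_norml -leNgt; exact: f0n.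
rewrite !Rintegral_itv.
have -> : \int[mu]_x (f x * derive1 phi x * (x \in `](- n%:R : R), n%:R[)%:R) =
    \int[mu]_x (f x * derive1 phi x).
  apply: eq_Rintegral => x _; have [|/out[-> _]] := boolP (x \in _).
    by rewrite mulr1.
  by rewrite !mul0r.
have -> : \int[mu]_x (f' x * phi x * (x \in `](- n%:R : R), n%:R[)%:R) =
    \int[mu]_x (f' x * phi x).
  apply: eq_Rintegral => x _; have [|/out[_ ->]] := boolP (x \in _).
    by rewrite mulr1.
  by rewrite !mul0r.
have tT : test1 setT phi by case: tphi => sphi [C [cC _ C0]]; split => //; exists C.
have := flat_derivative fr tT.
by rewrite /flat_pair big_nil addr0 -fE.
Qed.

(** The problem at a single index of the net, with a real viscosity; [d] stands for the
    ultrafunction derivative of [u t]. [viscous_galerkin] recovers it for almost all indices. *)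
Record galerkin (V : set (R -> R)) T (u0 : R -> R) nu (u : R -> R -> R) : Prop := Galerkin {
  gal_C1 : C1flat T u;
  gal_V : forall t, timeI T t -> V (u t) /\ V (dt T u t);
  gal_eq : forall t, timeI T t ->
    exists2 d, V d /\ (forall v, V v -> ip d v = dpair (u t) v) &
      forall v, V v -> ip (dt T u t) v + cpair (u t) v = nu * dpair d v;
  gal_0 : u 0 = u0 }.

Lemma is_derive_quot (F : R -> R) t c :
  (forall e, 0 < e -> exists2 d : R, 0 < d & forall h, h != 0 -> `|h| < d ->
     `|(F (t + h) - F t) / h - c| <= e) -> is_derive t 1 F c.
Proof.
move=> Fc; have cv : h^-1 *: ((F \o shift t) (h *: (1 : R)) - F t) @[h --> (0 : R)^'] --> c.
  apply/cvgrPdist_le => e e0; have [d d0 dF] := Fc e e0.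
  near=> h; rewrite distrC /= /shift/= scaler1 (addrC h t).
  have -> : h^-1 *: (F (t + h) - F t) = (F (t + h) - F t) / h by exact: mulrC.
  apply: dF; first by near: h; exact: nbhs_dnbhs_neq.
  by near: h; exact: dnbhs0_lt.
by apply: DeriveDef; [apply/cvg_ex; exists c|apply/cvg_lim].
Unshelve. all: by end_near. Qed.

Lemma quot_right (F : R -> R) t c :
  (exists2 d : R, 0 < d & forall h, 0 < h < d -> `|(F (t + h) - F t) / h - c| <= 1) ->
  F x @[x --> t^'+] --> F t.
Proof.
move=> [d d0 dF]; pose K : R := `|c| + 1; have K0 : 0 < K by rewrite /K ltr_wpDl.
apply/cvgrPdist_le => e e0; have eK : 0 < e / K by rewrite divr_gt0.
near=> x.
have tx : t < x by [].
have xd : x < t + d by near: x; apply: nbhs_right_lt; rewrite ltrDl.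
have xe : x < t + e / K by near: x; apply: nbhs_right_lt; rewrite ltrDl.
have := dF (x - t); rewrite subr_gt0 tx ltrBlDl xd (addrC t) subrK => /(_ isT).
have xt : 0 < x - t by rewrite subr_gt0.
set q := (F x - F t) / (x - t) => qc.
have qK : `|q| <= K.
  rewrite -(subrK c q) (le_trans (ler_normD _ _))// /K addrC lerD2l//.
have -> : F t - F x = - (q * (x - t)) by rewrite /q divfK ?gt_eqF// opprB.
rewrite normrN normrM (gtr0_norm xt) (le_trans (ler_wpM2r (ltW xt) qK))//.
by rewrite mulrC -ler_pdivlMr// lerBlDl ltW.
Unshelve. all: by end_near. Qed.

(** * Time derivatives of inner products *)

Section time_derivative.
Variables (T : R) (u w : R -> R -> R).
Hypothesis uflat : forall t, timeI T t -> H1flat (u t).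
Hypothesis uw : time_derivative T u w.

Let ub t : timeI T t -> bcs (u t).
Proof. by move=> /uflat/H1flat_bcs. Qed.

Let wb t : timeI T t -> bcs (w t).
Proof. by case: uw => wf _ _ /wf/H1flat_bcs. Qed.

(** Remainder of the difference quotient, small in L^2 by the definition of [time_derivative]. All
    derivatives below follow from u(t + h) = u(t) + h (D + w). *)
Let D t h x := (u (t + h) x - u t x) / h - w t x.

Let Db t h : timeI T t -> timeI T (t + h) -> bcs (D t h).
Proof.
move=> It Ith; apply: bcsB; last exact: wb.
rewrite (_ : (fun x => _) = (fun x => h^-1 * (u (t + h) x - u t x))).
  by apply: bcsZ; apply: bcsB; exact: ub.
by apply/funext => x; rewrite mulrC.
Qed.

Let qD t e : timeI T t -> 0 < e -> exists2 d : R, 0 < d & forall h, h != 0 ->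
  `|h| < d -> timeI T (t + h) -> ip (D t h) (D t h) <= e.
Proof.
move=> It e0; case: uw => _ /(_ t It) + _ => /fine_cvg/cvgrPdist_le/(_ e e0).
move=> /nbhs_ballP[d /= d0 dP]; exists d => // h h0 hd Ith.
have := dP h; rewrite /ball/= sub0r normrN => /(_ hd h0 Ith).
rewrite sub0r normrN; apply: le_trans; apply: le_trans (ler_norm _).
by rewrite le_eqVlt /ip /Rintegral; apply/orP; left; apply/eqP; congr fine.
Qed.

Let ipD_small t f e : timeI T t -> bcs f -> 0 < e -> exists2 d : R, 0 < d &
  forall h, h != 0 -> `|h| < d -> timeI T (t + h) -> `|ip (D t h) f| <= e.
Proof.
move=> It bf e0; pose K := Num.sqrt (ip f f) + 1.
have K0 : 0 < K by rewrite /K ltr_wpDl// sqrtr_ge0.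
have eK : 0 < e / K by rewrite divr_gt0.
have [|d d0 dP] := @qD t ((e / K) ^+ 2) It; first by rewrite exprn_gt0.
exists d => // h h0 hd Ith.
rewrite (le_trans (ip_CS (Db It Ith) bf))//.
have : Num.sqrt (ip (D t h) (D t h)) <= e / K.
  by rewrite -[leRHS](gtr0_norm eK) -sqrtr_sqr ler_wsqrtr// dP.
move=> h1; rewrite -[leRHS](divfK (lt0r_neq0 K0)); apply: ler_pM => //; rewrite ?sqrtr_ge0//.
by rewrite /K lerDl.
Qed.

Let diffE t h x : h != 0 -> u (t + h) x = u t x + h * (D t h x + w t x).
Proof. by move=> h0; rewrite /D; field. Qed.

Let diff_ip t h f : timeI T t -> timeI T (t + h) -> h != 0 -> bcs f ->
  ip (u (t + h)) f = ip (u t) f + h * (ip (D t h) f + ip (w t) f).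
Proof.
move=> It Ith h0 bf.
rewrite (_ : u (t + h) = fun x => u t x + h * (D t h x + w t x)); last first.
  by apply/funext => x; exact: diffE.
have bD := Db It Ith; have bw := wb It; have bu := ub It.
have bDw := bcsD bD bw.
by rewrite (ipDl bu (bcsZ h bDw) bf) (ipZl h bDw bf) (ipDl bD bw bf).
Qed.

Let diff_N t h : timeI T t -> timeI T (t + h) -> h != 0 ->
  ip (u (t + h)) (u (t + h)) = ip (u t) (u t) + h * (2 * (ip (D t h) (u t) + ip (w t) (u t)) +
    h * (ip (D t h) (D t h) + 2 * ip (D t h) (w t) + ip (w t) (w t))).
Proof.
move=> It Ith h0; have bD := Db It Ith; have bw := wb It; have bu := ub It.
rewrite diff_ip//; last exact: ub.
rewrite (ipC (u t) (u _)) (ipC (D t h) (u (t + h))) (ipC (w t) (u (t + h))) !diff_ip//.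
rewrite (ipC (w t) (D t h)) (ipC (u t) (D t h)) (ipC (u t) (w t)); ring.
Qed.

Lemma ip_quot t f e : timeI T t -> bcs f -> 0 < e -> exists2 d : R, 0 < d &
  forall h, h != 0 -> `|h| < d -> timeI T (t + h) ->
  `|(ip (u (t + h)) f - ip (u t) f) / h - ip (w t) f| <= e.
Proof.
move=> It bf e0; have [d d0 dP] := ipD_small It bf e0.
exists d => // h h0 hd Ith; rewrite (le_trans _ (dP h h0 hd Ith))//.
rewrite le_eqVlt; apply/orP; left; apply/eqP; congr (`|_|).
by rewrite diff_ip//; field.
Qed.

Lemma N_quot t e : timeI T t -> 0 < e -> exists2 d : R, 0 < d &
  forall h, h != 0 -> `|h| < d -> timeI T (t + h) ->
  `|(ip (u (t + h)) (u (t + h)) - ip (u t) (u t)) / h - 2 * ip (w t) (u t)| <= e.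
Proof.
move=> It e0; have bu := ub It; have bw := wb It.
have e4 : 0 < e / 4 by rewrite divr_gt0.
have [d1 d10 P1] := ipD_small It bu e4.
have [d2 d20 P2] := ipD_small It bw ltr01.
have [d3 d30 P3] := qD It ltr01.
pose K := 3 + ip (w t) (w t); have K0 : 0 < K.
  by rewrite /K; have := ip_ge0 (w t); lra.
have d40 : 0 < e / 4 / K by rewrite divr_gt0.
exists (Num.min (Num.min d1 d2) (Num.min d3 (e / 4 / K))).
  by rewrite !lt_min d10 d20 d30 d40.
move=> h h0; rewrite !lt_min => /andP[/andP[hd1 hd2] /andP[hd3 hd4]] Ith.
have q1 := P1 h h0 hd1 Ith; have q2 := P2 h h0 hd2 Ith; have q3 := P3 h h0 hd3 Ith.
have -> : (ip (u (t + h)) (u (t + h)) - ip (u t) (u t)) / h - 2 * ip (w t) (u t) =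
   2 * ip (D t h) (u t) + h * (ip (D t h) (D t h) + 2 * ip (D t h) (w t) + ip (w t) (w t)).
  by rewrite diff_N//; field.
rewrite (le_trans (ler_normD _ _))// !normrM.
have n2 : `|2 : R| = 2 by rewrite ger0_norm.
have hK : `|h| * `|ip (D t h) (D t h) + 2 * ip (D t h) (w t) + ip (w t) (w t)| <= e / 4.
  rewrite -[leRHS](divfK (lt0r_neq0 K0)); apply: ler_pM => //; first exact: ltW.
  have := ip_ge0 (w t); have := ip_ge0 (D t h) => ? ?.
  move: q2; rewrite ler_norml => /andP[? ?].
  by rewrite /K ler_norml; apply/andP; split; lra.
rewrite n2; lra.
Qed.

Let open_time t : 0 < t < T -> exists2 d : R, 0 < d & forall h, `|h| < d -> timeI T (t + h).
Proof.
move=> /andP[t0 tT]; exists (Num.min t (T - t)); first by rewrite lt_min t0 subr_gt0.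
move=> h; rewrite /timeI/= in_itv/= lt_min !ltr_norml => /andP[/andP[h1 _] /andP[_ h2]].
by apply/andP; split; lra.
Qed.

Lemma ip_derive t f : 0 < t < T -> bcs f ->
  is_derive t 1 (fun t => ip (u t) f) (ip (w t) f).
Proof.
move=> tT bf; have It : timeI T t.
  by case/andP: tT => t0 tT'; rewrite /timeI/= in_itv/= (ltW t0).
apply: is_derive_quot => e e0; have [d1 d10 P1] := ip_quot It bf e0.
have [d2 d20 P2] := open_time tT.
exists (Num.min d1 d2); first by rewrite lt_min d10.
by move=> h h0; rewrite lt_min => /andP[h1 /P2]; exact: P1.
Qed.

Lemma N_derive t : 0 < t < T ->
  is_derive t 1 (fun t => ip (u t) (u t)) (2 * ip (w t) (u t)).
Proof.
move=> tT; have It : timeI T t.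
  by case/andP: tT => t0 tT'; rewrite /timeI/= in_itv/= (ltW t0).
apply: is_derive_quot => e e0; have [d1 d10 P1] := N_quot It e0.
have [d2 d20 P2] := open_time tT.
exists (Num.min d1 d2); first by rewrite lt_min d10.
by move=> h h0; rewrite lt_min => /andP[h1 /P2]; exact: P1.
Qed.

(** Covers t = 0, where the difference quotient exists only from the right. *)
Lemma ip_right t f : timeI T t -> bcs f ->
  ip (u x) f @[x --> t^'+] --> ip (u t) f.
Proof.
move=> It bf; apply: (@quot_right (fun x => ip (u x) f) t (ip (w t) f)).
have [d1 d10 P1] := ip_quot It bf ltr01.
move: It; rewrite /timeI/= in_itv/= => /andP[t0 tT].
exists (Num.min d1 (T - t)); first by rewrite lt_min d10 subr_gt0.
move=> h /andP[h0]; rewrite lt_min => /andP[h1 h2].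
by apply: P1; rewrite ?gt_eqF// ?gtr0_norm// /timeI/= in_itv/=; apply/andP; split; lra.
Qed.

Lemma N_right t : timeI T t ->
  ip (u x) (u x) @[x --> t^'+] --> ip (u t) (u t).
Proof.
move=> It; apply: (@quot_right (fun x => ip (u x) (u x)) t (2 * ip (w t) (u t))).
have [d1 d10 P1] := N_quot It ltr01.
move: It; rewrite /timeI/= in_itv/= => /andP[t0 tT].
exists (Num.min d1 (T - t)); first by rewrite lt_min d10 subr_gt0.
move=> h /andP[h0]; rewrite lt_min => /andP[h1 h2].
by apply: P1; rewrite ?gt_eqF// ?gtr0_norm// /timeI/= in_itv/=; apply/andP; split; lra.
Qed.

End time_derivative.

Lemma C1c_lin f f' g g' c : C1c f f' -> C1c g g' ->
  C1c (fun x => f x + c * g x) (fun x => f' x + c * g' x).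
Proof.
move=> [df cf [M M0 f0]] [dg cg [N N0 g0]]; split.
- move=> x; have dfx := df x; have dgx := dg x.
  by apply: is_derive_eq; rewrite /GRing.scale/=; ring.
- by move=> x; apply: cvgD; [exact: cf|apply: cvgM; [exact: cvg_cst|exact: cg]].
- exists (M + N); first by rewrite addr_gt0.
  move=> x MNx; have [|-> ->] := f0 x; first lra.
  by have [|-> ->] := g0 x; [lra|rewrite mulr0 addr0].
Qed.

Lemma C1c_bcs f f' : C1c f f' -> bcs f /\ bcs f'.
Proof.
move=> Cf; split; first exact: (H1flat_bcs (C1c_H1flat Cf)).
by case: Cf => _ cf' [M M0 f0]; apply: (@bcs_continuous _ _ M) => // x /f0[].
Qed.

(** * The energy inequality on one time interval *)

Section energy_step.
Variables (V : set (R -> R)) (T : R) (u0 : R -> R) (nu : R) (u : R -> R -> R).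
Hypotheses (Vflat : V `<=` H1flat) (nu0 : 0 < nu) (gal : galerkin V T u0 nu u).
Variables (f f1 f2 g g1 g2 : R -> R).
Hypotheses (Cf : C1c f f1) (Cf1 : C1c f1 f2) (Cg : C1c g g1) (Cg1 : C1c g1 g2).
Hypotheses (Vf : V f) (Vf1 : V f1) (Vg : V g) (Vg1 : V g1).
Variables (a b : R) (Ga ga : R -> R) (rho : R).
Hypotheses (a0 : 0 <= a) (bT : b <= T).

(** [W] is the comparison function, with time derivative g; [W1] and [W2] are its x-derivatives and
    [r] is its residual in the viscous equation. The equation is tested with f, g, f1 and g1
    separately and the results are combined linearly. *)
Let W t x := f x + (t - a) * g x.
Let W1 t x := f1 x + (t - a) * g1 x.
Let W2 t x := f2 x + (t - a) * g2 x.
Let r t x := g x + W t x * W1 t x - nu * W2 t x.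
Let E t := ip (fun x => u t x - W t x) (fun x => u t x - W t x).
Let E' t := 2 * ip (dt T u t) (u t) -
  2 * (ip (dt T u t) f + (ip (u t) g + (t - a) * ip (dt T u t) g)) +
  (2 * ip f g + 2 * (t - a) * ip g g).

(** The 1 is set aside for Young's inequality on the residual term. *)
Hypothesis W1_bound : forall t x, a < t < b -> `|W1 t x| <= ga t - 1.
Hypothesis r_bound : forall t, a < t < b -> ip (r t) (r t) <= rho.
Hypothesis dGa : forall t, a < t < b -> is_derive t 1 Ga (ga t).
Hypothesis cGa : {within `[a, b], continuous Ga}.
Hypothesis Ga0 : forall t, a <= t <= b -> 0 <= Ga t.

Let uw : time_derivative T u (dt T u).
Proof. by have [_ /getPex] := gal_C1 gal. Qed.

Let uflat t : timeI T t -> H1flat (u t).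
Proof. by have [+ _] := gal_C1 gal; apply. Qed.

Let timeP t : a <= t < b -> timeI T t.
Proof.
move=> /andP[ta tb]; rewrite /timeI/= in_itv/= (le_trans a0 ta)/=.
exact: lt_le_trans tb bT.
Qed.

Let CW t : C1c (W t) (W1 t). Proof. exact: C1c_lin. Qed.
Let CW1 t : C1c (W1 t) (W2 t). Proof. exact: C1c_lin. Qed.

Lemma energy_expand t : timeI T t -> E t = ip (u t) (u t) -
  2 * (ip (u t) f + (t - a) * ip (u t) g) +
  (ip f f + 2 * (t - a) * ip f g + (t - a) ^+ 2 * ip g g).
Proof.
move=> It; have bu := H1flat_bcs (uflat It); have [bW _] := C1c_bcs (CW t).
have [bf _] := C1c_bcs Cf; have [bg _] := C1c_bcs Cg; have btg := bcsZ (t - a) bg.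
have bd := bcsB bu bW.
have uW v : bcs v -> ip v (W t) = ip v f + (t - a) * ip v g.
  by move=> bv; rewrite /W ipDr// ipZr.
rewrite /E ipBl// !ipBr// (ipC (W t) (u t)) !uW// !(ipC (W t)) !uW//.
rewrite (ipC g f); ring.
Qed.

Lemma energy_derive t : 0 < t < T -> is_derive t 1 E (E' t).
Proof.
move=> t0T; have := t0T; move=> /andP[t0 tT].
have [bf _] := C1c_bcs Cf; have [bg _] := C1c_bcs Cg.
apply: (@near_eq_is_derive R R R (fun t => ip (u t) (u t) -
  2 * (ip (u t) f + (t - a) * ip (u t) g) +
  (ip f f + 2 * (t - a) * ip f g + (t - a) ^+ 2 * ip g g))).
  near=> s; rewrite energy_expand// /timeI/= in_itv/=; apply/andP; split.
    by rewrite ltW//; near: s; exact: lt_nbhsr.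
  by near: s; exact: lt_nbhsl.
have d1 := N_derive uflat uw t0T.
have d2 := ip_derive uflat uw t0T bf; have d3 := ip_derive uflat uw t0T bg.
apply: is_derive_eq; rewrite /E' /GRing.scale/=; ring.
Unshelve. all: by end_near. Qed.

(** With e = u - W, all terms combine into E' = -2 nu |d - W1|^2 - <e^2, W1> - 2 <e, r>. The
    diffusion term has a sign, the convection term is bounded by sup |W1|, and Young's inequality
    handles the residual. *)
Lemma energy_ineq t : a < t < b -> E' t <= ga t * E t + rho.
Proof.
move=> tab; have := tab; move=> /andP[ta tb].
have It : timeI T t by apply: timeP; rewrite (ltW ta).
have uf := uflat It; have bu := H1flat_bcs uf.
have [d [Vd dE] dV] := gal_eq gal It; have [Vu Vw] := gal_V gal It.
have df := Vflat Vd; have bd := H1flat_bcs df.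
have bw := H1flat_bcs (Vflat Vw).
have [bf bf1] := C1c_bcs Cf; have [bg bg1] := C1c_bcs Cg.
have [_ bf2] := C1c_bcs Cf1; have [_ bg2] := C1c_bcs Cg1.
have [bW bW1] := C1c_bcs (CW t); have [_ bW2] := C1c_bcs (CW1 t).
have Wf := C1c_H1flat (CW t); have W1f := C1c_H1flat (CW1 t).
pose e x := u t x - W t x; have be : bcs e by exact: bcsB.
have br : bcs (r t).
  by apply: bcsB; [apply: bcsD => //; exact: bcsM|exact: bcsZ].
have linW v : bcs v -> ip v (W t) = ip v f + (t - a) * ip v g.
  by move=> bv; rewrite /W ipDr ?ipZr//; exact: bcsZ.
have linW1 v : bcs v -> ip v (W1 t) = ip v f1 + (t - a) * ip v g1.
  by move=> bv; rewrite /W1 ipDr ?ipZr//; exact: bcsZ.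
have linW2 v : bcs v -> ip v (W2 t) = ip v f2 + (t - a) * ip v g2.
  by move=> bv; rewrite /W2 ipDr ?ipZr//; exact: bcsZ.
have bu2 := bcsX 1 bu.
(* The energy identity: convection drops out for v = u, and antisymmetry followed by the definition
   of d gives <d/dx d, u> = -<d, d>. *)
have e1 : ip (dt T u t) (u t) = - nu * ip d d.
  have := dV _ Vu; rewrite cpair_self// addr0 => ->.
  by rewrite dpair_anti// -dE// mulNr mulrN.
have test k k1 : C1c k k1 -> V k -> ip (dt T u t) k =
    2^-1 * ip (fun x => u t x ^+ 2) k1 - nu * ip d k1.
  move=> Ck Vk; have := dV _ Vk; rewrite (cpair_C1c Ck uf).
  rewrite (dpair_anti df (C1c_H1flat Ck)) (dpair_C1c Ck df) (ipC k1 d); lra.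
have e2 : ip (dt T u t) (W t) = 2^-1 * ip (fun x => u t x ^+ 2) (W1 t) - nu * ip d (W1 t).
  by rewrite linW// (test _ _ Cf Vf) (test _ _ Cg Vg) !linW1//; ring.
have test1 k k1 : C1c k k1 -> V k -> ip d k = - ip (u t) k1.
  move=> Ck Vk; rewrite dE// (dpair_anti uf (C1c_H1flat Ck)).
  by rewrite (dpair_C1c Ck uf) ipC.
have e3 : ip d (W1 t) = - ip (u t) (W2 t).
  by rewrite linW1// linW2// (test1 _ _ Cf1 Vf1) (test1 _ _ Cg1 Vg1); ring.
have e4 : ip (W t) (W2 t) = - ip (W1 t) (W1 t).
  rewrite -(dpair_C1c (CW t) W1f) (dpair_anti Wf W1f) (dpair_C1c (CW1 t) Wf).
  by rewrite opprK ipC.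
have e5 : ip (fun x => W t x ^+ 2) (W1 t) = 0.
  by have := cpair_C1c (CW t) Wf; rewrite cpair_self//; lra.
have e6 : ip (fun x => e x ^+ 2) (W1 t) = ip (fun x => u t x ^+ 2) (W1 t) -
    2 * ip (fun x => u t x * W t x) (W1 t) + ip (fun x => W t x ^+ 2) (W1 t).
  have buW := bcsM bu bW; have bW2' := bcsX 1 bW.
  rewrite -ipZl// -ipBl//; last exact: bcsZ.
  rewrite -ipDl//; last by apply: bcsB => //; exact: bcsZ.
  by apply: eq_Rintegral => x _; rewrite /e; ring.
have e7 : ip e g = ip e (r t) - (ip (fun x => u t x * W t x) (W1 t) -
    ip (fun x => W t x ^+ 2) (W1 t)) + nu * (ip (u t) (W2 t) - ip (W t) (W2 t)).
  have buW := bcsM bu bW; have bW2' := bcsX 1 bW.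
  rewrite -ipBl// -ipBl// -ipZr//.
  rewrite (_ : ip (fun x => _ - _) (W1 t) = ip e (fun x => W t x * W1 t x)); last first.
    by apply: eq_Rintegral => x _; rewrite /e; ring.
  have bWW := bcsM bW bW1; have bnW := bcsZ nu bW2.
  rewrite -(ipBr br bWW be) -(ipDr (bcsB br bWW) bnW be).
  by apply: eq_Rintegral => x _; rewrite /r; ring.
have e8 : 0 <= ip d d - 2 * ip d (W1 t) + ip (W1 t) (W1 t).
  have := ip_ge0 (fun x => d x - W1 t x).
  rewrite ipBl// ?ipBr// ?(ipC (W1 t) d); last exact: bcsB.
  by lra.
have e9 : - ip (fun x => e x ^+ 2) (W1 t) <= (ga t - 1) * ip e e.
  rewrite -(ipZl (ga t - 1) be be) -[leLHS]mulN1r -(ipZl (-1) (bcsX 1 be) bW1).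
  apply: le_ip => //.
  - by apply: bcsZ; exact: (bcsX 1 be).
  - exact: bcsZ.
  - move=> x; have := W1_bound x tab; rewrite ler_norml => /andP[h1 h2].
    have := sqr_ge0 (e x); nra.
have e10 := ip_young be br.
have e11 := r_bound tab.
have e12 : - (2 * ip e (r t)) <= 2 * `|ip e (r t)|.
  by rewrite -mulrN ler_wpM2l// -normrN ler_norm.
have -> : E' t = 2 * ip (dt T u t) (u t) - 2 * ip (dt T u t) (W t) - 2 * ip e g.
  rewrite /E' linW// /e ipBl// [ip (W t) g]ipC linW// (ipC g f); ring.
have e3' : ip (u t) (W2 t) = - ip d (W1 t) by rewrite e3 opprK.
have e13 := mulr_ge0 (ltW nu0) e8.
have -> : E t = ip e e by [].
rewrite e3' e4 in e7; rewrite e7 e1 e2; lra.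
Qed.

(** Gronwall with the integrating factor exp(-Ga): the function [H] is nonincreasing. Since Ga >= 0
    the factor is at most 1, so the residual enters with constant rho. *)
Lemma energy_step t : a <= t <= b -> t < T ->
  E t * expR (- Ga t) <= E a * expR (- Ga a) + rho * (t - a).
Proof.
move=> /andP[]; rewrite le_eqVlt => /predU1P[<- _ _|ta tb tT].
  by rewrite subrr mulr0 addr0.
pose H s := E s * expR (- Ga s) - rho * (s - a).
have aT : timeI T a by rewrite /timeI/= in_itv/= a0 (lt_trans ta).
have sT s : a < s <= t -> 0 < s < T.
  by move=> /andP[as_ st]; rewrite (le_lt_trans a0 as_) (le_lt_trans st).
have [bf _] := C1c_bcs Cf; have [bg _] := C1c_bcs Cg.
have dH s : a < s < t -> is_derive s 1 H (E' s * expR (- Ga s) +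
    E s * (expR (- Ga s) * - ga s) - rho).
  move=> /andP[as_ st].
  have dE : is_derive s 1 E (E' s) by apply: energy_derive; apply: sT; rewrite as_ ltW.
  have dG : is_derive s 1 Ga (ga s) by apply: dGa; rewrite as_ (lt_le_trans st).
  have dX : is_derive s 1 (fun s => expR (- Ga s)) (expR (- Ga s) * - ga s).
    by apply: (@is_derive1_comp _ expR (fun s => - Ga s)).
  apply: is_derive_eq; rewrite /GRing.scale/=; ring.
have cE : {within `[a, t], continuous E}.
  have Ect s : a < s <= t -> {for s, continuous E}.
    move=> /sT/energy_derive [dE _]; exact/differentiable_continuous/derivable1_diffP.
  apply/(continuous_within_itvP _ ta); split.
  - by move=> s; rewrite in_itv/= => /andP[as_ st]; apply: Ect; rewrite as_ ltW.
  (* At the left endpoint, possibly time 0, only right continuity is at hand; it is read off the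
     expanded energy. *)
  - rewrite energy_expand//.
    pose G s := ip (u s) (u s) - 2 * (ip (u s) f + (s - a) * ip (u s) g) +
      (ip f f + 2 * (s - a) * ip f g + (s - a) ^+ 2 * ip g g).
    have GE : {near a^'+, G =1 E}.
      near=> s; rewrite /G energy_expand// /timeI/= in_itv/=; apply/andP; split.
        by rewrite (le_trans a0)//.
      by rewrite (lt_trans _ tT)//; near: s; exact: nbhs_right_lt.
    apply: cvg_trans (near_eq_cvg GE) _.
    have id_a : s @[s --> a^'+] --> a by apply: cvg_at_right_filter; exact: cvg_id.
    have c0 : (s - a) @[s --> a^'+] --> a - a by apply: cvgB => //; exact: cvg_cst.
    apply: cvgD.
      apply: cvgB; first exact: (N_right uflat uw).
      apply: cvgM; first exact: cvg_cst.
      apply: cvgD; first exact: (ip_right uflat uw).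
      by apply: cvgM => //; exact: (ip_right uflat uw).
    apply: cvgD; last by apply: cvgM; [rewrite expr2; under eq_fun do rewrite expr2; exact: cvgM|exact: cvg_cst].
    apply: cvgD; first exact: cvg_cst.
    apply: cvgM; last exact: cvg_cst.
    by apply: cvgM => //; exact: cvg_cst.
  - by apply: cvg_at_left_filter; apply: Ect; rewrite ta lexx.
have cGt : {within `[a, t], continuous Ga}.
  by apply: continuous_subspaceW cGa; apply: subset_itvl; rewrite bnd_simp.
have cH : {within `[a, t], continuous H}.
  move=> s; apply: cvgB.
    apply: cvgM; first exact: cE.
    apply: continuous_cvg; first exact: continuous_expR.
    by apply: cvgN; exact: cGt.
  apply: cvgM; first exact: cvg_cst.
  apply: cvgB; last exact: cvg_cst.
  by apply: continuous_subspaceT => z; exact: cvg_id.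
have HH := @ler0_derive1_nincr R H a t _ _ cH a t (lexx a) (ltW ta) (lexx t).
suff : H t <= H a by rewrite /H subrr mulr0 subr0 lerBlDr.
apply: HH => s; rewrite in_itv/= => sat; have [dHs dHE] := dH s sat => //.
rewrite derive1E dHE.
have sab : a < s < b by case/andP: sat => -> st; rewrite (lt_le_trans st).
have E1 := energy_ineq sab.
have x0 := expR_gt0 (- Ga s).
have x1 : expR (- Ga s) <= 1.
  by rewrite -expR0 ler_expR oppr_le0 Ga0//; case/andP: sab => /ltW-> /ltW->.
have rho0 : 0 <= rho by apply: le_trans (r_bound sab); exact: ip_ge0.
have : (E' s - ga s * E s) * expR (- Ga s) <= rho.
  apply: (@le_trans _ _ (rho * expR (- Ga s))).
    by rewrite ler_wpM2r ?(ltW x0)//; lra.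
  by rewrite ler_piMr.
lra.
Unshelve. all: by end_near. Qed.

End energy_step.

End galerkin.

(** * The Cole-Hopf solution *)

Section gaussian_averages.
Context {R : realType}.
Local Notation mu := (@lebesgue_measure R).
Implicit Types (q f : R -> R) (x y z s t M L c C th : R).

Definition gau z : R := expR (- z ^+ 2).

Lemma gau_gt0 z : 0 < gau z. Proof. exact: expR_gt0. Qed.

Lemma gau_continuous : continuous gau. Proof. exact: continuous_gauss_fun. Qed.

Lemma gau_integrable : mu.-integrable setT (EFin \o gau).
Proof. exact: integrableT_gauss. Qed.

Definition mass : R := \int[mu]_z gau z.

Lemma mass_gt0 : 0 < mass.
Proof.
by rewrite /mass /Rintegral integralT_gauss /= sqrtr_gt0 pi_gt0.
Qed.

Lemma gau_th_integrable th : 0 < th ->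
  mu.-integrable setT (EFin \o (fun z => expR (- th * z ^+ 2))).
Proof.
move=> th0; pose sg := (Num.sqrt (2 * th))^-1.
have s2 : 0 < Num.sqrt (2 * th) by rewrite sqrtr_gt0 mulr_gt0.
have sg0 : sg != 0 by rewrite invr_eq0 gt_eqF.
have := integrable_normal_pdf 0 sg.
move=> /(intRZ measurableT (normal_peak sg)^-1).
congr (_.-integrable _ _); apply/funext => z; rewrite /= /normal_pdf (negbTE sg0).
rewrite /normal_fun mulrA mulVf ?mul1r ?gt_eqF ?normal_peak_gt0//.
congr (expR _)%:E; rewrite subr0 /sg exprVn sqr_sqrtr ?mulr_ge0 ?ltW//.
by field; rewrite gt_eqF.
Qed.

Lemma gau_moment2_le z : (1 + z ^+ 2) * gau z <= 2 * expR (- (1 / 2) * z ^+ 2).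
Proof.
have -> : gau z = expR (- (1/2) * z ^+ 2) * expR (- (1/2) * z ^+ 2).
  by rewrite -expRD; congr expR; lra.
rewrite mulrA ler_wpM2r ?expR_ge0// mulNr expRN ler_pdivrMr ?expR_gt0//.
have := expR_ge1Dx (1/2 * z ^+ 2); lra.
Qed.

Lemma gau_moment2_integrable : mu.-integrable setT (EFin \o (fun z => (1 + z ^+ 2) * gau z)).
Proof.
have i := intRZ measurableT 2 (gau_th_integrable (divr_gt0 ltr01 (ltr0Sn R 1))).
apply: (@intR_le _ _ R mu _ measurableT _ _ _ i).
  apply: continuous_measurable_fun => z; apply: cvgM; last exact: gau_continuous.
  apply: cvgD; first exact: cvg_cst.
  by apply: (cvgM (f := id) (g := id)); exact: cvg_id.
move=> z _; rewrite ger0_norm; first exact: gau_moment2_le.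
by rewrite mulr_ge0 ?(ltW (gau_gt0 _))// addr_ge0// sqr_ge0.
Qed.

Definition mass2 : R := \int[mu]_z ((1 + z ^+ 2) * gau z).

Lemma mass_le2 : mass <= mass2.
Proof.
apply: le_Rintegral => //; [exact: gau_integrable|exact: gau_moment2_integrable|].
by move=> z _; rewrite ler_peMl ?(ltW (gau_gt0 _))// lerDl sqr_ge0.
Qed.

(** The weight absorbs factors |z| and 1 + z^2 alike, since |z| <= 1 + z^2, so [mass2] serves as the
    constant in these estimates. *)
Lemma gau_dom f C : measurable_fun setT f ->
  (forall z, `|f z| <= C * ((1 + z ^+ 2) * gau z)) ->
  mu.-integrable setT (EFin \o f) /\ `|\int[mu]_z f z| <= C * mass2.
Proof.
move=> mf fC; have i := intRZ measurableT C gau_moment2_integrable.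
have fi : mu.-integrable setT (EFin \o f).
  by apply: (@intR_le _ _ R mu _ measurableT _ _ _ i).
split => //; rewrite (le_trans (le_normr_Rintegral _ fi))//.
rewrite /mass2 -RintegralZl//; last exact: gau_moment2_integrable.
by apply: le_Rintegral => //; exact: intR_abs.
Qed.

(** For s = sqrt(4 nu t) this is sqrt(pi) times the solution at time t of the heat equation with
    diffusivity nu and datum q, after the substitution y = x + s z. In this form s = 0 is not
    singular. *)
Definition gavg q s x : R := \int[mu]_z (q (x + s * z) * gau z).

Lemma cont_shift q s x : continuous q -> continuous (fun z => q (x + s * z)).
Proof.
move=> cq z; apply: (@continuous_comp _ _ _ (fun z => x + s * z) q); last exact: cq.
apply: cvgD; first exact: cvg_cst.
by apply: cvgM; [exact: cvg_cst|exact: cvg_id].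
Qed.

Lemma gavg_integrable q M s x : continuous q -> (forall y, `|q y| <= M) ->
  mu.-integrable setT (EFin \o (fun z => q (x + s * z) * gau z)).
Proof.
move=> cq qM; have := @intR_bM _ _ R mu setT measurableT _ (fun z => q (x + s * z)) M gau_integrable.
move=> h; rewrite (_ : (fun z => q (x + s * z) * gau z) = (fun z => gau z * q (x + s * z))).
  apply: h; [exact: (continuous_measurable_fun (@cont_shift q s x cq))|by move=> z _; exact: qM].
by apply/funext => z; rewrite mulrC.
Qed.

Lemma gavg_le q M s x : continuous q -> (forall y, `|q y| <= M) ->
  `|gavg q s x| <= M * mass.
Proof.
move=> cq qM; have qi := gavg_integrable s x cq qM.
rewrite /gavg (le_trans (le_normr_Rintegral _ qi))// /mass -RintegralZl//; last exact: gau_integrable.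
apply: le_Rintegral => //; [exact: intR_abs|exact/intRZ/gau_integrable|].
by move=> z _; rewrite normrM (gtr0_norm (gau_gt0 z)) ler_wpM2r ?(ltW (gau_gt0 z)).
Qed.

Lemma gavg_ge q M c s x : continuous q -> (forall y, `|q y| <= M) ->
  (forall y, c <= q y) -> c * mass <= gavg q s x.
Proof.
move=> cq qM qc; have qi := gavg_integrable s x cq qM.
rewrite /gavg /mass -RintegralZl//; last exact: gau_integrable.
apply: le_Rintegral => //; first exact/intRZ/gau_integrable.
by move=> z _; rewrite ler_wpM2r ?(ltW (gau_gt0 z)).
Qed.

Lemma gavg_dist q q' M d s x : continuous q -> continuous q' ->
  (forall y, `|q y| <= M) -> (forall y, `|q' y| <= M) ->
  (forall y, `|q y - q' y| <= d) -> `|gavg q s x - gavg q' s x| <= d * mass.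
Proof.
move=> cq cq' qM qM' qq'.
have qi := gavg_integrable s x cq qM; have qi' := gavg_integrable s x cq' qM'.
rewrite /gavg -RintegralB//.
have cd : continuous (fun y => q y - q' y) by move=> y; apply: cvgB; [exact: cq|exact: cq'].
have := gavg_le s x cd qq'; rewrite /gavg.
by under eq_Rintegral do rewrite mulrBl.
Qed.

Lemma derive_under (f f' : R -> R -> R) (G : R -> R) x :
  (forall x, mu.-integrable setT (EFin \o f x)) ->
  (forall x y, is_derive x 1 (f ^~ y) (f' x y)) ->
  (forall x y, `|f' x y| <= G y) -> mu.-integrable setT (EFin \o G) ->
  is_derive x 1 (fun x => \int[mu]_y f x y) (\int[mu]_y f' x y).
Proof.
move=> fi df f'G Gi.
have G0 y : 0 <= G y by apply: le_trans (f'G 0 y).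
have Ix : `](x - 1), (x + 1)[%classic x by rewrite /= in_itv/=; apply/andP; split; lra.
have d1 a y : partial1of2 f a y = f' a y.
  by rewrite /partial1of2; exact: is_derive_derive1.
have dfd a y : derivable (f ^~ y) a 1 by have [] := df a y.
have h a y : `](x - 1), (x + 1)[%classic a -> setT y -> `|partial1of2 f a y| <= G y.
  by rewrite d1.
have d2 := @derivable_under_integral R _ _ mu f setT measurableT x (x - 1) (x + 1) Ix
  (fun y _ => fi y) (fun a y _ _ => dfd a y) G G0 Gi h.
have d3 := @differentiation_under_integral R _ _ mu f setT measurableT x (x - 1) (x + 1) Ix
  (fun y _ => fi y) (fun a y _ _ => dfd a y) G G0 Gi h.
apply: DeriveDef; first exact: d2.
rewrite -derive1E d3; apply: eq_Rintegral => y _; exact: d1.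
Qed.

Definition C1b q q' := [/\ forall x, is_derive x 1 q (q' x), continuous q' &
  exists M : R, forall x, `|q x| <= M /\ `|q' x| <= M].

Lemma C1b_continuous q q' : C1b q q' -> continuous q.
Proof.
by move=> [dq _ _] x; apply/differentiable_continuous/derivable1_diffP; have [] := dq x.
Qed.

Lemma C1b_lipschitz q q' M : (forall x, is_derive x 1 q (q' x)) ->
  (forall x, `|q' x| <= M) -> forall x y, `|q x - q y| <= M * `|x - y|.
Proof.
move=> dq q'M x y.
wlog xy : x y / y < x => [H|].
  case: (ltgtP x y) => [xy|yx|->]; [|exact: H|by rewrite !subrr !normr0 mulr0].
  by rewrite distrC (distrC x); exact: H.
have cq : continuous q.
  by move=> z; apply/differentiable_continuous/derivable1_diffP; have [] := dq z.
have [c _ ->] := @MVT R q q' y x xy (fun z _ => dq z) (continuous_subspaceT cq).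
by rewrite normrM ler_wpM2r.
Qed.

Lemma gavg_lipschitz q q' M s x s' x' : C1b q q' -> (forall x, `|q' x| <= M) ->
  `|gavg q s x - gavg q s' x'| <= M * mass2 * (`|x - x'| + `|s - s'|).
Proof.
move=> Cq q'M; have [dq cq' [B qB]] := Cq; have cq := C1b_continuous Cq.
have qb y : `|q y| <= B by exact: (qB y).1.
have i1 := gavg_integrable s x cq qb; have i2 := gavg_integrable s' x' cq qb.
rewrite /gavg -RintegralB// mulrAC.
have M0 : 0 <= M by apply: le_trans (q'M 0).
apply: (gau_dom _ _).2; first exact: intR_measurable (intRB measurableT i1 i2).
move=> z; rewrite -mulrBl normrM (gtr0_norm (gau_gt0 z)) mulrA.
rewrite ler_wpM2r ?(ltW (gau_gt0 z))//.
rewrite (le_trans (C1b_lipschitz dq q'M _ _))// -mulrA ler_wpM2l//.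
have -> : x + s * z - (x' + s' * z) = (x - x') + (s - s') * z by ring.
rewrite (le_trans (ler_normD _ _))// normrM.
have z1 : `|z| <= 1 + z ^+ 2.
  have := sqr_ge0 (`|z| - 1).
  rewrite -[z ^+ 2](real_normK (num_real z)); have := normr_ge0 z; nra.
have := normr_ge0 (x - x'); have := normr_ge0 (s - s'); have := sqr_ge0 z; nra.
Qed.

Lemma gavg_derive_x q q' s x : C1b q q' ->
  is_derive x 1 (gavg q s) (gavg q' s x).
Proof.
move=> Cq; have [dq cq' [B qB]] := Cq; have cq := C1b_continuous Cq.
apply: (@derive_under (fun x z => q (x + s * z) * gau z)
  (fun x z => q' (x + s * z) * gau z) (fun z => B * gau z)).
- by move=> y; apply: (@gavg_integrable _ B) => // z; have [] := qB z.
- move=> y z.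
  have h : is_derive y 1 (fun y => q (y + s * z)) (q' (y + s * z)).
    rewrite -[q' _]mulr1; apply: (@is_derive1_comp _ q (fun y => y + s * z)).
    by apply: is_derive_eq; rewrite addr0.
  by apply: is_derive_eq; rewrite /GRing.scale/=; ring.
- by move=> y z; rewrite normrM (gtr0_norm (gau_gt0 z)) ler_wpM2r ?(ltW (gau_gt0 z))// (qB _).2.
- exact/intRZ/gau_integrable.
Qed.

Lemma gau_derive z : is_derive z 1 gau (- 2 * z * gau z).
Proof.
have h : is_derive z 1 (fun z => - z ^+ 2) (- (2 * z)).
  by apply: is_derive_eq; rewrite /GRing.scale/= ?expr1; ring.
have := @is_derive1_comp _ expR (fun z => - z ^+ 2) z _ _ (is_derive_expR _) h.
by rewrite /gau; congr is_derive; ring.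
Qed.

Lemma gau_cvg0 : gau n%:R @[n --> \oo] --> 0.
Proof.
apply: (@squeeze_cvgr _ _ _ _ (fun=> 0) harmonic); last 2 first.
- exact: cvg_cst.
- exact: cvg_harmonic.
near=> n; rewrite (ltW (gau_gt0 _))/= /harmonic /gau expRN lef_pV2 ?posrE ?expR_gt0 ?ltr0n//.
rewrite (le_trans _ (expR_ge1Dx _))// -natr1 addrC lerD2l -natrX ler_nat.
have n0 : (0 < n)%N by near: n; exists 1%N.
by rewrite -[leqLHS]muln1 expnS expn1 leq_mul2l n0 orbT.
Unshelve. all: by end_near. Qed.

(** The integral of the derivative of f gau over [-n-1, n+1] is a boundary term, which tends to 0
    because f is bounded and gau decays. *)
Lemma gau_ibp f f' : C1b f f' ->
  \int[mu]_z (f z * (2 * z * gau z)) = \int[mu]_z (f' z * gau z).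
Proof.
move=> Cf; have [df cf' [B fB]] := Cf; have cf := C1b_continuous Cf.
pose F z := f z * gau z.
pose F' z := f' z * gau z - f z * (2 * z * gau z).
have B0 : 0 <= B by apply: le_trans (fB 0).1.
have dF z : is_derive z 1 F (F' z).
  have dfz := df z; have dgz := gau_derive z.
  by apply: is_derive_eq; rewrite /GRing.scale/= /F'; ring.
have c2 : continuous (fun z => 2 * z * gau z).
  move=> z; apply: cvgM; last exact: gau_continuous.
  by apply: cvgM; [exact: cvg_cst|exact: cvg_id].
have cF' : continuous F'.
  move=> z; apply: cvgB; apply: cvgM; [exact: cf'|exact: gau_continuous|exact: cf|exact: c2].
have i1 : mu.-integrable setT (EFin \o (fun z => f' z * gau z)).
  apply: (gau_dom (C := B) _ _).1.
    by apply: continuous_measurable_fun => z; apply: cvgM; [exact: cf'|exact: gau_continuous].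
  move=> z; rewrite normrM (gtr0_norm (gau_gt0 z)) mulrA ler_wpM2r ?(ltW (gau_gt0 z))//.
  by rewrite (le_trans (fB z).2)// ler_peMr// lerDl sqr_ge0.
have i2 : mu.-integrable setT (EFin \o (fun z => f z * (2 * z * gau z))).
  apply: (gau_dom (C := 2 * B) _ _).1.
    by apply: continuous_measurable_fun => z; apply: cvgM; [exact: cf|exact: c2].
  move=> z; rewrite !normrM (gtr0_norm (gau_gt0 z)) !mulrA ler_wpM2r ?(ltW (gau_gt0 z))//.
  rewrite (ger0_norm (ler0n _ 2)).
  have z1 : `|z| <= 1 + z ^+ 2.
    have := sqr_ge0 (`|z| - 1).
    rewrite -[z ^+ 2](real_normK (num_real z)); have := normr_ge0 z; nra.
  have := (fB z).1; have := normr_ge0 (f z); have := normr_ge0 z; nra.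
have iF' : mu.-integrable setT (EFin \o F') by exact: intRB.
suff : \int[mu]_z F' z = 0.
  by rewrite /F' RintegralB// => /eqP; rewrite subr_eq0 => /eqP ->.
have lim1 : \int[mu]_z (F' z * (z \in `[(- n.+1%:R : R), n.+1%:R])%:R) @[n --> \oo] -->
    \int[mu]_z F' z.
  apply: (@Rintegral_dominated _ _ R mu setT measurableT _ _ (fun z => `|F' z|)).
  - move=> n; apply: measurable_funM; first exact: continuous_measurable_fun.
    exact: measurable_mem_itv.
  - exact: intR_abs.
  - by move=> n z _; rewrite normrM; case: (_ \in _); rewrite ?normr1 ?normr0 ?mulr1 ?mulr0.
  - exact: continuous_measurable_fun.
  - apply: aeW => z _; apply: cvg_near_cst; near=> n.
    rewrite (_ : z \in _) ?mulr1// in_itv/= -ler_norml.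
    rewrite (le_trans (ltW (archi_boundP (normr_ge0 z))))// ler_nat.
    by apply: leqW; near: n; exists (Num.bound `|z|).
have eqn n : \int[mu]_z (F' z * (z \in `[(- n.+1%:R : R), n.+1%:R])%:R) = F n.+1%:R - F (- n.+1%:R).
  have nn : - n.+1%:R < n.+1%:R :> R by rewrite gtrN// ltr0n.
  rewrite -Rintegral_itv /Rintegral (@continuous_FTC2 _ F' F)//.
  - exact: continuous_subspaceT.
  - have cF : continuous F by move=> z; apply: cvgM; [exact: cf|exact: gau_continuous].
    split; first by move=> z _; have [] := dF z.
      by apply: cvg_at_right_filter; exact: cF.
    by apply: cvg_at_left_filter; exact: cF.
  - by move=> z _; exact: is_derive_derive1.
have lim0 : \int[mu]_z (F' z * (z \in `[(- n.+1%:R : R), n.+1%:R])%:R) @[n --> \oo] --> (0 : R).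
  apply/norm_cvg0P; apply: (@squeeze_cvgr _ _ _ _ (fun=> 0) (fun n => 2 * B * gau n.+1%:R)).
  - apply: nearW => n; rewrite normr_ge0/= eqn (le_trans (ler_normB _ _))//.
    rewrite /F !normrM {2}/gau sqrrN -/(gau n.+1%:R) (gtr0_norm (gau_gt0 _)).
    rewrite -mulrDl ler_wpM2r ?(ltW (gau_gt0 _))//.
    have := (fB n.+1%:R).1; have := (fB (- n.+1%:R)).1; lra.
  - exact: cvg_cst.
  - rewrite -(mulr0 (2 * B)); apply: cvgM; first exact: cvg_cst.
    have := gau_cvg0; by rewrite -cvg_shiftS.
by rewrite -(cvg_lim (@Rhausdorff R) lim1) (cvg_lim (@Rhausdorff R) lim0).
Unshelve. all: by end_near. Qed.

Lemma C1b_shift f f' s x : C1b f f' -> C1b (fun z => f (x + s * z)) (fun z => s * f' (x + s * z)).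
Proof.
move=> [df cf' [B fB]]; split.
- move=> z; rewrite mulrC; apply: (@is_derive1_comp _ f (fun z => x + s * z)).
  by apply: is_derive_eq; rewrite /GRing.scale/=; ring.
- by move=> z; apply: cvgM; [exact: cvg_cst|exact: cont_shift].
- exists (B + `|s| * B) => z.
  have B0 : 0 <= B by apply: le_trans (fB 0).1.
  have [h1 h2] := fB (x + s * z); split.
    by rewrite (le_trans h1)// lerDl mulr_ge0.
  by rewrite normrM (le_trans (ler_wpM2l (normr_ge0 s) h2))// lerDr.
Qed.

(** The derivative is moved from q onto the Gaussian: the bound uses only the sup norm of q, at the
    price of a factor 1/s. *)
Lemma gavg_smoothing q q' M s x : C1b q q' -> (forall y, `|q y| <= M) -> 0 < s ->
  `|gavg q' s x| <= 2 * M * mass2 / s.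
Proof.
move=> Cq qM s0; have [dq cq' [B qB]] := Cq; have cq := C1b_continuous Cq.
have := gau_ibp (C1b_shift s x Cq).
under [in X in _ = X -> _]eq_Rintegral do rewrite -mulrA.
rewrite RintegralZl//; last by apply: (@gavg_integrable _ B) => // y; have [] := qB y.
rewrite -/(gavg q' s x) => E; rewrite ler_pdivlMr// mulrC -{1}(gtr0_norm s0) -normrM -E.
have M0 : 0 <= M by apply: le_trans (qM 0).
apply: (gau_dom _ _).2.
  apply: continuous_measurable_fun => z; apply: cvgM; first exact: cont_shift.
  apply: cvgM; last exact: gau_continuous.
  by apply: cvgM; [exact: cvg_cst|exact: cvg_id].
move=> z; rewrite !normrM (gtr0_norm (gau_gt0 z)) !mulrA ler_wpM2r ?(ltW (gau_gt0 z))//.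
rewrite (ger0_norm (ler0n _ 2)).
have z1 : `|z| <= 1 + z ^+ 2.
  have := sqr_ge0 (`|z| - 1).
  rewrite -[z ^+ 2](real_normK (num_real z)); have := normr_ge0 z; nra.
have := qM (x + s * z); have := normr_ge0 (q (x + s * z)); have := normr_ge0 z; nra.
Qed.

(** Differentiation in s produces a factor z, which Gaussian integration by parts trades for one
    more derivative of q. With s = sqrt(4 nu t) this is the heat equation. *)
Lemma gavg_derive_s q q' q'' s x : C1b q q' -> C1b q' q'' ->
  is_derive s 1 (fun s => gavg q s x) (s / 2 * gavg q'' s x).
Proof.
move=> Cq Cq'; have [dq cq' [B qB]] := Cq; have cq := C1b_continuous Cq.
have [_ cq'' [B' qB']] := Cq'.
have B0 : 0 <= B by apply: le_trans (qB 0).1.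
have -> : s / 2 * gavg q'' s x = \int[mu]_z (q' (x + s * z) * (z * gau z)).
  have := gau_ibp (C1b_shift s x Cq').
  under [in X in _ = X -> _]eq_Rintegral do rewrite -mulrA.
  rewrite RintegralZl//; last by apply: (@gavg_integrable _ B') => // y; have [] := qB' y.
  rewrite -/(gavg q'' s x) => E; rewrite mulrAC -E mulrC -RintegralZl//.
    by apply: eq_Rintegral => z _; field.
  apply: (gau_dom (C := 2 * B) _ _).1.
    apply: continuous_measurable_fun => z; apply: cvgM; first exact: cont_shift.
    apply: cvgM; last exact: gau_continuous.
    by apply: cvgM; [exact: cvg_cst|exact: cvg_id].
  move=> z; rewrite !normrM (gtr0_norm (gau_gt0 z)) !mulrA ler_wpM2r ?(ltW (gau_gt0 z))//.
  rewrite (ger0_norm (ler0n _ 2)).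
  have z1 : `|z| <= 1 + z ^+ 2.
    have := sqr_ge0 (`|z| - 1).
    rewrite -[z ^+ 2](real_normK (num_real z)); have := normr_ge0 z; nra.
  have := (qB (x + s * z)).2; have := normr_ge0 (q' (x + s * z)); have := normr_ge0 z; nra.
apply: (@derive_under (fun s z => q (x + s * z) * gau z)
  (fun s z => q' (x + s * z) * (z * gau z)) (fun z => B * ((1 + z ^+ 2) * gau z))).
- by move=> y; apply: (@gavg_integrable _ B) => // z; have [] := qB z.
- move=> y z.
  have h : is_derive y 1 (fun y => q (x + y * z)) (q' (x + y * z) * z).
    apply: (@is_derive1_comp _ q (fun y => x + y * z)).
    by apply: is_derive_eq; rewrite /GRing.scale/=; ring.
  by apply: is_derive_eq; rewrite /GRing.scale/=; ring.
- move=> y z; rewrite !normrM (gtr0_norm (gau_gt0 z)) !mulrA ler_wpM2r ?(ltW (gau_gt0 z))//.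
  have z1 : `|z| <= 1 + z ^+ 2.
    have := sqr_ge0 (`|z| - 1).
    rewrite -[z ^+ 2](real_normK (num_real z)); have := normr_ge0 z; nra.
  have := (qB (x + y * z)).2; have := normr_ge0 (q' (x + y * z)); have := normr_ge0 z; nra.
- exact/intRZ/gau_moment2_integrable.
Qed.

(* Decay: 1 + x^2 <= 2 (1 + (x + s z)^2) (1 + s^2 z^2). *)
Lemma gavg_decay q C s x : continuous q -> (forall y, (1 + y ^+ 2) * `|q y| <= C) ->
  (1 + x ^+ 2) * `|gavg q s x| <= 2 * C * (1 + s ^+ 2) * mass2.
Proof.
move=> cq qC.
have C0 : 0 <= C by apply: le_trans (qC 0); rewrite mulr_ge0// addr_ge0// sqr_ge0.
have x0 : 0 <= 1 + x ^+ 2 by rewrite addr_ge0// sqr_ge0.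
have qC' y : `|q y| <= C.
  by apply: le_trans (qC y); rewrite ler_peMl// lerDl sqr_ge0.
rewrite -{1}(ger0_norm x0) -normrM /gavg -RintegralZl//; last exact: (gavg_integrable _ _ cq qC').
apply: (gau_dom _ _).2.
  apply: continuous_measurable_fun => z; apply: cvgM; first exact: cvg_cst.
  by apply: cvgM; [exact: cont_shift|exact: gau_continuous].
move=> z; rewrite !normrM (gtr0_norm (gau_gt0 z)) !mulrA ler_wpM2r ?(ltW (gau_gt0 z))//.
rewrite (ger0_norm x0).
have h1 : 1 + x ^+ 2 <= 2 * (1 + (x + s * z) ^+ 2) * (1 + s ^+ 2 * z ^+ 2).
  have h3 := sqr_ge0 (x + s * z + s * z); have h4 := sqr_ge0 ((x + s * z) * (s * z)).
  have h5 := sqr_ge0 (x + s * z); have h6 := sqr_ge0 (s * z).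
  have -> : x ^+ 2 = (x + s * z) ^+ 2 - 2 * (x + s * z) * (s * z) + (s * z) ^+ 2 by ring.
  have -> : s ^+ 2 * z ^+ 2 = (s * z) ^+ 2 by ring.
  nra.
have h2 : 1 + s ^+ 2 * z ^+ 2 <= (1 + s ^+ 2) * (1 + z ^+ 2).
  have := sqr_ge0 s; have := sqr_ge0 z; nra.
have q0 := normr_ge0 (q (x + s * z)).
apply: (le_trans (ler_wpM2r q0 h1)).
have h3 := qC (x + s * z).
rewrite mulrAC -[2 * _ * _]mulrA.
have k0 : 0 <= 1 + s ^+ 2 * z ^+ 2 by rewrite addr_ge0// mulr_ge0// sqr_ge0.
apply: (@le_trans _ _ (2 * C * (1 + s ^+ 2 * z ^+ 2))).
  by rewrite ler_wpM2r// -mulrA ler_wpM2l.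
have -> : 2 * (C * (1 + s ^+ 2)) * (1 + z ^+ 2) = 2 * C * ((1 + s ^+ 2) * (1 + z ^+ 2)) by ring.
by rewrite ler_wpM2l// mulr_ge0.
Qed.

End gaussian_averages.

(** * Bounded C^1 functions, and Hölder continuity in time *)

Section C1b_algebra.
Context {R : realType}.
Implicit Types (f g : R -> R) (x s t C T : R).

Lemma C1bM f f' g g' : C1b f f' -> C1b g g' ->
  C1b (fun x => f x * g x) (fun x => f' x * g x + f x * g' x).
Proof.
move=> Cf Cg; have [df cf' [M fM]] := Cf; have [dg cg' [N gN]] := Cg.
have cf := C1b_continuous Cf; have cg := C1b_continuous Cg; split.
- move=> x; have dfx := df x; have dgx := dg x.
  by apply: is_derive_eq; rewrite /GRing.scale/=; ring.
- by move=> x; apply: cvgD; apply: cvgM; [exact: cf'|exact: cg|exact: cf|exact: cg'].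
- exists (2 * (M * N)) => x; have [h1 h2] := fM x; have [h3 h4] := gN x.
  have M0 : 0 <= M by apply: le_trans h1.
  have N0 : 0 <= N by apply: le_trans h3.
  split; first by rewrite normrM; have := ler_pM (normr_ge0 _) (normr_ge0 _) h1 h3; have := mulr_ge0 M0 N0; lra.
  rewrite (le_trans (ler_normD _ _))// !normrM.
  have := ler_pM (normr_ge0 _) (normr_ge0 _) h2 h3.
  have := ler_pM (normr_ge0 _) (normr_ge0 _) h1 h4; lra.
Qed.

Lemma C1bD f f' g g' : C1b f f' -> C1b g g' ->
  C1b (fun x => f x + g x) (fun x => f' x + g' x).
Proof.
move=> [df cf' [M fM]] [dg cg' [N gN]]; split.
- by move=> x; have dfx := df x; have dgx := dg x; apply: is_derive_eq.
- by move=> x; apply: cvgD; [exact: cf'|exact: cg'].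
- exists (M + N) => x; have [h1 h2] := fM x; have [h3 h4] := gN x.
  by split; rewrite (le_trans (ler_normD _ _))// lerD.
Qed.

Lemma C1b_cst c : C1b (fun _ : R => c) (fun=> 0).
Proof.
split; first by move=> x; exact: is_derive_cst.
  by move=> x; exact: cvg_cst.
by exists `|c| => x; rewrite normr0.
Qed.

Lemma C1bZ c f f' : C1b f f' -> C1b (fun x => c * f x) (fun x => c * f' x).
Proof.
move=> Cf; have := C1bM (C1b_cst c) Cf.
by congr C1b; apply/funext => x /=; rewrite mul0r add0r.
Qed.

Lemma C1c_C1b f f' : C1c f f' -> C1b f f'.
Proof.
move=> Cf; have [[_ [M fM]] [_ [N fN]]] := C1c_bcs Cf.
case: Cf => df cf' _; split => //; exists (`|M| + `|N|) => x; split.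
  by rewrite (le_trans (fM x).1)// (le_trans (ler_norm M))// lerDl.
by rewrite (le_trans (fN x).1)// (le_trans (ler_norm N))// lerDr.
Qed.

Lemma C1b_expR c f f' : C1b f f' ->
  C1b (fun x => expR (c * f x)) (fun x => c * f' x * expR (c * f x)).
Proof.
move=> Cf; have [df cf' [M fM]] := Cf; have cf := C1b_continuous Cf.
have ce : continuous (fun x => expR (c * f x)).
  move=> x; apply: continuous_cvg; first exact: continuous_expR.
  by apply: cvgM; [exact: cvg_cst|exact: cf].
have eM x : expR (c * f x) <= expR (`|c| * M).
  rewrite ler_expR (le_trans (ler_norm _))// normrM ler_wpM2l//; exact: (fM x).1.
split.
- move=> x; have dfx := df x.
  have h : is_derive x 1 (fun x => c * f x) (c * f' x).
    by apply: is_derive_eq; rewrite /GRing.scale/=; ring.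
  have := @is_derive1_comp _ expR _ x _ _ (is_derive_expR _) h.
  by rewrite mulrC.
- by move=> x; apply: cvgM; [apply: cvgM; [exact: cvg_cst|exact: cf']|exact: ce].
- exists ((1 + `|c| * M) * expR (`|c| * M)) => x; have [h1 h2] := fM x.
  have M0 : 0 <= M by apply: le_trans h1.
  have cM0 : 0 <= `|c| * M by rewrite mulr_ge0.
  split.
    rewrite gtr0_norm ?expR_gt0// (le_trans (eM x))// ler_peMl ?expR_ge0//; lra.
  rewrite !normrM (gtr0_norm (expR_gt0 _)) ler_pM ?mulr_ge0 ?expR_ge0//.
  by rewrite (le_trans (ler_wpM2l (normr_ge0 c) h2))// lerDr.
Qed.

(** Bounded and 1/2-Hölder in time, uniformly in x. The exponent is that of s = sqrt(4 nu t) at t =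
    0. *)
Definition tlip T (F : R -> R -> R) := exists2 C : R, 0 <= C &
  forall s t x, 0 <= s <= T -> 0 <= t <= T ->
    `|F t x| <= C /\ `|F t x - F s x| <= C * Num.sqrt `|t - s|.

Lemma tlipD T F G : tlip T F -> tlip T G -> tlip T (fun t x => F t x + G t x).
Proof.
move=> [C C0 FC] [D D0 GD]; exists (C + D); first exact: addr_ge0.
move=> s t x sT tT; have [h1 h2] := FC s t x sT tT; have [h3 h4] := GD s t x sT tT.
split; first by rewrite (le_trans (ler_normD _ _))// lerD.
rewrite opprD addrACA mulrDl (le_trans (ler_normD _ _))// lerD//.
Qed.

Lemma tlipM T F G : tlip T F -> tlip T G -> tlip T (fun t x => F t x * G t x).
Proof.
move=> [C C0 FC] [D D0 GD]; exists (2 * (C * D)); first by rewrite !mulr_ge0.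
move=> s t x sT tT; have [h1 h2] := FC s t x sT tT; have [h3 h4] := GD s t x sT tT.
have [h5 _] := FC s s x sT sT.
split; first by rewrite normrM; have := ler_pM (normr_ge0 _) (normr_ge0 _) h1 h3; have := mulr_ge0 C0 D0; lra.
have -> : F t x * G t x - F s x * G s x =
  (F t x - F s x) * G t x + F s x * (G t x - G s x) by ring.
rewrite (le_trans (ler_normD _ _))// !normrM.
have := ler_pM (normr_ge0 _) (normr_ge0 _) h2 h3.
have := ler_pM (normr_ge0 _) (normr_ge0 _) h5 h4; lra.
Qed.

Lemma tlip_cst T c : tlip T (fun _ _ => c).
Proof.
by exists `|c| => // s t x _ _; rewrite subrr normr0 mulr_ge0.
Qed.

Lemma tlipZ T c F : tlip T F -> tlip T (fun t x => c * F t x).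
Proof. by move=> FT; apply: tlipM => //; exact: tlip_cst. Qed.

Lemma tlipV T c F : 0 < c -> (forall t x, c <= F t x) -> tlip T F ->
  tlip T (fun t x => (F t x)^-1).
Proof.
move=> c0 Fc [C C0 FC]; have ci : 0 < c^-1 by rewrite invr_gt0.
have F0 t x : 0 < F t x by apply: lt_le_trans (Fc t x).
have Fi t x : `|(F t x)^-1| <= c^-1.
  by rewrite gtr0_norm ?invr_gt0// lef_pV2 ?posrE.
exists (c^-1 + c^-1 * C * c^-1); first by rewrite addr_ge0 ?mulr_ge0 ?(ltW ci).
move=> s t x sT tT; have [h1 h2] := FC s t x sT tT; split.
  by rewrite (le_trans (Fi t x))// lerDl !mulr_ge0 ?(ltW ci).
have -> : (F t x)^-1 - (F s x)^-1 = (F t x)^-1 * (F s x - F t x) * (F s x)^-1.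
  by field; rewrite !gt_eqF.
rewrite !normrM distrC mulrDl.
apply: (@le_trans _ _ (c^-1 * (C * Num.sqrt `|t - s|) * c^-1)).
  by rewrite ler_pM ?mulr_ge0// ler_pM.
have -> : c^-1 * (C * Num.sqrt `|t - s|) * c^-1 = c^-1 * C * c^-1 * Num.sqrt `|t - s| by ring.
by rewrite lerDr mulr_ge0 ?sqrtr_ge0// ltW.
Qed.

Lemma sqrt_holder s t : 0 <= s -> 0 <= t ->
  `|Num.sqrt t - Num.sqrt s| <= Num.sqrt `|t - s|.
Proof.
move=> s0 t0; rewrite -[leLHS]ger0_norm// -[leLHS]sqrtr_sqr ler_wsqrtr//.
have h1 := sqrtr_ge0 t; have h2 := sqrtr_ge0 s.
have -> : t - s = (Num.sqrt t - Num.sqrt s) * (Num.sqrt t + Num.sqrt s).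
  by rewrite -[in LHS](sqr_sqrtr t0) -[in LHS](sqr_sqrtr s0); ring.
rewrite normrM expr2 ler_wpM2l// ger0_norm ?addr_ge0// ler_norml; apply/andP; split; lra.
Qed.

End C1b_algebra.

Lemma quot_derive {R : realType} (f g : R -> R) (f' g' z : R) :
  is_derive z 1 f f' -> is_derive z 1 g g' ->
  g z != 0 -> is_derive z 1 (fun z => f z / g z) (f' / g z - (f z / g z) * (g' / g z)).
Proof.
move=> df dg gz; have dV := is_deriveV gz dg.
by apply: is_derive_eq; rewrite /GRing.scale/=; field.
Qed.

(* The Cole-Hopf transform -2 nu P_x / P and its derivatives, in terms of
   p_k = (d/dx)^k P / P. *)
Section cole_hopf_algebra.
Context {R : realType}.
Variables (nu T : R) (p1 p2 p3 : R -> R -> R).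
Implicit Types t x : R.
Definition hopf t x := - (2 * nu) * p1 t x.
Definition hopf1 t x := - (2 * nu) * (p2 t x - p1 t x * p1 t x).
Definition hopf2 t x :=
  - (2 * nu) * (p3 t x + - 3 * (p1 t x * p2 t x) + 2 * (p1 t x * (p1 t x * p1 t x))).
(** Written as the right-hand side nu w_xx - w w_x; [hopf_derive_t] identifies it with the time
    derivative, so the equation holds by construction. *)
Definition hopft t x := nu * hopf2 t x + - 1 * (hopf t x * hopf1 t x).

Hypotheses (l1 : tlip T p1) (l2 : tlip T p2) (l3 : tlip T p3).

Lemma hopf_tlip : [/\ tlip T hopf, tlip T hopf1, tlip T hopf2 & tlip T hopft].
Proof.
have h0 := tlipZ (- (2 * nu)) l1.
have h1 : tlip T hopf1.
  have [C C0 h] := tlipZ (- (2 * nu)) (tlipD l2 (tlipZ (-1) (tlipM l1 l1))).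
  by exists C => // s t x sT tT; have := h s t x sT tT; rewrite /hopf1 !mulN1r.
have h2 : tlip T hopf2 by apply/tlipZ/tlipD; [apply: tlipD => //|]; do !apply: tlipM => //; exact: tlip_cst.
by split => //; apply: tlipD; apply: tlipZ => //; exact: tlipM.
Qed.

Lemma hopf_derive_x t x :
  is_derive x 1 (p1 t) (p2 t x - p1 t x * p1 t x) ->
  is_derive x 1 (p2 t) (p3 t x - p2 t x * p1 t x) ->
  is_derive x 1 (hopf t) (hopf1 t x) /\ is_derive x 1 (hopf1 t) (hopf2 t x).
Proof.
move=> d1 d2; split; rewrite /hopf /hopf1 /hopf2; apply: is_derive_eq; rewrite /GRing.scale/=; ring.
Qed.

Lemma hopf_derive_t t x :
  is_derive t 1 (p1 ^~ x) (nu * p3 t x - p1 t x * (nu * p2 t x)) ->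
  is_derive t 1 (hopf ^~ x) (hopft t x).
Proof.
move=> d1; rewrite /hopf /hopft /hopf2 /hopf1 /hopf.
by apply: is_derive_eq; rewrite /GRing.scale/=; ring.
Qed.

End cole_hopf_algebra.

(** * The Cole-Hopf solution for a C^3 datum with compact support *)

Section cole_hopf.
Context {R : realType}.
Local Notation mu := (@lebesgue_measure R).
Variables (nu : R) (v0 v1 v2 v3 : R -> R).
Hypotheses (nu0 : 0 < nu) (Cv0 : C1c v0 v1) (Cv1 : C1c v1 v2) (Cv2 : C1c v2 v3).
Implicit Types (x s t C T M : R).

Definition cha : R := - (2 * nu)^-1.
Local Notation a := cha.
(** The Cole-Hopf datum exp(-V/(2 nu)), with V the primitive of v0; [chq1] to [chq4] are its
    successive derivatives. *)
Definition chq0 x := expR (a * prim v0 x).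
Local Notation q0 := chq0.
Definition chq1 x := a * v0 x * q0 x.
Local Notation q1 := chq1.
Definition chq2 x := (a * v1 x + a ^+ 2 * v0 x ^+ 2) * q0 x.
Local Notation q2 := chq2.
Definition chq3 x := (a * v2 x + 3 * a ^+ 2 * (v0 x * v1 x) + a ^+ 3 * v0 x ^+ 3) * q0 x.
Local Notation q3 := chq3.
Definition chq4 x := (a * v3 x + a ^+ 2 * (4 * v0 x * v2 x + 3 * v1 x ^+ 2)
  + 6 * a ^+ 3 * v0 x ^+ 2 * v1 x + a ^+ 4 * v0 x ^+ 4) * q0 x.
Local Notation q4 := chq4.

Lemma bcs_prim_bounded v : bcs v -> exists2 B : R, 0 <= B & forall x, `|prim v x| <= B.
Proof.
move=> bv; have vi := bcs_integrable bv.
exists (\int[mu]_x `|v x|); last by move=> x; exact: prim_le.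
by apply: Rintegral_ge0.
Qed.

Lemma chC1b_V : C1b (prim v0) v0.
Proof.
have [bv0 _] := C1c_bcs Cv0; have cv0 := C1b_continuous (C1c_C1b Cv0).
have [B B0 VB] := bcs_prim_bounded bv0; case: (bv0) => _ [M vM]; split => //.
- by move=> x; apply: prim_derive; [exact: bcs_integrable|exact: cv0].
- exists (`|B| + `|M|) => x; split.
    by rewrite (le_trans (VB x))// (le_trans (ler_norm B))// lerDl.
  by rewrite (le_trans (vM x).1)// (le_trans (ler_norm M))// lerDr.
Qed.

Lemma chC01 : C1b q0 q1.
Proof. exact: C1b_expR chC1b_V. Qed.

Lemma chC12 : C1b q1 q2.
Proof.
have := C1bM (C1bZ a (C1c_C1b Cv0)) chC01.
by congr C1b; apply/funext => x; rewrite /chq2 /chq1; ring.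
Qed.

Lemma chC23 : C1b q2 q3.
Proof.
have C0 := C1c_C1b Cv0; have C1 := C1c_C1b Cv1.
have := C1bM (C1bD (C1bZ a C1) (C1bZ (a ^+ 2) (C1bM C0 C0))) chC01.
by congr C1b; apply/funext => x; rewrite /chq3 /chq2 /chq1; ring.
Qed.

Lemma chC34 : C1b q3 q4.
Proof.
have C0 := C1c_C1b Cv0; have C1 := C1c_C1b Cv1; have C2 := C1c_C1b Cv2.
have := C1bM (C1bD (C1bZ a C2) (C1bD (C1bZ (3 * a ^+ 2) (C1bM C0 C1))
  (C1bZ (a ^+ 3) (C1bM C0 (C1bM C0 C0))))) chC01.
by congr C1b; apply/funext => x; rewrite /chq4 /chq3 /chq1; ring.
Qed.

Definition chs t : R := Num.sqrt (4 * nu * t).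
Local Notation sv := chs.
Definition chP t x := gavg q0 (sv t) x.
Local Notation P0 := chP.
Definition chp q t x := gavg q (sv t) x / P0 t x.

Definition chw := hopf nu (chp q1).
Definition chw1 := hopf1 nu (chp q1) (chp q2).
Definition chw2 := hopf2 nu (chp q1) (chp q2) (chp q3).
Definition chwt := hopft nu (chp q1) (chp q2) (chp q3).

Lemma chq0_bounds B : (forall x, `|prim v0 x| <= B) -> forall x,
  expR (a * B) <= q0 x /\ q0 x <= expR (- a * B).
Proof.
move=> VB x; have a0 : a <= 0 by rewrite oppr_le0 invr_ge0 mulr_ge0// ltW.
have := VB x; rewrite ler_norml => /andP[h1 h2].
rewrite /chq0 !ler_expR; split; first by rewrite ler_wnM2l.
have -> : - a * B = a * (- B) by ring.
by rewrite ler_wnM2l.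
Qed.

Lemma chP0_ge B t x : (forall x, `|prim v0 x| <= B) -> expR (a * B) * mass <= P0 t x.
Proof.
move=> VB; have [_ _ [M qM]] := chC01.
apply: (@gavg_ge _ _ M) => //; first exact: C1b_continuous chC01.
- by move=> y; exact: (qM y).1.
- by move=> y; exact: (chq0_bounds VB y).1.
Qed.

Lemma chP0_gt0 t x : 0 < P0 t x.
Proof.
have [B _ VB] := bcs_prim_bounded (C1c_bcs Cv0).1.
by apply: lt_le_trans (chP0_ge t x VB); rewrite mulr_gt0 ?expR_gt0 ?mass_gt0.
Qed.

Lemma chP_tlip T q q' : C1b q q' -> tlip T (fun t x => gavg q (sv t) x).
Proof.
move=> Cq; have [dq cq' [M qM]] := Cq; have cq := C1b_continuous Cq.
have M0 : 0 <= M by apply: le_trans (qM 0).1.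
have m20 : 0 <= mass2 :> R by rewrite (le_trans _ mass_le2)// ltW// mass_gt0.
exists (M * mass + M * mass2 * Num.sqrt (4 * nu)).
  by rewrite addr_ge0 ?mulr_ge0 ?sqrtr_ge0// ltW// mass_gt0.
move=> s t x /andP[s0 _] /andP[t0 _]; split.
  rewrite (le_trans (gavg_le _ _ cq (fun y => (qM y).1)))// lerDl.
  by rewrite !mulr_ge0 ?sqrtr_ge0.
rewrite (le_trans (gavg_lipschitz _ _ _ _ Cq (fun y => (qM y).2)))// subrr normr0 add0r.
have n4 : 0 <= 4 * nu by rewrite mulr_ge0// ltW.
rewrite /chs !(sqrtrM _ n4) -mulrBr normrM (ger0_norm (sqrtr_ge0 _)) mulrDl mulrA.
rewrite (le_trans (ler_wpM2l _ (sqrt_holder s0 t0))) ?mulr_ge0 ?sqrtr_ge0//.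
set k := Num.sqrt (4 * nu); rewrite ler_wpM2r ?sqrtr_ge0//.
by rewrite lerDr mulr_ge0// ltW// mass_gt0.
Qed.

Lemma chp_tlip T q q' : C1b q q' -> tlip T (chp q).
Proof.
move=> Cq; have [B _ VB] := bcs_prim_bounded (C1c_bcs Cv0).1.
apply: tlipM; first exact: chP_tlip Cq.
apply: (@tlipV _ _ (expR (a * B) * mass)); first by rewrite mulr_gt0 ?expR_gt0 ?mass_gt0.
  by move=> t x; exact: chP0_ge.
exact: chP_tlip chC01.
Qed.

Lemma chw_tlip T : [/\ tlip T chw, tlip T chw1, tlip T chw2 & tlip T chwt].
Proof.
exact: hopf_tlip (chp_tlip T chC12) (chp_tlip T chC23) (chp_tlip T chC34).
Qed.

Lemma chp_derive_x q q' t x : C1b q q' ->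
  is_derive x 1 (chp q t) (chp q' t x - chp q t x * chp q1 t x).
Proof.
move=> Cq; apply: quot_derive; [exact: gavg_derive_x Cq|exact: gavg_derive_x chC01|].
by rewrite gt_eqF// chP0_gt0.
Qed.

Lemma chw_derive_x t x :
  is_derive x 1 (chw t) (chw1 t x) /\ is_derive x 1 (chw1 t) (chw2 t x).
Proof. exact: hopf_derive_x (chp_derive_x t x chC12) (chp_derive_x t x chC23). Qed.

Lemma chs_derive t : 0 < t -> is_derive t 1 sv (2 * nu / sv t).
Proof.
move=> t0; have p : 0 < 4 * nu * t by rewrite !mulr_gt0.
have d1 : is_derive t 1 (fun t => 4 * nu * t) (4 * nu).
  by apply: is_derive_eq; rewrite /GRing.scale/=; ring.
have := @is_derive1_comp _ Num.sqrt (fun t => 4 * nu * t) t _ _ (is_derive1_sqrt p) d1.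
by rewrite /chs => h; apply: is_derive_eq; field; rewrite gt_eqF// sqrtr_gt0.
Qed.

Lemma chP_derive_t q q' q'' t x : 0 < t -> C1b q q' -> C1b q' q'' ->
  is_derive t 1 (fun t => gavg q (sv t) x) (nu * gavg q'' (sv t) x).
Proof.
move=> t0 Cq Cq'.
have := @is_derive1_comp _ (fun s => gavg q s x) sv t _ _
  (gavg_derive_s (sv t) x Cq Cq') (chs_derive t0).
have s0 : sv t != 0 by rewrite gt_eqF// sqrtr_gt0 !mulr_gt0.
by move=> h; apply: is_derive_eq; field.
Qed.

Lemma chw_derive_t t x : 0 < t -> is_derive t 1 (chw ^~ x) (chwt t x).
Proof.
move=> t0; apply: hopf_derive_t.
have d1 := quot_derive (chP_derive_t x t0 chC12 chC23) (chP_derive_t x t0 chC01 chC12)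
  (lt0r_neq0 (chP0_gt0 t x)).
by apply: is_derive_eq; rewrite /chp !mulrA.
Qed.

Lemma chw_0 x : chw 0 x = v0 x.
Proof.
have g q : gavg q (sv 0) x = q x * mass.
  rewrite /gavg /chs mulr0 sqrtr0; under eq_Rintegral do rewrite mul0r addr0.
  by rewrite RintegralZl//; exact: gau_integrable.
rewrite /chw /hopf /chp /P0 !g /chq1.
have h1 := mass_gt0 (R := R); have h2 : 0 < q0 x by exact: expR_gt0.
by rewrite /cha; field; rewrite !gt_eqF.
Qed.

Lemma cha_norm : `|a| = (2 * nu)^-1.
Proof. by rewrite /cha normrN normfV gtr0_norm// mulr_gt0. Qed.

(** Since q1 = a v0 q0, the solution is a weighted mean of values of v0 with weights q0 gau: a
    maximum principle. *)
Lemma chw_le M t x : (forall x, `|v0 x| <= M) -> `|chw t x| <= M.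
Proof.
move=> vM; have := chP0_gt0 t x => P00.
have M0 : 0 <= M by apply: le_trans (vM 0).
have n2 : 0 < 2 * nu by rewrite mulr_gt0.
rewrite /chw /hopf normrM normrN (gtr0_norm n2) /chp normrM normfV (gtr0_norm P00).
rewrite mulrA ler_pdivrMr// -ler_pdivlMl//.
have [_ _ [N qN]] := chC12; have [_ _ [N0 qN0]] := chC01.
have i1 := @gavg_integrable _ _ _ (sv t) x (C1b_continuous chC12) (fun y => (qN y).1).
have i0 := @gavg_integrable _ _ _ (sv t) x (C1b_continuous chC01) (fun y => (qN0 y).1).
rewrite {1}/gavg (le_trans (le_normr_Rintegral _ i1))// mulrA /chP /gavg -RintegralZl//.
apply: le_Rintegral => //; [exact: intR_abs|exact: intRZ|].
move=> z _; rewrite normrM (gtr0_norm (gau_gt0 z)) mulrA ler_wpM2r ?(ltW (gau_gt0 z))//.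
rewrite /chq1 !normrM (gtr0_norm (expR_gt0 _)) ler_wpM2r ?expR_ge0//.
by rewrite cha_norm ler_wpM2l// invr_ge0 ltW.
Qed.

(* The bound on w1 does not involve derivatives of v0. *)
Lemma chw1_le M B t x : (forall x, `|v0 x| <= M) -> (forall x, `|prim v0 x| <= B) -> 0 < t ->
  `|chw1 t x| <= M ^+ 2 / (2 * nu) +
    2 * M * expR (B / nu) * mass2 / mass / Num.sqrt (4 * nu) / Num.sqrt t.
Proof.
move=> vM VB t0; have P00 := chP0_gt0 t x; have m0 := mass_gt0 (R := R).
have M0 : 0 <= M by apply: le_trans (vM 0).
have n2 : 0 < 2 * nu by rewrite mulr_gt0.
(* The square is controlled by the maximum principle; what is left is P_xx / P, where smoothing
   applied to [q1] avoids the derivative of v0. *)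
have -> : chw1 t x = (chw t x) ^+ 2 / (2 * nu) - 2 * nu * chp q2 t x.
  by rewrite /chw1 /chw /hopf1 /hopf; field; rewrite gt_eqF.
rewrite (le_trans (ler_normB _ _))// lerD//.
  rewrite normrM normfV (gtr0_norm n2) ler_wpM2r ?invr_ge0 ?(ltW n2)//.
  by rewrite normrX lerXn2r ?nnegrE// chw_le.
have s0 : 0 < sv t by rewrite sqrtr_gt0 !mulr_gt0.
have q1M y : `|q1 y| <= M / (2 * nu) * expR (- a * B).
  rewrite /chq1 !normrM (gtr0_norm (expR_gt0 _)) ler_pM ?mulr_ge0 ?expR_ge0//.
    by rewrite mulrC cha_norm ler_wpM2r// invr_ge0 ltW.
  exact: (chq0_bounds VB y).2.
have h1 := gavg_smoothing x chC12 q1M s0; have h2 := chP0_ge t x VB.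
have e0 := expR_gt0 (a * B).
have e1 : expR (a * B) * expR (- a * B) = 1 by rewrite -expRD (_ : _ + _ = 0) ?expR0//; ring.
(* exp(B/nu) is the ratio of the upper bound of [q0], used in the numerator, to the lower bound,
   used in the denominator. *)
have e2 : expR (B / nu) = expR (- a * B) * expR (- a * B).
  by rewrite -expRD; congr expR; rewrite /cha; field; rewrite gt_eqF.
have s1 : sv t = Num.sqrt (4 * nu) * Num.sqrt t by rewrite /chs sqrtrM// mulr_ge0// ltW.
rewrite normrM (gtr0_norm n2) normrM normfV (gtr0_norm P00) mulrA ler_pdivrMr//.
apply: (@le_trans _ _ (2 * nu * (2 * (M / (2 * nu) * expR (- a * B)) * mass2 / sv t))).
  by rewrite ler_wpM2l// ltW.
rewrite e2 -[_ / Num.sqrt t]mulrA -invfM -s1.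
have -> : 2 * nu * (2 * (M / (2 * nu) * expR (- a * B)) * mass2 / sv t) =
  2 * M * (expR (- a * B) * expR (- a * B)) * mass2 / mass / sv t * (expR (a * B) * mass).
  rewrite -[LHS]mulr1 -e1; field; rewrite !gt_eqF ?expR_gt0//.
rewrite ler_wpM2l// !mulr_ge0 ?invr_ge0 ?expR_ge0 ?(ltW s0) ?(ltW m0)//.
by rewrite (le_trans (ltW m0) mass_le2).
Qed.

(** [q1] and [q2] inherit the compact support of v0, and Gaussian averages of such functions decay
    quadratically, while the denominator stays away from 0. This pays for the cutoff in space. *)
Lemma chw_decay T : exists2 C, 0 <= C & forall t x, 0 <= t <= T ->
  (1 + x ^+ 2) * `|chw t x| <= C /\ (1 + x ^+ 2) * `|chw1 t x| <= C.
Proof.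
have dec q q' N : C1b q q' -> (forall y, N < `|y| -> q y = 0) ->
    exists2 C, 0 <= C & forall t x, 0 <= t <= T -> (1 + x ^+ 2) * `|chp q t x| <= C.
  move=> Cq q0; have [_ _ [M qM]] := Cq.
  have M0 : 0 <= M by apply: le_trans (qM 0).1.
  have qC y : (1 + y ^+ 2) * `|q y| <= (1 + N ^+ 2) * M.
    have [yN|/q0->] := leP `|y| N; last by rewrite normr0 mulr0 mulr_ge0// addr_ge0// sqr_ge0.
    rewrite ler_pM ?addr_ge0 ?sqr_ge0// ?(qM y).1// lerD2l -[y ^+ 2]real_normK ?num_real//.
    by rewrite lerXn2r ?nnegrE// (le_trans (normr_ge0 y)).
  have [B _ VB] := bcs_prim_bounded (C1c_bcs Cv0).1.
  pose c := expR (a * B) * mass; have c0 : 0 < c by rewrite mulr_gt0 ?expR_gt0 ?mass_gt0.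
  have m2 : 0 <= mass2 :> R by rewrite (le_trans _ mass_le2)// ltW// mass_gt0.
  have C0 : 0 <= 2 * ((1 + N ^+ 2) * M) * (1 + `|4 * nu * T|) * mass2 / c.
    by rewrite !mulr_ge0 ?invr_ge0 ?(ltW c0)// addr_ge0// sqr_ge0.
  exists (2 * ((1 + N ^+ 2) * M) * (1 + `|4 * nu * T|) * mass2 / c) => //.
  move=> t x /andP[t0 tT]; have P00 := chP0_gt0 t x.
  rewrite /chp normrM normfV (gtr0_norm P00) [leLHS]mulrA.
  rewrite ler_pM ?mulr_ge0 ?addr_ge0 ?sqr_ge0 ?invr_ge0 ?(ltW P00)//; last first.
    by rewrite lef_pV2 ?posrE//; exact: chP0_ge.
  rewrite (le_trans (gavg_decay _ _ (C1b_continuous Cq) qC))// ler_wpM2r// ler_wpM2l//.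
    by rewrite !mulr_ge0// addr_ge0// sqr_ge0.
  rewrite lerD2l /chs sqr_sqrtr ?mulr_ge0 ?(ltW nu0)//.
  by rewrite (le_trans _ (ler_norm _))// ler_wpM2l// mulr_ge0// ltW.
have [_ _ [N0 N00 v00]] := Cv0; have [_ _ [N1 N10 v10]] := Cv1.
have [C1 C10 h1] : exists2 C, 0 <= C & forall t x, 0 <= t <= T -> (1 + x ^+ 2) * `|chp q1 t x| <= C.
  apply: (dec _ _ N0 chC12) => y /v00[vy _]; by rewrite /chq1 vy mulr0 mul0r.
have [C2 C20 h2] : exists2 C, 0 <= C & forall t x, 0 <= t <= T -> (1 + x ^+ 2) * `|chp q2 t x| <= C.
  apply: (dec _ _ N0 chC23) => y /v00[vy vy1]; by rewrite /chq2 vy vy1 expr0n/= !mulr0 addr0 mul0r.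
have n2 : 0 < 2 * nu by rewrite mulr_gt0.
exists (2 * nu * (C1 + C2 + C1 * C1)); first by rewrite mulr_ge0 ?addr_ge0 ?(ltW n2)// mulr_ge0.
move=> t x tT; have e1 := h1 t x tT; have e2 := h2 t x tT.
have x1 : 1 <= 1 + x ^+ 2 by rewrite lerDl sqr_ge0.
have x0 : 0 <= 1 + x ^+ 2 by rewrite (le_trans ler01).
rewrite /chw /chw1 /hopf /hopf1 normrM [X in _ /\ _ * X <= _]normrM normrN (gtr0_norm n2).
rewrite !(mulrCA _ (2 * nu)) !ler_pM2l//.
have e3 : `|chp q1 t x| <= C1 by rewrite (le_trans _ e1)// ler_peMl.
have C11 := mulr_ge0 C10 C10.
split; first lra.
rewrite (le_trans (ler_wpM2l x0 (ler_normB _ _)))//.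
rewrite mulrDr [X in _ + _ * X]normrM [X in _ + X]mulrA.
have := ler_pM (mulr_ge0 x0 (normr_ge0 _)) (normr_ge0 _) e1 e3; lra.
Qed.

End cole_hopf.

(** * Mollification, and stability of the Cole-Hopf formula in the datum *)

Section mollification.
Context {R : realType}.
Local Notation mu := (@lebesgue_measure R).
Implicit Types (u f v : R -> R) (x y e M N w : R).

Lemma compact_support_uniform u N w : continuous u -> (forall x, N < `|x| -> u x = 0) ->
  0 < w -> exists2 e, 0 < e & forall x y, `|x - y| <= e -> `|u x - u y| <= w.
Proof.
move=> cu u0 w0.
have cK := @segment_compact R (- (N + 1)) (N + 1).
have := (compact_near_coveringP _).1 cK R 0^'+ (fun e x => forall y, `|x - y| <= e -> `|u x - u y| <= w) _.
case.
- move=> x _; have w2 : 0 < w / 2 by rewrite divr_gt0.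
  have := cu x => /cvgrPdist_le/(_ _ w2)/nbhs_ballP[d d0 ud].
  have d2 : 0 < d / 2 by rewrite divr_gt0.
  exists (ball x (d / 2), [set e | e < d / 2]).
    by split; [exact: nbhsx_ballx|exact: nbhs_right_lt].
  move=> [x' e] /= [xx' ed] y x'y; move: xx'; rewrite /ball/= => xx'.
  have h1 := ud x'; have h2 := ud y; rewrite /ball/= in h1 h2.
  have k1 : `|u x - u x'| <= w / 2 by apply: h1; lra.
  have k2 : `|u x - u y| <= w / 2.
    apply: h2; have := ler_distD x' x y; lra.
  have := ler_distD (u x) (u x') (u y); rewrite (distrC (u x') (u x)); lra.
- move=> e1 /= e10 H; pose e := Num.min (e1 / 2) 1.
  have e0 : 0 < e by rewrite lt_min ltr01 divr_gt0.
  have ee1 : e < e1 by rewrite gt_min; apply/orP; left; lra.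
  have eu : e <= 1 by rewrite ge_min lexx orbT.
  have H' x y : `|x| <= N + 1 -> `|x - y| <= e -> `|u x - u y| <= w.
    move=> xN xy; apply: (H e) => //; first by rewrite /= sub0r normrN gtr0_norm.
    by rewrite /= in_itv/= -ler_norml.
  exists e => // x y xy.
  have [xN|xN] := leP `|x| (N + 1); first exact: H'.
  have [yN|yN] := leP `|y| (N + 1); first by rewrite distrC H'// distrC.
  by rewrite !u0 ?subrr ?normr0 ?ltW//; lra.
Qed.

Lemma prim_le_support v M N x : bcs v -> 0 <= N -> (forall y, `|v y| <= M) ->
  (forall y, N < `|y| -> v y = 0) -> `|prim v x| <= M * (2 * N).
Proof.
move=> bv N0 vM v0; have vi := bcs_integrable bv.
have M0 : 0 <= M by apply: le_trans (vM 0).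
rewrite (le_trans (prim_le x vi))//.
have key y : `|v y| <= M * (y \in `[- N, N])%:R.
  rewrite in_itv/= -ler_norml; have [yN|yN] := leP `|y| N; first by rewrite mulr1.
  by rewrite v0// normr0 mulr0.
have ii : mu.-integrable setT (EFin \o (fun y => M * (y \in `[- N, N])%:R)).
  apply: bcs_integrable; apply: bcsZ; split; first exact: measurable_mem_itv.
  exists (N + 1) => y; split; first by case: (_ \in _); rewrite ?normr1 ?normr0; lra.
  by rewrite in_itv/= -ler_norml => h; rewrite leNgt (_ : (N < `|y|) = true)//; lra.
apply: (@le_trans _ _ (\int[mu]_y (M * (y \in `[- N, N])%:R))).
  apply: le_Rintegral => //; first exact: intR_abs.
rewrite -(@Rintegral_itv _ `[- N, N] (fun=> M)).
rewrite Rintegral_cst//= lebesgue_measure_itv/= lte_fin.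
by case: ifP => _ /=; rewrite ?mulr0 ?mulr_ge0// ler_wpM2l//; lra.
Qed.

(** Steklov average over [x, x + e]; its derivative is the forward difference quotient [D]. *)
Let S e f x := (prim f (x + e) - prim f x) / e.
Let D e f x := (f (x + e) - f x) / e.

Let is_derive_D e f f' : (forall x, is_derive x 1 f (f' x)) ->
  forall x, is_derive x 1 (D e f) (D e f' x).
Proof.
move=> df x; have d1 := df x.
have d2 : is_derive x 1 (fun x => f (x + e)) (f' (x + e)).
  have := @is_derive1_comp _ f (fun x => x + e) x _ 1 (df (x + e)).
  rewrite mulr1; apply; apply: is_derive_eq; rewrite addr0//.
by rewrite /D; apply: is_derive_eq; rewrite /GRing.scale/=; ring.
Qed.

Let D_continuous e f : continuous f -> continuous (D e f).
Proof.
move=> cf x; apply: cvgM; last exact: cvg_cst.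
apply: cvgB; last exact: cf.
apply: (@continuous_comp _ _ _ (fun x => x + e) f); last exact: cf.
by apply: cvgD; [exact: cvg_id|exact: cvg_cst].
Qed.

Let D_support e f N : 0 < e <= 1 -> (forall x, N < `|x| -> f x = 0) ->
  forall x, N + 1 < `|x| -> D e f x = 0.
Proof.
move=> /andP[e0 e1] f0 x xN; rewrite /D !f0 ?subrr ?mul0r//; first lra.
have := ler_normD (x + e) (- e); rewrite addrK normrN (gtr0_norm e0); lra.
Qed.

(** Three Steklov averages of a continuous function are C^3. By the mean value theorem each average
    is a value of its argument within e to the right: the bound M is kept, the support grows by at
    most 1 each time, and uniform continuity at distance 3 e gives closeness. *)
Lemma mollify u N M w : continuous u -> 0 <= N -> (forall x, N < `|x| -> u x = 0) ->
  (forall x, `|u x| <= M) -> 0 < w -> exists v0 v1 v2 v3,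
  [/\ C1c v0 v1, C1c v1 v2 & C1c v2 v3] /\
  [/\ (forall x, N + 3 < `|x| -> v0 x = 0),
      (forall x, `|v0 x| <= M) & forall x, `|v0 x - u x| <= w].
Proof.
move=> cu N0 u0 uM w0; have [e1 e10 He] := compact_support_uniform cu u0 w0.
pose e := Num.min (e1 / 3) 1.
have e0 : 0 < e by rewrite lt_min ltr01 divr_gt0.
have e3 : 3 * e <= e1 by have : e <= e1 / 3 by [rewrite ge_min lexx]; lra.
have eu : 0 < e <= 1 by rewrite e0 ge_min lexx orbT.
have SP f P : continuous f -> 0 <= P -> (forall x, P < `|x| -> f x = 0) ->
  [/\ (forall x, is_derive x 1 (S e f) (D e f x)),
      (forall x, P + 1 < `|x| -> S e f x = 0), continuous (S e f) &
      forall x, exists2 y, x <= y <= x + e & S e f x = f y].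
  move=> cf P0 f0; have bf : bcs f by apply: (@bcs_continuous _ _ P).
  have dS : forall x, is_derive x 1 (S e f) (D e f x).
    by apply: is_derive_D => x; apply: prim_derive; [exact: bcs_integrable|exact: cf].
  have mS x : exists2 y, x <= y <= x + e & S e f x = f y.
    have xe : x < x + e by rewrite ltrDl.
    have pc := prim_continuous (bcs_integrable bf).
    have [y yx E] := @MVT R (prim f) f x (x + e) xe
      (fun z _ => prim_derive (bcs_integrable bf) (cf z)) (continuous_subspaceT pc).
    exists y; first by move: yx; rewrite in_itv/= => /andP[/ltW-> /ltW->].
    by rewrite /S E addrAC subrr add0r mulfK ?gt_eqF.
  split => //.
    move=> x xP; have [y /andP[xy ye] ->] := mS x; apply: f0.
    have : `|x - y| <= 1 by rewrite ler_norml; case/andP: eu => _ ?; apply/andP; split; lra.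
    have := ler_normD (x - y) y; rewrite subrK; lra.
  move=> x; apply/differentiable_continuous/derivable1_diffP; by have [] := dS x.
have [d1 s1 c1 m1] := SP _ _ cu N0 u0.
have N1 : 0 <= N + 1 by lra.
have [d2 s2 c2 m2] := SP _ _ c1 N1 s1.
have N2 : 0 <= N + 1 + 1 by lra.
have [d3 s3 c3 m3] := SP _ _ c2 N2 s2.
have C f f' P : 0 <= P -> (forall x, is_derive x 1 f (f' x)) -> continuous f' ->
    (forall x, P < `|x| -> f x = 0) -> (forall x, P < `|x| -> f' x = 0) -> C1c f f'.
  move=> P0 df cf' f0 f'0; split => //; exists (P + 1); first lra.
  by move=> x xP; rewrite f0 ?f'0//; lra.
have N3 : 0 <= N + 1 + 1 + 1 by lra.
have t1 := D_support eu s2; have t0 := D_support eu u0; have t0' := D_support eu s1.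
have t2 := D_support eu t0'; have t00 := D_support eu t0; have t000 := D_support eu t00.
exists (S e (S e (S e u))), (D e (S e (S e u))), (D e (D e (S e u))), (D e (D e (D e u))).
split; split.
- by apply: (C _ _ _ N3) => //; exact: D_continuous.
- apply: (C _ _ _ N3); [exact: is_derive_D|exact/D_continuous/D_continuous|exact: t1|exact: t2].
- apply: (C _ _ _ N3); [exact/is_derive_D/is_derive_D| |exact: t2|exact: t000].
  exact/D_continuous/D_continuous/D_continuous.
- by move=> x xN; apply: s3; lra.
- by move=> x; have [y _ ->] := m3 x; have [z _ ->] := m2 y; have [t _ ->] := m1 z.
- move=> x; have [y /andP[? ?] ->] := m3 x; have [z /andP[? ?] ->] := m2 y.
  have [t /andP[? ?] ->] := m1 z.
  by apply: He; rewrite ger0_norm; lra.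
Qed.

(* [chw] with the derivative carried out under the Gaussian average: this form
   makes sense for a datum that is only continuous. *)
Definition colehopf nu v t x : R :=
  gavg (fun y => v y * chq0 nu v y) (chs nu t) x / gavg (chq0 nu v) (chs nu t) x.

Section cole_hopf_bounds.
Variables (nu N M : R).
Hypotheses (nu0 : 0 < nu) (N0 : 0 <= N).
Definition datum v := [/\ continuous v, (forall x, N < `|x| -> v x = 0) &
  forall x, `|v x| <= M].

Lemma datum_bcs v : datum v -> bcs v.
Proof. by move=> [cv v0 _]; exact: (@bcs_continuous _ _ N). Qed.

Let A := (2 * nu)^-1.
Let B := M * (2 * N).

Lemma datum_chq0 v : datum v -> [/\ continuous (chq0 nu v),
  (forall x, expR (- (A * B)) <= chq0 nu v x <= expR (A * B)),
  (forall x, `|chq0 nu v x| <= expR (A * B)),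
  continuous (fun x => v x * chq0 nu v x) &
  forall x, `|v x * chq0 nu v x| <= M * expR (A * B)].
Proof.
move=> dv; have bv := datum_bcs dv; have [cv v0 vM] := dv.
have VB x : `|prim v x| <= B by apply: prim_le_support.
have cq : continuous (chq0 nu v).
  move=> x; apply: continuous_cvg; first exact: continuous_expR.
  by apply: cvgM; [exact: cvg_cst|exact: (prim_continuous (bcs_integrable bv))].
have qb x : expR (- (A * B)) <= chq0 nu v x <= expR (A * B).
  have A0 : 0 <= A by rewrite invr_ge0 mulr_ge0// ltW.
  have := VB x; rewrite ler_norml => /andP[h1 h2].
  rewrite /chq0 /cha !ler_expR -/A mulNr; apply/andP; split.
    by rewrite lerN2 ler_wpM2l.
  by rewrite -mulrN ler_wpM2l//; lra.
have qM x : `|chq0 nu v x| <= expR (A * B).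
  by rewrite gtr0_norm ?expR_gt0//; case/andP: (qb x).
split => //; first by move=> x; apply: cvgM; [exact: cv|exact: cq].
by move=> x; rewrite normrM ler_pM.
Qed.

Lemma colehopf_den v t x : datum v ->
  0 < gavg (chq0 nu v) (chs nu t) x /\
  expR (- (A * B)) * mass <= gavg (chq0 nu v) (chs nu t) x.
Proof.
move=> dv; have [cq qb qM _ _] := datum_chq0 dv.
have h : expR (- (A * B)) * mass <= gavg (chq0 nu v) (chs nu t) x.
  by apply: (gavg_ge _ _ cq qM) => y; case/andP: (qb y).
by split => //; apply: lt_le_trans h; rewrite mulr_gt0 ?expR_gt0 ?mass_gt0.
Qed.

Lemma colehopf_le v t x : datum v -> `|colehopf nu v t x| <= M.
Proof.
move=> dv; have [cq qb qM cvq vqM] := datum_chq0 dv.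
have [d0 _] := colehopf_den t x dv; have [_ _ vM] := dv.
rewrite /colehopf normrM normfV (gtr0_norm d0) ler_pdivrMr//.
have i1 := gavg_integrable (chs nu t) x cvq vqM.
have i0 := gavg_integrable (chs nu t) x cq qM.
rewrite {1}/gavg (le_trans (le_normr_Rintegral _ i1))// /gavg -RintegralZl//.
apply: le_Rintegral => //; [exact: intR_abs|exact: intRZ|].
move=> z _; rewrite normrM (gtr0_norm (gau_gt0 z)) mulrA ler_wpM2r ?(ltW (gau_gt0 z))//.
by rewrite normrM ler_pM// gtr0_norm ?expR_gt0.
Qed.

Lemma chw_colehopf v t x : datum v -> chw nu v t x = colehopf nu v t x.
Proof.
move=> dv; have [cq qb qM cvq vqM] := datum_chq0 dv.
rewrite /chw /hopf /chp /colehopf mulrA; congr (_ / _).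
have i1 := gavg_integrable (chs nu t) x cvq vqM.
rewrite /gavg -RintegralZl//; last first.
  have := intRZ measurableT (cha nu) i1; congr (_.-integrable _ _).
  by apply/funext => z; rewrite /chq1 /= !mulrA.
apply: eq_Rintegral => z _; rewrite /chq1 /cha !mulrA mulrNN mulfV ?mul1r//.
by rewrite gt_eqF// mulr_gt0.
Qed.

Lemma expR_lipschitz (K x y : R) : x <= K -> y <= K ->
  `|expR x - expR y| <= expR K * `|x - y|.
Proof.
move=> xK yK; wlog xy : x y xK yK / y < x => [H|].
  case: (ltgtP x y) => [xy|yx|->]; [|exact: H|by rewrite !subrr !normr0 mulr0].
  by rewrite distrC (distrC x); exact: H.
have [c cxy ->] := @MVT R expR expR y x xy (fun z _ => is_derive_expR z)
  (continuous_subspaceT (@continuous_expR R)).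
rewrite normrM ler_wpM2r// gtr0_norm ?expR_gt0// ler_expR.
by move: cxy; rewrite in_itv/= => /andP[_ /ltW cx]; exact: le_trans xK.
Qed.

(** The constant depends on nu, N and M only, not on the smoothness of the data, so it is known
    before the datum is mollified. *)
Lemma colehopf_stable : exists2 K, 0 <= K & forall v v' w, datum v -> datum v' ->
  (forall x, `|v x - v' x| <= w) ->
  forall t x, `|colehopf nu v t x - colehopf nu v' t x| <= K * w.
Proof.
(* A negative M admits no datum, and any constant will do. *)
have [M0|M0] := ltP M 0; first by exists 0 => // v v' w [_ _ /(_ 0)]; have := normr_ge0 (v 0); lra.
pose E := expR (A * B); pose c := expR (- (A * B)) * @mass R.
have E0 : 0 < E := expR_gt0 _; have m0 := mass_gt0 (R := R).
have c0 : 0 < c by rewrite mulr_gt0 ?expR_gt0.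
have A0 : 0 <= A by rewrite invr_ge0 mulr_ge0// ltW.
pose L := E * (A * (2 * N)); have L0 : 0 <= L by rewrite !mulr_ge0// ltW.
have ci : 0 <= c^-1 by rewrite invr_ge0 ltW.
exists (((E + M * L) * mass + M * L * mass) / c).
  by rewrite !(mulr_ge0, addr_ge0) ?(ltW m0) ?(ltW E0).
move=> v v' w dv dv' vv' t x.
have [cq qb qM cvq vqM] := datum_chq0 dv; have [cq' qb' qM' cvq' vqM'] := datum_chq0 dv'.
have [d0 dc] := colehopf_den t x dv; have [d'0 d'c] := colehopf_den t x dv'.
have w0 : 0 <= w by apply: le_trans (vv' 0).
have bv := datum_bcs dv; have bv' := datum_bcs dv'.
have [_ v0 vM] := dv; have [_ v'0 v'M] := dv'.
have dp y : `|prim v y - prim v' y| <= w * (2 * N).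
  have -> : prim v y - prim v' y = prim (fun x => v x + -1 * v' x) y.
    rewrite primD; [|exact: bcs_integrable|exact/bcs_integrable/bcsZ].
    by rewrite primZ ?mulN1r//; exact: bcs_integrable.
  apply: prim_le_support => //; first by apply: bcsD => //; exact: bcsZ.
    by move=> z; rewrite mulN1r.
  by move=> z zN; rewrite v0// v'0// mulr0 addr0.
have dq y : `|chq0 nu v y - chq0 nu v' y| <= L * w.
  have VB u : datum u -> - A * prim u y <= A * B.
    move=> du; have [_ /(_ y)/andP[_]] := datum_chq0 du.
    by rewrite /chq0 /cha ler_expR.
  rewrite (le_trans (expR_lipschitz (VB _ dv) (VB _ dv')))// -mulrBr normrM normrN (ger0_norm A0).
  have -> : L * w = E * (A * (w * (2 * N))) by rewrite /L; ring.
  by rewrite ler_wpM2l ?(ltW E0)// ler_wpM2l// dp.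
have dn y : `|v y * chq0 nu v y - v' y * chq0 nu v' y| <= (E + M * L) * w.
  have -> : v y * chq0 nu v y - v' y * chq0 nu v' y =
    (v y - v' y) * chq0 nu v y + v' y * (chq0 nu v y - chq0 nu v' y) by ring.
  rewrite (le_trans (ler_normD _ _))// !normrM mulrDl lerD//.
    by rewrite mulrC ler_pM// qM.
  by rewrite -mulrA ler_pM.
have h1 := gavg_dist (chs nu t) x cvq cvq' vqM vqM' dn.
have h2 := gavg_dist (chs nu t) x cq cq' qM qM' dq.
have h3 := colehopf_le t x dv'.
move: h1 h2 h3 dc d0; rewrite /colehopf.
set n := gavg _ _ _; set n' := gavg (fun y => v' y * _) _ _.
set d := gavg (chq0 nu v) _ _; set d' := gavg (chq0 nu v') _ _ in d'0 d'c *.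
move=> h1 h2 h3 dc d0.
(* In this form the quotient n'/d' is bounded by M, and a single lower bound for a denominator
   remains. *)
have -> : n / d - n' / d' = ((n - n') - n' / d' * (d - d')) / d.
  by clearbody n n' d d'; field; rewrite !gt_eqF.
rewrite normrM normfV (gtr0_norm d0).
apply: (@le_trans _ _ (((E + M * L) * w * mass + M * (L * w * mass)) / d)).
  rewrite ler_wpM2r ?invr_ge0 ?(ltW d0)// (le_trans (ler_normB _ _))// lerD//.
  by rewrite normrM ler_pM.
have -> : (E + M * L) * w * mass + M * (L * w * mass) = ((E + M * L) * mass + M * L * mass) * w by ring.
rewrite [leRHS]mulrAC -[leLHS]mulrA -[leRHS]mulrA ler_wpM2l//.
  by rewrite !(mulr_ge0, addr_ge0) ?(ltW m0) ?(ltW E0).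
by rewrite ler_wpM2l// lef_pV2.
Qed.

End cole_hopf_bounds.

End mollification.

(** * Galerkin solutions are close to Cole-Hopf solutions *)

Section cutoff.
Context {R : realType}.
Local Notation mu := (@lebesgue_measure R).
Implicit Types (x y z s t r : R).

Definition pospart z : R := Num.max 0 z.

Lemma pospart_ge0 z : 0 <= pospart z. Proof. by rewrite le_max lexx. Qed.

Lemma pospart_le z : z <= pospart z. Proof. by rewrite le_max lexx orbT. Qed.

Lemma pospart_continuous : continuous pospart.
Proof. by move=> z; apply: continuous_max; [exact: cvg_cst|exact: cvg_id]. Qed.

Lemma pospart_derive n z : (n < 2)%N ->
  is_derive z 1 (fun z => pospart z ^+ n.+2) (n.+2%:R * pospart z ^+ n.+1).
Proof.
move=> n2; have [z0|z0|->] := ltgtP z 0.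
- rewrite /pospart (max_l (ltW z0)) expr0n/= mulr0.
  apply: (@near_eq_is_derive R R R (fun=> 0)) => //.
  by near=> y; rewrite max_l ?expr0n//; apply: ltW; near: y; exact: lt_nbhsl.
- rewrite /pospart (max_r (ltW z0)).
  apply: (@near_eq_is_derive R R R (fun z => z ^+ n.+2)).
    by near=> y; rewrite max_r//; apply: ltW; near: y; exact: lt_nbhsr.
  by case: n n2 => [|[|//]] _; apply: is_derive_eq; rewrite /GRing.scale/= ?expr1; ring.
- rewrite {2}/pospart maxxx expr0n/= mulr0.
  apply: is_derive_quot => e e0; exists (Num.min e 1); first by rewrite lt_min e0 ltr01.
  move=> y y0; rewrite lt_min => /andP[ye y1].
  rewrite add0r /pospart maxxx expr0n/= !subr0 normrM normfV ler_pdivrMr ?normr_gt0//.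
  have py : `|Num.max 0 y| <= `|y|.
    by rewrite ger0_norm ?le_max ?lexx// ge_max normr_ge0 ler_norm.
  rewrite normrX exprS ler_pM ?exprn_ge0//; last first.
    by rewrite exprS (le_trans _ py)// ler_piMr// exprn_ile1// (le_trans py)// ltW.
  by rewrite (le_trans py)// ltW.
Unshelve. all: by end_near. Qed.

(** The cube of the positive part of 1 - (x/r)^2 is the cutoff; the third power makes it C^2. *)
Definition chi r x := pospart (1 - (x / r) ^+ 2) ^+ 3.
Definition chi1 r x := - 6 * pospart (1 - (x / r) ^+ 2) ^+ 2 * (x / r ^+ 2).
Definition chi2 r x := 24 * pospart (1 - (x / r) ^+ 2) * (x / r ^+ 2) ^+ 2
  - 6 * pospart (1 - (x / r) ^+ 2) ^+ 2 / r ^+ 2.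

Section chi.
Variable r : R.
Hypothesis r1 : 1 <= r.

Let r0 : 0 < r. Proof. exact: lt_le_trans r1. Qed.
Let rN0 : r != 0. Proof. by rewrite gt_eqF. Qed.

Let k x := pospart (1 - (x / r) ^+ 2).

Let k01 x : 0 <= k x <= 1.
Proof.
rewrite pospart_ge0/= /k /pospart ge_max ler01/= gerBl sqr_ge0//.
Qed.

Let kx x : k x != 0 -> `|x| <= r.
Proof.
rewrite /k /pospart => h; rewrite leNgt; apply: contra h => rx; rewrite max_l//.
rewrite subr_le0 -[leRHS]real_normK ?num_real// normrM normfV (gtr0_norm r0).
by rewrite exprn_ege1// ler_pdivlMr// mul1r ltW.
Qed.

Lemma chi_derive x : is_derive x 1 (chi r) (chi1 r x).
Proof.
have d1 : is_derive x 1 (fun x => 1 - (x / r) ^+ 2) (- 2 * (x / r ^+ 2)).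
  by apply: is_derive_eq; rewrite /GRing.scale/= ?expr1; field.
have := @is_derive1_comp _ (fun z => pospart z ^+ 3) _ x _ _ (@pospart_derive 1 _ isT) d1.
by move=> h; apply: is_derive_eq; rewrite /chi1; ring.
Qed.

Lemma chi1_derive x : is_derive x 1 (chi1 r) (chi2 r x).
Proof.
have d1 : is_derive x 1 (fun x => 1 - (x / r) ^+ 2) (- 2 * (x / r ^+ 2)).
  by apply: is_derive_eq; rewrite /GRing.scale/= ?expr1; field.
have d2 := @is_derive1_comp _ (fun z => pospart z ^+ 2) _ x _ _ (@pospart_derive 0 _ isT) d1.
rewrite /chi1; apply: is_derive_eq; rewrite /chi2 /GRing.scale/= expr1; field => //.
Qed.

Lemma chi2_continuous : continuous (chi2 r).
Proof.
have ck : continuous k.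
  move=> x; apply: (@continuous_comp _ _ _ (fun x => 1 - (x / r) ^+ 2) pospart).
    apply: cvgB; first exact: cvg_cst.
    apply: (@continuous_comp _ _ _ (fun x => x / r) (fun z => z ^+ 2)).
      by apply: cvgM; [exact: cvg_id|exact: cvg_cst].
    exact: exprn_continuous.
  exact: pospart_continuous.
move=> x; apply: cvgB; apply: cvgM.
- by apply: cvgM; [exact: cvg_cst|exact: ck].
- apply: (@continuous_comp _ _ _ (fun x => x / r ^+ 2) (fun z => z ^+ 2)).
    by apply: cvgM; [exact: cvg_id|exact: cvg_cst].
  exact: exprn_continuous.
- apply: cvgM; first exact: cvg_cst.
  by apply: (@continuous_comp _ _ _ k (fun z => z ^+ 2)); [exact: ck|exact: exprn_continuous].
- exact: cvg_cst.
Qed.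

Lemma chi_support x : r < `|x| -> [/\ chi r x = 0, chi1 r x = 0 & chi2 r x = 0].
Proof.
move=> rx; have k0 : k x = 0.
  by apply/eqP; apply: contraTT rx => /kx; rewrite -leNgt.
by rewrite /chi /chi1 /chi2 -/(k x) k0 !expr0n/= !(mulr0, mul0r) subrr.
Qed.

Lemma chi_C1c : C1c (chi r) (chi1 r) /\ C1c (chi1 r) (chi2 r).
Proof.
split; split.
- exact: chi_derive.
- by move=> x; apply/differentiable_continuous/derivable1_diffP; have [] := chi1_derive x.
- by exists r => // x /chi_support[].
- exact: chi1_derive.
- exact: chi2_continuous.
- by exists r => // x /chi_support[].
Qed.

(** Each deviation from the constant 1 is of order 1/r^2, up to a factor x^2 or |x| that the
    quadratic decay of w absorbs. The 3 comes from 1 - k^3 <= 3 (1 - k) and the 30 is 24 + 6. *)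
Lemma chi_bounds x : [/\ 0 <= chi r x <= 1, 1 - chi r x <= 3 * x ^+ 2 / r ^+ 2,
  `|chi1 r x| <= 6 * `|x| / r ^+ 2 & `|chi2 r x| <= 30 / r ^+ 2].
Proof.
have /andP[k0 k1] := k01 x; have r2 : 0 < r ^+ 2 by rewrite exprn_gt0.
have ri : 0 <= (r ^+ 2)^-1 by rewrite invr_ge0 ltW.
have k2 : (k x) ^+ 2 <= 1 by rewrite exprn_ile1.
have k20 : 0 <= (k x) ^+ 2 by rewrite sqr_ge0.
rewrite /chi /chi1 /chi2 -/(k x); split.
- by rewrite exprn_ge0//= exprn_ile1.
- have : 1 - (x / r) ^+ 2 <= k x by exact: pospart_le.
  have -> : 3 * x ^+ 2 / r ^+ 2 = 3 * (x / r) ^+ 2 by field.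
  have -> : 1 - k x ^+ 3 = (1 - k x) * (1 + k x + k x ^+ 2) by ring.
  nra.
- rewrite [`|_ * (x / _)|]normrM [`|_ * k x ^+ 2|]normrM normrN (ger0_norm k20).
  rewrite [`|x / _|]normrM normfV (gtr0_norm r2) !(ger0_norm (ler0n _ _)).
  by rewrite mulrA ler_wpM2r// ler_wpM2r// ler_piMr.
- have [->|kn] := eqVneq (k x) 0.
    by rewrite expr0n/= !(mulr0, mul0r) subrr normr0 mulr_ge0.
  have xr := kx kn.
  have xr2 : x ^+ 2 <= r ^+ 2.
    by rewrite -[x ^+ 2]real_normK ?num_real// lerXn2r ?nnegrE// ltW.
  have h0 := sqr_ge0 (x / r ^+ 2).
  rewrite (le_trans (ler_normB _ _))// (ger0_norm (mulr_ge0 (mulr_ge0 (ler0n R 24) k0) h0)).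
  rewrite (ger0_norm (mulr_ge0 (mulr_ge0 (ler0n R 6) k20) ri)).
  have h : (x / r ^+ 2) ^+ 2 <= (r ^+ 2)^-1.
    have -> : (x / r ^+ 2) ^+ 2 = x ^+ 2 / r ^+ 2 / r ^+ 2 by field.
    by rewrite ler_piMl// ler_pdivrMr// mul1r.
  have : k x * (x / r ^+ 2) ^+ 2 <= 1 * (r ^+ 2)^-1 by rewrite ler_pM.
  have : k x ^+ 2 * (r ^+ 2)^-1 <= 1 * (r ^+ 2)^-1 by rewrite ler_wpM2r.
  lra.
Qed.

End chi.

Lemma C1cM f f' g g' : C1c f f' -> (forall x, is_derive x 1 g (g' x)) -> continuous g' ->
  C1c (fun x => f x * g x) (fun x => f' x * g x + f x * g' x).
Proof.
move=> Cf dg cg'; have [df cf' [M M0 f0]] := Cf; have cf := C1b_continuous (C1c_C1b Cf).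
have cg : continuous g.
  by move=> x; apply/differentiable_continuous/derivable1_diffP; have [] := dg x.
split.
- move=> x; have dfx := df x; have dgx := dg x.
  by apply: is_derive_eq; rewrite /GRing.scale/=; ring.
- by move=> x; apply: cvgD; apply: cvgM; [exact: cf'|exact: cg|exact: cf|exact: cg'].
- by exists M => // x /f0[-> ->]; rewrite !mul0r addr0.
Qed.

Lemma C1cD f f' g g' : C1c f f' -> C1c g g' ->
  C1c (fun x => f x + g x) (fun x => f' x + g' x).
Proof.
move=> Cf Cg; have := C1c_lin 1 Cf Cg.
by under eq_fun do rewrite mul1r; under [X in C1c _ X]eq_fun do rewrite mul1r.
Qed.

Lemma tlip_fun T (g : R -> R) C : (forall x, `|g x| <= C) -> tlip T (fun _ => g).
Proof.
move=> gC; have C0 : 0 <= C by apply: le_trans (gC 0).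
by exists C => // s t x _ _; rewrite subrr normr0 mulr_ge0 ?sqrtr_ge0.
Qed.

End cutoff.

(** * Cole-Hopf solutions cut off in space *)

Section approximants.
Context {R : realType}.
Implicit Types (x s t C D : R).
Variables (nu T : R) (v0 v1 v2 v3 : R -> R) (r : R).
Hypotheses (nu0 : 0 < nu) (T0 : 0 < T) (Cv0 : C1c v0 v1) (Cv1 : C1c v1 v2) (Cv2 : C1c v2 v3).
Hypothesis r1 : 1 <= r.

Local Notation w := (chw nu v0).
Local Notation w1 := (chw1 nu v0 v1).
Local Notation w2 := (chw2 nu v0 v1 v2).
Local Notation wt := (chwt nu v0 v1 v2).

Definition cut t x := chi r x * w t x.
Definition cut1 t x := chi1 r x * w t x + chi r x * w1 t x.
Definition cut2 t x := (chi2 r x * w t x + chi1 r x * w1 t x) +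
  (chi1 r x * w1 t x + chi r x * w2 t x).
Definition cutt t x := chi r x * wt t x.

Lemma chw2_continuous t : continuous (w2 t).
Proof.
have cp q q' : C1b q q' -> continuous (chp nu v0 q t).
  move=> Cq x; apply/differentiable_continuous/derivable1_diffP.
  by have [] := chp_derive_x nu0 Cv0 t x Cq.
have c1 := cp _ _ (chC12 nu Cv0); have c2 := cp _ _ (chC23 nu Cv0 Cv1).
have c3 := cp _ _ (chC34 nu Cv0 Cv1 Cv2).
move=> x; apply: cvgM; first exact: cvg_cst.
apply: cvgD; first apply: cvgD.
- exact: c3.
- by apply: cvgM; [exact: cvg_cst|apply: cvgM; [exact: c1|exact: c2]].
- apply: cvgM; first exact: cvg_cst.
  by apply: cvgM; [exact: c1|apply: cvgM; exact: c1].
Qed.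

Lemma cut_C1c t : C1c (cut t) (cut1 t) /\ C1c (cut1 t) (cut2 t).
Proof.
have [Cc Cc1] := chi_C1c r1; have d := chw_derive_x nu0 Cv0 Cv1 t.
have dw x := (d x).1; have dw1 x := (d x).2.
have cw1 : continuous (w1 t).
  by move=> x; apply/differentiable_continuous/derivable1_diffP; have [] := dw1 x.
have cw2 : continuous (w2 t) by exact: chw2_continuous.
by split; [exact: C1cM|apply: C1cD; exact: C1cM].
Qed.

Lemma cut_tlip : exists2 C, 0 <= C & forall s t x, 0 <= s <= T -> 0 <= t <= T ->
  [/\ `|cut t x| <= C, `|cut1 t x| <= C & `|cut2 t x| <= C] /\
  [/\ `|cut t x - cut s x| <= C * Num.sqrt `|t - s|,
      `|cut1 t x - cut1 s x| <= C * Num.sqrt `|t - s|,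
      `|cut2 t x - cut2 s x| <= C * Num.sqrt `|t - s| &
      `|cutt t x - cutt s x| <= C * Num.sqrt `|t - s|].
Proof.
have [l0 l1 l2 lt] := chw_tlip nu0 Cv0 Cv1 Cv2 T.
have [[_ [K0 k0]] [_ [K1 k1]]] := C1c_bcs (chi_C1c r1).1.
have [_ [_ [K2 k2]]] := C1c_bcs (chi_C1c r1).2.
have c0 := tlip_fun T (fun x => (k0 x).1); have c1 := tlip_fun T (fun x => (k1 x).1).
have c2 := tlip_fun T (fun x => (k2 x).1).
have [A0 A00 a0] := tlipM c0 l0.
have [A1 A10 a1] := tlipD (tlipM c1 l0) (tlipM c0 l1).
have [A2 A20 a2] := tlipD (tlipD (tlipM c2 l0) (tlipM c1 l1)) (tlipD (tlipM c1 l1) (tlipM c0 l2)).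
have [A3 A30 a3] := tlipM c0 lt.
exists (A0 + A1 + A2 + A3); first by rewrite !addr_ge0.
move=> s t x sT tT; have q0 := sqrtr_ge0 `|t - s|.
have [? ?] := a0 s t x sT tT; have [? ?] := a1 s t x sT tT.
have [? ?] := a2 s t x sT tT; have [? ?] := a3 s t x sT tT.
have [b0 b1 b2 b3] : [/\ A0 <= A0 + A1 + A2 + A3, A1 <= A0 + A1 + A2 + A3,
    A2 <= A0 + A1 + A2 + A3 & A3 <= A0 + A1 + A2 + A3].
  split; first by rewrite -!addrA lerDl !addr_ge0.
  - by rewrite -!addrA [leRHS]addrCA lerDl !addr_ge0.
  - by rewrite -addrA [leRHS]addrCA lerDl !addr_ge0.
  - by rewrite lerDr !addr_ge0.
move: (A0 + A1 + A2 + A3) b0 b1 b2 b3 => C b0 b1 b2 b3.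
have up y A : y <= A -> A <= C -> y <= C by exact: le_trans.
have upq y A : y <= A * Num.sqrt `|t - s| -> A <= C -> y <= C * Num.sqrt `|t - s|.
  by move=> yA AC; rewrite (le_trans yA)// ler_wpM2r.
by do 2!split; [exact: up b0|exact: up b1|exact: up b2|exact: upq b0|exact: upq b1|exact: upq b2|exact: upq b3].
Qed.

(** As w solves the equation exactly, the residual of chi w contains only products with 1 - chi or
    with a derivative of chi, all of order 1/r^2 by decay. The constants are 9 = 3 + 6 and 42 = 30 +
    2 * 6. *)
Lemma cut_residual D t x : 0 <= D -> (1 + x ^+ 2) * `|w t x| <= D ->
  (1 + x ^+ 2) * `|w1 t x| <= D ->
  [/\ `|cut t x - w t x| <= 3 * D / r ^+ 2,
      `|cut1 t x| <= `|w1 t x| + 6 * D / r ^+ 2 &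
      `|cutt t x + cut t x * cut1 t x - nu * cut2 t x| <= (9 * D ^+ 2 + 42 * nu * D) / r ^+ 2].
Proof.
move=> D0 h0 h1; have [/andP[c0 c1] c2 c3 c4] := chi_bounds r1 x.
have r2 : 0 < r ^+ 2 by rewrite exprn_gt0// (lt_le_trans ltr01).
have ri : 0 <= (r ^+ 2)^-1 by rewrite invr_ge0 ltW.
have n0 := normr_ge0 (w t x); have n1 := normr_ge0 (w1 t x).
have x0 : 0 <= x ^+ 2 := sqr_ge0 x.
have xx : `|x| <= 1 + x ^+ 2.
  have := sqr_ge0 (`|x| - 1); rewrite -[x ^+ 2](real_normK (num_real x)).
  have := normr_ge0 x; nra.
have w0D : `|w t x| <= D by rewrite (le_trans _ h0)// ler_peMl// lerDl.
have xw : `|x| * `|w t x| <= D by rewrite (le_trans _ h0)// ler_wpM2r.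
have xw1 : `|x| * `|w1 t x| <= D by rewrite (le_trans _ h1)// ler_wpM2r.
have x2w : x ^+ 2 * `|w t x| <= D by rewrite (le_trans _ h0)// ler_wpM2r// lerDr.
have w1D : `|w1 t x| <= D by rewrite (le_trans _ h1)// ler_peMl// lerDl.
have e1 : (1 - chi r x) * `|w t x| <= 3 * D / r ^+ 2.
  rewrite (le_trans (ler_wpM2r n0 c2))// mulrAC ler_wpM2r// -mulrA ler_wpM2l//.
have e2 : `|chi1 r x| * `|w t x| <= 6 * D / r ^+ 2.
  by rewrite (le_trans (ler_wpM2r n0 c3))// mulrAC ler_wpM2r// -mulrA ler_wpM2l.
have e3 : `|chi1 r x| * `|w1 t x| <= 6 * D / r ^+ 2.
  by rewrite (le_trans (ler_wpM2r n1 c3))// mulrAC ler_wpM2r// -mulrA ler_wpM2l.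
have e4 : `|chi2 r x| * `|w t x| <= 30 * D / r ^+ 2.
  by rewrite (le_trans (ler_pM _ _ c4 w0D))// mulrAC.
have wtE : wt t x = nu * w2 t x - w t x * w1 t x.
  by rewrite /chwt /hopft mulN1r.
rewrite /cut /cut1 /cut2 /cutt.
set c := chi r x in c0 c1 c2 e1 *; set d := chi1 r x in c3 e2 e3 *.
set d2 := chi2 r x in c4 e4 *; set y := w t x in h0 n0 w0D xw x2w e1 e2 e4 wtE *.
set y1 := w1 t x in h1 n1 xw1 w1D e3 wtE *; set y2 := w2 t x in wtE *.
set yt := wt t x in wtE *.
clearbody c d d2 y y1 y2 yt.
split.
- rewrite (_ : _ - _ = - ((1 - c) * y)); last by ring.
  by rewrite normrN normrM ger0_norm// subr_ge0.
- rewrite addrC (le_trans (ler_normD _ _))// !normrM lerD//.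
  by rewrite ler_piMl// ger0_norm.
- have -> : c * yt + c * y * (d * y + c * y1) -
    nu * (d2 * y + d * y1 + (d * y1 + c * y2)) =
    - (c * y1 * ((1 - c) * y)) + c * y * (d * y)
    - nu * (d2 * y + 2 * (d * y1)).
    by rewrite wtE; ring.
  have e5 : `|c * y1 * ((1 - c) * y)| <= D * (3 * D / r ^+ 2).
    rewrite normrM ler_pM// normrM; last by rewrite [`|1 - _|]ger0_norm// subr_ge0.
    by rewrite (le_trans _ w1D)// ler_piMl// ger0_norm.
  have e6 : `|c * y * (d * y)| <= D * (6 * D / r ^+ 2).
    rewrite normrM ler_pM// normrM//.
    by rewrite (le_trans _ w0D)// ler_piMl// ger0_norm.
  have e7 : `|nu * (d2 * y + 2 * (d * y1))| <= nu * (42 * D / r ^+ 2).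
    rewrite normrM (gtr0_norm nu0) ler_wpM2l ?(ltW nu0)//.
    rewrite (le_trans (ler_normD _ _))// !normrM (ger0_norm (ler0n _ 2)).
    have -> : 42 * D / r ^+ 2 = 30 * D / r ^+ 2 + 2 * (6 * D / r ^+ 2) by ring.
    lra.
  have -> : (9 * D ^+ 2 + 42 * nu * D) / r ^+ 2 =
    D * (3 * D / r ^+ 2) + D * (6 * D / r ^+ 2) + nu * (42 * D / r ^+ 2) by ring.
  rewrite (le_trans (ler_normB _ _))// lerD// (le_trans (ler_normD _ _))// normrN lerD//.
Qed.

Lemma cut_derive_t t x : 0 < t -> is_derive t 1 (cut ^~ x) (cutt t x).
Proof.
move=> t0; have d := chw_derive_t nu0 Cv0 Cv1 x t0.
by rewrite /cut; apply: is_derive_eq; rewrite /cutt /GRing.scale/=; ring.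
Qed.

Lemma cut_support t x : r < `|x| -> [/\ cut t x = 0, cut1 t x = 0 & cut2 t x = 0].
Proof.
by move=> /(chi_support r1)[h0 h1 h2]; rewrite /cut /cut1 /cut2 h0 h1 h2 !mul0r !addr0.
Qed.

End approximants.

(** * Gronwall's lemma along a time grid *)

Section chain.
Context {R : realType}.
Implicit Types (x y s t : R).
Variables (V : set (R -> R)) (T : R) (u0 : R -> R) (nu : R) (u : R -> R -> R).
Hypotheses (Vflat : V `<=` H1flat) (nu0 : 0 < nu) (gal : galerkin V T u0 nu u) (T0 : 0 < T).
Variables (n : nat) (F F1 F2 : R -> R -> R).
Hypothesis n0 : (0 < n)%N.
Hypotheses (CF : forall t, C1c (F t) (F1 t)) (CF1 : forall t, C1c (F1 t) (F2 t)).

Definition tstep : R := T / n%:R.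
Local Notation h := tstep.
Definition tpoint (j : nat) : R := j%:R * h.
Local Notation p := tpoint.
Definition slope (F : R -> R -> R) (j : nat) x := (F (p j.+1) x - F (p j) x) / h.
Definition interp (F : R -> R -> R) j t x := F (p j) x + (t - p j) * slope F j x.

Hypothesis VF : forall j, (j < n)%N ->
  [/\ V (F (p j)), V (F1 (p j)), V (slope F j) & V (slope F1 j)].
Variables (A B rho : R).
Hypotheses (A0 : 0 <= A) (B0 : 0 <= B) (rho0 : 0 <= rho).
Hypothesis W1_bound : forall j t x, (j < n)%N -> p j < t < p j.+1 ->
  `|interp F1 j t x| <= A + B / Num.sqrt t.
Hypothesis r_bound : forall j t, (j < n)%N -> p j < t < p j.+1 ->
  ip (fun x => slope F j x + interp F j t x * interp F1 j t x - nu * interp F2 j t x)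
     (fun x => slope F j x + interp F j t x * interp F1 j t x - nu * interp F2 j t x) <= rho.

Lemma tstep_gt0 : 0 < h. Proof. by rewrite divr_gt0// ltr0n. Qed.

Lemma tpointS j : p j.+1 = p j + h.
Proof. by rewrite /tpoint -natr1 mulrDl mul1r. Qed.

Lemma tpoint_ge0 j : 0 <= p j. Proof. by rewrite mulr_ge0// ltW// tstep_gt0. Qed.

Lemma tpoint_le j : (j <= n)%N -> p j <= T.
Proof.
move=> jn; rewrite /tpoint /tstep mulrA ler_pdivrMr ?ltr0n// mulrC ler_wpM2l ?(ltW T0)//.
by rewrite ler_nat.
Qed.

Lemma tpoint_lt j : (j < n)%N -> p j < T.
Proof.
move=> jn; rewrite /tpoint /tstep mulrA ltr_pdivrMr ?ltr0n// mulrC ltr_pM2l//.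
by rewrite ltr_nat.
Qed.

Lemma interp_right j x : interp F j (p j.+1) x = F (p j.+1) x.
Proof.
rewrite /interp /slope tpointS addrAC subrr add0r mulrC mulfVK ?gt_eqF ?tstep_gt0//.
by rewrite addrC subrK.
Qed.

Lemma C1cZ c f f' : C1c f f' -> C1c (fun x : R => c * f x) (fun x => c * f' x).
Proof.
move=> Cf; have := C1c_lin (c - 1) Cf Cf.
by congr C1c; apply/funext => x; ring.
Qed.

Lemma slope_C1c j : C1c (slope F j) (slope F1 j) /\ C1c (slope F1 j) (slope F2 j).
Proof.
have k (f f' : R -> R -> R) : (forall t, C1c (f t) (f' t)) -> C1c (slope f j) (slope f' j).
  move=> Cf; have := C1cZ h^-1 (C1c_lin (-1) (Cf (p j.+1)) (Cf (p j))).
  by congr C1c; apply/funext => x; rewrite /slope mulN1r mulrC.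
by split; exact: k.
Qed.

(** The primitive of [ga]: the bound on the x-derivative is singular like 1 / sqrt t at 0, but
    integrable. *)
Let Ga t := (A + 1) * t + 2 * B * Num.sqrt t.
Let ga t := A + 1 + B / Num.sqrt t.

Let energy f t := ip (fun x => u t x - f t x) (fun x => u t x - f t x).

Lemma chain_step j t : (j < n)%N -> p j <= t <= p j.+1 -> t < T ->
  energy (interp F j) t * expR (- Ga t) <=
  energy (fun t => F (p j)) (p j) * expR (- Ga (p j)) + rho * (t - p j).
Proof.
move=> jn tj tT; have [V0 V1 V2 V3] := VF jn; have [s1 s2] := slope_C1c j.
have := @energy_step R V T u0 nu u Vflat nu0 gal _ _ _ _ _ _ (CF (p j)) (CF1 (p j)) s1 s2
  V0 V1 V2 V3 (p j) (p j.+1) Ga ga rho (tpoint_ge0 j) (tpoint_le jn).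
rewrite subrr => h1; have := h1 _ _ _ _ _ t tj tT.
rewrite (_ : ip (fun x => u (p j) x - (F (p j) x + 0 * _)) _ = energy (fun t => F (p j)) (p j)); last first.
  by rewrite /energy; congr ip; apply/funext => x; rewrite mul0r addr0.
apply.
- move=> s x sj; have := W1_bound x jn sj; rewrite /interp /ga; lra.
- by move=> s sj; exact: r_bound.
- move=> s /andP[js _]; have s0 : 0 < s by rewrite (le_lt_trans (tpoint_ge0 j)).
  have d1 := is_derive1_sqrt s0.
  apply: is_derive_eq; rewrite /ga /GRing.scale/=.
  by field; rewrite gt_eqF// sqrtr_gt0.
- apply: continuous_subspaceT => s; apply: cvgD.
    by apply: cvgM; [exact: cvg_cst|exact: cvg_id].
  by apply: cvgM; [exact: cvg_cst|exact: sqrt_continuous].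
- move=> s /andP[js _]; have s0 : 0 <= s by rewrite (le_trans (tpoint_ge0 j)).
  by rewrite /Ga addr_ge0// ?mulr_ge0 ?sqrtr_ge0// addr_ge0.
Qed.

Let E0 := ip (fun x => u0 x - F 0 x) (fun x => u0 x - F 0 x).

(** The interpolant reaches the next node exactly, so the energies weighted with exp(-Ga)
    concatenate. The resulting constant does not depend on the number of steps. *)
Lemma chain_points j : (j < n)%N ->
  energy (fun t => F (p j)) (p j) * expR (- Ga (p j)) <= E0 + rho * p j.
Proof.
elim: j => [_|j IH jn].
  have p0 : p 0 = 0 by rewrite /tpoint mul0r.
  have G0 : Ga 0 = 0 by rewrite /Ga sqrtr0 !mulr0 addr0.
  by rewrite p0 G0 oppr0 expR0 !mulr1 mulr0 addr0 /energy (gal_0 gal).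
have := @chain_step j (p j.+1) (ltnW jn); rewrite lexx andbT.
rewrite (_ : energy (interp F j) (p j.+1) = energy (fun t => F (p j.+1)) (p j.+1)); last first.
  by rewrite /energy; congr ip; apply/funext => x; rewrite interp_right.
have jj : p j <= p j.+1 by rewrite tpointS lerDl ltW// tstep_gt0.
move=> /(_ jj (tpoint_lt jn)); have := IH (ltnW jn).
rewrite mulrBr; lra.
Qed.

Lemma chain t : timeI T t -> exists2 j, (j < n)%N /\ p j <= t <= p j.+1 &
  energy (interp F j) t <= expR ((A + 1) * T + 2 * B * Num.sqrt T) * (E0 + rho * T).
Proof.
rewrite /timeI/= in_itv/= => /andP[t0 tT].
have h0 := tstep_gt0; have th0 : 0 <= t / h by rewrite divr_ge0// ltW.
pose j := Num.truncn (t / h).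
have /andP[j1 j2] := truncn_itv th0; rewrite -/j in j1 j2.
have jt : p j <= t by rewrite /tpoint -ler_pdivlMr.
have tj : t < p j.+1 by rewrite /tpoint -ltr_pdivrMr.
have jn : (j < n)%N.
  rewrite ltnNge; apply/negP => nj; have : p j < T by exact: le_lt_trans tT.
  rewrite ltNge => /negP; apply; rewrite /tpoint -ler_pdivrMr// /tstep invfM invrK mulrA.
  by rewrite mulfV ?gt_eqF// mul1r ler_nat.
exists j; first by rewrite jn jt ltW.
have h1 : energy (interp F j) t * expR (- Ga t) <= E0 + rho * T.
  have tjj : p j <= t <= p j.+1 by rewrite jt ltW.
  have := chain_step jn tjj tT; have := chain_points jn; have := ler_wpM2l rho0 (ltW tT).
  rewrite mulrBr; lra.
have E00 : 0 <= E0 + rho * T by rewrite (le_trans _ h1)// mulr_ge0 ?expR_ge0// ip_ge0.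
have -> : energy (interp F j) t = energy (interp F j) t * expR (- Ga t) * expR (Ga t).
  by rewrite -mulrA -expRD addrC subrr expR0 mulr1.
rewrite mulrC ler_pM ?expR_ge0 ?mulr_ge0 ?ip_ge0 ?expR_ge0//.
rewrite ler_expR lerD// ler_wpM2l ?addr_ge0 ?(ltW tT)//; last first.
  by rewrite ler_wsqrtr// ltW.
by rewrite mulr_ge0.
Qed.

End chain.

(** * Choice of the comparison function *)

Section approximation.
Context {R : realType}.
Local Notation mu := (@lebesgue_measure R).
Implicit Types (x y s t C : R).

Lemma sqrt_le_sqr x y : 0 <= y -> x <= y ^+ 2 -> Num.sqrt x <= y.
Proof. by move=> y0 /(@ler_wsqrtr R); rewrite sqrtr_sqr ger0_norm. Qed.

Lemma holder_continuous (f : R -> R) a b C : 0 <= C ->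
  (forall s t, a <= s <= b -> a <= t <= b -> `|f t - f s| <= C * Num.sqrt `|t - s|) ->
  {within `[a, b], continuous f}.
Proof.
move=> C0 fC; apply/subspace_continuousP => t; rewrite /= in_itv/= => tab.
apply/cvgrPdist_le => e e0; have C1 : 0 < C + 1 by lra.
have d0 : 0 < (e / (C + 1)) ^+ 2 by rewrite exprn_gt0// divr_gt0.
near=> s.
have sab : a <= s <= b.
  have : `[a, b]%classic s by near: s; exact: withinT.
  by rewrite /= in_itv.
have st : `|t - s| < (e / (C + 1)) ^+ 2.
  near: s; apply: cvg_within.
  by apply/nbhs_ballP; exists ((e / (C + 1)) ^+ 2).
rewrite (le_trans (fC s t sab tab))//.
have -> : e = (C + 1) * (e / (C + 1)) by field; rewrite gt_eqF.
rewrite ler_pM ?sqrtr_ge0//; first lra.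
by apply: sqrt_le_sqr; [rewrite divr_ge0 ?(ltW e0) ?(ltW C1)|exact: ltW].
Unshelve. all: by end_near. Qed.

Lemma ip_sup f c r : bcs f -> 0 <= r -> (forall x, `|f x| <= c) ->
  (forall x, r < `|x| -> f x = 0) -> ip f f <= c ^+ 2 * (2 * r).
Proof.
move=> bf r0 fc f0; have bff := bcsM bf bf.
have := @prim_le_support _ (fun x => f x * f x) (c ^+ 2) r r bff r0.
rewrite (@prim_above _ _ r r)//; last by move=> y ry; rewrite f0 ?mul0r// (lt_le_trans ry)// ler_norm.
move=> h; apply: le_trans (ler_norm _) (h _ _).
  by move=> y; rewrite normrM expr2 ler_pM.
by move=> y ry; rewrite f0// mul0r.
Qed.

Section interp.
Variables (T : R) (n : nat).
Hypotheses (T0 : 0 < T) (n0 : (0 < n)%N).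
Local Notation h := (tstep T n).
Local Notation p := (tpoint T n).

Lemma interpE (f : R -> R -> R) j t x : interp T n f j t x =
  f (p j) x + (t - p j) / h * (f (p j.+1) x - f (p j) x).
Proof. by rewrite /interp /slope; ring. Qed.

Lemma tweight j t : p j <= t <= p j.+1 -> 0 <= (t - p j) / h <= 1.
Proof.
move=> /andP[jt tj]; have h0 := tstep_gt0 T0 n0.
rewrite divr_ge0 ?subr_ge0 ?(ltW h0)//= ler_pdivrMr// mul1r.
by move: tj; rewrite tpointS; lra.
Qed.

Lemma interp_le (f : R -> R -> R) C j t x : p j <= t <= p j.+1 ->
  `|f (p j) x| <= C -> `|f (p j.+1) x| <= C -> `|interp T n f j t x| <= C.
Proof.
move=> /tweight/andP[]; rewrite interpE; set th := _ / h => th0 th1.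
rewrite !ler_norml => /andP[? ?] /andP[? ?]; apply/andP; split; nra.
Qed.

Lemma interp_close (f : R -> R -> R) C j t x : 0 <= C -> (j < n)%N -> p j <= t <= p j.+1 ->
  (forall s t x, 0 <= s <= T -> 0 <= t <= T -> `|f t x - f s x| <= C * Num.sqrt `|t - s|) ->
  `|interp T n f j t x - f t x| <= 2 * (C * Num.sqrt h).
Proof.
move=> C0 jn tj fC; have /andP[th0 th1] := tweight tj.
have p0 := tpoint_ge0 T0 n0; have pT := tpoint_le T0 n0.
have h0 := tstep_gt0 T0 n0.
have e1 : `|f (p j) x - f t x| <= C * Num.sqrt h.
  case/andP: tj => jt tj; rewrite (le_trans (fC _ _ _ _ _))//.
  - by rewrite (le_trans (p0 j) jt)/= (le_trans tj)// pT.
  - by rewrite p0 pT// ltnW.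
  rewrite ler_wpM2l// ler_wsqrtr// distrC ger0_norm ?subr_ge0//.
  by move: tj; rewrite tpointS; lra.
have e2 : `|f (p j.+1) x - f (p j) x| <= C * Num.sqrt h.
  rewrite (le_trans (fC _ _ _ _ _)) ?p0 ?pT ?(ltnW jn)//.
  by rewrite ler_wpM2l// ler_wsqrtr// tpointS addrAC subrr add0r ger0_norm// ltW.
rewrite interpE addrAC (le_trans (ler_normD _ _))// normrM (ger0_norm th0).
have := ler_pM th0 (normr_ge0 _) th1 e2; lra.
Qed.

End interp.

(** The mean value theorem in time. It requires the derivative only inside the step, so the first
    step may start at t = 0, where Hölder continuity suffices. *)
Lemma cut_slope (nu T : R) (v0 v1 v2 v3 : R -> R) r C n j x :
  0 < nu -> 0 < T -> (0 < n)%N -> (j < n)%N -> C1c v0 v1 -> C1c v1 v2 -> C1c v2 v3 -> 0 <= C ->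
  (forall s t x, 0 <= s <= T -> 0 <= t <= T ->
    `|cut nu v0 r t x - cut nu v0 r s x| <= C * Num.sqrt `|t - s|) ->
  exists2 xi, tpoint T n j < xi < tpoint T n j.+1 &
    slope T n (cut nu v0 r) j x = cutt nu v0 v1 v2 r xi x.
Proof.
move=> nu0 T0 n0 jn Cv0 Cv1 Cv2 C0 FC; have h0 := tstep_gt0 T0 n0.
have pj : tpoint T n j < tpoint T n j.+1 by rewrite tpointS ltrDl.
have p0 := tpoint_ge0 T0 n0; have pT := tpoint_le T0 n0.
have cF : {within `[tpoint T n j, tpoint T n j.+1], continuous (fun t => cut nu v0 r t x)}.
  apply: (holder_continuous C0) => s t /andP[s1 s2] /andP[t1 t2]; apply: FC.
    by rewrite (le_trans (p0 j) s1)/= (le_trans s2)// pT.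
  by rewrite (le_trans (p0 j) t1)/= (le_trans t2)// pT.
have [|xi xij E] := @MVT R (fun t => cut nu v0 r t x) (fun t => cutt nu v0 v1 v2 r t x) _ _ pj _ cF.
  move=> t; rewrite in_itv/= => /andP[t1 _].
  by apply: (cut_derive_t r nu0 Cv0 Cv1); rewrite (le_lt_trans (p0 j)).
exists xi; first by move: xij; rewrite in_itv.
by rewrite /slope E tpointS addrAC subrr add0r mulfK// gt_eqF.
Qed.


Lemma inv_sq_le X tgt r : 0 <= X -> 0 < tgt -> 1 <= r -> X / tgt <= r -> X / r ^+ 2 <= tgt :> R.
Proof.
move=> X0 t0 r1 Xr; have r0 : 0 < r by exact: lt_le_trans r1.
rewrite ler_pdivrMr ?exprn_gt0//; move: Xr; rewrite ler_pdivrMr// mulrC => /le_trans; apply.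
by rewrite ler_pM2l// expr2 ler_peMr// ltW.
Qed.

(** A number of steps n for which C sqrt(T/n) <= kap. *)
Lemma bound_mul C kap T : 0 < kap -> 0 <= T ->
  C ^+ 2 * T <= kap ^+ 2 * (Num.bound (T * (C / kap) ^+ 2)).+1%:R.
Proof.
move=> k0 T0; have -> : C ^+ 2 * T = kap ^+ 2 * (T * (C / kap) ^+ 2).
  by field; rewrite gt_eqF.
rewrite ler_pM2l ?exprn_gt0// (le_trans (ltW (archi_boundP _)))// ?ler_nat//.
by rewrite mulr_ge0 ?sqr_ge0.
Qed.

(** The constants are chosen so that each depends on earlier ones only: the Gronwall factor G, the
    mollification [om], the residual tolerance [rho], the cutoff radius [r], the time tolerance
    [kap] with the number of steps, and the range [dl] of viscosities. The comparison function
    solves the equation for nu and is used for every nu2 near nu. *)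
Lemma galerkin_approx (N M T nu eta : R) u0 : 0 < nu -> 0 < T -> 0 <= N -> datum N M u0 ->
  0 < eta -> exists2 dl : R, 0 < dl & exists S : set (R -> R), [/\ finite_set S, S `<=` H1flat &
    forall V nu2 u, V `<=` H1flat -> S `<=` V -> 0 < nu2 -> `|nu2 - nu| < dl ->
      galerkin V T u0 nu2 u -> forall t, timeI T t -> exists f, [/\ bcs f,
        ip (fun x => u t x - f x) (fun x => u t x - f x) <= eta &
        forall x, `|f x - colehopf nu u0 t x| <= eta]].
Proof.
move=> nu0 T0 N0 du eta0; have [cu uN uM] := du.
have M0 : 0 <= M by apply: le_trans (uM 0).
have N3 : 0 <= N + 3 by lra.
have [K K0 stab] := @colehopf_stable R nu (N + 3) M nu0 N3.
pose B := M * (2 * (N + 3)).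
(* The 2 leaves room for the cutoff and for the interpolation in time, each of which changes the
   x-derivative by at most 1. *)
pose A1 := M ^+ 2 / (2 * nu) + 2.
pose B1 := 2 * M * expR (B / nu) * @mass2 R / @mass R / Num.sqrt (4 * nu).
have m0 := mass_gt0 (R := R).
have m2 : 0 <= @mass2 R by rewrite (le_trans (ltW m0) mass_le2).
have A10 : 0 <= A1 by rewrite addr_ge0// divr_ge0 ?sqr_ge0// mulr_ge0// ltW.
have B10 : 0 <= B1 by rewrite !mulr_ge0 ?invr_ge0 ?expR_ge0 ?sqrtr_ge0 ?(ltW m0).
pose G := expR ((A1 + 1) * T + 2 * B1 * Num.sqrt T).
have G0 : 0 < G by exact: expR_gt0.
(* The bounds serve stability of the Cole-Hopf formula (K om <= eta/3) and the initial error, whose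
   square 8 (N + 3) om^2 times G must be at most eta/2; om <= 1 gives om^2 <= om. *)
pose om := Num.min (eta / (3 * (K + 1))) (Num.min 1 (eta / (16 * (N + 3) * G))).
have om0 : 0 < om.
  by rewrite !lt_min ltr01/=; apply/andP; split; rewrite divr_gt0// !mulr_gt0//; lra.
have omK : K * om <= eta / 3.
  have : om <= eta / (3 * (K + 1)) by rewrite ge_min lexx.
  rewrite ler_pdivlMr ?mulr_gt0//; [nra|lra].
have om1 : om <= 1 by rewrite !ge_min lexx orbT.
have omG : (16 * (N + 3) * om) * G <= eta.
  have : om <= eta / (16 * (N + 3) * G) by rewrite !ge_min lexx !orbT.
  rewrite ler_pdivlMr; last by rewrite !mulr_gt0//; lra.
  by rewrite mulrC; congr (_ <= _); ring.
clearbody om.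
have [v0 [v1 [v2 [v3 [[Cv0 Cv1 Cv2] [vN vM vu]]]]]] := mollify cu N0 uN uM om0.
have cv : continuous v0 := C1b_continuous (C1c_C1b Cv0).
have dv : datum (N + 3) M v0 by [].
have du3 : datum (N + 3) M u0 by split => // x xN; apply: uN; lra.
have VB x : `|prim v0 x| <= B by apply: prim_le_support => //; exact: (C1c_bcs Cv0).1.
have [D D0 wD] := chw_decay nu0 Cv0 Cv1 T.
pose K0' := 9 * D ^+ 2 + 42 * nu * D.
have K0'0 : 0 <= K0' by rewrite addr_ge0 ?mulr_ge0 ?sqr_ge0// ltW.
pose k1 := K0' + 1; have k10 : 0 < k1 by rewrite /k1; lra.
pose rho := eta / (2 * G * T); have rho0 : 0 < rho by rewrite divr_gt0// !mulr_gt0.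
have rhoG : G * (rho * T) = eta / 2 by rewrite /rho; field; rewrite !gt_eqF.
have k1K : K0' <= k1 by rewrite /k1 lerDl.
clearbody rho k1.
(* One summand for each of the requirements [c1] to [c4]. In [c4] the length 2 r of the support
   costs one power of r out of the four in the squared residual. *)
pose r := 1 + 3 * D / om + 9 * D / eta + 6 * D + 8 * k1 ^+ 2 / rho.
have x1 : 0 <= 3 * D / om by rewrite divr_ge0 ?mulr_ge0// ltW.
have x2 : 0 <= 9 * D / eta by rewrite divr_ge0 ?mulr_ge0// ltW.
have x3 : 0 <= 6 * D by rewrite mulr_ge0.
have x4 : 0 <= 8 * k1 ^+ 2 / rho.
  by apply: divr_ge0; [apply: mulr_ge0 => //; exact: sqr_ge0|exact: ltW].
have r1 : 1 <= r by rewrite /r; lra.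
have r0 : 0 < r by lra.
have rr : 0 < r ^+ 2 by rewrite exprn_gt0.
have c1 : 3 * D / r ^+ 2 <= om.
  by apply: inv_sq_le => //; rewrite ?mulr_ge0// /r; lra.
have c2 : 3 * D / r ^+ 2 <= eta / 3.
  apply: inv_sq_le => //; rewrite ?mulr_ge0 ?divr_gt0//.
  have -> : 3 * D / (eta / 3) = 9 * D / eta by field; rewrite gt_eqF.
  rewrite /r; lra.
have c3 : 6 * D / r ^+ 2 <= 1 by apply: inv_sq_le => //; rewrite divr1 /r; lra.
have c4 : (2 * k1 / r ^+ 2) ^+ 2 * (2 * r) <= rho.
  have -> : (2 * k1 / r ^+ 2) ^+ 2 * (2 * r) = 8 * k1 ^+ 2 / r ^+ 2 / r.
    by field; rewrite gt_eqF.
  have h : 8 * k1 ^+ 2 / r ^+ 2 <= rho.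
    by apply: inv_sq_le => //; rewrite ?mulr_ge0 ?sqr_ge0// /r; lra.
  by rewrite ler_pdivrMr// (le_trans h)// ler_peMr// ltW.
clearbody r.
have [C C0 lip] := cut_tlip T nu0 Cv0 Cv1 Cv2 r1.
(* The three bounds serve [W1b], the final closeness (2 kap <= eta/3) and the share of the residual
   due to discretisation in time. *)
pose kap := Num.min (1 / 2) (Num.min (eta / 6) (k1 / (2 * r ^+ 2 * (1 + 4 * C + 4 * nu)))).
have q0 : 0 < 1 + 4 * C + 4 * nu by move: C0 nu0; clear; lra.
have kap0 : 0 < kap.
  by rewrite !lt_min; apply/and3P; split; rewrite divr_gt0// !mulr_gt0.
pose n := (Num.bound (T * (C / kap) ^+ 2)).+1.
have n0 : (0 < n)%N by [].
pose h := tstep T n; have h0 : 0 < h by exact: tstep_gt0.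
have Ch : C * Num.sqrt h <= kap.
  rewrite -[C]ger0_norm// -sqrtr_sqr -sqrtrM ?sqr_ge0//.
  apply: sqrt_le_sqr; first exact: ltW.
  rewrite /h /tstep mulrA ler_pdivrMr ?ltr0n//.
  by rewrite bound_mul// ltW.
have kap1 : kap <= 1 / 2 by rewrite ge_min lexx.
have kap2 : kap <= eta / 6 by rewrite !ge_min lexx orbT.
have kap3 : kap * (1 + 4 * C + 4 * nu) <= k1 / (2 * r ^+ 2).
  have : kap <= k1 / (2 * r ^+ 2 * (1 + 4 * C + 4 * nu)) by rewrite !ge_min lexx !orbT.
  by rewrite invfM mulrA ler_pdivlMr.
clearbody kap.
(* dl <= nu keeps nu2 below 2 nu; the other bound controls (nu2 - nu) W2. *)
pose dl := Num.min nu (k1 / (2 * r ^+ 2 * (C + 1))).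
have C1 : 0 < C + 1 by rewrite ltr_wpDl.
have dl0 : 0 < dl by rewrite lt_min nu0 divr_gt0// !mulr_gt0.
have dlC : dl * C <= k1 / (2 * r ^+ 2).
  have : dl <= k1 / (2 * r ^+ 2 * (C + 1)) by rewrite ge_min lexx orbT.
  rewrite invfM mulrA ler_pdivlMr//; move: (ltW dl0); clear; lra.
have dlnu : dl <= nu by rewrite ge_min lexx.
clearbody dl.
pose F := cut nu v0 r; pose F1 := cut1 nu v0 v1 r; pose F2 := cut2 nu v0 v1 v2 r.
pose Ft := cutt nu v0 v1 v2 r.
have CF t : C1c (F t) (F1 t) by exact: (cut_C1c nu0 Cv0 Cv1 Cv2 r1 t).1.
have CF1 t : C1c (F1 t) (F2 t) by exact: (cut_C1c nu0 Cv0 Cv1 Cv2 r1 t).2.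
pose p := tpoint T n.
have [sl0 sl1] : (forall j, C1c (slope T n F j) (slope T n F1 j)) /\
    forall j, C1c (slope T n F1 j) (slope T n F2 j).
  by split => j; have [] := slope_C1c T n CF CF1 j.
exists dl => //.
exists ([set F (p j) | j in `I_n] `|` [set F1 (p j) | j in `I_n] `|`
  ([set slope T n F j | j in `I_n] `|` [set slope T n F1 j | j in `I_n])).
split.
- by rewrite !finite_setU; do 2!split; apply: finite_image; exact: finite_II.
- move=> f [[|]|[|]] [j _ <-]; apply: C1c_H1flat.
  + exact: CF.
  + exact: CF1.
  + exact: sl0.
  + exact: sl1.
move=> V nu2 u Vflat SV nu20 nu2d gal.
have nu2nu : nu2 <= 2 * nu.
  move: nu2d dlnu; rewrite ltr_norml => /andP[_]; clear; lra.
have VF j : (j < n)%N -> [/\ V (F (p j)), V (F1 (p j)), V (slope T n F j) & V (slope T n F1 j)].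
  move=> jn; split; apply: SV; [left; left|left; right|right; left|right; right]; by exists j.
have p0 := tpoint_ge0 T0 n0; have pT := tpoint_le T0 n0.
have rng j t : (j < n)%N -> p j <= t <= p j.+1 -> 0 <= t <= T.
  by move=> jn /andP[h1 h2]; rewrite (le_trans (p0 j) h1)/= (le_trans h2)// pT.
have rngp j : (j <= n)%N -> 0 <= p j <= T by move=> jn; rewrite p0 pT.
have l0 s t x hs ht := (lip s t x hs ht).2.
have b0 s t x hs ht := (lip s t x hs ht).1.
have W1b j t x : (j < n)%N -> p j < t < p j.+1 ->
    `|interp T n F1 j t x| <= A1 + B1 / Num.sqrt t.
  move=> jn /andP[pt tp]; have ptp : p j <= t <= p j.+1 by rewrite !ltW.
  have t0 : 0 < t by rewrite (le_lt_trans (p0 j)).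
  have cl : `|interp T n F1 j t x - F1 t x| <= 2 * (C * Num.sqrt h).
    by apply: interp_close => // s' t' x' hs ht; have [] := l0 s' t' x' hs ht.
  have [hd0 hd1] := wD t x (rng j t jn ptp).
  have [_ e2 _] := cut_residual v2 nu0 r1 D0 hd0 hd1.
  have e3 := chw1_le nu0 Cv0 x vM VB t0.
  have := ler_normD (interp T n F1 j t x - F1 t x) (F1 t x); rewrite subrK.
  rewrite /A1 /B1; move: e2 e3 cl Ch kap1 c3; rewrite -/(F1 t x); clear; lra.
have rb j t : (j < n)%N -> p j < t < p j.+1 ->
    ip (fun x => slope T n F j x + interp T n F j t x * interp T n F1 j t x - nu2 * interp T n F2 j t x)
     (fun x => slope T n F j x + interp T n F j t x * interp T n F1 j t x - nu2 * interp T n F2 j t x) <= rho.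
  move=> jn /andP[pt tp]; have ptp : p j <= t <= p j.+1 by rewrite !ltW.
  have CW : C1c (interp T n F j t) (interp T n F1 j t) by apply: C1c_lin.
  have CW1 : C1c (interp T n F1 j t) (interp T n F2 j t) by apply: C1c_lin.
  have [bW bW1] := C1c_bcs CW; have [_ bW2] := C1c_bcs CW1; have [bs _] := C1c_bcs (sl0 j).
  apply: le_trans c4; apply: ip_sup; last 2 first.
  - move=> x.
    have tT := rng j t jn ptp.
    have cl (f : R -> R -> R) : (forall s t x, 0 <= s <= T -> 0 <= t <= T ->
        `|f t x - f s x| <= C * Num.sqrt `|t - s|) ->
        `|interp T n f j t x - f t x| <= 2 * kap.
      by move=> fC; apply: (le_trans (interp_close T0 n0 x C0 jn ptp fC)); rewrite ler_pM2l.
    have d0 : `|interp T n F j t x - F t x| <= 2 * kap.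
      by apply: cl => s' t' x' hs ht; have [] := l0 s' t' x' hs ht.
    have d1 : `|interp T n F1 j t x - F1 t x| <= 2 * kap.
      by apply: cl => s' t' x' hs ht; have [] := l0 s' t' x' hs ht.
    have d2 : `|interp T n F2 j t x - F2 t x| <= 2 * kap.
      by apply: cl => s' t' x' hs ht; have [] := l0 s' t' x' hs ht.
    have W1C : `|interp T n F1 j t x| <= C.
      apply: interp_le => //.
        by have [] := b0 (p j) (p j) x (rngp j (ltnW jn)) (rngp j (ltnW jn)).
      by have [] := b0 (p j.+1) (p j.+1) x (rngp j.+1 jn) (rngp j.+1 jn).
    have [F0C F1C F2C] := b0 t t x tT tT.
    have [xi /andP[xi1 xi2] E] : exists2 xi, p j < xi < p j.+1 & slope T n F j x = Ft xi x.
      apply: (cut_slope x nu0 T0 n0 jn Cv0 Cv1 Cv2 C0) => s' t' x' hs ht.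
      by have [] := l0 s' t' x' hs ht.
    have d3 : `|slope T n F j x - Ft t x| <= kap.
      rewrite E (le_trans _ Ch)//.
      have xiT : 0 <= xi <= T by apply: (rng j) => //; rewrite !ltW.
      have [_ _ _ h4] := l0 t xi x tT xiT; rewrite (le_trans h4)// ler_wpM2l// ler_wsqrtr//.
      by move: xi1 xi2 pt tp; rewrite /p tpointS -/h ler_norml; clear => ? ? ? ?; apply/andP; split; lra.
    have [hd0 hd1] := wD t x tT.
    have [_ _ e3] := cut_residual v2 nu0 r1 D0 hd0 hd1.
    move: e3 d0 d1 d2 W1C F0C F1C F2C d3; rewrite -/(Ft t x) -/(F t x) -/(F1 t x) -/(F2 t x).
    move: (slope T n F j x) (interp T n F j t x) (interp T n F1 j t x) (interp T n F2 j t x)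
      (Ft t x) (F t x) (F1 t x) (F2 t x) => sl W W1 W2 ft f f1 f2.
    move=> e3 d0 d1 d2 W1C F0C F1C F2C d3.
    have -> : sl + W * W1 - nu2 * W2 = (ft + f * f1 - nu * f2) + ((sl - ft) +
      (W - f) * W1 + f * (W1 - f1) - nu2 * (W2 - f2) - (nu2 - nu) * f2) by ring.
    have g1 : `|(W - f) * W1| <= 2 * kap * C by rewrite normrM ler_pM.
    have g2 : `|f * (W1 - f1)| <= C * (2 * kap) by rewrite normrM ler_pM.
    have g3 : `|nu2 * (W2 - f2)| <= 2 * nu * (2 * kap).
      by rewrite normrM ler_pM// gtr0_norm.
    have g4 : `|(nu2 - nu) * f2| <= dl * C by rewrite normrM ler_pM// ltW.
    (* Shares of the residual: cutoff in space, discretisation in time, change of viscosity. *)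
    have -> : 2 * k1 / r ^+ 2 = k1 / r ^+ 2 + (k1 / (2 * r ^+ 2) + k1 / (2 * r ^+ 2)).
      by field; rewrite gt_eqF.
    rewrite (le_trans (ler_normD _ _))// lerD//.
      by rewrite (le_trans e3)// ler_wpM2r ?invr_ge0 ?(ltW rr).
    apply: le_trans (lerD kap3 dlC).
    rewrite (le_trans (ler_normB _ _))// lerD//.
    rewrite (le_trans (ler_normB _ _))//.
    have := ler_normD (sl - ft + (W - f) * W1) (f * (W1 - f1)).
    have := ler_normD (sl - ft) ((W - f) * W1); move: g1 g2 g3 d3; clear; lra.
  - move=> x xr.
    have z t' : [/\ F t' x = 0, F1 t' x = 0 & F2 t' x = 0] by exact: cut_support.
    have [z1 z2 z3] := z (p j); have [z4 z5 z6] := z (p j.+1).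
    by rewrite !interpE /slope z1 z2 z3 z4 z5 z6 !(subrr, mulr0, mul0r, addr0, oppr0).
  - by apply: bcsB; [apply: bcsD => //; exact: bcsM|exact: bcsZ].
  - exact: ltW.
move=> t It; have [j [jn ptp] ch] := chain Vflat nu20 gal T0 n0 CF CF1 VF A10 B10 (ltW rho0) W1b rb It.
exists (interp T n F j t).
have CW : C1c (interp T n F j t) (interp T n F1 j t) by apply: C1c_lin.
have tT := rng j t jn ptp.
split; first exact: (C1c_bcs CW).1.
- apply: (le_trans ch); rewrite -/G.
  (* The initial error is pointwise at most 2 om: one om from mollification, one from the cutoff. *)
  have E0 : ip (fun x => u0 x - F 0 x) (fun x => u0 x - F 0 x) <= (2 * om) ^+ 2 * (2 * (N + 3)).
    apply: ip_sup => //.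
    + apply: bcsB; [exact: datum_bcs du|exact: (C1c_bcs (CF 0)).1].
    + move=> x; have z00 : (0 : R) <= 0 <= T by apply/andP; split => //; exact: ltW.
      have [hd0 hd1] := wD 0 x z00.
      have [e1 _ _] := cut_residual v2 nu0 r1 D0 hd0 hd1.
      have := ler_distD (v0 x) (u0 x) (F 0 x); move: e1 (vu x).
      rewrite chw_0// -/(F 0 x) (distrC (F 0 x)) (distrC (v0 x) (u0 x)); move: c1; clear; lra.
    + move=> x xN; rewrite uN; last by rewrite (le_lt_trans _ xN)// lerDl.
      by rewrite /F /cut chw_0// vN// mulr0 subr0.
  have h1 : (2 * om) ^+ 2 * (2 * (N + 3)) * G <= eta / 2.
    have om2 : om ^+ 2 <= om by rewrite expr2 ler_piMr// ltW.
    have -> : (2 * om) ^+ 2 * (2 * (N + 3)) * G = 8 * (N + 3) * G * om ^+ 2 by ring.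
    have NG : 0 <= 8 * (N + 3) * G by rewrite !mulr_ge0// ltW.
    move: (ler_wpM2l NG om2) omG; clear; clearbody G; lra.
  rewrite mulrDr rhoG; move: (ler_wpM2l (ltW G0) E0) h1; clear; clearbody G; lra.
- move=> x.
  have cl : `|interp T n F j t x - F t x| <= 2 * kap.
    apply: (@le_trans _ _ (2 * (C * Num.sqrt h))); last by rewrite ler_pM2l.
    by apply: interp_close => // s' t' x' hs ht; have [] := l0 s' t' x' hs ht.
  have [hd0 hd1] := wD t x tT.
  have [e1 _ _] := cut_residual v2 nu0 r1 D0 hd0 hd1.
  have e2 := stab v0 u0 om dv du3 vu t x.
  move: e1 e2; rewrite (chw_colehopf nu0 N3 t x dv) -/(F t x) => e1 e2.
  move: (ler_distD (F t x) (interp T n F j t x) (colehopf nu u0 t x)).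
  move: (ler_distD (colehopf nu v0 t x) (F t x) (colehopf nu u0 t x)) e1 e2 cl c2 omK kap2.
  move: (interp T n F j t x) (F t x) (colehopf nu v0 t x) (colehopf nu u0 t x) => c c' d d'.
  by clear; lra.
Qed.

End approximation.

(** * The Lax-Oleinik formula *)

Section countability.
Context {R : realType}.

Lemma countable_code (T : countType) (A : set R) (P : R -> T -> Prop) :
  (forall x, A x -> exists q, P x q) ->
  (forall x y q, A x -> A y -> P x q -> P y q -> x = y) -> countable A.
Proof.
move=> AP PA; apply/countable_injP.
have H x : exists n, A x -> exists q, P x q /\ n = pickle q.
  have [Ax|nAx] := pselect (A x); last by exists 0%N.
  by have [q Pq] := AP x Ax; exists (pickle q) => _; exists q.
have [f fP] := choice H; exists f => x y; rewrite !inE => Ax Ay fxy.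
have [q [Pxq fx]] := fP x Ax; have [q' [Pyq' fy]] := fP y Ay.
have qq' : q = q' by apply: (pcan_inj pickleK); rewrite -fx -fy.
by apply: (PA x y q) => //; rewrite qq'.
Qed.

(** A rational interval isolates each strict local maximum; two of them sharing an interval would
    each exceed the other. *)
Lemma strict_max_countable (f : R -> R) : countable [set t : R |
  exists2 d : R, 0 < d & forall s, s != t -> `|s - t| < d -> f s < f t].
Proof.
apply: (@countable_code (rat * rat)%type _ (fun t q => ratr q.1 < t < ratr q.2 /\
    forall s, s != t -> ratr q.1 < s < ratr q.2 -> f s < f t)).
- move=> t /= [d d0 td]; have h1 : t - d < t by lra.
  have h2 : t < t + d by lra.
  have [q1] := rat_in_itvoo h1; have [q2] := rat_in_itvoo h2.
  rewrite !in_itv/= => /andP[a1 a2] /andP[b1 b2]; exists (q1, q2) => /=.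
  split; first by rewrite b2 a1.
  by move=> s st /andP[s1 s2]; apply: td => //; rewrite ltr_norml; apply/andP; split; lra.
- move=> t t' q _ _ [tq H] [t'q H']; apply/eqP/negPn/negP => tt'.
  have := H t'; rewrite eq_sym => /(_ tt' t'q); have := H' t tt' tq => /lt_trans h /h.
  by rewrite ltxx.
Qed.

(** A concave kink becomes a strict local maximum after subtracting a line of rational slope, and
    the rational slopes are countable. *)
Lemma kink_countable (f : R -> R) : countable [set t : R |
  exists a : rat, exists2 d : R, 0 < d & forall s, s != t -> `|s - t| < d ->
    f s - ratr a * s < f t - ratr a * t].
Proof.
have := @bigcup_countable _ _ (@setT rat) (fun a => [set t : R | exists2 d : R, 0 < d &
  forall s, s != t -> `|s - t| < d -> f s - ratr a * s < f t - ratr a * t]).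
move=> /(_ (countableP _)) h; apply: sub_countable (h _).
  by apply: subset_card_le => t [a ta]; exists a.
by move=> a _; exact: (strict_max_countable (fun s => f s - ratr a * s)).
Qed.

End countability.

Section slopes.
Context {R : realType}.
Implicit Types (f : R -> R) (t s a c : R).

Lemma is_derive_approx f t c e : is_derive t 1 f c -> 0 < e -> exists2 d : R, 0 < d &
  forall s, s != t -> `|s - t| < d -> `|(f s - f t) / (s - t) - c| < e.
Proof.
move=> [df dfE] e0; have := df; rewrite /derivable => /cvg_ex[l hl].
have lc : l = c by rewrite -dfE /derive; apply/esym; exact: (cvg_lim (@Rhausdorff R)).
move: hl; rewrite lc => /cvgrPdist_lt/(_ _ e0)/nbhs_ballP[d /= d0 hd].
exists d => // s st sd; have st0 : s - t != 0 by rewrite subr_eq0.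
have := hd (s - t); rewrite /ball/= sub0r normrN => /(_ sd st0).
rewrite /shift/= /GRing.scale/= mulr1 subrK distrC.
by rewrite [_^-1 * _]mulrC.
Qed.

Lemma derive_slope_right f t c a : is_derive t 1 f c -> c < a -> exists2 d : R, 0 < d &
  forall s, t < s -> `|s - t| < d -> f s - a * s < f t - a * t.
Proof.
move=> df ca; have e0 : 0 < a - c by rewrite subr_gt0.
have [d d0 hd] := is_derive_approx df e0; exists d => // s ts sd.
have := hd s (negbT (gt_eqF ts)) sd; rewrite ltr_norml => /andP[_].
by rewrite ltrBlDr subrK ltr_pdivrMr ?subr_gt0//; lra.
Qed.

Lemma derive_slope_left f t c a : is_derive t 1 f c -> a < c -> exists2 d : R, 0 < d &
  forall s, s < t -> `|s - t| < d -> f s - a * s < f t - a * t.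
Proof.
move=> df ca; have e0 : 0 < c - a by rewrite subr_gt0.
have [d d0 hd] := is_derive_approx df e0; exists d => // s ts sd.
have := hd s (negbT (lt_eqF ts)) sd; rewrite ltr_norml => /andP[+ _].
rewrite opprB ltrBrDr subrK -mulrNN -invrN opprB ltr_pdivlMr ?subr_gt0//; lra.
Qed.

End slopes.

(** * Minimisers of the Lax-Oleinik functional, and the entropy condition *)

Section lax_oleinik.
Context {R : realType}.
Local Notation mu := (@lebesgue_measure R).
Implicit Types (x y z s t : R).
Variables (u0 : R -> R) (N M : R).
Hypotheses (N0 : 0 <= N) (du : datum N M u0).

Let cu : continuous u0. Proof. by case: du. Qed.
Let bu : bcs u0. Proof. exact: datum_bcs du. Qed.
Let U0 := prim u0.
Let B := M * (2 * N).
Let U0B x : `|U0 x| <= B.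
Proof. by case: du => _ ? ?; apply: prim_le_support. Qed.
Let cU : continuous U0. Proof. exact: prim_continuous (bcs_integrable bu). Qed.
Let M0 : 0 <= M. Proof. by case: du => _ _ uM; apply: le_trans (uM 0). Qed.
Let B0 : 0 <= B. Proof. by rewrite !mulr_ge0. Qed.

Definition cost t x y := U0 y + (x - y) ^+ 2 / (2 * t).
Local Notation K := cost.
Definition minimiser t x y := forall z, K t x y <= K t x z.

Let rad t := 4 * t * B + 1.

(** rad t >= 1, so its square is at least rad t > 4 t B; the quadratic term then exceeds 2 B, the
    largest possible variation of [U0]. *)
Lemma cost_far t x y : 0 < t -> rad t < `|x - y| -> K t x x < K t x y.
Proof.
move=> t0 h; rewrite /cost subrr expr0n/= mul0r addr0.
have r1 : 1 <= rad t by rewrite lerDr !mulr_ge0// ltW.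
have h2 : rad t <= (x - y) ^+ 2.
  rewrite -real_normK ?num_real//; apply: (@le_trans _ _ (rad t ^+ 2)).
    by rewrite expr2 ler_peMl// (le_trans ler01).
  by rewrite lerXn2r ?nnegrE ?(le_trans ler01 r1)// ltW.
have h3 : 2 * B < (x - y) ^+ 2 / (2 * t).
  by rewrite ltr_pdivlMr ?mulr_gt0// (lt_le_trans _ h2)// /rad; lra.
have := U0B x; have := U0B y; rewrite !ler_norml => /andP[? ?] /andP[? ?]; lra.
Qed.

Lemma cost_continuous t x : continuous (K t x).
Proof.
move=> y; apply: cvgD; first exact: cU.
apply: cvgM; last exact: cvg_cst.
have h : (x - z) @[z --> y] --> x - y by apply: cvgB; [exact: cvg_cst|exact: cvg_id].
by rewrite expr2; under eq_fun do rewrite expr2; exact: cvgM.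
Qed.

Lemma minimiser_exists t x : 0 < t -> exists y, minimiser t x y.
Proof.
move=> t0; have r1 : 1 <= rad t by rewrite lerDr !mulr_ge0// ltW.
have h : x - rad t <= x + rad t by lra.
have [y _ ymin] := @EVT_min R (K t x) _ _ h (continuous_subspaceT (@cost_continuous t x)).
exists y => z; have [zr|zr] := leP `|x - z| (rad t).
  by apply: ymin; rewrite in_itv/=; move: zr; rewrite ler_norml => /andP[? ?]; apply/andP; split; lra.
rewrite ltW// (le_lt_trans _ (cost_far t0 zr))//; apply: ymin.
by rewrite in_itv/=; apply/andP; split; lra.
Qed.

Lemma minimiser_near t x y : 0 < t -> minimiser t x y -> `|x - y| <= rad t.
Proof.
by move=> t0 ymin; rewrite leNgt; apply/negP => /(cost_far t0); rewrite ltNge ymin.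
Qed.

(** Adding the two minimality inequalities cancels [U0] and leaves (x' - x) (y' - y) >= 0:
    characteristics do not cross. *)
Lemma minimiser_mono t x x' y y' : 0 < t -> x < x' -> minimiser t x y -> minimiser t x' y' ->
  y <= y'.
Proof.
move=> t0 xx' /(_ y') h1 /(_ y) h2.
have : (x - y) ^+ 2 / (2 * t) + (x' - y') ^+ 2 / (2 * t) <=
       (x - y') ^+ 2 / (2 * t) + (x' - y) ^+ 2 / (2 * t) by move: h1 h2; rewrite /cost; lra.
rewrite -!mulrDl ler_pM2r ?invr_gt0 ?mulr_gt0// => h.
have : 0 <= (x' - x) * (y' - y) by nra.
by rewrite pmulr_rge0 ?subr_gt0// subr_ge0.
Qed.

Lemma minimiser_limit t x y (F : set_system R) (f : R -> R) : ProperFilter F ->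
  F --> x -> f @ F --> y -> (\forall x' \near F, minimiser t x' (f x')) -> minimiser t x y.
Proof.
move=> FF Fx Fy Fmin z.
have k1 : K t x' (f x') @[x' --> F] --> K t x y.
  apply: cvgD; first exact: (continuous_cvg _ (cU (x := y)) Fy).
  apply: cvgM; last exact: cvg_cst.
  have h : (x' - f x') @[x' --> F] --> x - y by apply: cvgB.
  by rewrite expr2; under eq_fun do rewrite expr2; exact: cvgM.
have k2 : K t x' z @[x' --> F] --> K t x z.
  apply: cvgD; first exact: cvg_cst.
  apply: cvgM; last exact: cvg_cst.
  have h : (x' - z) @[x' --> F] --> x - z by apply: cvgB => //; exact: cvg_cst.
  by rewrite expr2; under eq_fun do rewrite expr2; exact: cvgM.
by apply: ler_cvg_to k1 k2 _; near=> x'; have : minimiser t x' (f x') by near: x'.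
Unshelve. all: by end_near. Qed.

(** The least minimiser: the infimum is attained, and it is nondecreasing and left continuous in
    x. *)
Definition lo t x := inf [set y | minimiser t x y].

Lemma has_inf_minimiser t x : 0 < t -> has_inf [set y | minimiser t x y].
Proof.
move=> t0; split; first exact: minimiser_exists.
exists (x - rad t) => y /= /(minimiser_near t0); rewrite ler_norml => /andP[_]; lra.
Qed.

Lemma lo_least t x y : 0 < t -> minimiser t x y -> lo t x <= y.
Proof. by move=> t0 h; apply: ge_inf => //; exact: (has_inf_minimiser x t0).2. Qed.

Lemma lo_minimiser t x : 0 < t -> minimiser t x (lo t x).
Proof.
move=> t0 z; rewrite leNgt; apply/negP => h.
have e0 : 0 < K t x (lo t x) - K t x z by rewrite subr_gt0.
have := @cost_continuous t x (lo t x) => /cvgrPdist_lt/(_ _ e0)/nbhs_ballP[d d0 hd].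
have [y ymin yd] := inf_adherent d0 (has_inf_minimiser x t0).
have ly := lo_least t0 ymin.
have h2 : ball (lo t x) d y by rewrite /ball/= distrC ger0_norm ?subr_ge0// ltrBlDl.
have := hd y h2; rewrite /= ltr_norml => /andP[_]; have := ymin z; lra.
Qed.

Lemma lo_mono t x x' : 0 < t -> x <= x' -> lo t x <= lo t x'.
Proof.
move=> t0; rewrite le_eqVlt => /predU1P[->//|xx'].
by apply: (minimiser_mono t0 xx'); exact: lo_minimiser.
Qed.

(** The first-order condition: the characteristic starting at y with speed u0(y) passes through (t,
    x). *)
Lemma minimiser_slope t x y : 0 < t -> minimiser t x y -> u0 y = (x - y) / t.
Proof.
move=> t0 ymin.
have dK z : is_derive z 1 (K t x) (u0 z - (x - z) / t).
  have dU := prim_derive (bcs_integrable bu) (@cu z).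
  by rewrite /cost /U0; apply: is_derive_eq; rewrite /GRing.scale/= ?expr1; field; rewrite gt_eqF.
have h : is_derive y 1 (K t x) 0.
  apply: (@derive1_at_min _ _ (y - 1) (y + 1)) => //; first lra.
    by rewrite in_itv/=; apply/andP; split; lra.
by have [_ E] := dK y; have [_] := h; rewrite E => /eqP; rewrite subr_eq0 => /eqP.
Qed.

Lemma lo_left t x : 0 < t -> lo t y @[y --> x^'-] --> lo t x.
Proof.
move=> t0.
have cv : cvg (lo t y @[y --> x^'-]).
  apply: nondecreasing_at_left_is_cvgr.
    by near=> y => a b _ _; exact: lo_mono.
  near=> y; exists (lo t x) => _ [z /= + <-]; rewrite in_itv/= => /andP[_ zx].
  by apply: lo_mono => //; exact: ltW.
suff -> : lo t x = lim (lo t y @[y --> x^'-]) by [].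
apply/le_anti/andP; split.
  apply: lo_least => //; apply: (@minimiser_limit t x _ x^'- (lo t)) => //.
    by apply: cvg_within.
  by near=> y; exact: lo_minimiser.
by apply: limr_le => //; near=> y; apply: lo_mono.
Unshelve. all: by end_near. Qed.

Lemma lo_right t x : 0 < t -> exists2 y, minimiser t x y & lo t z @[z --> x^'+] --> y.
Proof.
move=> t0.
have cv : cvg (lo t y @[y --> x^'+]).
  apply: nondecreasing_at_right_is_cvgr.
    by near=> y => a b _ _; exact: lo_mono.
  near=> y; exists (lo t x) => _ [z /= + <-]; rewrite in_itv/= => /andP[xz _].
  by apply: lo_mono => //; exact: ltW.
exists (lim (lo t y @[y --> x^'+])) => //.
apply: (@minimiser_limit t x _ x^'+ (lo t)) => //; first by apply: cvg_within.
by near=> y; exact: lo_minimiser.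
Unshelve. all: by end_near. Qed.

(** A point with several minimisers has a rational number strictly between two of them; by
    monotonicity no two points share such a rational in the sense of the code, so these points are
    countable. *)
Lemma minimiser_ae_unique t : 0 < t ->
  {ae mu, forall x, forall y, minimiser t x y -> y = lo t x}.
Proof.
move=> t0; apply: (@countable_ae _ [set x | exists2 y, minimiser t x y & y != lo t x]).
  apply: (@countable_code _ rat _ (fun x q => lo t x < ratr q /\
    exists2 y, minimiser t x y & ratr q < y)).
    move=> x [y ymin yl]; have ly : lo t x < y by rewrite lt_neqAle eq_sym yl lo_least.
    have [q] := rat_in_itvoo ly; rewrite in_itv/= => /andP[q1 q2].
    by exists q; split => //; exists y.
  have aux x x' q : x < x' -> (lo t x < ratr q /\ exists2 y, minimiser t x y & ratr q < y) ->
      (lo t x' < ratr q /\ exists2 y, minimiser t x' y & ratr q < y) -> False.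
    move=> xx' [_ [y ymin qy]] [h _].
    have := minimiser_mono t0 xx' ymin (lo_minimiser x' t0); lra.
  move=> x x' q _ _ h h'; case: (ltgtP x x') => // xx'; first by case: (aux _ _ _ xx' h h').
  by case: (aux _ _ _ xx' h' h).
move=> x nx y ymin; apply/eqP/negPn/negP => yl; apply: nx; by exists y.
Qed.

Definition laxo t x := if 0 < t then u0 (lo t x) else u0 x.

Lemma laxo_le t x : `|laxo t x| <= M.
Proof. by rewrite /laxo; case: ifP => _; case: du. Qed.

(* z(t, x-) and z(t, x+) are the slopes of the extreme minimisers; if they had
   different Rankine-Hugoniot speeds, s |-> min K(s, g(s)) would have a strict
   concave kink at t. *)
Lemma laxo_entropy T : entropy_conditions T laxo.
Proof.
move=> g _; pose h s := K s (g s) (lo s (g s)).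
apply: (countable_ae (kink_countable h)) => t nkink /andP[t0 tT] dg zl zr.
set x := g t; set g' := derive1 g t => zl_lim zr_lim zlr.
have laxE : laxo t = u0 \o lo t by apply/funext => y; rewrite /laxo t0.
have [yr yr_min yr_lim] := lo_right x t0.
have zlE : zl = u0 (lo t x).
  have h1 : laxo t y @[y --> x^'-] --> u0 (lo t x).
    by rewrite laxE; apply: (@continuous_cvg _ _ _ _ _ (lo t) u0); [exact: cu|exact: lo_left].
  exact: (cvg_unique _ zl_lim h1).
have zrE : zr = u0 yr.
  have h1 : laxo t y @[y --> x^'+] --> u0 yr.
    by rewrite laxE; apply: (@continuous_cvg _ _ _ _ _ (lo t) u0); [exact: cu|exact: yr_lim].
  exact: (cvg_unique _ zr_lim h1).
have sl := minimiser_slope t0 (lo_minimiser x t0); have sr := minimiser_slope t0 yr_min.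
have yy : lo t x < yr.
  rewrite lt_neqAle lo_least// andbT; apply: contra zlr => /eqP e.
  by rewrite zlE zrE e.
have zlr' : zr < zl.
  by rewrite zlE zrE sl sr ltr_pM2r ?invr_gt0//; lra.
pose ph y s := K s (g s) y.
(* The cost of a fixed minimiser along the curve, differentiated at t; the first-order condition
   turns its slope into u0(y) g' - u0(y)^2 / 2. *)
have dph y : u0 y = (x - y) / t -> is_derive t 1 (ph y) (u0 y * g' - u0 y ^+ 2 / 2).
  move=> uy; have dg' : is_derive t 1 g g' by exact: derivable_is_derive1.
  have t20 : 2 * t != 0 by rewrite mulf_neq0 ?gt_eqF.
  have d2 : is_derive t 1 (fun s => 2 * s) 2.
    by apply: is_derive_eq; rewrite /GRing.scale/=; ring.
  have d3 : is_derive t 1 (fun s => (g s - y) ^+ 2) (2 * (x - y) * g').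
    by apply: is_derive_eq; rewrite /GRing.scale/= ?expr1 -/x; ring.
  have := quot_derive d3 d2 t20; set k := _ - _ => d4.
  have kE : k = u0 y * g' - u0 y ^+ 2 / 2 by rewrite /k uy -/x; field; rewrite gt_eqF.
  rewrite -kE /ph /cost.
  have := is_deriveD (is_derive_cst (U0 y) t 1) d4; rewrite add0r; exact.
have hle y s : 0 < s -> h s <= ph y s by move=> s0; exact: lo_minimiser.
have hl : h t = ph (lo t x) t by [].
have hr : h t = ph yr t.
  by apply/le_anti/andP; split; [exact: hle|exact: yr_min].
have dl := dph _ sl; have dr := dph _ sr.
have posd d : 0 < d -> exists2 d' : R, 0 < d' & forall s, `|s - t| < d' -> 0 < s /\ `|s - t| < d.
  move=> d0; exists (Num.min d t); first by rewrite lt_min d0.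
  move=> s; rewrite lt_min => /andP[sd]; rewrite ltr_norml => /andP[]; split => //; lra.
rewrite zlE zrE; rewrite zlE zrE in zlr'.
(* Equal slopes are the Rankine-Hugoniot relation: g' is the mean of the two traces, hence strictly
   between them. Otherwise a rational slope separates them, and [h], which lies below both branches
   and meets them at t, has a kink there. *)
suff E : u0 (lo t x) * g' - u0 (lo t x) ^+ 2 / 2 = u0 yr * g' - u0 yr ^+ 2 / 2.
  have : (u0 (lo t x) - u0 yr) * (g' - (u0 (lo t x) + u0 yr) / 2) = 0 by lra.
  move/eqP; rewrite mulf_eq0 subr_eq0 (gt_eqF zlr')/= subr_eq0 => /eqP E2.
  by split; rewrite E2; lra.
apply/eqP/negPn/negP => /eqP/eqP; rewrite neq_lt => /orP[] lt_lr; apply: nkink.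
- have [a] := rat_in_itvoo lt_lr; rewrite in_itv/= => /andP[a1 a2]; exists a.
  have [d1 d10 H1] := derive_slope_right dl a1.
  have [d2 d20 H2] := derive_slope_left dr a2.
  have d0 : 0 < Num.min d1 d2 by rewrite lt_min d10.
  have [d d'0 H] := posd _ d0; exists d => // s st std; have [s0] := H s std.
  rewrite lt_min => /andP[sd1 sd2]; case/orP: (lt_total st) => s_t.
    have := hle yr s s0; have := H2 s s_t sd2; rewrite hr; lra.
  have := hle (lo t x) s s0; have := H1 s s_t sd1; rewrite hl; lra.
- have [a] := rat_in_itvoo lt_lr; rewrite in_itv/= => /andP[a1 a2]; exists a.
  have [d1 d10 H1] := derive_slope_right dr a1.
  have [d2 d20 H2] := derive_slope_left dl a2.
  have d0 : 0 < Num.min d1 d2 by rewrite lt_min d10.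
  have [d d'0 H] := posd _ d0; exists d => // s st std; have [s0] := H s std.
  rewrite lt_min => /andP[sd1 sd2]; case/orP: (lt_total st) => s_t.
    have := hle (lo t x) s s0; have := H2 s s_t sd2; rewrite hl; lra.
  have := hle yr s s0; have := H1 s s_t sd1; rewrite hr; lra.
Qed.

End lax_oleinik.

(** * Bound, support and variation of the initial datum *)

Section initial_datum.
Context {R : realType}.
Local Notation mu := (@lebesgue_measure R).
Implicit Types (x y a b : R).

Lemma weak_derivative_restrict (u g : R -> R) a b : weak_derivative setT u g ->
  weak_derivative `]a, b[ u g.
Proof.
move=> ug phi tphi; have [sphi [K [cK Kab phi0]]] := tphi.
have out x : x \notin `]a, b[ -> phi x = 0 /\ derive1 phi x = 0.
  move=> xab; have nK : ~ K x by move=> /Kab; rewrite /= (negbTE xab).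
  split; first exact: phi0.
  apply: derive1_locally0; have oK : open (~` K).
    by apply: closed_openC; apply: compact_closed => //; exact: Rhausdorff.
  by apply: filterS (open_nbhs_nbhs (conj oK nK)) => y; exact: phi0.
have tT : test1 setT phi by split => //; exists K.
have := ug phi tT; rewrite !Rintegral_itv.
rewrite (_ : \int[mu]_x (u x * _ * _) = \int[mu]_x (u x * derive1 phi x)); last first.
  apply: eq_Rintegral => x _; case: (boolP (x \in `]a, b[)) => [|/out[_ ->]].
    by rewrite mulr1.
  by rewrite !mulr0.
rewrite (_ : \int[mu]_x (g x * _ * _) = \int[mu]_x (g x * phi x))//.
apply: eq_Rintegral => x _; case: (boolP (x \in `]a, b[)) => [|/out[-> _]].
  by rewrite mulr1.
by rewrite !mulr0.
Qed.

Lemma L2_itv_integrable (g : R -> R) a b : L2 setT g -> mu.-integrable `]a, b[ (EFin \o g).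
Proof.
move=> [mg ig].
have m1 : measurable (`]a, b[%classic : set R) by exact: measurable_itv.
have fin : (mu `]a, b[%classic < +oo)%E.
  by rewrite /= lebesgue_measure_itv/=; case: ifP => _; rewrite ?ltry.
have i1 : mu.-integrable `]a, b[ (EFin \o (fun x => 1 + g x ^+ 2)).
  apply: (@intRD _ _ R mu _ m1).
    by apply: (@intR_finite _ _ R mu _ m1 _ 1) => // x _; rewrite normr1.
  exact: (integrableS measurableT).
apply: (@intR_le _ _ R mu _ m1 _ _ _ i1).
  exact: measurable_funS mg.
move=> x _; have := sqr_ge0 (`|g x| - 1); rewrite -[g x ^+ 2](real_normK (num_real _)).
have := normr_ge0 (g x); nra.
Qed.

Lemma prim_abs_dominates (G : R -> R) x y : mu.-integrable setT (EFin \o G) -> x <= y ->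
  `|prim G y - prim G x| <= prim (fun t => `|G t|) y - prim (fun t => `|G t|) x.
Proof.
move=> iG xy; have iA := intR_abs iG.
have i1 := integrable_below x iG; have i2 := integrable_below y iG.
have j1 := integrable_below x iA; have j2 := integrable_below y iA.
rewrite !primE -!RintegralB//.
apply: (le_trans (le_normr_Rintegral _ _)) => //; first exact: intRB.
apply: le_Rintegral => //; [exact/intR_abs/intRB|exact: intRB|].
move=> t _; rewrite -!mulrBr normrM ler_wpM2l// /below ler_norml.
have : (t <= x)%R%:R <= (t <= y)%R%:R :> R.
  by case: (leP t x) => [tx|_]; rewrite ?ler0n// (le_trans tx xy).
by move=> h; apply/andP; split; lra.
Qed.

Lemma H1c_datum (u0 : R -> R) : H1c u0 -> exists N M, [/\ 0 <= N, datum N M u0 &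
  exists2 k : R -> R, exists C : R, forall x, `|k x| <= C &
    forall x y, x <= y -> `|u0 y - u0 x| <= k y - k x].
Proof.
move=> [cu [_ [g [Lg wg]]] [K [cK K0]]].
have [M0 [_ HM]] := compact_bounded cK.
pose N := `|M0| + 1.
have N0 : 0 <= N by rewrite addr_ge0.
have uN x : N < `|x| -> u0 x = 0.
  move=> Nx; apply: K0 => Kx; have := HM N _ x Kx.
  have MN : M0 < N by rewrite (le_lt_trans (ler_norm M0))// ltrDl.
  by move=> /(_ MN) /(lt_le_trans Nx); rewrite ltxx.
have bu := bcs_continuous cu uN; have [_ [M uM]] := bu.
exists N, M; split => //; first by split => // x; exact: (uM x).1.
pose a := - (N + 1); pose b := N + 1.
have ab : a < b by rewrite /a /b; lra.
have ig := L2_itv_integrable a b Lg.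
have [iG uE] := weak_derivative_prim ab (continuous_subspaceT cu) ig (weak_derivative_restrict wg).
move: iG uE; set G := fun x => _ => iG uE.
have N1 : N < N + 1 by rewrite ltrDl.
have ua : u0 a = 0 by apply: uN; rewrite /a normrN ger0_norm ?addr_ge0.
have ub : u0 b = 0 by apply: uN; rewrite /b ger0_norm ?addr_ge0.
have Gout y : y \notin `]a, b[ -> G y = 0 by rewrite /G => /negbTE ->; rewrite mulr0.
have uG x : u0 x = prim G x.
  have [xa|ax] := leP x a.
    rewrite uN; last by rewrite (lt_le_trans N1)// -normrN (le_trans _ (ler_norm _))// lerNr.
    rewrite (prim_below (a := a))// => y ya; apply: Gout.
    by rewrite in_itv/= ltNge ya.
  have [xb|bx] := leP x b.
    by rewrite uE ?ua ?add0r// in_itv/= xb ltW.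
  rewrite uN; last by rewrite (lt_trans N1)// (lt_le_trans bx)// ler_norm.
  have Gb y : b < y -> G y = 0 by move=> yb; apply: Gout; rewrite in_itv/= (le_gtF (ltW yb)) andbF.
  rewrite (prim_above Gb (ltW bx)) -(prim_above Gb (lexx b)).
  by have := uE b; rewrite ub ua add0r => ->//; rewrite in_itv/= lexx ltW.
exists (prim (fun t => `|G t|)); last by move=> x y xy; rewrite !uG; exact: prim_abs_dominates.
exists (\int[mu]_x (`|(`|G x|)|)) => x; exact/prim_le/intR_abs.
Qed.

End initial_datum.

(** * Joint measurability from continuity in time *)

Section strip_measurability.
Context {R : realType}.
Implicit Types (t s x : R).

Lemma measurable_fst_comp (f : R -> R) : measurable_fun setT f ->
  measurable_fun setT (fun p : R * R => f p.1).
Proof. by move=> mf; exact: (measurableT_comp mf measurable_fst). Qed.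

Lemma measurable_snd_comp (f : R -> R) : measurable_fun setT f ->
  measurable_fun setT (fun p : R * R => f p.2).
Proof. by move=> mf; exact: (measurableT_comp mf measurable_snd). Qed.

(** Freezing time at the grid point k/(n+1) to its left makes F a finite sum of products of a
    function of t and one of x; continuity in time gives convergence. [G] is cut to 0 beyond T,
    where F is not controlled. *)
Lemma strip_measurable T (F : R -> R -> R) : 0 < T ->
  (forall t, timeI T t -> measurable_fun setT (F t)) ->
  (forall t x, timeI T t -> F s x @[s --> within (timeI T) (nbhs t)] --> F t x) ->
  measurable_fun (strip T) (fun p => F p.1 p.2).
Proof.
move=> T0 mF cF.
pose G k x := if k < T then F k x else 0.
have mG (k : R) : 0 <= k -> measurable_fun setT (G k).
  move=> k0; rewrite /G; case: (ltP k T) => kT; last exact: measurable_cst.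
  by apply: mF; rewrite /timeI/= in_itv/= k0.
pose i n k := `[k%:R / n.+1%:R, k.+1%:R / n.+1%:R[ : interval R.
pose K n := (Num.bound (T * n.+1%:R)).+1.
pose H n (p : R * R) := \sum_(k < K n) (p.1 \in i n k)%:R * G (k%:R / n.+1%:R) p.2.
apply: (@measurable_fun_cvg _ _ _ _ H).
  move=> n; apply: measurable_funTS; apply: measurable_sum => k.
  apply: measurable_funM.
    exact: (measurable_fst_comp (measurable_mem_itv (i n k))).
  by apply: measurable_snd_comp; apply: mG; exact: divr_ge0.
move=> [t x] [/= tI _]; have := tI; rewrite /timeI/= in_itv/= => /andP[t0 tT].
pose tn n : R := (Num.truncn (t * n.+1%:R))%:R / n.+1%:R.
have tn_le n : tn n <= t < tn n + n.+1%:R^-1.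
  have := @truncn_itv R (t * n.+1%:R); rewrite mulr_ge0// => /(_ isT)/andP[h1 h2].
  rewrite /tn ler_pdivrMr ?ltr0n// h1/= -[X in _ < _ + X]mul1r -mulrDl natr1.
  by rewrite ltr_pdivlMr ?ltr0n.
have tn0 n : 0 <= tn n by exact: divr_ge0.
have tnT n : tn n < T by case/andP: (tn_le n) => h _; exact: le_lt_trans tT.
have HE n : H n (t, x) = F (tn n) x.
  have h1 : (Num.truncn (t * n.+1%:R) < K n)%N.
    rewrite ltnS -(ler_nat R) (@le_trans _ _ (t * n.+1%:R))//.
      by have /andP[] := @truncn_itv R (t * n.+1%:R) (mulr_ge0 t0 (ler0n _ _)).
    rewrite (le_trans _ (ltW (archi_boundP _))) ?mulr_ge0 ?(ltW T0)//.
    by rewrite ler_wpM2r// ltW.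
  rewrite /H (bigD1 (Ordinal h1))//= big1 ?addr0.
    have -> : t \in i n (Num.truncn (t * n.+1%:R)).
      rewrite in_itv/=; case/andP: (tn_le n) => -> /=.
      by rewrite /tn -[X in _ / _ + X]mul1r -mulrDl natr1.
    by rewrite mul1r /G -/(tn n) tnT.
  move=> k kn; rewrite (_ : _ \in _ = false) ?mul0r//; apply/negbTE; apply: contra kn.
  rewrite in_itv/= ler_pdivrMr ?ltr0n// ltr_pdivlMr ?ltr0n// => kt.
  by apply/eqP/val_inj => /=; apply/esym/eqP; rewrite truncn_eq ?mulr_ge0.
under eq_fun do rewrite HE.
have tnt : tn n @[n --> \oo] --> t.
  apply: (@squeeze_cvgr _ _ _ _ (fun n => t - n.+1%:R^-1) (fun=> t)).
  - by apply: nearW => n; have /andP[h1 h2] := tn_le n; rewrite h1 andbT lerBlDr ltW.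
  - rewrite -[X in _ --> X]subr0; apply: cvgB; first exact: cvg_cst.
    exact: cvg_harmonic.
  - exact: cvg_cst.
have tnw : tn n @[n --> \oo] --> within (timeI T) (nbhs t).
  move=> A hA.
  have h : \forall n \near \oo, timeI T (tn n) -> A (tn n) by exact: tnt _ hA.
  change (\forall n \near \oo, A (tn n)); apply: filterS h => n; apply.
  by rewrite /timeI/= in_itv/= tn0 tnT.
exact: (cvg_comp _ _ tnw (cF t x tI)).
Qed.

End strip_measurability.

(** * Variation and measurability of the Lax-Oleinik formula *)

Section laxo_regularity.
Context {R : realType}.
Local Notation mu := (@lebesgue_measure R).
Implicit Types (x y z s t : R).
Variables (u0 : R -> R) (N M : R).
Hypotheses (N0 : 0 <= N) (du : datum N M u0).

(** f = k - (k - f) is a difference of nondecreasing functions; the second varies by at most twice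
    the variation of k, whence the 3. *)
Lemma variation_dominated (f k : R -> R) a b : a <= b ->
  (forall x y, x <= y -> `|f y - f x| <= k y - k x) ->
  (total_variation a b f <= (3 * (k b - k a))%:E)%E.
Proof.
move=> ab fk.
have mk : {homo k : x y / x <= y}.
  by move=> x y xy; rewrite -subr_ge0; apply: le_trans (fk x y xy).
have mkf : {homo (fun x => k x - f x) : x y / x <= y}.
  move=> x y xy; have := fk x y xy; rewrite ler_norml => /andP[_]; lra.
have h1 := @nondecreasing_total_variation R a b k ab (in2W mk).
have h2 := @nondecreasing_total_variation R a b _ ab (in2W mkf).
rewrite (_ : f = (k \+ (\- (fun x => k x - f x)))%R); last by apply/funext => x /=; ring.
apply: (le_trans (total_variation_le _ _ ab)).
rewrite total_variationN h1 h2 -EFinD lee_fin.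
have := fk a b ab; rewrite ler_norml => /andP[]; lra.
Qed.

Lemma laxo_BV T (k : R -> R) C : (forall x, `|k x| <= C) ->
  (forall x y, x <= y -> `|u0 y - u0 x| <= k y - k x) -> BV_slices T (laxo u0).
Proof.
move=> kC uk; exists (3 * (2 * C)) => t a b _ ab.
have bd x y : 3 * (k y - k x) <= 3 * (2 * C).
  rewrite ler_pM2l//; have := kC x; have := kC y.
  by rewrite !ler_norml => /andP[? ?] /andP[? ?]; lra.
have [t0|t0] := ltP 0 t.
  apply: (le_trans (@variation_dominated _ (fun x => k (lo u0 t x)) _ _ ab _)).
    by move=> x y xy; rewrite /laxo t0; apply: uk; exact: (lo_mono N0 du).
  by rewrite lee_fin.
apply: (le_trans (@variation_dominated _ k _ _ ab _)); last by rewrite lee_fin.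
by move=> x y xy; rewrite /laxo ltNge t0/=; exact: uk.
Qed.

Let U0 := prim u0.
(** The cost times 2 t, which removes the division by t. Its infimum over rational y, [S] below, is
    measurable as a countable infimum, and by continuity it is the true minimum for t > 0. *)
Let C t x y := 2 * t * U0 y + (x - y) ^+ 2.
Let ratn (k : nat) : R := ratr (odflt 0 (unpickle k)).

Let CK t x y : 0 < t -> C t x y = 2 * t * cost u0 t x y.
Proof. by move=> t0; rewrite /C /cost /U0; field; rewrite gt_eqF. Qed.

Let S (p : R * R) := infs (fun k => C p.1 p.2 (ratn k)) 0.

Let lbound_C t x : has_lbound (range (fun k => C t x (ratn k))).
Proof.
have bu := datum_bcs du; have [B _ UB] := bcs_prim_bounded bu.
exists (- (2 * `|t| * B)) => _ [k _ <-]; rewrite /C.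
have := sqr_ge0 (x - ratn k); have h := UB (ratn k).
have : `|2 * t * U0 (ratn k)| <= 2 * `|t| * B.
  by rewrite !normrM ger0_norm// ler_wpM2l// mulr_ge0.
by rewrite ler_norml => /andP[]; lra.
Qed.

Let measurable_S : measurable_fun setT S.
Proof.
apply: measurable_fun_infs; first by move=> p _; exact: lbound_C.
move=> k; apply: measurable_funD.
  apply: measurable_funM; last exact: measurable_cst.
  by apply: (measurable_fst_comp (f := fun t => 2 * t)); apply: measurable_funM.
apply: (measurable_snd_comp (f := fun x => (x - ratn k) ^+ 2)).
by apply: measurable_funX; apply: measurable_funB.
Qed.

Let SE t x : 0 < t -> S (t, x) = C t x (lo u0 t x).
Proof.
move=> t0; have lomin := lo_minimiser N0 du x t0.
have Cmin z : C t x (lo u0 t x) <= C t x z.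
  by rewrite !CK// ler_pM2l ?mulr_gt0.
have nb : nonempty (sdrop (fun k => C t x (ratn k)) 0) by exists (C t x (ratn 0%N)); exists 0%N.
apply/le_anti/andP; split; last first.
  by apply: lb_le_inf => // _ [k _ <-].
apply/ler_addgt0Pr => e e0.
have cC : {for lo u0 t x, continuous (C t x)}.
  have cU : continuous U0 := prim_continuous (bcs_integrable (datum_bcs du)).
  apply: cvgD; first by apply: cvgM; [exact: cvg_cst|exact: cU].
  have h : (x - z) @[z --> lo u0 t x] --> x - lo u0 t x by apply: cvgB; [exact: cvg_cst|exact: cvg_id].
  by rewrite expr2; under eq_fun do rewrite expr2; exact: cvgM.
move/cvgrPdist_lt/(_ _ e0)/nbhs_ballP : cC => [d /= d0 hd].
have lod : lo u0 t x < lo u0 t x + d by rewrite ltrDl.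
have [q] := rat_in_itvoo lod; rewrite in_itv/= => /andP[q1 q2].
have qn : ratn (pickle q) = ratr q by rewrite /ratn pickleK.
have bq : ball (lo u0 t x) d (ratr q) by rewrite /ball/= distrC gtr0_norm ?subr_gt0// ltrBlDl.
have := hd _ bq; rewrite /= ltr_norml => /andP[h _].
apply: (@le_trans _ _ (C t x (ratn (pickle q)))); last by rewrite qn; lra.
apply: ge_inf; last by exists (pickle q).
have [b bP] := lbound_C t x; exists b => _ [k _ <-]; apply: bP; by exists k.
Qed.

(** The envelope theorem: the x-derivative of the minimum of C is 2 (x - lo). Inserting each
    minimiser into the other problem squeezes the left difference quotient, and left continuity of
    [lo] closes the gap. Thus [lo] is a limit of measurable functions. *)
Let lo_limit t x : 0 < t ->
  n.+1%:R / 2 * (S (t, x) - S (t, x - n.+1%:R^-1)) @[n --> \oo] --> x - lo u0 t x.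
Proof.
move=> t0; pose x' n : R := x - n.+1%:R^-1.
have x'x : x' n @[n --> \oo] --> x.
  by rewrite -[X in _ --> X]subr0; apply: cvgB; [exact: cvg_cst|exact: cvg_harmonic].
have x'_lt n : x' n < x by rewrite ltrBlDr ltrDl invr_gt0.
have x'l : x' n @[n --> \oo] --> x^'-.
  move=> A hA; have h : \forall n \near \oo, x' n < x -> A (x' n) by exact: x'x _ hA.
  by change (\forall n \near \oo, A (x' n)); apply: filterS h => n; apply; exact: x'_lt.
have lol : lo u0 t (x' n) @[n --> \oo] --> lo u0 t x .
  by apply: (cvg_comp _ _ x'l); apply: (lo_left N0 du).
have mid : (x + x' n) / 2 @[n --> \oo] --> x.
  rewrite [X in _ --> X](_ : x = (x + x) / 2); last by field.
  apply: cvgM; last exact: cvg_cst.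
  by apply: cvgD => //; exact: cvg_cst.
apply: (@squeeze_cvgr _ _ _ _ (fun n => (x + x' n) / 2 - lo u0 t x)
  (fun n => (x + x' n) / 2 - lo u0 t (x' n))).
- apply: nearW => n; rewrite !SE// -/(x' n).
  have Cmin a z : C t a (lo u0 t a) <= C t a z.
    by rewrite !CK// ler_pM2l ?mulr_gt0//; exact: (lo_minimiser N0 du).
  have h1 := Cmin x (lo u0 t (x' n)); have h2 := Cmin (x' n) (lo u0 t x).
  have n0 : 0 < n.+1%:R / 2 :> R by rewrite divr_gt0.
  have e y : n.+1%:R / 2 * (C t x y - C t (x' n) y) = (x + x' n) / 2 - y.
    have : n.+1%:R != 0 :> R by rewrite pnatr_eq0.
    by rewrite /C /x'; move: (n.+1%:R : R) => m m0; field.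
  by rewrite -!e !ler_pM2l//; apply/andP; split; lra.
- by apply: cvgB => //; exact: cvg_cst.
- exact: cvgB.
Qed.

Lemma measurable_laxo : measurable_fun setT (fun p : R * R => laxo u0 p.1 p.2).
Proof.
pose D := [set p : R * R | 0 < p.1].
have mD : measurable_fun setT (fun p : R * R => 0 < p.1).
  by apply: measurable_fun_ltr => //; exact: measurable_fst.
have mD' : measurable D by rewrite -[D]setTI; exact: (mD measurableT [set true]).
have mlo : measurable_fun D (fun p => lo u0 p.1 p.2).
  have h : measurable_fun D (fun p => p.2 - (p.2 - lo u0 p.1 p.2)).
    apply: measurable_funB; first exact: measurable_funTS measurable_snd.
    apply: (@measurable_fun_cvg _ _ _ _ (fun n p => n.+1%:R / 2 * (S p - S (p.1, p.2 - n.+1%:R^-1)))).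
      move=> n; apply: measurable_funTS; apply: measurable_funM; first exact: measurable_cst.
      apply: measurable_funB => //; apply: (measurableT_comp measurable_S).
      apply: measurable_fun_pair; first exact: measurable_fst.
      by apply: measurable_funB; [exact: measurable_snd|exact: measurable_cst].
    by move=> [t x] /= t0; exact: lo_limit.
  by move: h; congr measurable_fun; apply/funext => p; ring.
have mu0 : measurable_fun setT u0 by case: du => cu _ _; exact: continuous_measurable_fun.
rewrite /laxo; apply: measurable_fun_if => //.
- rewrite setTI; apply: (measurableT_comp mu0).
  by move: mlo; congr measurable_fun.
- by apply: measurable_funTS; exact: measurable_snd_comp.
Qed.

End laxo_regularity.

(** The z for which x + s z lies within r of y fill an interval of length 2 r / s, on which the
    weight is at least k. *)
Lemma weight_mass_ge {R : realType} (W : R -> R) k x y s r : 0 <= k -> 0 < s -> 0 < r ->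
  (@lebesgue_measure R).-integrable setT (EFin \o W) -> (forall z, 0 <= W z) ->
  (forall z, `|y - (x + s * z)| <= r -> k <= W z) ->
  k * (2 * r / s) <= \int[@lebesgue_measure R]_z W z.
Proof.
move=> k0 s0 r0 iW W0 Wk; pose a := (y - x - r) / s; pose b := (y - x + r) / s.
have ab : a <= b by rewrite ler_pM2r ?invr_gt0//; lra.
have -> : 2 * r / s = b - a by rewrite /a /b; field; rewrite gt_eqF.
rewrite -Rintegral_indic_itv// -RintegralZl//; last exact/bcs_integrable/bcs_indic.
apply: le_Rintegral => //; first exact/intRZ/bcs_integrable/bcs_indic.
move=> z _; rewrite indicE; case: (boolP (z \in `[a, b]%classic)) => [|_]; last by rewrite mulr0.
rewrite mulr1 inE/= in_itv/= /a /b ler_pdivrMr// ler_pdivlMr// => /andP[z1 z2].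
apply: Wk; rewrite ler_norml; move: z1 z2; rewrite ![z * s]mulrC => z1 z2.
by apply/andP; split; lra.
Qed.

(** * The inviscid limit *)

Section laplace.
Context {R : realType}.
Local Notation mu := (@lebesgue_measure R).
Implicit Types (x y z s t e nu : R).
Variables (u0 : R -> R) (N M : R).
Hypotheses (N0 : 0 <= N) (du : datum N M u0).
Variables (t x : R).
Hypotheses (t0 : 0 < t) (uniq_min : forall y, minimiser u0 t x y -> y = lo u0 t x).

Local Notation K := (cost u0 t x).
Local Notation y0 := (lo u0 t x).
Let m := K y0.
Let B := M * (2 * N).

Let U0B y : `|prim u0 y| <= B.
Proof. by case: (du) => _ ? ?; apply: prim_le_support => //; exact: datum_bcs du. Qed.

Let mmin y : m <= K y. Proof. exact: (lo_minimiser N0 du x t0). Qed.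

Let mB : 0 <= m + B.
Proof.
have := U0B y0; rewrite ler_norml => /andP[h _]; rewrite /m /cost.
have : 0 <= (x - y0) ^+ 2 / (2 * t) by rewrite divr_ge0 ?sqr_ge0// mulr_ge0// ltW.
lra.
Qed.

(** Coercivity settles the points far from x; on the two compact pieces that remain the minimum is
    attained, and it exceeds m by uniqueness of the minimiser. *)
Lemma cost_gap d : 0 < d -> exists2 c, 0 < c & forall y, d <= `|y - y0| -> m + c <= K y.
Proof.
move=> d0; pose r := 2 * t * (m + 1 + B) + 1 + `|x - y0| + d.
have q0 : 0 <= 2 * t * (m + 1 + B).
  by rewrite mulr_ge0//; [rewrite mulr_ge0// ltW|move: mB; lra].
have x0 := normr_ge0 (x - y0).
have r1 : 1 <= r by rewrite /r; lra.
have xy : `|x - y0| + d <= r by rewrite /r; lra.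
have far y : r < `|x - y| -> m + 1 <= K y.
  move=> h; have h2 : 2 * t * (m + 1 + B) <= (x - y) ^+ 2.
    rewrite -real_normK ?num_real//; apply: (@le_trans _ _ (r ^+ 2)).
      by apply: (@le_trans _ _ r); [rewrite /r; lra|rewrite expr2 ler_peMl// (le_trans ler01)].
    by rewrite lerXn2r ?nnegrE ?(le_trans ler01 r1)// ltW.
  have : m + 1 + B <= (x - y) ^+ 2 / (2 * t) by rewrite ler_pdivlMr ?mulr_gt0// mulrC.
  by have := U0B y; rewrite ler_norml /cost => /andP[]; lra.
have gt y : y != y0 -> m < K y.
  move=> yy0; rewrite lt_neqAle mmin andbT; apply: contra yy0 => /eqP E.
  by apply/eqP/uniq_min => z; rewrite -E; exact: mmin.
have := xy; have := ler_norm (x - y0); have := ler_norm (y0 - x); rewrite distrC => n1 n2 n3.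
have cK : continuous K := @cost_continuous _ u0 N M du t x.
have a1 : y0 + d <= x + r by lra.
have a2 : x - r <= y0 - d by lra.
have [y1 y1i y1m] := @EVT_min R K _ _ a1 (continuous_subspaceT cK).
have [y2 y2i y2m] := @EVT_min R K _ _ a2 (continuous_subspaceT cK).
have k1 : m < K y1.
  by apply: gt; move: y1i; rewrite in_itv/= => /andP[h _]; rewrite gt_eqF// (lt_le_trans _ h)// ltrDl.
have k2 : m < K y2.
  by apply: gt; move: y2i; rewrite in_itv/= => /andP[_ h]; rewrite lt_eqF// (le_lt_trans h)// gtrBl.
exists (Num.min 1 (Num.min (K y1 - m) (K y2 - m))).
  by rewrite !lt_min ltr01 !subr_gt0 k1 k2.
move=> y yd; have [yr|yr] := leP `|x - y| r; last first.
  by apply: le_trans (far y yr); rewrite lerD2l ge_min lexx.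
move: yr; rewrite ler_norml => /andP[r2 r3].
have [yy|yy] := leP y0 y.
  apply: (@le_trans _ _ (K y1)); last first.
    apply: y1m; rewrite in_itv/=; move: yd; rewrite ger0_norm ?subr_ge0// => yd.
    by apply/andP; split; lra.
  by rewrite -lerBrDl !ge_min lexx orbT.
apply: (@le_trans _ _ (K y2)); last first.
  apply: y2m; rewrite in_itv/=; move: yd; rewrite ltr0_norm ?subr_lt0// => yd.
  by apply/andP; split; lra.
by rewrite -lerBrDl !ge_min lexx !orbT.
Qed.

Let W nu z := expR (- (K (x + chs nu t * z) - m) / (2 * nu)).

(** For y = x + s z the Gaussian exponent z^2 equals (x - y)^2 / (4 nu t), so Cole-Hopf weight and
    Gaussian combine into exp(-K/(2 nu)). The common factor exp(-m/(2 nu)) cancels in the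
    quotient. *)
Let weight nu z : 0 < nu ->
  chq0 nu u0 (x + chs nu t * z) * gau z = expR (- m / (2 * nu)) * W nu z.
Proof.
move=> nu0; rewrite /chq0 /gau /W -!expRD; congr expR; rewrite /cost /cha.
have -> : (x - (x + chs nu t * z)) ^+ 2 = 4 * nu * t * z ^+ 2.
  have <- : chs nu t ^+ 2 = 4 * nu * t by rewrite sqr_sqrtr// !mulr_ge0// ltW.
  by ring.
by field; rewrite !gt_eqF.
Qed.

(** [colehopf] is a mean of u0(x + s z) with weight W. Within d of the minimiser u0 varies by at
    most e/2; beyond it the weight is smaller than exp(-3c/(8 nu)) times a fixed Gaussian, while the
    total mass is at least of order exp(-c/(8 nu)) / s. *)
Lemma laplace : colehopf nu u0 t x @[nu --> 0^'+] --> u0 y0.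
Proof.
have [cu uN uM] := du; have M0 : 0 <= M by apply: le_trans (uM 0).
apply/cvgrPdist_le => e e0.
have e2 : 0 < e / 2 by rewrite divr_gt0.
have := cu y0 => /cvgrPdist_le/(_ _ e2)/nbhs_ballP[d /= d0 ud].
have [c c0 cP] := cost_gap d0.
have c4 : 0 < c / 4 by rewrite divr_gt0.
have := @cost_continuous _ u0 N M du t x y0.
move=> /cvgrPdist_le/(_ _ c4)/nbhs_ballP[r' /= r'0 Kr].
pose r := r' / 2; have r0 : 0 < r by rewrite divr_gt0.
have rr : r < r' by rewrite /r ltr_pdivrMr// ltr_pMr// ltr1n.
(* A fraction kp of the cost supplies a Gaussian in z that does not depend on nu; the rest still
   exceeds the minimum by 3c/4, since kp (c + m + B) = c/4. *)
pose kp := c / (4 * (c + (m + B))).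
have cmB : 0 < c + (m + B) by move: mB; lra.
have kp0 : 0 < kp by rewrite divr_gt0// mulr_gt0.
have kpE : kp * (c + (m + B)) = c / 4 by rewrite /kp; field; rewrite gt_eqF.
pose Gk := \int[mu]_z expR (- kp * z ^+ 2).
have iG := gau_th_integrable kp0.
have Gk0 : 0 <= Gk by apply: Rintegral_ge0 => z _; exact: expR_ge0.
pose Cst := M * Gk * Num.sqrt (4 * t) / r * (4 / c).
have Cst0 : 0 <= Cst by rewrite !mulr_ge0 ?invr_ge0 ?sqrtr_ge0 ?(ltW r0) ?(ltW c0).
pose dl := Num.min 1 (e / (2 * (Cst + 1))).
have dl0 : 0 < dl by rewrite lt_min ltr01 divr_gt0// mulr_gt0// ltr_wpDl.
near=> nu.
have nu0 : 0 < nu by near: nu; exact: nbhs_right_gt.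
have nudl : nu < dl by near: nu; exact: nbhs_right_lt.
have nu1 : nu <= 1 by rewrite (le_trans (ltW nudl))// ge_min lexx.
have nuC : Cst * nu <= e / 2.
  have : nu <= e / (2 * (Cst + 1)) by rewrite (le_trans (ltW nudl))// ge_min lexx orbT.
  rewrite ler_pdivlMr ?mulr_gt0 ?ltr_wpDl// => h.
  have := ltW nu0; move: h; lra.
set s := chs nu t; have s0 : 0 < s by rewrite sqrtr_gt0 !mulr_gt0.
have sle : s <= Num.sqrt (4 * t).
  by rewrite ler_wsqrtr// ler_wpM2r ?(ltW t0)// ler_piMr.
have n2 : 0 < 2 * nu by rewrite mulr_gt0.
have [cq qb qM cvq vqM] := datum_chq0 nu0 N0 du.
pose E := expR (- m / (2 * nu)); have E0 : 0 < E := expR_gt0 _.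
have i0 := gavg_integrable s x cq qM.
have iW : mu.-integrable setT (EFin \o W nu).
  have := intRZ measurableT E^-1 i0; congr (_.-integrable _ _); apply/funext => z /=.
  by rewrite weight// mulKf// gt_eqF.
have i1 := gavg_integrable s x cvq vqM.
have denE : gavg (chq0 nu u0) s x = E * \int[mu]_z W nu z.
  by rewrite -RintegralZl//; apply: eq_Rintegral => z _; exact: weight.
pose far := 2 * M * expR (- (3 * c / (8 * nu))).
have cW : continuous (W nu).
  move=> z; apply: continuous_cvg; first exact: continuous_expR.
  apply: cvgM; last exact: cvg_cst.
  apply: cvgN; apply: cvgB; last exact: cvg_cst.
  apply: (@cont_shift _ K s x); exact: (@cost_continuous _ u0 N M du t x).
pose dv z := u0 (x + s * z) - u0 y0.
have dvb z : `|dv z * W nu z| <= e / 2 * W nu z + far * expR (- kp * z ^+ 2).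
  have W0 : 0 <= W nu z := expR_ge0 _.
  have F0 : 0 <= far * expR (- kp * z ^+ 2) by rewrite !mulr_ge0 ?expR_ge0.
  rewrite normrM (ger0_norm W0).
  have [yd|yd] := ltP `|x + s * z - y0| d.
    have := ud (x + s * z); rewrite /ball/= distrC => /(_ yd) h.
    by rewrite ler_wpDr// ler_wpM2r// /dv distrC.
  apply: ler_wpDl; first by rewrite mulr_ge0// ltW.
  rewrite /far -[leRHS]mulrA ler_pM//.
    have := uM (x + s * z); have := uM y0; have := ler_normB (u0 (x + s * z)) (u0 y0).
    by rewrite -/(dv z); lra.
  rewrite -expRD ler_expR -/s.
  have h1 := cP _ yd; set k := K (x + s * z) in h1 *.
  have h2 : - B + 2 * nu * z ^+ 2 <= k.
    rewrite /k /cost.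
    have -> : (x - (x + s * z)) ^+ 2 / (2 * t) = 2 * nu * z ^+ 2.
      have -> : (x - (x + s * z)) ^+ 2 = s ^+ 2 * z ^+ 2 by ring.
      by rewrite sqr_sqrtr ?mulr_ge0 ?(ltW nu0) ?(ltW t0)//; field; rewrite gt_eqF.
    by rewrite lerD2r; have := U0B (x + s * z); rewrite ler_norml => /andP[].
  have kp4 : kp <= 1.
    rewrite /kp ler_pdivrMr ?mulr_gt0// mul1r; move: mB; lra.
  have h3 : 3 * c / 4 + kp * (2 * nu * z ^+ 2) <= k - m.
    have := ler_wpM2l (ltW kp0) h2.
    have : (1 - kp) * (m + c) <= (1 - kp) * k by rewrite ler_wpM2l// subr_ge0.
    move: kpE; lra.
  have -> : - (3 * c / (8 * nu)) + - kp * z ^+ 2 =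
      - (3 * c / 4 + kp * (2 * nu * z ^+ 2)) / (2 * nu) by field; rewrite gt_eqF.
  by rewrite ler_wpM2r ?invr_ge0 ?(ltW n2)// lerN2.
have mdv : measurable_fun setT (fun z => dv z * W nu z).
  apply: continuous_measurable_fun => z; apply: cvgM; last exact: cW.
  by apply: cvgB; [exact: (@cont_shift _ u0 s x)|exact: cvg_cst].
have ib : mu.-integrable setT (EFin \o (fun z => e / 2 * W nu z + far * expR (- kp * z ^+ 2))).
  by apply: (intRD measurableT); exact: intRZ.
have idv : mu.-integrable setT (EFin \o (fun z => dv z * W nu z)).
  by apply: (@intR_le _ _ R mu _ measurableT _ _ mdv ib) => z _; exact: dvb.
have num : `|\int[mu]_z (dv z * W nu z)| <= e / 2 * \int[mu]_z W nu z + far * Gk.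
  rewrite (le_trans (le_normr_Rintegral _ idv))//.
  rewrite /Gk -!RintegralZl// -RintegralD//; [|exact: intRZ|exact: intRZ].
  by apply: le_Rintegral => //; exact: intR_abs.
have W_near z : `|y0 - (x + s * z)| <= r -> expR (- (c / (8 * nu))) <= W nu z.
  move=> yr; have := Kr (x + s * z); rewrite /ball/= => /(_ (le_lt_trans yr rr)).
  rewrite ler_norml => /andP[h _].
  rewrite /W ler_expR -/s -/m; rewrite -/m in h.
  have -> : - (c / (8 * nu)) = - (c / 4) / (2 * nu) by field; rewrite gt_eqF.
  rewrite ler_wpM2r ?invr_ge0 ?(ltW n2)// lerN2.
  by rewrite -lerN2 opprB.
have den := weight_mass_ge (expR_ge0 _) s0 r0 iW (fun z => expR_ge0 _) W_near.
have D0 : 0 < \int[mu]_z W nu z.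
  by apply: lt_le_trans den; rewrite mulr_gt0 ?expR_gt0// divr_gt0// mulr_gt0.
have -> : u0 y0 - colehopf nu u0 t x = - (\int[mu]_z (dv z * W nu z)) / \int[mu]_z W nu z.
  rewrite /colehopf -/s denE.
  have -> : gavg (fun y => u0 y * chq0 nu u0 y) s x =
      E * (\int[mu]_z (dv z * W nu z) + u0 y0 * \int[mu]_z W nu z).
    rewrite -[u0 y0 * _]RintegralZl// -RintegralD//; last exact: intRZ.
    rewrite -RintegralZl//; last by apply: (intRD measurableT) => //; exact: intRZ.
    apply: eq_Rintegral => z _; rewrite -mulrA weight// -/E /dv; ring.
  by move: (\int[mu]_z (dv z * W nu z)) (\int[mu]_z W nu z) (u0 y0) D0 => I1 I2 u I20; field; rewrite !gt_eqF.
rewrite normrM normrN normfV (gtr0_norm D0) ler_pdivrMr//.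
apply: (le_trans num).
(* The exponentials leave exp(-c/(4 nu)), and exp(-y) <= 1/y makes this linear in nu; the factor s
   is bounded by sqrt(4 t) as nu <= 1. *)
have farE : far * Gk <= Cst * nu * (expR (- (c / (8 * nu))) * (2 * r / s)).
  have cn : 0 < c / (4 * nu) by rewrite divr_gt0// mulr_gt0.
  have h1 : expR (- (c / (4 * nu))) <= 4 * nu / c.
    rewrite expRN (_ : 4 * nu / c = (c / (4 * nu))^-1); last by rewrite invf_div.
    rewrite lef_pV2 ?posrE ?expR_gt0//.
    by rewrite (le_trans _ (expR_ge1Dx _))// lerDr.
  have h2 : expR (- (3 * c / (8 * nu))) = expR (- (c / (4 * nu))) * expR (- (c / (8 * nu))).
    by rewrite -expRD; congr expR; field; rewrite gt_eqF.
  have -> : far * Gk = (2 * M * Gk * expR (- (c / (8 * nu)))) * expR (- (c / (4 * nu))).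
    by rewrite /far h2; ring.
  have -> : Cst * nu * (expR (- (c / (8 * nu))) * (2 * r / s)) =
      (2 * M * Gk * expR (- (c / (8 * nu)))) * ((4 * nu / c) * (Num.sqrt (4 * t) / s)).
    by rewrite /Cst; move: (Num.sqrt (4 * t)) => q; field; rewrite !gt_eqF.
  rewrite ler_wpM2l ?mulr_ge0 ?expR_ge0// (le_trans h1)// ler_peMr//.
    by rewrite divr_ge0 ?mulr_ge0// ltW.
  by rewrite ler_pdivlMr// mul1r.
apply: (@le_trans _ _ (e / 2 * \int[mu]_z W nu z + e / 2 * \int[mu]_z W nu z)); last first.
  by rewrite -mulrDl -splitr.
rewrite lerD2l (le_trans farE)//; apply: ler_pM => //.
  by apply: mulr_ge0 => //; exact: ltW.
apply: mulr_ge0; first exact: expR_ge0.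
by apply: divr_ge0; [apply: mulr_ge0 => //; exact: ltW|exact: ltW].
Unshelve. all: by end_near. Qed.

End laplace.

(** * Test functions on the strip *)

Section test_functions.
Context {R : realType}.
Local Notation mu := (@lebesgue_measure R).
Implicit Types (t s x b X : R) (psi : R -> R -> R).

Definition vanish T b X psi := forall t x, timeI T t -> b < t \/ X < `|x| -> psi t x = 0.

Definition jointly_continuous psi := continuous (fun p : R * R => psi p.1 p.2).

Lemma jointly_continuous_t psi t : jointly_continuous psi -> continuous (psi t).
Proof.
move=> cp x; apply: (@continuous_comp _ _ _ (fun x => (t, x)) (fun p : R * R => psi p.1 p.2)).
  by apply: (@cvg_pair _ _ _ (nbhs x) (nbhs t) (nbhs x)); [exact: cvg_cst|exact: cvg_id].
exact: cp.
Qed.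

Lemma jointly_continuous_x psi x : jointly_continuous psi -> continuous (psi ^~ x).
Proof.
move=> cp t; apply: (@continuous_comp _ _ _ (fun t => (t, x)) (fun p : R * R => psi p.1 p.2)).
  by apply: (@cvg_pair _ _ _ (nbhs t) (nbhs t) (nbhs x)); [exact: cvg_id|exact: cvg_cst].
exact: cp.
Qed.

Lemma vanish_bound T b X psi : 0 <= b -> 0 <= X -> jointly_continuous psi ->
  vanish T b X psi -> exists2 C, 0 <= C & forall t x, timeI T t -> `|psi t x| <= C.
Proof.
move=> b0 X0 cp vp.
have cK : compact (`[0, b]%classic `*` `[- X, X]%classic : set (R * R)).
  by apply: compact_setX; exact: segment_compact.
have := compact_bounded (continuous_compact (continuous_subspaceT cp) cK).
move=> [M0 [_ HM]]; exists (`|M0| + 1); first by rewrite addr_ge0.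
move=> t x It; have [tb|tb] := leP t b; last by rewrite vp; [rewrite normr0 addr_ge0| |left].
have [xX|xX] := leP `|x| X; last by rewrite vp; [rewrite normr0 addr_ge0| |right].
apply: HM; first by rewrite (le_lt_trans (ler_norm M0))// ltrDl.
exists (t, x) => //; split => /=; rewrite in_itv/=; last by rewrite -ler_norml.
by move: It; rewrite /timeI/= in_itv/= => /andP[->].
Qed.

(** The time projection of the support is compact and misses T, so it misses a neighbourhood of
    T. *)
Lemma test2_vanish T phi : 0 < T -> test2 T phi ->
  exists b X, [/\ 0 < b, b < T, 0 < X & vanish T b X phi].
Proof.
move=> T0 [_ [K [cK KT K0]]].
have c1 : compact [set p.1 | p in K].
  by apply: continuous_compact cK; apply: continuous_subspaceT => p; exact: cvg_fst.
have [M0 [_ HM]] := compact_bounded (continuous_compact (continuous_subspaceT (fun p => @cvg_snd _ _ (nbhs p.1) (nbhs p.2) _)) cK).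
have nT : (~` [set p.1 | p in K]) T.
  by move=> [p /KT[/= + _] pT]; rewrite pT /timeI/= in_itv/= ltxx andbF.
have o1 : open (~` [set p.1 | p in K]).
  by apply: closed_openC; apply: compact_closed => //; exact: Rhausdorff.
have /nbhs_ballP[d /= d0 hd] := open_nbhs_nbhs (conj o1 nT).
pose dd := Num.min d T / 2.
have m0 : 0 < Num.min d T by rewrite lt_min d0.
have md : Num.min d T <= d by rewrite ge_min lexx.
have mT : Num.min d T <= T by rewrite ge_min lexx orbT.
exists (T - dd), (`|M0| + 1); split; [rewrite /dd; lra|rewrite /dd; lra|by rewrite ltr_wpDl|].
move=> t x It h; apply: (K0 (t, x)) => //= Ktx; case: h => [h|].
  apply: (hd t); last by exists (t, x).
  move: It; rewrite /timeI/= in_itv/= => /andP[_ tT].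
  by rewrite /ball/= gtr0_norm ?subr_gt0//; move: h; rewrite /dd; lra.
rewrite ltNge => /negP; apply; apply: HM; last by exists (t, x).
by rewrite (le_lt_trans (ler_norm M0))// ltrDl.
Qed.

Lemma vanish_x T b X psi : vanish T b X psi -> vanish T b X (partial_x psi).
Proof.
move=> vp t x It h; apply: derive1_locally0; case: h => [h|h].
  by near=> y; apply: vp => //; left.
move: h; rewrite ltr_normr => /orP[h|h]; near=> y; apply: vp => //; right; rewrite ltr_normr.
  by apply/orP; left; near: y; exact: lt_nbhsr.
by apply/orP; right; rewrite ltrNr; near: y; apply: lt_nbhsl; rewrite ltrNr.
Unshelve. all: by end_near. Qed.

(** At t = 0 the derivative sees negative times, where psi is not controlled; its value there is the
    limit of the values at positive times. *)
Lemma vanish_t T b X psi : 0 < b -> b < T -> jointly_continuous (partial_t psi) ->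
  vanish T b X psi -> vanish T b X (partial_t psi).
Proof.
move=> b0 bT ct vp.
have pos t x : 0 < t -> t < T -> b < t \/ X < `|x| -> partial_t psi t x = 0.
  move=> t0 tT h; have I_near : \forall s \near t, timeI T s.
    near=> s; rewrite /timeI/= in_itv/=; apply/andP; split.
      by apply: ltW; near: s; exact: lt_nbhsr.
    by near: s; exact: lt_nbhsl.
  apply: derive1_locally0; case: h => [bt|h].
    by near=> s; apply: vp; [near: s|left; near: s; exact: lt_nbhsr].
  by near=> s; apply: vp; [near: s|right].
move=> t x; rewrite /timeI/= in_itv/= => /andP[]; rewrite le_eqVlt => /predU1P[<-|t0] tT h; last exact: pos.
have cx : partial_t psi s x @[s --> 0^'+] --> partial_t psi 0 x.
  by apply: cvg_at_right_filter; exact: jointly_continuous_x.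
have : partial_t psi s x @[s --> 0^'+] --> (0 : R).
  apply: cvg_near_cst; near=> s; apply: pos.
  - by near: s; exact: nbhs_right_gt.
  - by near: s; exact: nbhs_right_lt.
  - by case: h => [h|]; [have := lt_trans b0 h; rewrite ltxx|right].
by move=> c0; exact: (cvg_unique _ cx c0).
Unshelve. all: by end_near. Qed.

Record box_test T b X C psi : Prop := BoxTest {
  bt_cont : jointly_continuous psi;
  bt_vanish : vanish T b X psi;
  bt_bound : forall t x, timeI T t -> `|psi t x| <= C }.

Lemma test2_box T phi : 0 < T -> test2 T phi -> exists b X C,
  [/\ 0 < b < T, 0 < X, 0 <= C & (forall t x, is_derive t 1 (phi ^~ x) (partial_t phi t x)) /\
     [/\ (forall t x, is_derive x 1 (phi t) (partial_x phi t x)) &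
      forall t x, is_derive x 1 (partial_x phi t) (partial_x (partial_x phi) t x)]] /\
  [/\ box_test T b X C phi, box_test T b X C (partial_t phi), box_test T b X C (partial_x phi) &
      box_test T b X C (partial_x (partial_x phi))].
Proof.
move=> T0 tphi; have [b [X [b0 bT X0 vp]]] := test2_vanish T0 tphi.
have [sphi _] := tphi.
have [c0 [dt dx [ct _] [cx [_ dxx _ [cxx _]]]]] := sphi 2%N.
have vt := vanish_t b0 bT ct vp; have vx := vanish_x vp; have vxx := vanish_x vx.
have [C0 C00 h0] := vanish_bound (ltW b0) (ltW X0) c0 vp.
have [C1 C10 h1] := vanish_bound (ltW b0) (ltW X0) ct vt.
have [C2 C20 h2] := vanish_bound (ltW b0) (ltW X0) cx vx.
have [C3 C30 h3] := vanish_bound (ltW b0) (ltW X0) cxx vxx.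
exists b, X, (C0 + C1 + C2 + C3); split; split.
- by rewrite b0.
- by [].
- by rewrite !addr_ge0.
- split; first by move=> t x; exact: derivable_is_derive1.
  by split=> t x; exact: derivable_is_derive1.
- by split => // t x It; apply: le_trans (h0 t x It) _; rewrite -!addrA lerDl !addr_ge0.
- split => // t x It; apply: le_trans (h1 t x It) _.
  by rewrite -!addrA [leRHS]addrCA lerDl !addr_ge0.
- split => // t x It; apply: le_trans (h2 t x It) _.
  by rewrite -addrA [leRHS]addrCA lerDl !addr_ge0.
- by split => // t x It; apply: le_trans (h3 t x It) _; rewrite lerDr !addr_ge0.
Qed.

End test_functions.

(** * Pairings on the strip, computed slice by slice *)

Section strip_pairing.
Context {R : realType}.
Local Notation mu := (@lebesgue_measure R).
Local Notation mu2 := (@mu2 R).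
Implicit Types (t s x b X C M T : R) (u psi : R -> R -> R).

Lemma measurable_strip T :
  @measurable _ (measurableTypeR R * measurableTypeR R)%type (strip T).
Proof. by apply: measurableX; [exact: measurable_itv|exact: measurableT]. Qed.

Lemma pair2_fubini T u psi :
  mu2.-integrable (strip T) (EFin \o (fun p => u p.1 p.2 * psi p.1 p.2)) ->
  (forall t, timeI T t -> mu.-integrable setT (EFin \o (fun x => u t x * psi t x))) ->
  mu.-integrable setT (EFin \o (fun t => (\int[mu]_x (u t x * psi t x)) * (t \in `[0, T[)%:R)) /\
  pair2 T u psi = \int[mu]_t ((\int[mu]_x (u t x * psi t x)) * (t \in `[0, T[)%:R).
Proof.
move=> i2 i1; pose F (p : R * R) := u p.1 p.2 * psi p.1 p.2 * (p.1 \in `[0, T[)%:R.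
have sP (p : R * R) : strip T p <-> p.1 \in `[0, T[ by split => [[]|].
have iF : mu2.-integrable setT (EFin \o F).
  move/(integrable_mkcond _ (measurable_strip T)) : i2.
  congr (_.-integrable _ _); apply/funext => p; rewrite patchE /F /=.
  case: (boolP (p.1 \in `[0, T[)) => pT.
    by rewrite mulr1 (_ : p \in strip T = true)//; apply/mem_set/sP.
  by rewrite mulr0 (_ : p \in strip T = false)//; apply/negbTE/negP => /set_mem/sP; apply/negP.
have FE t : (fun x => F (t, x)) = (fun x => u t x * psi t x * (t \in `[0, T[)%:R) by [].
have iFt t : mu.-integrable setT (EFin \o (fun x => F (t, x))).
  rewrite FE; case: (boolP (t \in `[0, T[)) => tT.
    by under eq_fun do rewrite mulr1; exact: i1.
  by under eq_fun do rewrite mulr0; exact: (bcs_integrable (@bcs0 R)).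
have FI t : \int[mu]_x F (t, x) = (\int[mu]_x (u t x * psi t x)) * (t \in `[0, T[)%:R.
  rewrite FE; case: (boolP (t \in `[0, T[)) => tT.
    by rewrite mulr1; apply: eq_Rintegral => x _; rewrite mulr1.
  rewrite mulr0 -[RHS](mul0r (fine (mu setT))) -Rintegral_cst//.
  by apply: eq_Rintegral => x _; rewrite mulr0.
split.
  have := integrable_fubini_F iF; congr (_.-integrable _ _); apply/funext => t.
  by rewrite /fubini_F /= -FI RintegralE.
rewrite (_ : pair2 T u psi = \int[mu2]_p F p); last exact: Rintegral_bool.
rewrite (Rintegral_prod iF iFt).
by apply: eq_Rintegral => t _; exact: FI.
Qed.

Definition strip_bounded T M u := [/\ measurable_fun (strip T) (fun p => u p.1 p.2),
  (forall t, timeI T t -> measurable_fun setT (u t)) &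
  forall t x, timeI T t -> `|u t x| <= M].

Lemma box_measurable T b X C psi : 0 < T -> box_test T b X C psi ->
  measurable_fun (strip T) (fun p => psi p.1 p.2).
Proof.
move=> T0 [cp _ _]; apply: strip_measurable => //.
  by move=> t _; apply: continuous_measurable_fun; exact: jointly_continuous_t.
move=> t x _; apply: cvg_within_filter; exact: (jointly_continuous_x (x := x) cp).
Qed.

Lemma box_slice T b X C psi t : 0 < X -> box_test T b X C psi -> timeI T t -> bcs (psi t).
Proof.
move=> X0 [cp vp _] It; apply: (@bcs_continuous _ _ X); first exact: jointly_continuous_t.
by move=> x Xx; apply: vp => //; right.
Qed.

Lemma strip_pair T b X C M u psi : 0 < T -> 0 < X -> 0 <= M -> 0 <= C ->
  strip_bounded T M u -> box_test T b X C psi ->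
  [/\ mu2.-integrable (strip T) (EFin \o (fun p => u p.1 p.2 * psi p.1 p.2)),
      (forall t, timeI T t -> mu.-integrable setT (EFin \o (fun x => u t x * psi t x))) &
      forall t, timeI T t -> `|\int[mu]_x (u t x * psi t x)| <= M * C * (2 * X)].
Proof.
move=> T0 X0 M0 C0 [mU mut uM] bp; have [cp vp pC] := bp.
have uC t x : timeI T t -> `|u t x * psi t x| <= M * C * (x \in `[- X, X])%:R.
  move=> It; rewrite in_itv/= -ler_norml; have [xX|xX] := leP `|x| X.
    by rewrite mulr1 normrM ler_pM ?uM ?pC.
  by rewrite vp//; [rewrite !mulr0 normr0|right].
have bslice t : timeI T t -> bcs (fun x => u t x * psi t x).
  move=> It; have := bcs_bM (box_slice X0 bp It) (mut t It) (fun x => uM t x It).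
  by congr bcs; apply/funext => x; rewrite mulrC.
split.
- have i1 : mu.-integrable setT (EFin \o (fun t : R => (t \in `[0, T])%:R)).
    by have := bcs_integrable (bcs_indic 0 T); rewrite (@indic_bool _ _ _ (fun t : R => t \in `[0, T])).
  have i2 : mu.-integrable setT (EFin \o (fun x : R => (x \in `[- X, X])%:R)).
    by have := bcs_integrable (bcs_indic (- X) X); rewrite (@indic_bool _ _ _ (fun t : R => t \in `[- X, X])).
  have i3 := intRZ measurableT (M * C) (integrable_prodM i1 i2).
  have mS := measurable_strip T.
  have i4 := integrableS measurableT mS (@subsetT _ _) i3.
  apply: (@intR_le _ _ R mu2 _ mS _ _ _ i4).
    by apply: measurable_funM => //; exact: box_measurable bp.
  move=> [t x] [/= It _]; rewrite (le_trans (uC t x It))//.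
  by move: It; rewrite /timeI/= !in_itv/= => /andP[-> /ltW ->]; rewrite mul1r.
- by move=> t It; exact/bcs_integrable/bslice.
- move=> t It; have X0' := ltW X0.
  rewrite -(@prim_above _ _ X X)//; last first.
    by move=> y Xy; rewrite vp ?mulr0//; right; rewrite (lt_le_trans Xy)// ler_norm.
  apply: prim_le_support => //; first exact: bslice.
    by move=> y; rewrite normrM ler_pM ?uM ?pC.
  by move=> y Xy; rewrite vp ?mulr0//; right.
Qed.

(** Dominated convergence in x on each slice, and once more in t. The exceptional null set may
    depend on t. *)
Lemma pair2_cvg T b X C M (un : nat -> R -> R -> R) u psi : 0 < T -> 0 < X -> 0 <= M -> 0 <= C ->
  (forall n, strip_bounded T M (un n)) -> strip_bounded T M u -> box_test T b X C psi ->
  (forall t, 0 < t < T -> {ae mu, forall x, un n t x @[n --> \oo] --> u t x}) ->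
  pair2 T (un n) psi @[n --> \oo] --> pair2 T u psi.
Proof.
move=> T0 X0 M0 C0 bn bu bp cv.
have [j2 j1 jM] := strip_pair T0 X0 M0 C0 bu bp.
have [k1 ->] := pair2_fubini j2 j1.
have H n := strip_pair T0 X0 M0 C0 (bn n) bp.
have iI : mu.-integrable setT (EFin \o (fun t : R => M * C * (2 * X) * (t \in `[0, T])%:R)).
  apply: (intRZ measurableT).
  by have := bcs_integrable (bcs_indic 0 T); rewrite (@indic_bool _ _ _ (fun t : R => t \in `[0, T])).
rewrite (_ : (fun n => pair2 T (un n) psi) = (fun n => \int[mu]_t ((\int[mu]_x (un n t x * psi t x)) * (t \in `[0, T[)%:R))); last first.
  by apply/funext => n; have [j2n j1n _] := H n; have [_ ->] := pair2_fubini j2n j1n.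
apply: (@Rintegral_dominated _ _ R mu setT measurableT _ _ _ _ iI).
- move=> n; have [j2n j1n _] := H n; have [k1n _] := pair2_fubini j2n j1n.
  exact: intR_measurable k1n.
- move=> n t _; have [_ _ jMn] := H n; rewrite normrM; case: (boolP (t \in `[0, T[)) => tT.
    have -> : t \in `[0, T] by move: tT; rewrite !in_itv/= => /andP[-> /ltW->].
    by rewrite normr1 !mulr1; exact: jMn.
  by rewrite normr0 mulr0 !mulr_ge0 ?(ltW X0).
- exact: intR_measurable k1.
apply: (countable_ae (countable1 (0 : R))) => t /= t0 _.
have [tT|tT] := boolP (t \in `[0, T[); last by under eq_fun do rewrite mulr0; rewrite mulr0; exact: cvg_cst.
rewrite mulr1; under eq_fun do rewrite mulr1.
have t0T : 0 < t < T.
  move: tT; rewrite in_itv/= => /andP[h ->]; rewrite lt_neqAle h !andbT eq_sym.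
  exact/eqP.
have bs := box_slice X0 bp tT.
have ia : mu.-integrable setT (EFin \o (fun x => M * `|psi t x|)).
  exact/(intRZ measurableT)/intR_abs/bcs_integrable.
have [_ mut _] := bu.
apply: (@Rintegral_dominated _ _ R mu setT measurableT _ _ _ _ ia).
- move=> n; have [_ mn _] := bn n; apply: measurable_funM; first exact: mn.
  exact: bs.1.
- by move=> n x _; have [_ _ uM] := bn n; rewrite normrM ler_wpM2r ?uM.
- by apply: measurable_funM; [exact: mut|exact: bs.1].
- by apply: (ae_imply1 (cv t t0T)) => x h _; apply: cvgM => //; exact: cvg_cst.
Qed.

End strip_pairing.

(** * Integrals depending on time *)

Section parametric_integrals.
Context {R : realType}.
Local Notation mu := (@lebesgue_measure R).
Implicit Types (t s x a b X C : R) (F : R -> R -> R).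

Lemma C1c_int0 (f f' : R -> R) : C1c f f' -> \int[mu]_x f' x = 0.
Proof. by move=> /C1c_rep[[_ _ h _] _]. Qed.

Lemma box_integrable X C : mu.-integrable setT (EFin \o (fun x => C * (x \in `[- X, X])%:R)).
Proof.
apply: (intRZ measurableT); have := bcs_integrable (bcs_indic (- X) X).
by rewrite (@indic_bool _ _ _ (fun t : R => t \in `[- X, X])).
Qed.

Lemma param_continuous F b X C : 0 <= b ->
  (forall t, 0 <= t <= b -> measurable_fun setT (F t)) ->
  (forall t x, 0 <= t <= b -> `|F t x| <= C * (x \in `[- X, X])%:R) ->
  (forall x, continuous (F ^~ x)) ->
  {within `[0, b], continuous (fun t => \int[mu]_x F t x)}.
Proof.
(* Time is clamped to [0, b], so that the bounds hold at all times and continuity can be shown on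
   the whole line. *)
move=> b0 mF FC cF; pose cl t := Num.max 0 (Num.min b t).
have cl0 t : 0 <= cl t <= b.
  by rewrite /cl le_max lexx/= ge_max b0 ge_min lexx.
have cl_id t : t \in `[0, b] -> cl t = t.
  by rewrite in_itv/= => /andP[t0 tb]; rewrite /cl min_r// max_r.
have ccl : continuous cl.
  move=> t; apply: continuous_max; first exact: cvg_cst.
  by apply: continuous_min; [exact: cvg_cst|exact: cvg_id].
apply: (@subspace_eq_continuous _ _ _ (fun t => \int[mu]_x F (cl t) x)).
  by move=> t; rewrite inE/= => tb; rewrite cl_id.
apply: continuous_subspaceT => t.
apply/(@cvg_nbhsP _ R^o) => w wt.
apply: (@Rintegral_dominated _ _ R mu setT measurableT (fun n x => F (cl (w n)) x) (F (cl t)) _ _ (box_integrable X C)).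
- by move=> n; exact: mF.
- by move=> n x _; exact: FC.
- exact: mF.
- apply: aeW => x _; apply: (@continuous_cvg _ _ _ _ _ (fun n => cl (w n)) (F ^~ x)); first exact: cF.
  by apply: (@continuous_cvg _ _ _ _ _ w cl) => //; exact: ccl.
Qed.

Lemma derive_under_loc F F' G a b t : a < t < b ->
  (forall s, a < s < b -> mu.-integrable setT (EFin \o F s)) ->
  (forall s x, a < s < b -> is_derive s 1 (F ^~ x) (F' s x)) ->
  (forall s x, a < s < b -> `|F' s x| <= G x) -> mu.-integrable setT (EFin \o G) ->
  is_derive t 1 (fun s => \int[mu]_x F s x) (\int[mu]_x F' t x).
Proof.
move=> tab Fi dF F'G Gi.
have IP s : `]a, b[%classic s -> a < s < b by rewrite /= in_itv.
have It : `]a, b[%classic t by rewrite /= in_itv.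
have G0 x : 0 <= G x by apply: le_trans (F'G t x tab).
have d1 s x : a < s < b -> partial1of2 F s x = F' s x.
  by move=> sab; rewrite /partial1of2; have := dF s x sab; exact: is_derive_derive1.
have dFd s x : a < s < b -> derivable (F ^~ x) s 1 by move=> sab; have [] := dF s x sab.
have h s x : `]a, b[%classic s -> setT x -> `|partial1of2 F s x| <= G x.
  by move=> /IP sab _; rewrite d1//; exact: F'G.
have d2 := @derivable_under_integral R _ _ mu F setT measurableT t a b It
  (fun s Is => Fi s (IP s Is)) (fun s x Is _ => dFd s x (IP s Is)) G G0 Gi h.
have d3 := @differentiation_under_integral R _ _ mu F setT measurableT t a b It
  (fun s Is => Fi s (IP s Is)) (fun s x Is _ => dFd s x (IP s Is)) G G0 Gi h.
apply: DeriveDef; first exact: d2.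
rewrite -derive1E d3; apply: eq_Rintegral => x _; exact: d1.
Qed.

End parametric_integrals.

(** * Weak form of the viscous equation for Cole-Hopf solutions *)

Section viscous_weak_form.
Context {R : realType}.
Local Notation mu := (@lebesgue_measure R).
Implicit Types (t s x : R).
Variables (nu T : R) (v0 v1 v2 v3 : R -> R).
Hypotheses (nu0 : 0 < nu) (T0 : 0 < T) (Cv0 : C1c v0 v1) (Cv1 : C1c v1 v2) (Cv2 : C1c v2 v3).
Variables (phi phit phix phixx : R -> R -> R) (b X C : R).
Hypotheses (b0 : 0 < b) (bT : b < T) (X0 : 0 < X) (C0 : 0 <= C).
Hypotheses (dt : forall t x, is_derive t 1 (phi ^~ x) (phit t x))
  (dx : forall t x, is_derive x 1 (phi t) (phix t x))
  (dxx : forall t x, is_derive x 1 (phix t) (phixx t x)).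
Hypotheses (bp : box_test T b X C phi) (bt : box_test T b X C phit)
  (bx : box_test T b X C phix) (bxx : box_test T b X C phixx).

Local Notation w := (chw nu v0).
Local Notation w1 := (chw1 nu v0 v1).
Local Notation w2 := (chw2 nu v0 v1 v2).
Local Notation wt := (chwt nu v0 v1 v2).

Lemma chw_continuous_t x : continuous (w ^~ x).
Proof.
have cs : continuous (chs nu).
  move=> t; apply: (@continuous_comp _ _ _ (fun t => 4 * nu * t) Num.sqrt); last exact: sqrt_continuous.
  by apply: cvgM; [exact: cvg_cst|exact: cvg_id].
have cg q q' : C1b q q' -> continuous (fun t => gavg q (chs nu t) x).
  move=> Cq t; have [_ _ [K qK]] := Cq.
  have K0 : 0 <= K by apply: le_trans (qK 0).1.
  have m2 : 0 <= @mass2 R by rewrite (le_trans _ mass_le2)// ltW// mass_gt0.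
  apply: (@continuous_comp _ _ _ (chs nu) (fun s => gavg q s x)); first exact: cs.
  move: (chs nu t) => s; apply/cvgrPdist_le => e e0.
  have k0 : 0 < K * mass2 + 1 by rewrite ltr_wpDl// mulr_ge0.
  near=> s'.
  rewrite (le_trans (gavg_lipschitz _ _ _ _ Cq (fun y => (qK y).2)))// subrr normr0 add0r.
  have h : `|s - s'| <= e / (K * mass2 + 1).
    near: s'; apply/nbhs_ballP; exists (e / (K * mass2 + 1)); first by rewrite /= divr_gt0.
    by move=> y /ltW.
  move: h; rewrite ler_pdivlMr// => h; have := normr_ge0 (s - s'); nra.
move=> t; apply: cvgM; first exact: cvg_cst.
apply: cvgM; first exact: cg (chC12 nu Cv0) _.
apply: cvgV; first by rewrite gt_eqF// (chP0_gt0 nu0 Cv0).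
exact: cg (chC01 nu Cv0) _.
Unshelve. all: by end_near. Qed.

Lemma chw_continuous_x t : continuous (w t).
Proof.
move=> x; apply/differentiable_continuous/derivable1_diffP.
by have [[]] := chw_derive_x nu0 Cv0 Cv1 t x.
Qed.

Lemma strip_bounded_chw M : (forall x, `|v0 x| <= M) -> strip_bounded T M w.
Proof.
move=> vM; split.
- apply: strip_measurable => //.
    by move=> t _; apply: continuous_measurable_fun; exact: chw_continuous_x.
  by move=> t x _; apply: cvg_within_filter; exact: chw_continuous_t.
- by move=> t _; apply: continuous_measurable_fun; exact: chw_continuous_x.
- by move=> t x _; exact: (chw_le nu0 Cv0).
Qed.

(** The function h(t) = int w phi has derivative H, the slice of the pairings including the viscous
    one. It starts at the datum term and ends at 0, so the fundamental theorem of calculus in time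
    gives the identity. *)
Lemma chw_weak : pair2 T w phit + pair2 T (fun t x => w t x ^+ 2 / 2) phix +
  \int[mu]_x (v0 x * phi 0 x) = - (nu * pair2 T w phixx).
Proof.
have [_ [M vM']] := (C1c_bcs Cv0).1; have vM x := (vM' x).1.
have M0 : 0 <= M by apply: le_trans (vM 0).
have [mw mwt wM] := strip_bounded_chw vM.
have bw : strip_bounded T M w by [].
have bw2 : strip_bounded T (M ^+ 2) (fun t x => w t x ^+ 2 / 2).
  split.
  - apply: measurable_funM; last exact: measurable_cst.
    exact: measurable_funX.
  - move=> t It; apply: measurable_funM; last exact: measurable_cst.
    by apply: measurable_funX; exact: mwt.
  - move=> t x It; rewrite normrM normrX [`|2^-1|]ger0_norm ?invr_ge0//.
    have : `|w t x| ^+ 2 <= M ^+ 2 by rewrite lerXn2r ?nnegrE// wM.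
    have := sqr_ge0 `|w t x|; lra.
have [i1 j1 k1] := strip_pair T0 X0 M0 C0 bw bt.
have [i2 j2 k2] := strip_pair T0 X0 (sqr_ge0 M) C0 bw2 bx.
have [i3 j3 k3] := strip_pair T0 X0 M0 C0 bw bxx.
have [l1 ->] := pair2_fubini i1 j1; have [l2 ->] := pair2_fubini i2 j2.
have [l3 ->] := pair2_fubini i3 j3.
pose Hf t x := w t x * phit t x + (w t x ^+ 2 / 2 * phix t x + nu * (w t x * phixx t x)).
pose H t := \int[mu]_x Hf t x.
have HE t : timeI T t -> H t = \int[mu]_x (w t x * phit t x) +
    (\int[mu]_x (w t x ^+ 2 / 2 * phix t x) + nu * \int[mu]_x (w t x * phixx t x)).
  move=> It; have a1 := j1 t It; have a2 := j2 t It; have a3 := j3 t It.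
  rewrite -RintegralZl// -RintegralD//; last exact: intRZ.
  by rewrite -RintegralD//; apply: (intRD measurableT) => //; exact: intRZ.
(* A time past the support of the test functions but before T, where everything is still controlled
   on the closed interval [0, b2]. *)
pose b2 := (b + T) / 2.
have [b2b b2T] : b < b2 /\ b2 < T by rewrite /b2; split; rewrite midf_lt.
have b20 : 0 < b2 by exact: lt_trans b2b.
have I02 t : 0 <= t <= b2 -> timeI T t.
  by move=> /andP[t0 tb]; rewrite /timeI/= in_itv/= t0 (le_lt_trans tb).
have box K (a x : R) : (X < `|x| -> a = 0) -> `|a| <= K -> `|a| <= K * (x \in `[- X, X])%:R.
  move=> a0 aK; rewrite in_itv/= -ler_norml; have [xX|/a0->] := leP `|x| X; first by rewrite mulr1.
  by rewrite normr0 mulr0.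
pose h t := \int[mu]_x (w t x * phi t x).
have ch : {within `[0, b2], continuous h}.
  apply: (@param_continuous _ (fun t x => w t x * phi t x) b2 X (M * C)) => //.
  - by exact: ltW.
  - move=> t /I02 It; apply: measurable_funM; first exact: mwt.
    by exact: (box_slice X0 bp It).1.
  - move=> t x /I02 It; apply: box => //.
      by move=> xX; rewrite (bt_vanish bp) ?mulr0//; right.
    by rewrite normrM ler_pM ?wM ?(bt_bound bp).
  - by move=> x t; apply: cvgM; [exact: chw_continuous_t|exact: (jointly_continuous_x (bt_cont bp))].
have cH : {within `[0, b2], continuous H}.
  apply: (@param_continuous _ Hf b2 X (M * C + (M ^+ 2 * C + nu * (M * C)))) => //.
  - by exact: ltW.
  - move=> t /I02 It; apply: measurable_funD.
      by apply: measurable_funM; [exact: mwt|exact: (box_slice X0 bt It).1].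
    apply: measurable_funD.
      by apply: measurable_funM; [case: bw2 => _ m2 _; exact: m2|exact: (box_slice X0 bx It).1].
    apply: measurable_funM; first exact: measurable_cst.
    by apply: measurable_funM; [exact: mwt|exact: (box_slice X0 bxx It).1].
  - move=> t x /I02 It; apply: box => //.
      move=> xX; rewrite /Hf (bt_vanish bt)//; last by right.
      rewrite (bt_vanish bx)//; last by right.
      by rewrite (bt_vanish bxx)//; [rewrite !mulr0 !addr0|right].
    rewrite /Hf (le_trans (ler_normD _ _))// lerD//.
      by rewrite normrM ler_pM ?wM ?(bt_bound bt).
    rewrite (le_trans (ler_normD _ _))// lerD//.
      by case: bw2 => _ _ m2; rewrite normrM ler_pM ?m2 ?(bt_bound bx).
    rewrite normrM (gtr0_norm nu0) ler_wpM2l ?(ltW nu0)//.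
    by rewrite normrM ler_pM ?wM ?(bt_bound bxx).
  - move=> x t; have cw := @chw_continuous_t x t.
    apply: cvgD; first by apply: cvgM => //; exact: (jointly_continuous_x (bt_cont bt)).
    apply: cvgD.
      apply: cvgM; last exact: (jointly_continuous_x (bt_cont bx)).
      apply: cvgM; last exact: cvg_cst.
      by apply: (@continuous_comp _ _ _ (w ^~ x) (fun z => z ^+ 2)); [exact: cw|exact: exprn_continuous].
    apply: cvgM; first exact: cvg_cst.
    by apply: cvgM => //; exact: (jointly_continuous_x (bt_cont bxx)).
have [_ _ _ [K K0 wtK]] := chw_tlip nu0 Cv0 Cv1 Cv2 T.
have dh t : 0 < t < b2 -> is_derive t 1 h (H t).
  move=> /andP[t0 tb2].
  have It : timeI T t by apply: I02; rewrite !ltW.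
  have -> : H t = \int[mu]_x (wt t x * phi t x + w t x * phit t x).
    have Cp : C1c (phi t) (phix t).
      split; [exact: dx|exact: (jointly_continuous_t (bt_cont bx))|].
      exists X => // x xX.
      by rewrite (bt_vanish bp)//; [rewrite (bt_vanish bx)//; right|right].
    have Cpx : C1c (phix t) (phixx t).
      split; [exact: dxx|exact: (jointly_continuous_t (bt_cont bxx))|].
      exists X => // x xX.
      by rewrite (bt_vanish bx)//; [rewrite (bt_vanish bxx)//; right|right].
    have dw x := (chw_derive_x nu0 Cv0 Cv1 t x).1.
    have dw1 x := (chw_derive_x nu0 Cv0 Cv1 t x).2.
    have cw1 : continuous (w1 t).
      by move=> x; apply/differentiable_continuous/derivable1_diffP; have [] := dw1 x.
    have cw2 : continuous (w2 t).
      by move=> x; exact: (chw2_continuous nu0 Cv0 Cv1 Cv2).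
    have q1 := C1cM Cpx dw cw1; have q2 := C1cM Cp dw1 cw2.
    have dww x : is_derive x 1 (fun x => w t x ^+ 2 / 2) (w t x * w1 t x).
      by have := dw x => d; apply: is_derive_eq; rewrite /GRing.scale/= ?expr1; field.
    have cww : continuous (fun x => w t x * w1 t x).
      by move=> x; apply: cvgM; [exact: chw_continuous_x|exact: cw1].
    have q3 := C1cM Cp dww cww.
    have z1 := C1c_int0 q1; have z2 := C1c_int0 q2; have z3 := C1c_int0 q3.
    have k1' := bcs_integrable (C1c_bcs q1).2; have k2' := bcs_integrable (C1c_bcs q2).2.
    have k3' := bcs_integrable (C1c_bcs q3).2.
    have iH : mu.-integrable setT (EFin \o (Hf t)).
      apply: (intRD measurableT); first exact: j1.
      by apply: (intRD measurableT); [exact: j2|apply: (intRZ measurableT); exact: j3].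
    have k21 := intRB measurableT k2' k1'.
    (* All integrations by parts in x at once: integrals of derivatives of compactly supported
       functions vanish, and adding them makes the integrands agree pointwise. *)
    have <- : H t + (nu * (\int[mu]_x (phix t x * w1 t x + phi t x * w2 t x) -
        \int[mu]_x (phixx t x * w t x + phix t x * w1 t x)) -
        \int[mu]_x (phix t x * (w t x ^+ 2 / 2) + phi t x * (w t x * w1 t x))) = H t.
      by rewrite z1 z2 z3 !subr0 mulr0 addr0.
    rewrite -RintegralB// -RintegralZl// -RintegralB//; last exact: intRZ.
    rewrite -RintegralD//; last by apply: (intRB measurableT) => //; exact: intRZ.
    apply: eq_Rintegral => x _.
    have -> : wt t x = nu * w2 t x - w t x * w1 t x by rewrite /chwt /hopft mulN1r.
    by rewrite /Hf; ring.
  pose pf s x := w s x * phi s x; pose df s x := wt s x * phi s x + w s x * phit s x.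
  pose G x := (K * C + M * C) * (x \in `[- X, X])%:R.
  have tt : 0 < t < b2 by rewrite t0.
  apply: (derive_under_loc (F := pf) (F' := df) (G := G) tt).
  - move=> s /andP[s0 sb]; have Is : timeI T s by apply: I02; rewrite !ltW.
    by have [_ jp _] := strip_pair T0 X0 M0 C0 bw bp; exact: jp.
  - move=> s x /andP[s0 sb]; have d1 := chw_derive_t nu0 Cv0 Cv1 x s0; have d2 := dt s x.
    by apply: is_derive_eq; rewrite /GRing.scale/= /df; ring.
  - move=> s x /andP[s0 sb]; have Is : timeI T s by apply: I02; rewrite !ltW.
    have sT : 0 <= s <= T by rewrite (ltW s0) (ltW (lt_trans sb b2T)).
    rewrite /df /G; apply: box.
      move=> xX; rewrite (bt_vanish bp)//; last by right.
      by rewrite (bt_vanish bt)//; [rewrite !mulr0 addr0|right].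
    rewrite (le_trans (ler_normD _ _))// lerD// normrM ler_pM ?wM ?(bt_bound bp) ?(bt_bound bt)//.
    exact: (wtK s s x sT sT).1.
  - exact: box_integrable.
have hb : h b2 = 0.
  rewrite /h -[RHS](mul0r (fine (mu setT))) -Rintegral_cst//; apply: eq_Rintegral => x _.
  by rewrite (bt_vanish bp) ?mulr0//; [apply: I02; rewrite lexx ltW|left].
have h0 : h 0 = \int[mu]_x (v0 x * phi 0 x).
  by apply: eq_Rintegral => x _; rewrite chw_0.
have cI : {within `[0, b2], continuous h} := ch.
have FTC : \int[mu]_(t in `[0, b2]) H t = h b2 - h 0.
  rewrite /Rintegral (@continuous_FTC2 _ H h 0 b2 b20)//.
    have [_ c1 c2] := (continuous_within_itvP h b20).1 ch.
    by split => // t; rewrite in_itv/= => /dh[].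
  by move=> t; rewrite in_itv/= => /dh; exact: is_derive_derive1.
have E1 : \int[mu]_t (H t * (t \in `[0, T[)%:R) = h b2 - h 0.
  rewrite -FTC Rintegral_itv; apply: eq_Rintegral => t _; rewrite !in_itv/=.
  case: (leP 0 t) => //= t0; case: (leP t b2) => tb; first by rewrite (le_lt_trans tb).
  case: (ltP t T) => // tT; rewrite mulr0 mulr1 /H.
  have It : timeI T t by rewrite /timeI/= in_itv/= t0 tT.
  have bt2 : b < t by exact: lt_trans tb.
  rewrite -[RHS](mul0r (fine (mu setT))) -Rintegral_cst//; apply: eq_Rintegral => x _.
  rewrite /Hf (bt_vanish bt)//; last by left.
  rewrite (bt_vanish bx)//; last by left.
  by rewrite (bt_vanish bxx)//; [rewrite !mulr0 !addr0|left].
move: E1; rewrite hb h0 sub0r => E1.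
have E2 : \int[mu]_t (H t * (t \in `[0, T[)%:R) =
   \int[mu]_t ((\int[mu]_x (w t x * phit t x)) * (t \in `[0, T[)%:R) +
   (\int[mu]_t ((\int[mu]_x (w t x ^+ 2 / 2 * phix t x)) * (t \in `[0, T[)%:R) +
   nu * \int[mu]_t ((\int[mu]_x (w t x * phixx t x)) * (t \in `[0, T[)%:R)).
  rewrite -RintegralZl// -RintegralD//; last exact: intRZ.
  rewrite -RintegralD//; last by apply: (intRD measurableT) => //; exact: intRZ.
  apply: eq_Rintegral => t _; case: (boolP (t \in `[0, T[)) => tT; last by rewrite !mulr0 !addr0.
  by rewrite !mulr1 HE.
move: E1; rewrite E2 addrA => /(canRL (addrK _)) ->.
by rewrite addrAC addNr add0r.
Qed.

End viscous_weak_form.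

(** * The Lax-Oleinik formula as a limit and as an entropy weak solution *)

Section entropy_solution_of_formula.
Context {R : realType} {N M : R} {u0 : R -> R}.
Hypotheses (N0 : 0 <= N) (du : datum N M u0).
Local Notation mu := (@lebesgue_measure R).
Implicit Types (T nu e t x : R) (nun : nat -> R).

Lemma datum_widen : datum (N + 3) M u0.
Proof. by case: du => cu u00 uM; split => // x Nx; apply: u00; apply: lt_trans Nx; rewrite ltrDl. Qed.

Lemma datum_bound_ge0 : 0 <= M.
Proof. by case: du => _ _ /(_ 0); exact: le_trans. Qed.

Lemma strip_bounded_laxo T : strip_bounded T M (laxo u0).
Proof.
have m2 := measurable_laxo N0 du.
split; first exact: measurable_funTS.
- move=> t _; apply: (@measurableT_comp _ _ _ _ _ _ _ _ (fun x : R => (t, x)) m2).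
  by apply: measurable_fun_pair; [exact: measurable_cst|exact: measurable_id].
- by move=> t x _; exact: laxo_le du t x.
Qed.

Lemma viscous_approx nu e : 0 < nu -> 0 < e -> exists v0 v1 v2 v3,
  [/\ C1c v0 v1, C1c v1 v2 & C1c v2 v3] /\
  [/\ datum (N + 3) M v0, forall x, `|v0 x - u0 x| <= e &
      forall t x, `|chw nu v0 t x - colehopf nu u0 t x| <= e].
Proof.
move=> nu0 e0; have N3 : 0 <= N + 3 by rewrite addr_ge0.
have [K K0 st] := @colehopf_stable _ nu _ M nu0 N3.
have K1 : 0 < K + 1 by rewrite ltr_wpDl.
have w0 : 0 < e / (K + 1) by rewrite divr_gt0.
have [cu u00 uM] := du.
have [v0 [v1 [v2 [v3 [Cv [vN vM vu]]]]]] := mollify cu N0 u00 uM w0.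
have [Cv0 _ _] := Cv.
have dv : datum (N + 3) M v0.
  split => //; have [d0 _ _] := Cv0.
  by move=> x; apply/differentiable_continuous/derivable1_diffP; have [] := d0 x.
exists v0, v1, v2, v3; split => //; split => // [x|t x].
  apply: (le_trans (vu x)); rewrite ler_pdivrMr// ler_peMr ?(ltW e0)//.
  by rewrite lerDr.
rewrite (chw_colehopf nu0 N3 t x dv) (le_trans (st _ _ _ dv datum_widen vu t x))//.
by rewrite mulrCA ler_piMr ?(ltW e0)// ler_pdivrMr// mul1r lerDl.
Qed.

(** Each viscosity gets its own mollified datum, close enough for the Cole-Hopf solutions of the
    mollified datum and of u0 to be within 1/(n+1). *)
Lemma viscous_sequence nun : (forall n, 0 < nun n) ->
  exists v : nat -> R -> R, exists v1 v2 v3 : nat -> R -> R,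
  [/\ forall n, [/\ C1c (v n) (v1 n), C1c (v1 n) (v2 n) & C1c (v2 n) (v3 n)],
      forall n, datum (N + 3) M (v n),
      forall n x, `|v n x - u0 x| <= n.+1%:R^-1 &
      forall n t x, `|chw (nun n) (v n) t x - colehopf (nun n) u0 t x| <= n.+1%:R^-1].
Proof.
move=> nu0.
have H n : exists f : (R -> R) * (R -> R) * (R -> R) * (R -> R),
  [/\ C1c f.1.1.1 f.1.1.2, C1c f.1.1.2 f.1.2 & C1c f.1.2 f.2] /\
  [/\ datum (N + 3) M f.1.1.1, forall x, `|f.1.1.1 x - u0 x| <= n.+1%:R^-1 &
      forall t x, `|chw (nun n) f.1.1.1 t x - colehopf (nun n) u0 t x| <= n.+1%:R^-1].
  have e0 : 0 < n.+1%:R^-1 :> R by rewrite invr_gt0.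
  by have [a [b [c [d h]]]] := viscous_approx (nu0 n) e0; exists (a, b, c, d).
have [f fP] := choice H.
exists (fun n => (f n).1.1.1), (fun n => (f n).1.1.2), (fun n => (f n).1.2), (fun n => (f n).2).
by split => [n|n|n x|n t x]; have [? [? ? ?]] := fP n.
Qed.

Lemma colehopf_seq_cvg nun t : (forall n, 0 < nun n) -> nun n @[n --> \oo] --> 0 -> 0 < t ->
  {ae mu, forall x, colehopf (nun n) u0 t x @[n --> \oo] --> laxo u0 t x}.
Proof.
move=> nu0 nuc t0; apply: (ae_imply1 (minimiser_ae_unique N0 du t0)) => x ux.
have := laplace N0 du t0 ux; rewrite /laxo t0 => h.
apply: (cvg_comp nun (fun nu => colehopf nu u0 t x) _ h).
move=> A /= [d d0 dA].
have : \forall n \near \oo, ball (0 : R) d (nun n) by apply: nuc; exact: nbhsx_ballx.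
by apply: filterS => n bn; exact: dA.
Qed.

Lemma near_cvg (f g : nat -> R) (l : R) : (forall n, `|f n - g n| <= n.+1%:R^-1) ->
  g n @[n --> \oo] --> l -> f n @[n --> \oo] --> l.
Proof.
move=> fg gl; have h : (f n - g n) @[n --> \oo] --> (0 : R).
  apply/cvgr0Pnorm_lt => e e0; have hn := (cvgr0Pnorm_lt _).1 (@cvg_harmonic R) e e0.
  apply: filterS (hn _) => n; apply: le_lt_trans; rewrite (le_trans (fg n))//.
  by rewrite /harmonic ler_norm.
rewrite (_ : f = (fun n => (f n - g n) + g n)).
  by rewrite -[l]add0r; exact: cvgD.
by apply/funext => n; rewrite subrK.
Qed.

Lemma cvgD3 (f g h : nat -> R) (a b c : R) : f n @[n --> \oo] --> a -> g n @[n --> \oo] --> b ->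
  h n @[n --> \oo] --> c -> f n + g n + h n @[n --> \oo] --> a + b + c.
Proof. by move=> fa gb hc; apply: cvgD => //; exact: cvgD. Qed.

Lemma cvgNM (f g : nat -> R) (a b : R) : f n @[n --> \oo] --> a -> g n @[n --> \oo] --> b ->
  - (f n * g n) @[n --> \oo] --> - (a * b).
Proof. by move=> fa gb; apply: cvgN; exact: cvgM. Qed.

(** The weak form of the viscous equation with nu = 1/(n+1) and mollified data passes to the limit
    term by term; the viscous term vanishes because its pairing converges. *)
Lemma weak_laxo T : 0 < T -> weak_solution T u0 (laxo u0).
Proof.
move=> T0; have M0 := datum_bound_ge0.
split; first exact: measurable_funTS (measurable_laxo N0 du).
  by exists M => t x _; exact: laxo_le du t x.
move=> phi tphi.
have [b [X [C [[/andP[b0 bT] X0 C0 [dt1 [dx dxx]]] [bp bt bx bxx]]]]] := test2_box T0 tphi.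
pose nun n : R := n.+1%:R^-1.
have nu0 n : 0 < nun n by rewrite invr_gt0.
have nuc : nun n @[n --> \oo] --> 0 by exact: cvg_harmonic.
have [v [v1 [v2 [v3 [Cv dv vu wu]]]]] := viscous_sequence nu0.
pose w n := chw (nun n) (v n).
have bw n : strip_bounded T M (w n).
  have [? ? ?] := Cv n; apply: (@strip_bounded_chw _ _ _ _ (v1 n) (v2 n)) => //.
  by case: (dv n).
have wc t : 0 < t < T -> {ae mu, forall x, w n t x @[n --> \oo] --> laxo u0 t x}.
  move=> /andP[t0 _]; apply: (ae_imply1 (colehopf_seq_cvg nu0 nuc t0)) => x.
  by apply: near_cvg => n; exact: wu.
have sqb (g : R -> R -> R) : strip_bounded T M g -> strip_bounded T (M ^+ 2) (fun t x => g t x ^+ 2 / 2).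
  move=> [mg mgt gM]; split.
  - apply: measurable_funM; last exact: measurable_cst.
    exact: measurable_funX.
  - move=> t It; apply: measurable_funM; last exact: measurable_cst.
    by apply: measurable_funX; exact: mgt.
  - move=> t x It; rewrite normrM normrX [`|2^-1|]ger0_norm ?invr_ge0//.
    have : `|g t x| ^+ 2 <= M ^+ 2 by rewrite lerXn2r ?nnegrE// gM.
    have := sqr_ge0 `|g t x|; lra.
have c1 := pair2_cvg T0 X0 M0 C0 bw (strip_bounded_laxo T) bt wc.
have c2 : pair2 T (fun t x => w n t x ^+ 2 / 2) (partial_x phi) @[n --> \oo] -->
    pair2 T (fun t x => laxo u0 t x ^+ 2 / 2) (partial_x phi).
  apply: (@pair2_cvg _ T b X C (M ^+ 2) (fun n t x => w n t x ^+ 2 / 2) (fun t x => laxo u0 t x ^+ 2 / 2)) => //.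
  - exact: sqr_ge0.
  - by move=> n; exact/sqb/bw.
  - exact/sqb/strip_bounded_laxo.
  - move=> t tT; apply: (ae_imply1 (wc t tT)) => x h.
    apply: cvgM; last exact: cvg_cst.
    exact: cvgM.
have c4 := pair2_cvg T0 X0 M0 C0 bw (strip_bounded_laxo T) bxx wc.
have I0 : timeI T 0 by rewrite /timeI/= in_itv/= lexx T0.
have bp0 := box_slice X0 bp I0.
have c3 : \int[mu]_x (v n x * phi 0 x) @[n --> \oo] --> \int[mu]_x (u0 x * phi 0 x).
  apply: (@Rintegral_dominated _ _ R mu setT measurableT _ _ (fun x => M * `|phi 0 x|)).
  - move=> n; apply: measurable_funM; last exact: bp0.1.
    by case: (dv n) => cv _ _; exact: continuous_measurable_fun.
  - exact/(intRZ measurableT)/intR_abs/bcs_integrable.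
  - by move=> n x _; rewrite normrM ler_wpM2r//; case: (dv n).
  - apply: measurable_funM; last exact: bp0.1.
    by case: du => cu _ _; exact: continuous_measurable_fun.
  - apply: aeW => x _; apply: cvgM; last exact: cvg_cst.
    by apply: near_cvg (cvg_cst (u0 x)) => n; exact: vu.
have L : pair2 T (w n) (partial_t phi) + pair2 T (fun t x => w n t x ^+ 2 / 2) (partial_x phi) +
    \int[mu]_x (v n x * phi 0 x) @[n --> \oo] --> pair2 T (laxo u0) (partial_t phi) +
    pair2 T (fun t x => laxo u0 t x ^+ 2 / 2) (partial_x phi) + \int[mu]_x (u0 x * phi 0 x).
  exact: (cvgD3 c1 c2 c3).
have L' : - (nun n * pair2 T (w n) (partial_x (partial_x phi))) @[n --> \oo] --> (0 : R).
  rewrite -oppr0 -[X in - X](mul0r (pair2 T (laxo u0) (partial_x (partial_x phi)))).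
  exact: (cvgNM nuc c4).
apply: (cvg_unique _ L); first exact: norm_hausdorff.
rewrite (_ : (fun n => _) = (fun n => - (nun n * pair2 T (w n) (partial_x (partial_x phi))))) //.
apply/funext => n; have [C0n C1n C2n] := Cv n.
exact: (chw_weak (nu0 n) T0 C0n C1n C2n b0 bT X0 C0 dt1 dx dxx bp bt bx bxx).
Qed.

Lemma entropy_weak_laxo T (k : R -> R) C : 0 < T -> (forall x, `|k x| <= C) ->
  (forall x y, x <= y -> `|u0 y - u0 x| <= k y - k x) -> entropy_weak_solution T u0 (laxo u0).
Proof.
by move=> T0 kC uk; split; [exact: weak_laxo|exact: (laxo_BV N0 du T kC uk)|exact: (laxo_entropy N0 du)].
Qed.

(** Measurability is inherited from Cole-Hopf solutions of mollified data, which converge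
    pointwise. *)
Lemma strip_bounded_colehopf T nu : 0 < T -> 0 < nu -> strip_bounded T M (colehopf nu u0).
Proof.
move=> T0 nu0.
have [v [v1 [v2 [v3 [Cv dv vu wu]]]]] := viscous_sequence (fun=> nu0).
have bw n : strip_bounded T M (chw nu (v n)).
  have [? ? ?] := Cv n; apply: (@strip_bounded_chw _ _ _ _ (v1 n) (v2 n)) => //.
  by case: (dv n).
have lim t x : chw nu (v n) t x @[n --> \oo] --> colehopf nu u0 t x.
  by apply: near_cvg (cvg_cst _) => n; exact: wu.
split.
- apply: (@measurable_fun_cvg _ _ _ _ (fun n p => chw nu (v n) p.1 p.2)) => //.
  by move=> n; case: (bw n).
- move=> t It; apply: (@measurable_fun_cvg _ _ _ _ (fun n => chw nu (v n) t)) => //.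
  by move=> n; case: (bw n) => _ h _; exact: h.
- by move=> t x _; exact: (colehopf_le nu0 N0 t x du).
Qed.

(** Failure would give a sequence of viscosities tending to 0, against dominated convergence along
    sequences. *)
Lemma pair2_colehopf_cvg T phi e : 0 < T -> test2 T phi -> 0 < e ->
  exists2 d, 0 < d & forall nu, 0 < nu < d ->
    `|pair2 T (colehopf nu u0) phi - pair2 T (laxo u0) phi| < e.
Proof.
move=> T0 tphi e0; apply: contrapT => H.
have Hn n : exists nu, 0 < nu < n.+1%:R^-1 /\ e <= `|pair2 T (colehopf nu u0) phi - pair2 T (laxo u0) phi|.
  apply: contrapT => h; apply: H; exists n.+1%:R^-1; first by rewrite invr_gt0.
  by move=> nu nud; rewrite ltNge; apply/negP => h'; apply: h; exists nu.
have [nun nunP] := choice Hn.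
have nu0 n : 0 < nun n by have [/andP[]] := nunP n.
have nuc : nun n @[n --> \oo] --> 0.
  apply: near_cvg (cvg_cst _) => n; rewrite subr0 gtr0_norm ?nu0// ltW//.
  by have [/andP[]] := nunP n.
have [b [X [C [[/andP[b0 bT] X0 C0 _] [bp _ _ _]]]]] := test2_box T0 tphi.
have wc t : 0 < t < T -> {ae mu, forall x, colehopf (nun n) u0 t x @[n --> \oo] --> laxo u0 t x}.
  by move=> /andP[t0 _]; exact: colehopf_seq_cvg.
have bw n := strip_bounded_colehopf T0 (nu0 n).
have c := pair2_cvg T0 X0 datum_bound_ge0 C0 bw (strip_bounded_laxo T) bp wc.
have [n _ /(_ n (leqnn n)) /=] := (cvgrPdist_lt _ _).1 c e e0.
by rewrite distrC ltNge; case: (nunP n) => _ ->.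
Qed.

End entropy_solution_of_formula.

(** * Galerkin solutions as distributions *)

Section window_averages.
Context {R : realType}.
Local Notation mu := (@lebesgue_measure R).
Local Notation mu2 := (@mu2 R).
Implicit Types (t x y a b e : R) (g v : R -> R) (s : seq (nat * R)).

Definition window a b y : R := below b y - below a y.

Lemma windowE a b y : a <= b -> window a b y = (y \in `]a, b])%:R.
Proof.
move=> ab; rewrite /window /below in_itv/=; case: (leP y a) => ya /=.
  by rewrite (le_trans ya ab) subrr.
by rewrite subr0.
Qed.

Lemma window_bcs a b : a <= b -> bcs (window a b).
Proof.
move=> ab; split.
  by apply: measurable_funB; exact: measurable_below.
exists (1 + `|a| + `|b|) => x; rewrite windowE// in_itv/=; split.
  case: (_ && _); rewrite ?normr1 ?normr0.
    by rewrite -addrA lerDl addr_ge0.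
  by rewrite !addr_ge0.
move=> xab; case: (ltP a x) => //= ax; case: (leP x b) => //= xb; exfalso.
move: xab; rewrite ltNge => /negP; apply.
rewrite ler_norml; apply/andP; split.
  have := ler_norm (- a); rewrite normrN; have := normr_ge0 b; lra.
have := ler_norm b; have := normr_ge0 a; lra.
Qed.

Lemma ip_window v a b : bcs v -> ip v (window a b) = prim v b - prim v a.
Proof.
move=> bv; have vi := bcs_integrable bv.
rewrite !primE /ip -RintegralB//; last 2 first.
- exact: integrable_below.
- exact: integrable_below.
by apply: eq_Rintegral => x _; rewrite /window mulrBr.
Qed.

Lemma window_int a b : a <= b -> \int[mu]_y window a b y = b - a.
Proof.
move=> ab; rewrite (_ : \int[mu]_y window a b y = \int[mu]_(y in `]a, b]) 1); last first.
  by rewrite Rintegral_itv; apply: eq_Rintegral => y _; rewrite windowE// mul1r.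
rewrite Rintegral_cst; last exact: (measurable_itv `]a, b]).
rewrite mul1r /= lebesgue_measure_itv/= lte_fin; case: ltP => [_|ba]; first by rewrite -EFinD.
by rewrite (le_anti (introT andP (conj ab ba))) subrr.
Qed.

Lemma average_near v a b c e : bcs v -> a < b -> 
  (forall y, a < y <= b -> `|v y - c| <= e) ->
  `|(b - a)^-1 * ip v (window a b) - c| <= e.
Proof.
move=> bv ab vc; have ba : 0 < b - a by rewrite subr_gt0.
have bw := window_bcs (ltW ab).
have bvw := bcs_integrable (bcsM bv bw).
have bcw := bcs_integrable (bcsZ c bw).
have bew := bcs_integrable (bcsZ e bw).
have -> : (b - a)^-1 * ip v (window a b) - c = (b - a)^-1 * \int[mu]_y (v y * window a b y - c * window a b y).
  rewrite RintegralB// RintegralZl//; last exact: bcs_integrable.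
  by rewrite window_int ?ltW// /ip; field; rewrite gt_eqF.
rewrite normrM gtr0_norm ?invr_gt0// ler_pdivrMl//.
rewrite (le_trans (le_normr_Rintegral _ _))//; first exact: intRB.
rewrite (_ : (b - a) * e = \int[mu]_y (e * window a b y)); last first.
  rewrite RintegralZl//; last exact: bcs_integrable.
  by rewrite window_int ?ltW// mulrC.
apply: le_Rintegral => //; first by apply/intR_abs/intRB.
move=> y _; rewrite -mulrBl normrM (windowE y (ltW ab)) in_itv/=.
case: (boolP (a < y <= b)) => [/vc h|_]; last by rewrite normr0 !mulr0.
by rewrite normr1 !mulr1.
Qed.

Lemma steps_constant_left s x : all (fun i => 0 < i.1)%N s -> 0 < x ->
  exists2 d, 0 < d & forall y, x - d < y <= x -> steps s y = steps s x.
Proof.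
move=> ps x0; elim: s ps => [_|[k c] s IH /= /andP[k0 /IH[d d0 dP]]].
  by exists 1 => // y _; rewrite /steps !big_nil.
have [e e0 eP] : exists2 e, 0 < e & forall y, x - e < y <= x -> box k y = box k x.
  have [xk|kx] := leP x k%:R.
    exists x => // y; rewrite subrr => /andP[y0 yx].
    by rewrite !boxE !gtr0_norm// xk (le_trans yx).
  exists (x - k%:R); first by rewrite subr_gt0.
  move=> y /andP[ky yx]; rewrite opprB addrCA subrr addr0 in ky.
  have y0 : 0 < y by rewrite (le_lt_trans _ ky).
  by rewrite !boxE !gtr0_norm// !leNgt ky kx.
exists (Num.min d e); first by rewrite lt_min d0.
move=> y /andP[yx yx']; rewrite /steps !big_cons; congr (_ + _).
  rewrite /= eP//; rewrite yx' andbT (le_lt_trans _ yx)//.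
  by rewrite lerB// ge_min lexx orbT.
apply: dP; rewrite yx' andbT (le_lt_trans _ yx)//.
by rewrite lerB// ge_min lexx.
Qed.

Lemma steps_constant_right s x : all (fun i => 0 < i.1)%N s -> x <= 0 ->
  exists2 d, 0 < d & forall y, x < y <= x + d -> steps s y = steps s x.
Proof.
move=> ps x0; elim: s ps => [_|[k c] s IH /= /andP[k0 /IH[d d0 dP]]].
  by exists 1 => // y _; rewrite /steps !big_nil.
have k1 : 1 <= k%:R :> R by rewrite ler1n.
have [e e0 eP] : exists2 e, 0 < e & forall y, x < y <= x + e -> box k y = box k x.
  have [xk|kx] := leP (- x) k%:R.
    exists 1 => // y /andP[xy yx].
    rewrite !boxE (ler0_norm x0) xk ler_norml (_ : (_ <= _ <= _) = true)//.
    by apply/andP; split; lra.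
  exists ((- x - k%:R) / 2); first by rewrite divr_gt0// subr_gt0.
  move=> y /andP[xy yx].
  have y0 : y < - k%:R by lra.
  have y0' : y < 0 by lra.
  by rewrite !boxE (ltr0_norm y0') (ler0_norm x0) !leNgt ltrNr y0 kx.
exists (Num.min d e); first by rewrite lt_min d0.
move=> y /andP[yx yx']; rewrite /steps !big_cons; congr (_ + _).
  rewrite /= eP//; rewrite yx /= (le_trans yx')//.
  by rewrite lerD2l ge_min lexx orbT.
apply: dP; rewrite yx /= (le_trans yx')//.
by rewrite lerD2l ge_min lexx.
Qed.

(** The window lies on the side of x facing the origin, where closed intervals [-k, k] have no jump
    at x. *)
Definition lo_end n x : R := if 0 < x then x - n.+1%:R^-1 else x.
Definition hi_end n x : R := if 0 < x then x else x + n.+1%:R^-1.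

Lemma endsE n x : hi_end n x - lo_end n x = n.+1%:R^-1.
Proof. by rewrite /hi_end /lo_end; case: ifP => _; ring. Qed.

Lemma ends_lt n x : lo_end n x < hi_end n x.
Proof. by rewrite -subr_gt0 endsE invr_gt0. Qed.

(* Elements of H1flat are left continuous on ]0, +oo[ and right continuous on ]-oo, 0]. *)
Lemma average_cvg v x : H1flat v ->
  n.+1%:R * ip v (window (lo_end n x) (hi_end n x)) @[n --> \oo] --> v x.
Proof.
move=> /[dup]/H1flat_bcs bv /H1flat_rep[g [s [gs vE]]]; have [gi _ _ ps] := gs.
apply/cvgrPdist_le => e e0.
have [d1 d10 P1] : exists2 d, 0 < d & forall y, `|y - x| < d -> `|prim g y - prim g x| <= e.
  have := (cvgrPdist_le _ _).1 (prim_continuous gi (x := x)) e e0.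
  move=> [d /= d0 dP]; exists d => // y yx; rewrite distrC; apply: dP.
  by rewrite /ball/= distrC.
have [d d0 dP] : exists2 d : R, 0 < d & forall (n : nat) y, n.+1%:R^-1 < d ->
    lo_end n x < y <= hi_end n x -> `|v y - v x| <= e.
  have [x0|x0] := ltP 0 x.
    have [d2 d20 P2] := steps_constant_left ps x0.
    exists (Num.min d1 d2); first by rewrite lt_min d10.
    move=> n y; rewrite /lo_end /hi_end x0 lt_min.
    move: (n.+1%:R^-1) => h /andP[n1 n2] /andP[y1 y2].
    rewrite vE /flat P2; last by rewrite y2 andbT; lra.
    rewrite opprD addrACA subrr addr0; apply: P1.
    by rewrite ltr_norml; apply/andP; split; lra.
  have [d2 d20 P2] := steps_constant_right ps x0.
  exists (Num.min d1 d2); first by rewrite lt_min d10.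
  move=> n y; rewrite /lo_end /hi_end !(ltNge 0 x) x0/= lt_min.
  move: (n.+1%:R^-1) => h /andP[n1 n2] /andP[y1 y2].
  rewrite vE /flat P2; last by rewrite y1/=; lra.
  rewrite opprD addrACA subrr addr0; apply: P1.
  by rewrite ltr_norml; apply/andP; split; lra.
have hn := (cvgr0Pnorm_lt _).1 (@cvg_harmonic R) d d0.
apply: filterS (hn _) => n nd; rewrite distrC -[X in X * ip _ _]invrK -(endsE n x).
apply: average_near => //; first exact: ends_lt.
by move=> y; apply: dP; move: nd; rewrite /harmonic ger0_norm ?invr_ge0.
Qed.

Lemma ip_time_continuous T (u w : R -> R -> R) f t : (forall t, timeI T t -> H1flat (u t)) ->
  time_derivative T u w -> timeI T t -> bcs f ->
  ip (u s) f @[s --> within (timeI T) (nbhs t)] --> ip (u t) f.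
Proof.
move=> uf uw It bf; have [d d0 dP] := ip_quot uf uw It bf ltr01.
set c := ip (w t) f in dP.
have c1 : 0 < `|c| + 1 by rewrite ltr_wpDl.
apply/cvgrPdist_le => e e0.
exists (Num.min d (e / (`|c| + 1))) => /=; first by rewrite lt_min d0 divr_gt0.
move=> s /=; rewrite lt_min => /andP[s1 s2] Is.
have [->|st] := eqVneq s t; first by rewrite subrr normr0 ltW.
have st0 : s - t != 0 by rewrite subr_eq0.
have := dP (s - t) st0; rewrite distrC s1 addrC subrK => /(_ isT Is) h.
have h2 : `|(ip (u s) f - ip (u t) f) / (s - t)| <= `|c| + 1.
  by rewrite -[X in `|X|](subrK c) addrC (le_trans (ler_normD _ _))// lerD2l.
rewrite distrC; move: h2; rewrite normrM normfV ler_pdivrMr ?normr_gt0// => /le_trans; apply.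
by rewrite mulrC -ler_pdivlMr// distrC ltW.
Qed.

(** The solution is continuous in time only in L^2, so its point values need not be. Window averages
    are continuous in time and converge to the point values. *)
Lemma strip_measurable_flat T (u w : R -> R -> R) : 0 < T -> (forall t, timeI T t -> H1flat (u t)) ->
  time_derivative T u w -> measurable_fun (strip T) (fun p => u p.1 p.2).
Proof.
move=> T0 uf uw.
pose F n t x := n.+1%:R * ip (u t) (window (lo_end n x) (hi_end n x)).
apply: (@measurable_fun_cvg _ _ _ _ (fun n p => F n p.1 p.2)); last first.
  by move=> [t x] [/= It _]; exact/average_cvg/uf.
have m0 : measurable_fun setT (fun x : R => 0 < x).
  by apply: measurable_fun_ltr; [exact: measurable_cst|exact: measurable_id].
have mends n : measurable_fun setT (lo_end n) /\ measurable_fun setT (hi_end n).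
  by split; apply: measurable_fun_if => //; apply: measurable_funTS;
    rewrite ?set_itvE; try exact: measurable_id;
    [apply: measurable_funB|apply: measurable_funD].
move=> n; apply: strip_measurable => //.
  move=> t It; have bu := H1flat_bcs (uf t It); have ui := bcs_integrable bu.
  rewrite (_ : F n t = (fun x => n.+1%:R * (prim (u t) (hi_end n x) - prim (u t) (lo_end n x)))); last first.
    by apply/funext => x; rewrite /F ip_window.
  apply: measurable_funM; first exact: measurable_cst.
  have [ml mh] := mends n; have mp := measurable_prim ui.
  by apply: measurable_funB; apply: measurableT_comp.
move=> t x It; apply: cvgM; first exact: cvg_cst.
apply: (ip_time_continuous uf uw It).
by apply: window_bcs; exact/ltW/ends_lt.
Qed.

End window_averages.

(** * Galerkin solutions tested against test functions *)

Section galerkin_pairing.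
Context {R : realType}.
Local Notation mu := (@lebesgue_measure R).
Local Notation mu2 := (@mu2 R).
Variables (V : set (R -> R)) (T : R) (u0 : R -> R) (nu : R) (u : R -> R -> R).
Hypotheses (T0 : 0 < T) (Vflat : V `<=` H1flat) (V0 : V (fun=> 0)) (nu0 : 0 < nu).
Hypothesis gal : galerkin V T u0 nu u.

Lemma C1c0 : C1c (fun=> 0 : R) (fun=> 0 : R).
Proof.
split=> [x|x|]; [exact: is_derive_cst|exact: cvg_cst|by exists 1].
Qed.

(** [energy_step] with the comparison function 0, which has residual 0. Its Gronwall rate is then 1,
    whence the factor exp(T), crude but independent of V and nu. *)
Lemma galerkin_energy t : timeI T t -> ip (u t) (u t) <= ip u0 u0 * expR T.
Proof.
rewrite /timeI/= in_itv/= => /andP[t0 tT].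
have H := @energy_step R V T u0 nu u Vflat nu0 gal _ _ _ _ _ _ C1c0 C1c0 C1c0 C1c0
  V0 V0 V0 V0 0 T id (fun=> 1) 0 (lexx _) (lexx _).
have tt : 0 <= t <= T by rewrite t0 ltW.
have E s : ip (fun x : R => u s x - (0 + (s - 0) * 0)) (fun x => u s x - (0 + (s - 0) * 0)) = ip (u s) (u s).
  by congr ip; apply/funext => x; rewrite mulr0 addr0 subr0.
have := H _ _ _ _ _ t tt tT; rewrite !E oppr0 expR0 mulr1 mul0r addr0 (gal_0 gal) => h.
have h1 : ip (u t) (u t) * expR (- t) <= ip u0 u0.
  apply: h.
  - by move=> s x _; rewrite mulr0 addr0 normr0 subrr.
  - move=> s _; rewrite (_ : (fun x : R => _) = (fun=> 0 : R)).
      rewrite /ip (_ : \int[mu]_x _ = \int[mu]_x (0 * (0 : R))) ?mulr0; last by apply: eq_Rintegral.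
      by rewrite Rintegral_cst// mul0r.
    by apply/funext => x; rewrite !(mulr0, addr0) subrr.
  - by apply: continuous_subspaceT => s; exact: cvg_id.
  - by move=> s /andP[].
have -> : ip (u t) (u t) = ip (u t) (u t) * expR (- t) * expR t.
  by rewrite -mulrA -expRD addrC subrr expR0 mulr1.
have i0 : 0 <= ip u0 u0 by exact: ip_ge0.
apply: ler_pM => //; rewrite ?expR_ge0 ?mulr_ge0 ?expR_ge0 ?ip_ge0//.
by rewrite ler_expR ltW.
Qed.

Lemma galerkin_flat t : timeI T t -> H1flat (u t).
Proof. by have [+ _] := gal_C1 gal; apply. Qed.

Lemma galerkin_measurable : measurable_fun (strip T) (fun p => u p.1 p.2).
Proof.
have [_ /getPex uw] := gal_C1 gal.
exact: (strip_measurable_flat T0 galerkin_flat uw).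
Qed.

(** Tonelli: slices of bounded L^1 norm over a bounded time interval. *)
Lemma strip_integrable_prod (h : R -> R -> R) K : 
  measurable_fun (strip T) (fun p => h p.1 p.2) ->
  (forall t, timeI T t -> mu.-integrable setT (EFin \o h t)) ->
  (forall t, timeI T t -> \int[mu]_x `|h t x| <= K) ->
  mu2.-integrable (strip T) (EFin \o (fun p => h p.1 p.2)).
Proof.
move=> mh ih hK; have mS := measurable_strip T.
pose F (p : R * R) := h p.1 p.2 * (p.1 \in `[0, T[)%:R.
have sP (p : R * R) : strip T p <-> p.1 \in `[0, T[ by split => [[]|].
have rE (k : R -> \bar R) : k 0 = 0%E -> (fun p => k (h p.1 p.2)) \_ (strip T) = (fun p => k (F p)).
  move=> k0; apply/funext => p; rewrite patchE /F.
  case: (boolP (p.1 \in `[0, T[)) => pT.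
    by rewrite mulr1 (_ : p \in strip T = true)//; apply/mem_set/sP.
  by rewrite mulr0 k0 (_ : p \in strip T = false)//; apply/negbTE/negP => /set_mem/sP; apply/negP.
have mF : measurable_fun setT (EFin \o F).
  have := (measurable_restrictT (EFin \o (fun p => h p.1 p.2)) mS).1.
  rewrite (rE EFin)//; apply; exact/measurable_EFinP.
suff iF : mu2.-integrable setT (EFin \o F).
  by apply/(integrable_mkcond _ mS); rewrite (rE EFin).
apply/integrable12ltyP => //.
pose G t := (\int[mu]_x `|h t x|) * (t \in `[0, T[)%:R.
have K0 : 0 <= K.
  have I0 : timeI T 0 by rewrite /timeI/= in_itv/= lexx T0.
  by apply: le_trans (hK 0 I0); apply: Rintegral_ge0.
have GE : (fun t => \int[mu]_x `|(EFin \o F) (t, x)|)%E = EFin \o G.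
  apply/funext => t; rewrite /F /G /=; case: (boolP (t \in `[0, T[)) => tT.
    rewrite mulr1 (_ : (fun x => _) = EFin \o (fun x => `|h t x|)); last first.
      by apply/funext => x /=; rewrite mulr1.
    by rewrite RintegralE//; exact/intR_abs/ih.
  by rewrite mulr0 integral0_eq// => x _; rewrite mulr0 normr0.
have mG : measurable_fun setT G.
  apply/measurable_EFinP; rewrite -/(EFin \o G) -GE.
  have := @measurable_fun_fubini_tonelli_F _ _ _ _ R mu (EFin \o (fun p => `|F p|)).
  apply; last by move=> p; rewrite /= lee_fin.
  apply/measurable_EFinP; apply: measurableT_comp => //; exact/measurable_EFinP.
have i1 : mu.-integrable setT (EFin \o (fun t : R => (t \in `[0, T])%:R)).
  by have := bcs_integrable (bcs_indic 0 T); rewrite (@indic_bool _ _ _ (fun t : R => t \in `[0, T])).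
have iG : mu.-integrable setT (EFin \o G).
  apply: (@intR_le _ _ R mu _ measurableT _ _ mG (intRZ measurableT K i1)) => t _.
  rewrite /G; case: (boolP (t \in `[0, T[)) => tT.
    have -> : t \in `[0, T] by move: tT; rewrite !in_itv/= => /andP[-> /ltW].
    by rewrite !mulr1 ger0_norm ?hK// Rintegral_ge0.
  by rewrite mulr0 normr0 mulr_ge0//.
by rewrite [X in (X < _)%E](_ : _ = (\int[mu]_t (EFin \o G) t)%E); [rewrite -RintegralE ?ltry|apply: eq_integral => t _; rewrite -GE].
Qed.

Lemma galerkin_L2strip : L2strip T u.
Proof.
split; first exact: galerkin_measurable.
apply: (@strip_integrable_prod (fun t x => u t x ^+ 2) (ip u0 u0 * expR T)).
- by apply: measurable_funX; exact: galerkin_measurable.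
- by move=> t It; apply: bcs_integrable; apply: bcsX; exact/H1flat_bcs/galerkin_flat.
- move=> t It; rewrite (le_trans _ (galerkin_energy It))//.
  rewrite le_eqVlt; apply/orP; left; apply/eqP; apply: eq_Rintegral => x _.
  by rewrite ger0_norm ?sqr_ge0// expr2.
Qed.

Section pairing.
Variables (b X C : R) (psi : R -> R -> R).
Hypotheses (X0 : 0 < X) (C0 : 0 <= C) (bp : box_test T b X C psi).

Let bpsi t : timeI T t -> bcs (psi t).
Proof. by move=> It; exact: (box_slice X0 bp It). Qed.

Let psi_norm t : timeI T t -> ip (psi t) (psi t) <= C ^+ 2 * (2 * X).
Proof.
move=> It; apply: ip_sup; [exact: bpsi|exact: ltW|by move=> x; exact: (bt_bound bp)|].
by move=> x xX; rewrite (bt_vanish bp)//; right.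
Qed.

Let psi_mass t : timeI T t -> \int[mu]_x `|psi t x| <= C * (2 * X).
Proof.
move=> It; have [mp [M pM]] := bpsi It.
have ba : bcs (fun x => `|psi t x|).
  by split; [exact: measurableT_comp|exists M => x; rewrite normr_id; have [? h] := pM x; split=> // /h ->; rewrite normr0].
have p0 x : X < `|x| -> `|psi t x| = 0 by move=> xX; rewrite (bt_vanish bp) ?normr0//; right.
have := @prim_le_support _ (fun x => `|psi t x|) C X X ba (ltW X0).
rewrite (@prim_above _ _ X X)//; last by move=> y Xy; rewrite p0// (lt_le_trans Xy)// ler_norm.
move=> h; apply: le_trans (ler_norm _) (h _ p0).
by move=> y; rewrite normr_id; exact: (bt_bound bp).
Qed.

Lemma galerkin_pair_integrable : 
  mu2.-integrable (strip T) (EFin \o (fun p => u p.1 p.2 * psi p.1 p.2)) /\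
  forall t, timeI T t -> mu.-integrable setT (EFin \o (fun x => u t x * psi t x)).
Proof.
have bu t : timeI T t -> bcs (u t) by move=> /galerkin_flat/H1flat_bcs.
have it t : timeI T t -> mu.-integrable setT (EFin \o (fun x => u t x * psi t x)).
  by move=> It; apply: bcs_integrable; apply: bcsM; [exact: bu|exact: bpsi].
split=> //; apply: (@strip_integrable_prod (fun t x => u t x * psi t x) (ip u0 u0 * expR T + C ^+ 2 * (2 * X))) => //.
  by apply: measurable_funM; [exact: galerkin_measurable|exact: box_measurable bp].
move=> t It; rewrite (le_trans _ (lerD (galerkin_energy It) (psi_norm It)))//.
have b1 := bcsM (bu t It) (bu t It); have b2 := bcsM (bpsi It) (bpsi It).
rewrite /ip -RintegralD//; [|exact: bcs_integrable|exact: bcs_integrable].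
apply: le_Rintegral => //; first exact/intR_abs/it.
  by apply/bcs_integrable/bcsD.
move=> x _; rewrite normrM -!expr2 -(real_normK (num_real (u t x))) -(real_normK (num_real (psi t x))).
move: (normr_ge0 (u t x)) (normr_ge0 (psi t x)); move: `|u t x| `|psi t x| => p q p0 q0.
have := sqr_ge0 (p - q); rewrite sqrrB; have := mulr_ge0 p0 q0; move: (p * q) (p ^+ 2) (q ^+ 2) => pq p2 q2.
lra.
Qed.

(** On each slice f mediates between u, close in L^2 and treated by Cauchy-Schwarz, and w, close in
    the sup norm. The function f may depend on t arbitrarily, since only the two pairings are
    integrated in time. *)
Lemma galerkin_pair_approx (w : R -> R -> R) M eta : 0 <= M -> 0 <= eta -> strip_bounded T M w ->
  (forall t, timeI T t -> exists f, [/\ bcs f, ip (fun x => u t x - f x) (fun x => u t x - f x) <= eta &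
        forall x, `|f x - w t x| <= eta]) ->
  `|pair2 T u psi - pair2 T w psi| <=
    (Num.sqrt eta * Num.sqrt (C ^+ 2 * (2 * X)) + eta * (C * (2 * X))) * T.
Proof.
move=> M0 eta0 bw uw; have [i2 i1] := galerkin_pair_integrable.
have [j2 j1 _] := strip_pair T0 X0 M0 C0 bw bp.
have [a1 ->] := pair2_fubini i2 i1; have [a2 ->] := pair2_fubini j2 j1.
set K := _ + eta * _.
have K0 : 0 <= K by rewrite addr_ge0 ?mulr_ge0 ?sqrtr_ge0// ltW.
have i3 : mu.-integrable setT (EFin \o (fun t : R => K * (t \in `[0, T])%:R)).
  apply: (intRZ measurableT).
  by have := bcs_integrable (bcs_indic 0 T); rewrite (@indic_bool _ _ _ (fun t : R => t \in `[0, T])).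
rewrite -RintegralB// (le_trans (le_normr_Rintegral _ _))//; first exact: intRB.
have -> : K * T = \int[mu]_t (K * (t \in `[0, T])%:R).
  rewrite -Rintegral_itv Rintegral_cst; last exact: (measurable_itv `[0, T]).
  by rewrite /= lebesgue_measure_itv/= lte_fin T0 -EFinD subr0.
apply: le_Rintegral => //; first by apply/intR_abs/intRB.
move=> t _; case: (boolP (t \in `[0, T[)) => tT; last by rewrite !mulr0 subrr normr0 mulr_ge0.
have -> : t \in `[0, T] by move: tT; rewrite !in_itv/= => /andP[-> /ltW].
rewrite !mulr1 -RintegralB//; [|exact: i1|exact: j1].
have [f [bf uf fw]] := uw t tT.
have b1 := bcsM (bcsB (H1flat_bcs (galerkin_flat tT)) bf) (bpsi tT).
have b2 : mu.-integrable setT (EFin \o (fun x => (f x - w t x) * psi t x)).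
  have -> : (fun x => (f x - w t x) * psi t x) = (fun x => f x * psi t x - w t x * psi t x).
    by apply/funext => x; rewrite mulrBl.
  by apply: (intRB measurableT); [exact/bcs_integrable/bcsM/bpsi|exact: j1].
have -> : \int[mu]_x (u t x * psi t x - w t x * psi t x) =
    ip (fun x => u t x - f x) (psi t) + \int[mu]_x ((f x - w t x) * psi t x).
  rewrite /ip -RintegralD//; last exact: bcs_integrable.
  by apply: eq_Rintegral => x _; rewrite -mulrDl addrA subrK mulrBl.
rewrite (le_trans (ler_normD _ _))// lerD//.
  have bd := bcsB (H1flat_bcs (galerkin_flat tT)) bf.
  apply: le_trans (ip_CS bd (bpsi tT)) _.
  by rewrite ler_pM ?sqrtr_ge0// ler_wsqrtr// psi_norm.
rewrite (le_trans (le_normr_Rintegral _ _))//.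
rewrite (le_trans _ (ler_wpM2l eta0 (psi_mass tT)))// -RintegralZl//; last first.
  exact/intR_abs/bcs_integrable/bpsi.
apply: le_Rintegral => //; first exact/intR_abs.
  by apply: (intRZ measurableT); exact/intR_abs/bcs_integrable/bpsi.
by move=> x _; rewrite normrM ler_wpM2r.
Qed.

End pairing.

End galerkin_pairing.

(** * Ultrapowers *)

Section ultrapower_facts.
Context {L : Type} {U : set_system L}.
Hypothesis FU : ProperFilter U.
Implicit Types (X Y Z : Type).

Lemma eq_Lim X (f g : L -> X) : U [set l | f l = g l] -> Lim U f = Lim U g.
Proof.
move=> fg; apply: eq_sig_hprop => [C p q|/=]; first exact: Prop_irrelevance.
apply/seteqP; split=> h /= hU; apply: filterS2 fg hU => l /= -> //.
Qed.

Lemma net_Lim X (f : L -> X) : U [set l | net (Lim U f) l = f l].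
Proof.
rewrite /net; case: cid => g /= e.
have : germ U g g by apply: filterS (filterT) => l _.
by rewrite -e; apply: filterS => l /= ->.
Qed.

Lemma Lim_net X (x : upower U X) : Lim U (net x) = x.
Proof.
apply: eq_sig_hprop => [C p q|/=]; first exact: Prop_irrelevance.
by rewrite /net; case: cid.
Qed.

Lemma star_elt_net X (x : X) : U [set l | net (star_elt U x) l = x].
Proof. exact: net_Lim. Qed.

Lemma star2_net X Y Z (f : X -> Y -> Z) (x : upower U X) (y : upower U Y) :
  U [set l | net (star2 f x y) l = f (net x l) (net y l)].
Proof. exact: net_Lim. Qed.

Lemma iapp_net X Y (f : upower U (X -> Y)) (x : upower U X) :
  U [set l | net (iapp f x) l = net f l (net x l)].
Proof. exact: net_Lim. Qed.

Lemma star_net X Y (f : X -> Y) (x : upower U X) : U [set l | net (star f x) l = f (net x l)].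
Proof. exact: net_Lim. Qed.

Lemma net_eq X (x y : upower U X) : x = y -> U [set l | net x l = net y l].
Proof. by move=> ->; apply: filterS (filterT) => l _. Qed.

Lemma LimSet_net X (A : L -> set X) x : LimSet U A x -> U [set l | A l (net x l)].
Proof. by move=> [f Af <-]; apply: filterS (net_Lim f) => l /= ->. Qed.

(** The representative is corrected, on a negligible set of indices, by arbitrary elements of the
    sets. *)
Lemma LimSet_intro X (A : L -> set X) (x : upower U X) : (forall l, A l !=set0) ->
  U [set l | A l (net x l)] -> LimSet U A x.
Proof.
move=> A0 Ax.
have E l : exists y, A l y /\ (A l (net x l) -> y = net x l).
  have [h|h] := pselect (A l (net x l)); first by exists (net x l).
  by have [y Ay] := A0 l; exists y.
have [f fP] := choice E.
exists f => [l|]; first exact: (fP l).1.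
by rewrite -[RHS]Lim_net; apply: eq_Lim; apply: filterS Ax => l; exact: (fP l).2.
Qed.

(* A choice of counterexamples turns an internal universal statement into one about nets. *)
Lemma filter_forall X (A : L -> set X) (P : L -> X -> Prop) : (forall l, A l !=set0) ->
  (forall f, (forall l, A l (f l)) -> U [set l | P l (f l)]) ->
  U [set l | forall x, A l x -> P l x].
Proof.
move=> A0 H.
have E l : exists x, A l x /\ (P l x -> forall y, A l y -> P l y).
  have [h|/existsNP[x /not_implyP[Ax nP]]] := pselect (forall y, A l y -> P l y).
    by have [x Ax] := A0 l; exists x.
  by exists x.
have [f fP] := choice E.
apply: filterS (H f (fun l => (fP l).1)) => l /= Pl; exact: (fP l).2.
Qed.

End ultrapower_facts.

(** * Standard parts computed from nets *)

Section standard_part.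
Context {R : realType} {L : Type} {U : set_system L}.
Hypothesis FU : ProperFilter U.
Implicit Types (x y : upower U R).

Lemma infinitesimal_net x e : infinitesimal x -> 0 < e -> U [set l | `|net x l| < e].
Proof.
move=> xi e0; apply: filterS3 (star_net FU Num.norm x) (star_elt_net FU e) (xi e e0) => l /=.
by move=> <- {2}<-.
Qed.

Lemma infinitesimal_intro x : (forall e, 0 < e -> U [set l | `|net x l| < e]) -> infinitesimal x.
Proof.
move=> h e e0; apply: filterS3 (star_net FU Num.norm x) (star_elt_net FU e) (h e e0) => l /=.
by rewrite /habs => -> ->.
Qed.

Lemma net_sub x (s : R) : U [set l | net (hadd x (hopp (star_elt U s))) l = net x l - s].
Proof.
apply: filterS3 (star2_net FU +%R x (hopp (star_elt U s))) (star_net FU -%R (star_elt U s))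
  (star_elt_net FU s) => l /=.
by rewrite /hadd /hopp => -> -> ->.
Qed.

Lemma standard_part x (r : R) : (forall e, 0 < e -> U [set l | `|net x l - r| < e]) ->
  hfinite x /\ sh x = r.
Proof.
move=> xr; split.
  exists (`|r| + 1); apply: filterS3 (star_net FU Num.norm x) (star_elt_net FU (`|r| + 1)) (xr 1 ltr01) => l /=.
  rewrite /habs => -> -> h.
  by rewrite -[net x l](subrK r) addrC (le_trans (ler_normD _ _))// lerD2l ltW.
have E s : infinitesimal (hadd x (hopp (star_elt U s))) <-> forall e, 0 < e -> U [set l | `|net x l - s| < e].
  split=> h; [move=> e e0|apply: infinitesimal_intro => e e0].
    by apply: filterS2 (net_sub x s) (infinitesimal_net h e0) => l /= ->.
  by apply: filterS2 (net_sub x s) (h e e0) => l /= ->.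
apply: get_unique; first exact/E.
move=> s /E xs; apply/eqP; rewrite -subr_eq0 -normr_le0; apply/ler_addgt0Pl => e e0.
have e2 : 0 < e / 2 by rewrite divr_gt0.
have [l [/= h1 h2]] := filter_ex (filterI (xr _ e2) (xs _ e2)).
rewrite addr0 (_ : s - r = (net x l - r) - (net x l - s)); last by ring.
by rewrite (le_trans (ler_normB _ _))// [e]splitr ltW// ltrD.
Qed.

End standard_part.

(** * From the nonstandard problem to Galerkin problems at almost all indices *)

Section fibrewise.
Context {R : realType} {U : set_system (finpart R)}.
Hypothesis FU : ProperFilter U.
Variables (UL : set (upower U (R -> R))) (Vl : finpart R -> set (R -> R)).
Hypotheses (UE : UL = LimSet U Vl) (V0 : forall l, Vl l !=set0).
Variables (T : R) (T0 : 0 < T) (u0 : R -> R) (nu : upower U R) (u : upower U (R -> R -> R)).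
Hypothesis sol : viscous_solution UL T u0 nu u.

(** The transfer principle carried out for this one formula: universal quantifiers over internal
    sets go through [filter_forall], and the net of the ultrafunction derivative supplies the
    witness [d]. *)
Lemma viscous_galerkin : U [set l | galerkin (Vl l) T u0 (net nu l) (net u l)].
Proof.
have [C1 uV ueq ui] := sol; rewrite UE in uV ueq.
have AI (l : finpart R) : timeI T !=set0 by exists 0; rewrite /timeI/= in_itv/= lexx T0.
have It (f : finpart R -> R) : (forall l, timeI T (f l)) -> star_set U (timeI T) (Lim U f).
  by move=> fI; exists f.
have utE (f : finpart R -> R) : U [set l | net (iapp u (Lim U f)) l = net u l (f l) /\
    net (iapp (star (dt T) u) (Lim U f)) l = dt T (net u l) (f l)].
  apply: filterS3 (net_Lim FU f) (iapp_net FU u (Lim U f))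
    (filterI (iapp_net FU (star (dt T) u) (Lim U f)) (star_net FU (dt T) u)) => l /=.
  by move=> <- -> [-> ->].
have h1 := LimSet_net FU C1.
have h2 : U [set l | forall t, timeI T t -> Vl l (net u l t) /\ Vl l (dt T (net u l) t)].
  apply: filter_forall => // f fI; have [a1 a2] := uV _ (It f fI).
  by apply: filterS3 (LimSet_net FU a1) (LimSet_net FU a2) (utE f) => l /= ? ? [<- <-].
have h3 : U [set l | forall t, timeI T t -> exists2 d,
    Vl l d /\ (forall v, Vl l v -> ip d v = Defs.dpair (net u l t) v) &
    forall v, Vl l v -> ip (dt T (net u l) t) v + cpair (net u l t) v = net nu l * Defs.dpair d v].
  apply: filter_forall => // f fI; have [d [dV dP] deq] := ueq _ (It f fI).
  have d2 : U [set l | forall v, Vl l v -> ip (net d l) v = Defs.dpair (net u l (f l)) v].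
    apply: filter_forall => // g gV; have e := net_eq FU (dP (Lim U g) (ex_intro2 _ _ g gV erefl)).
    apply: filterS3 e (filterI (net_Lim FU g) (utE f)) (filterI (star2_net FU ip d (Lim U g))
      (star2_net FU Defs.dpair (iapp u (Lim U f)) (Lim U g))) => l /= el [gE [uE _]] [e1 e2].
    by move: el; rewrite e1 e2 gE uE.
  have d3 : U [set l | forall v, Vl l v -> ip (dt T (net u l) (f l)) v + cpair (net u l (f l)) v =
      net nu l * Defs.dpair (net d l) v].
    apply: filter_forall => // g gV.
    set t := Lim U f; set v := Lim U g.
    have e := net_eq FU (deq v (ex_intro2 _ _ g gV erefl)).
    have e1 := filterI (star2_net FU +%R (star2 ip (iapp (star (dt T) u) t) v) (star2 cpair (iapp u t) v))
      (star2_net FU *%R nu (star2 Defs.dpair d v)).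
    have e2 := filterI (star2_net FU ip (iapp (star (dt T) u) t) v)
      (filterI (star2_net FU cpair (iapp u t) v) (star2_net FU Defs.dpair d v)).
    apply: filterS3 e (filterI (e1 _) (e2 _ _)) (filterI (net_Lim FU g) (utE f)) => l /=.
    rewrite /hadd /hmul => el [[f1 f2] [f3 [f4 f5]]] [gE [uE duE]].
    by move: el; rewrite f1 f2 f3 f4 f5 gE uE duE.
  apply: filterS3 (LimSet_net FU dV) d2 d3 => l /= Vd h h'.
  by exists (net d l).
have h4 : U [set l | net u l 0 = u0].
  apply: filterS3 (net_eq FU ui) (star_elt_net FU u0) (filterI (iapp_net FU u (star_elt U 0)) (star_elt_net FU (0 : R))) => l /=.
  by move=> el e [f1 e0]; move: el; rewrite f1 e e0.
by apply: filterS3 h1 h2 (filterI h3 h4) => l /= ? ? [? ?]; split.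
Qed.

End fibrewise.

(** * Uniformity over a compact range of viscosities *)

Section viscosity_range.
Context {R : realType}.
Implicit Types (V : set (R -> R)) (T nu eta : R) (u : R -> R -> R).

(** The reference viscosity nu1 may differ from nu; nu1 < nu + eta is enough for it to tend to 0
    together with nu and eta. *)
Definition close_to_viscous V T (u0 : R -> R) nu eta := forall u, galerkin V T u0 nu u ->
  exists2 nu1, 0 < nu1 < nu + eta & forall t, timeI T t -> exists f, [/\ bcs f,
    ip (fun x => u t x - f x) (fun x => u t x - f x) <= eta &
    forall x, `|f x - colehopf nu1 u0 t x| <= eta].

(** Every viscosity in [a, 1] has a ball on which one finite set of functions serves; finitely many
    balls cover the segment, and the union of their finite sets serves for all. The centres are the
    reference viscosities. *)
Lemma uniformly_close_to_viscous (N M T a eta : R) (u0 : R -> R) : 0 < T -> 0 <= N -> datum N M u0 ->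
  0 < a -> 0 < eta -> exists S : set (R -> R), [/\ finite_set S, S `<=` H1flat &
    forall V, V `<=` H1flat -> S `<=` V -> forall nu, a <= nu <= 1 -> close_to_viscous V T u0 nu eta].
Proof.
move=> T0 N0 du a0 eta0.
have H nu : exists p : R * set (R -> R), 0 < nu -> [/\ 0 < p.1 <= eta, finite_set p.2, p.2 `<=` H1flat &
    forall V nu2, V `<=` H1flat -> p.2 `<=` V -> 0 < nu2 -> `|nu2 - nu| < p.1 ->
      close_to_viscous V T u0 nu2 eta].
  (* For nu <= 0 the pair is a default value on which nothing is asserted. *)
  have [nu0|nu0] := ltP 0 nu; last by exists (0, set0) => h; exfalso; lra.
  have [dl dl0 [S [fS SH HS]]] := galerkin_approx nu0 T0 N0 du eta0.
  exists (Num.min dl eta, S) => _; split=> //=; first by rewrite lt_min dl0 eta0 ge_min lexx orbT.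
  move=> V nu2 VH SV n20; rewrite lt_min => /andP[nd ne] u gu.
  exists nu; first by move: ne; rewrite ltr_norml => /andP[? ?]; rewrite nu0/=; lra.
  exact: (HS V nu2 u).
have [p pP] := choice H.
have cpt := @segment_compact R a 1; rewrite compact_cover in cpt.
have posi nu : nu \in `[a, 1] -> 0 < nu by rewrite in_itv/= => /andP[h _]; exact: lt_le_trans h.
have [D [fD D0 cD]] : exists D : set R, [/\ finite_set D, forall nu, D nu -> 0 < nu &
    `[a, 1]%classic `<=` \bigcup_(nu in D) ball nu (p nu).1].
  have [] := cpt R `[a, 1]%classic (fun nu => ball nu (p nu).1).
  - by move=> nu /posi nu0; apply: ball_open; have [/andP[]] := pP nu nu0.
  - by move=> nu nuI; exists nu => //; apply: ballxx; have [/andP[]//] := pP nu (posi nu nuI).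
  move=> D DI cD; refine (ex_intro _ _ (And3 (finite_fset D) _ cD)).
  by move=> nu /= /DI/set_mem; exact: posi.
exists (\bigcup_(nu in D) (p nu).2); split.
- by apply: bigcup_finite => // nu /D0 nu0; have [] := pP nu nu0.
- by move=> f [nu /D0 nu0]; have [_ _ h _] := pP nu nu0; exact: h.
move=> V VH SV nu nuI; have [nu' nuD] := cD nu nuI.
have nu0 := D0 nu' nuD.
have [_ _ _ h] := pP nu' nu0.
rewrite /ball/= distrC => hb; apply: h => //.
- by move=> f fS; apply: SV; exists nu'.
- by apply: posi; rewrite in_itv.
Qed.

End viscosity_range.

(** * The net of approximation spaces, and the diagonal choice *)

Section approximation_spaces.
Context {R : realType} {U : set_system (finpart R)}.
Hypothesis fineU : fine_ultrafilter U.

Lemma fine_proper : ProperFilter U.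
Proof. by case: fineU => FU _; exact: ultra_proper. Qed.

(** The ultrafilter decides each equality with a standard k; since b is not standard it decides
    against, and finitely many values are excluded at once. *)
Lemma infinite_hypernat_ge (b : upower U nat) k : infinite_hypernat b ->
  U [set l | (k <= net b l)%N].
Proof.
have FU := fine_proper; have [UU _] := fineU.
move=> binf; elim: k => [|k IH]; first by apply: filterS (filterT) => l _.
have nk : U [set l | net b l <> k].
  have [h|//] := in_ultra_setVsetC [set l | net b l = k] UU.
  by exfalso; apply: (binf k); rewrite -[b]Lim_net; exact: eq_Lim.
apply: filterS2 IH nk => l /=; rewrite leq_eqVlt => /predU1P[->|//]; by case.
Qed.

(** N(l) is the largest n <= b(l) with l in A(n); the bound b makes the maximum exist. Wherever l
    lies in A(k) and k <= b(l), this maximum is at least k. *)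
Lemma diagonal_index (A : nat -> set (finpart R)) (b : finpart R -> nat) :
  (forall k, U (A k)) -> (forall k, U [set l | (k <= b l)%N]) ->
  exists N : finpart R -> nat, U [set l | A (N l) l] /\ forall k, U [set l | (k <= N l)%N].
Proof.
move=> UA Ub; have FU := fine_proper.
have H l : exists n, A 0%N l -> A n l /\ forall k, (k <= b l)%N -> A k l -> (k <= n)%N.
  have [A0|] := pselect (A 0%N l); last by exists 0%N.
  have ex : exists n, (n <= b l)%N && `[< A n l >] by exists 0%N; exact/asboolP.
  have bd n : (n <= b l)%N && `[< A n l >] -> (n <= b l)%N by case/andP.
  case: (ex_maxnP ex bd) => n /andP[_ /asboolP An] nmax; exists n => _; split=> // k kb Ak.
  by apply: nmax; rewrite kb; exact/asboolP.
have [N NP] := choice H; exists N; split.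
  by apply: filterS (UA 0%N) => l /NP[].
by move=> k; apply: filterS3 (UA 0%N) (UA k) (Ub k) => l /NP[_ h] Ak kb; exact: h.
Qed.

Variable Vl : finpart R -> set (R -> R).
Hypotheses (Vfin : forall l, fin_dim_subspace (Vl l) /\ Vl l `<=` H1flat)
  (Vmono : forall l m, finpart_le l m -> Vl l `<=` Vl m)
  (Vcofinal : forall W, fin_dim_subspace W -> W `<=` H1flat -> exists l, W `<=` Vl l).

Lemma approximation_space0 l : Vl l (fun=> 0).
Proof.
have [[n [e ->]] _] := Vfin l; exists 0%N, (fun=> 0), (fun _ => fun=> 0).
by split=> [[]//|]; apply/funext => x; rewrite big_ord0.
Qed.

(** The line spanned by f lies in some space of the net, hence in all later ones, and fineness makes
    the later indices almost all indices. *)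
Lemma eventually_mem f : H1flat f -> U [set l | Vl l f].
Proof.
move=> Hf; have FU := fine_proper; pose W := Defs.span (range (fun _ : 'I_1 => f)).
have WH : W `<=` H1flat.
  move=> g [n [c [e [eE ->]]]]; have [m [d [E [EA fE]]]] := Hf.
  exists m, (fun j => (\sum_(i < n) c i) * d j), E; split=> //; apply/funext => x.
  rewrite (eq_bigr (fun i => c i * f x)); last by move=> i _; have [_ _ <-] := eE i.
  by rewrite -mulr_suml fE mulr_sumr; apply: eq_bigr => j _; rewrite mulrA.
have [l Wl] := Vcofinal (ex_intro _ 1%N (ex_intro _ _ erefl)) WH.
have [_ fine] := fineU; apply: filterS (fine l) => m lm; apply: (Vmono lm); apply: Wl.
exists 1%N, (fun=> 1), (fun=> f); split; first by move=> i; exists ord0.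
by apply/funext => x; rewrite big_ord1 mul1r.
Qed.

Lemma eventually_subset S : finite_set S -> S `<=` H1flat -> U [set l | S `<=` Vl l].
Proof.
move=> /finite_seqP[s ->]; have FU := fine_proper; elim: s => [_|f s IH sH].
  by apply: filterS (filterT) => l _ f.
have fH : H1flat f by apply: sH; rewrite /= inE eqxx.
have sH' : [set` s] `<=` H1flat by move=> g gs; apply: sH; rewrite /= inE gs orbT.
apply: filterS2 (eventually_mem fH) (IH sH') => l lf ls g /=.
by rewrite inE => /predU1P[->|/ls].
Qed.

End approximation_spaces.

(** * Assembly *)

Section assembly.
Context {R : realType}.
Local Notation mu := (@lebesgue_measure R).

Lemma small_eta (K1 K2 T e : R) : 0 <= K1 -> 0 <= K2 -> 0 < T -> 0 < e ->
  exists2 d, 0 < d & forall eta, 0 <= eta <= d -> (Num.sqrt eta * K1 + eta * K2) * T < e.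
Proof.
move=> K10 K20 T0 e0; pose K := (K1 + K2) * T + 1.
have K0 : 0 < K by rewrite ltr_wpDl// mulr_ge0 ?addr_ge0// ltW.
pose s := Num.min 1 (e / K).
have s0 : 0 < s by rewrite lt_min ltr01 divr_gt0.
exists (s ^+ 2); first by rewrite exprn_gt0.
move=> eta /andP[eta0 etas].
have qs : Num.sqrt eta <= s by rewrite -[leRHS]ger0_norm ?(ltW s0)// -sqrtr_sqr ler_wsqrtr.
have q0 := sqrtr_ge0 eta.
have s1 : s <= 1 by rewrite ge_min lexx.
have h1 : eta * K2 <= Num.sqrt eta * K2.
  rewrite ler_wpM2r// -{1}[eta]sqr_sqrtr// expr2 ler_piMr// (le_trans qs)//.
have h2 : (Num.sqrt eta * K1 + eta * K2) * T <= s * ((K1 + K2) * T).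
  rewrite mulrA ler_wpM2r ?(ltW T0)// (le_trans (lerD (lexx _) h1))// -mulrDr ler_wpM2r// addr_ge0//.
apply: (le_lt_trans h2).
have h3 : s * K <= e by rewrite -ler_pdivlMr// ge_min lexx orbT.
by apply: lt_le_trans h3; rewrite ltr_pM2l// ltrDl.
Qed.

Lemma pair2_ae T (u v phi : R -> R -> R) : 0 < T -> test2 T phi ->
  measurable_fun (strip T) (fun p => u p.1 p.2) -> measurable_fun (strip T) (fun p => v p.1 p.2) ->
  {ae mu2, forall p, strip T p -> u p.1 p.2 = v p.1 p.2} -> pair2 T u phi = pair2 T v phi.
Proof.
move=> T0 tphi mu' mv uv.
have [b [X [C [[/andP[b0 bT] X0 C0 _] [bp _ _ _]]]]] := test2_box T0 tphi.
have mp := box_measurable T0 bp; have mS := measurable_strip T.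
apply: ae_Rintegral => //; [exact: measurable_funM|exact: measurable_funM|].
by apply: (ae_imply1 uv) => p h Sp; rewrite h.
Qed.

End assembly.

Theorem theorem50 (R : realType)
    (U : set_system (finpart R)) (fineU : fine_ultrafilter U)
    (beta : upower U nat) (beta_inf : infinite_hypernat beta)
    (UL : set (upower U (R -> R))) (UL_space : U_Lambda_space beta UL)
    (T : R) (T_gt0 : 0 < T)
    (u0 : R -> R) (u0_H1c : H1c u0)
    (z : R -> R -> R) (z_entropy : entropy_solution T u0 z)
    (u : upower U R -> upower U (R -> R -> R))
    (u_sol : forall nu : upower U R, hlt (star_elt U 0) nu ->
       viscous_solution UL T u0 nu (u nu)) :
  exists nu0 : upower U R,
    [/\ hlt (star_elt U 0) nu0, infinitesimal nu0 &
        forall nu : upower U R, infinitesimal nu -> hle nu0 nu ->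
          distribution_eq T (u nu) z].
Proof.
have FU := fine_proper fineU.
have [[Vl [Vfin Vmono Vcof ULE]] _ _ _] := UL_space.
have [N [M [N0 du [k [C kC uk]]]]] := H1c_datum u0_H1c.
pose e_ n : R := n.+1%:R^-1.
have e0 n : 0 < e_ n by rewrite invr_gt0.
have e_le m n : (m <= n)%N -> e_ n <= e_ m.
  by move=> mn; rewrite lef_pV2 ?posrE// ler_nat.
have e_small (d : R) : 0 < d -> exists n, e_ n < d.
  move=> d0; have [n _ h] := (cvgr0Pnorm_lt _).1 (@cvg_harmonic R) d d0.
  by exists n; have := h n (leqnn n); rewrite /harmonic ger0_norm// ltW.
(* A single scale 1/(n+1) serves as lower end of the range of viscosities and as accuracy. *)
pose A n := [set l | forall nu, e_ n <= nu <= 1 -> close_to_viscous (Vl l) T u0 nu (e_ n)].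
have UA n : U (A n).
  have [S [fS SH HS]] := uniformly_close_to_viscous T_gt0 N0 du (e0 n) (e0 n).
  apply: filterS (eventually_subset fineU Vmono Vcof fS SH) => l Sl.
  by apply: HS => //; exact: (Vfin l).2.
have [m [Am mU]] := diagonal_index fineU UA (fun n => infinite_hypernat_ge fineU n beta_inf).
have e_mU (d : R) : 0 < d -> U [set l | e_ (m l) < d].
  move=> d0; have [n nd] := e_small d d0.
  by apply: filterS (mU n) => l /e_le h; exact: le_lt_trans nd.
pose nu0 : upower U R := Lim U (fun l => e_ (m l)).
have nu0E : U [set l | net nu0 l = e_ (m l)] by exact: net_Lim.
have nu0_gt0 : hlt (star_elt U 0) nu0.
  by apply: filterS2 nu0E (star_elt_net FU (0 : R)) => l /= -> ->.
exists nu0; split => //.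
  apply: (infinitesimal_intro FU) => d d0; apply: filterS2 nu0E (e_mU d d0) => l /= ->.
  by rewrite ger0_norm// ltW.
move=> nu nui nu0nu.
have nuge : U [set l | e_ (m l) <= net nu l] by apply: filterS2 nu0E nu0nu => l /= ->.
have nupos : hlt (star_elt U 0) nu.
  by apply: filterS2 nuge (star_elt_net FU (0 : R)) => l /= h ->; exact: lt_le_trans h.
have V0 l : Vl l (fun=> 0) by exact: approximation_space0.
have gal := viscous_galerkin FU ULE (fun l => ex_intro _ _ (V0 l)) T_gt0 (u_sol nu nupos).
(* An infinitesimal nu >= nu0 lies between the scale of the index and 1 at almost all indices, which
   is the range covered by [A (m l)]. *)
have good : U [set l | galerkin (Vl l) T u0 (net nu l) (net (u nu) l) /\ 0 < net nu l /\
    close_to_viscous (Vl l) T u0 (net nu l) (e_ (m l))].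
  apply: filterS3 gal Am (filterI nuge (infinitesimal_net FU nui ltr01)) => l /= g a [h1 h2].
  split=> //; split; first exact: lt_le_trans h1.
  by apply: a; rewrite h1 ltW// (le_lt_trans (ler_norm _)).
split.
  apply: LimSet_intro => [_|].
    exists (fun _ _ => 0); split; first exact: measurable_cst.
    rewrite (_ : (fun p : R * R => _) = cst 0%E); first exact: integrable0.
    by apply/funext => p; rewrite expr0n.
  apply: filterS good => l /= [g [n0 _]].
  exact: (galerkin_L2strip T_gt0 (Vfin l).2 (V0 l) n0 g).
move=> phi tphi.
(* The only use of z: uniqueness among entropy weak solutions identifies it almost everywhere with
   the Lax-Oleinik formula. *)
have -> : pair2 T z phi = pair2 T (laxo u0) phi.
  have [[[mz _ _] _ _] zu] := z_entropy; apply/esym; apply: pair2_ae => //.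
    exact: measurable_funTS (measurable_laxo N0 du).
  exact: zu (entropy_weak_laxo N0 du T_gt0 kC uk).
apply: standard_part => // e egt0.
have e2 : 0 < e / 2 by rewrite divr_gt0.
have [b [X [K [[_ X0 K0 _] [bp _ _ _]]]]] := test2_box T_gt0 tphi.
have [d d0 dP] := small_eta (sqrtr_ge0 (K ^+ 2 * (2 * X))) (mulr_ge0 K0 (mulr_ge0 (ler0n _ 2) (ltW X0))) T_gt0 e2.
have [d' d'0 d'P] := pair2_colehopf_cvg N0 du T_gt0 tphi e2.
have d'2 : 0 < d' / 2 by rewrite divr_gt0.
apply: filterS3 good (filterI (star2_net FU (pair2 T) (u nu) (star_elt U phi)) (star_elt_net FU phi))
  (filterI (infinitesimal_net FU nui d'2) (filterI (e_mU d d0) (e_mU _ d'2))).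
move=> l /= [g [n0 /(_ _ g)[nu1 /andP[nu10 nu11] H]]] [-> ->] [h1 [h2 h3]].
have w1 := strip_bounded_colehopf N0 du T_gt0 nu10.
have := galerkin_pair_approx T_gt0 (Vfin l).2 (V0 l) n0 g X0 K0 bp (datum_bound_ge0 du) (ltW (e0 _)) w1 H.
have := dP (e_ (m l)); rewrite (ltW (e0 _)) (ltW h2) => /(_ isT) q1 q2.
(* nu1 is below nu plus the scale of the index, each less than d'/2, so the inviscid limit applies
   at nu1. *)
have q3 : `|pair2 T (colehopf nu1 u0) phi - pair2 T (laxo u0) phi| < e / 2.
  apply: d'P; rewrite nu10 (lt_trans nu11)// [d']splitr ltrD// (le_lt_trans (ler_norm _))//.
rewrite -[X in `|X - _|](subrK (pair2 T (colehopf nu1 u0) phi)) -addrA (le_lt_trans (ler_normD _ _))//.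
by rewrite [e]splitr ltrD// (le_lt_trans q2).
Qed.
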